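(* Let $\psi$ be an admissible wavelet with $\int_0^\infty|\ln a|\,|\mathcal H_\alpha\psi(a)|^2\frac{da}{a}<\infty$. For every $f\in\mathcal S_e(\mathbb R)$ such that $W_\psi f(a,\cdot)\in\mathcal S_e(\mathbb R)$ for every $a>0$, $$\int_{\mathcal R}\ln(a)\,|W_\psi f(a,x)|^2\,d\nu_\alpha(a,x)+\int_{\mathcal R}\ln(x)\,|W_\psi f(a,x)|^2\,d\nu_\alpha(a,x)\ \ge\ C_\alpha(\psi)\,\|f\|_{2,\mu_\alpha}^2,$$ where $$C_\alpha(\psi)=\ln 2+\frac{\Gamma'\left(\frac{\alpha+1}{2}\right)}{\Gamma\left(\frac{\alpha+1}{2}\right)}-c_\psi^{-1}\int_0^\infty\frac{\ln a}{a}\,|\mathcal H_\alpha\psi(a)|^2\,da.$$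
   Context: Fix a real number $\alpha>-1/2$. Let $\mu_\alpha$ be the measure on $\mathbb{R}_+=[0,\infty)$ given by $d\mu_\alpha(x)=\frac{x^{2\alpha+1}}{2^\alpha\Gamma(\alpha+1)}\,dx$; for $1\le p<\infty$ let $L^p_\alpha(\mathbb R_+)=L^p(\mathbb R_+,\mu_\alpha)$ with norm $\|f\|_{p,\mu_\alpha}=\left(\int_0^\infty|f|^p\,d\mu_\alpha\right)^{1/p}$, and let $L^\infty_\alpha(\mathbb R_+)$ be the essentially bounded functions. Let $j_\alpha(z)=\Gamma(\alpha+1)\sum_{n\ge0}\frac{(-1)^n}{n!\,\Gamma(n+\alpha+1)}(z/2)^{2n}$. The Hankel transform is $\mathcal H_\alpha f(\xi)=\int_0^\infty f(x)\,j_\alpha(x\xi)\,d\mu_\alpha(x)$ for $f\in L^1_\alpha(\mathbb R_+)$, extended to a unitary operator on $L^2_\alpha(\mathbb R_+)$. For $x\ge0$ the Hankel translation is $\tau_x^\alpha f(y)=\frac{\Gamma(\alpha+1)}{\Gamma(1/2)\Gamma(\alpha+1/2)}\int_0^\pi f\big(\sqrt{x^2+y^2+2xy\cos\theta}\big)\sin^{2\alpha}\theta\,d\theta$, and for $a>0$ the dilation is $D_af(x)=a^{\alpha+1}f(ax)$. A nonzero $\psi\in L^1_\alpha(\mathbb R_+)\cap L^\infty_\alpha(\mathbb R_+)$ is an admissible wavelet if $0<c_\psi:=\int_0^\infty|\mathcal H_\alpha\psi(a)|^2\,\frac{da}{a}<\infty$. For such $\psi$ and $f\in L^2_\alpha(\mathbb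 R_+)$, the Hankel wavelet transform is $W_\psi f(a,x)=c_\psi^{-1/2}\int_0^\infty f(t)\,\overline{\tau_x^\alpha(D_a\psi)(t)}\,d\mu_\alpha(t)$ for $(a,x)\in\mathcal R:=(0,\infty)\times[0,\infty)$. On $\mathcal R$ let $d\nu_\alpha(a,x)=a^{2\alpha+1}\,da\,d\mu_\alpha(x)$, $L^p_\alpha(\mathcal R)=L^p(\mathcal R,\nu_\alpha)$, with norm $\|F\|_{p,\nu_\alpha}$ (and $\|F\|_\infty$ the essential supremum). $\mathcal S_e(\mathbb R)$ denotes the space of even Schwartz functions on $\mathbb R$; such a function is identified with its restriction to $[0,\infty)$ (so $\mathcal S_e(\mathbb R)\subset L^2_\alpha(\mathbb R_+)$). The condition ''$W_\psi f(a,\cdot)\in\mathcal S_e(\mathbb R)$'' means that $x\mapsto W_\psi f(a,x)$, $x\ge0$, is the restriction of an even Schwartz function. *)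

(* Defs.v *)
From HB Require Import structures.
From mathcomp Require Import all_boot all_order all_algebra.
From mathcomp Require Import all_classical all_reals all_analysis.
From mathcomp Require Import complex.

Set Implicit Arguments.
Unset Strict Implicit.
Unset Printing Implicit Defensive.

Import Order.TTheory GRing.Theory Num.Theory.
Import numFieldNormedType.Exports.
Local Open Scope ring_scope.
Local Open Scope classical_set_scope.

Section HankelWavelet.
Context {R : realType}.

Local Notation leb := (@lebesgue_measure R).

Definition cabs (z : R[i]) : R := Num.sqrt (complex.Re z ^+ 2 + complex.Im z ^+ 2).

Definition cint (D : set R) (g : R -> R[i]) : R[i] :=
  Complex (Rintegral leb D (fun x => complex.Re (g x)))
          (Rintegral leb D (fun x => complex.Im (g x))).

Definition Gamma (s : R) : R :=
  Rintegral leb `]0%R, +oo[ (fun t => t `^ (s - 1) * expR (- t)).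

Definition jalpha (alpha z : R) : R :=
  Gamma (alpha + 1) *
  limn (@series R (fun n : nat =>
     (-1) ^+ n / ((n`!)%:R * Gamma (n%:R + alpha + 1)) * (z / 2) ^+ (2 * n))).

(* density of mu_alpha w.r.t. Lebesgue measure on [0, oo) *)
Definition wdens (alpha x : R) : R :=
  x `^ (2 * alpha + 1) / (2 `^ alpha * Gamma (alpha + 1)).

Definition int_mu (alpha : R) (g : R -> R[i]) : R[i] :=
  cint `[0%R, +oo[ (fun x => g x * Complex (wdens alpha x) 0).

Definition L2norm2 (alpha : R) (g : R -> R[i]) : R :=
  Rintegral leb `[0%R, +oo[ (fun x => cabs (g x) ^+ 2 * wdens alpha x).

Definition hankel (alpha : R) (g : R -> R[i]) (xi : R) : R[i] :=
  int_mu alpha (fun x => g x * Complex (jalpha alpha (x * xi)) 0).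

Definition htrans (alpha x : R) (g : R -> R[i]) (y : R) : R[i] :=
  Complex (Gamma (alpha + 1) / (Gamma (1 / 2) * Gamma (alpha + 1 / 2))) 0 *
  cint `[0, pi] (fun th =>
     g (Num.sqrt (x ^+ 2 + y ^+ 2 + 2 * x * y * cos th)) *
     Complex ((sin th) `^ (2 * alpha)) 0).

Definition dil (alpha a : R) (g : R -> R[i]) (x : R) : R[i] :=
  Complex (a `^ (alpha + 1)) 0 * g (a * x).

Definition cpsiE (alpha : R) (psi : R -> R[i]) : \bar R :=
  (\int[leb]_(a in `]0%R, +oo[) (cabs (hankel alpha psi a) ^+ 2 / a)%:E)%E.

Definition cpsi (alpha : R) (psi : R -> R[i]) : R := fine (cpsiE alpha psi).

Definition hwt (alpha : R) (psi f : R -> R[i]) (a x : R) : R[i] :=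
  Complex (Num.sqrt (cpsi alpha psi))^-1 0 *
  int_mu alpha (fun t => f t * conjc (htrans alpha x (dil alpha a psi) t)).

Definition cmeasurable (D : set R) (g : R -> R[i]) : Prop :=
  measurable_fun D (fun x => complex.Re (g x)) /\ measurable_fun D (fun x => complex.Im (g x)).

Definition in_L1 (alpha : R) (g : R -> R[i]) : Prop :=
  cmeasurable `[0%R, +oo[ g /\
  (\int[leb]_(x in `[0%R, +oo[) (cabs (g x) * wdens alpha x)%:E < +oo)%E.

(* g in L^infty_alpha(R_+): essentially bounded (mu_alpha and Lebesgue
   measure have the same null sets on [0, oo)) *)
Definition in_Linf (g : R -> R[i]) : Prop :=
  cmeasurable `[0%R, +oo[ g /\
  exists M : R, {ae leb, forall x, `[0%R, +oo[ x -> cabs (g x) <= M}.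

Definition nonzeroL (g : R -> R[i]) : Prop :=
  ~ {ae leb, forall x, `[0%R, +oo[ x -> g x = 0}.

Definition admissible (alpha : R) (psi : R -> R[i]) : Prop :=
  [/\ in_L1 alpha psi, in_Linf psi, nonzeroL psi &
      (0 < cpsiE alpha psi < +oo)%E].

Definition schwartzR (g : R -> R) : Prop :=
  (forall (n : nat) (x : R), derivable (derive1n n g) x 1) /\
  (forall m n : nat, exists M : R, forall x : R,
      `| x ^+ m * derive1n n g x | <= M).

Definition schwartz_e (g : R -> R[i]) : Prop :=
  [/\ schwartzR (fun x => complex.Re (g x)), schwartzR (fun x => complex.Im (g x)) &
      forall x, g (- x) = g x].

Definition Calpha (alpha : R) (psi : R -> R[i]) : R :=
  ln 2 + derive1 Gamma ((alpha + 1) / 2) / Gamma ((alpha + 1) / 2)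
  - (cpsi alpha psi)^-1 *
    Rintegral leb `]0%R, +oo[
      (fun a => ln a / a * cabs (hankel alpha psi a) ^+ 2).

(* density of nu_alpha w.r.t. Lebesgue measure on R x R, on (0,oo) x [0,oo) *)
Definition nudens (alpha : R) (p : R * R) : R :=
  p.1 `^ (2 * alpha + 1) * wdens alpha p.2.

End HankelWavelet.

(* Main.v *)
Require Import Defs.
From HB Require Import structures.
From mathcomp Require Import all_boot all_order all_algebra.
From mathcomp Require Import all_classical all_reals all_analysis.
From mathcomp Require Import measurable_realfun.
From mathcomp Require Import complex.
From mathcomp Require Import zify ring lra.

Set Implicit Arguments.
Unset Strict Implicit.
Unset Printing Implicit Defensive.

Import Order.TTheory GRing.Theory Num.Theory.
Import numFieldNormedType.Exports.
Local Open Scope ring_scope.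
Local Open Scope classical_set_scope.

(** Write H for the Hankel transform and c = alpha + 1.  For every scale a, the slice
    W_psi f(a, .) has the Hankel transform c_psi^(-1/2) a^(-c) H f(xi) conj(H psi(xi / a)) (up to conjugation of
    H psi, which does not affect its modulus).  Hence by Plancherel and the substitution b = xi / a,
    the integral of ln a |W|^2 equals that of ln xi |H f|^2 minus ||f||^2 c_psi^(-1) times that of ln b |H psi|^2 db/b.

    The integral of ln x |W|^2 is bounded below by differentiating at u = 0 the sharp Pitt inequality
    || x^(-u) g ||^2 <= C(u) || xi^u H g ||^2, where C(u) = 4^(-u) Gamma(c/2 - u) / Gamma(c/2 + u), so that
    C(0) = 1 and C'(0) = - 2 (ln 2 + Gamma'(c/2) / Gamma(c/2)); it is applied to every slice and integrated in a.
    The two logarithmic integrals of |H f|^2 cancel.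

    Pitt's inequality follows from the Schur test: x^(-2u) is a superposition of Gaussians exp(- t x^2), each of which
    corresponds on the other side to the symmetric positive heat kernel, a Gaussian times a Bessel function I; on the
    test function x^(-c) the superposition of these kernels is a Beta integral.  Plancherel is the limit t -> 0 of
    the same heat kernel identity. *)

(** Most exchanges of integrals and limits are made on nonnegative integrands, where Tonelli and
    monotone convergence ask for no integrability. Hence the Gaussian damping of the transforms and
    the splitting of the logarithms into positive and negative parts.

    Only C(0) and C'(0) survive in the result, which leaves freedom in the test function of the
    Schur test. The power x^(-c) is taken because it is formally its own Hankel transform, so that
    C(u) comes from the factor xi^(-2u) alone.

    The Schur test gives Pitt's inequality for integrable g, with weights on H g and g in the
    opposite roles to those needed. The roles are exchanged by applying it to a damped H g, which
    requires pointwise inversion. What makes inversion available is a bound on the increments of g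
    by x^2 - y^2, matched to the second moment of the heat kernel; even Schwartz functions have it
    by Cauchy's mean value theorem against x^2. The same bound makes the energy lost by damping
    O(t), a rate that also gives a finite second moment of H g and hence finite logarithmic
    integrals. *)

Section density_measure.
Context {R : realType}.
Variables (h : R -> R) (h0 : forall x, 0 <= h x) (mh : measurable_fun setT h).
Local Notation leb := (@lebesgue_measure R).
Local Open Scope ereal_scope.

(** Nonnegativity and measurability are arguments of the set function, so that its measure structure
    can be inferred from the term itself. *)
Definition mdens (_ : forall x, (0 <= h x)%R) (_ : measurable_fun setT h)
  (A : set R) : \bar R := \int[leb]_(x in A) (h x)%:E.

Local Notation mdens' := (mdens h0 mh).

Import HBNNSimple.

Let mdens_set0 : mdens' set0 = 0.
Proof. by rewrite /mdens integral_set0. Qed.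

Let mdens_ge0 A : 0 <= mdens' A.
Proof. by apply: integral_ge0 => x _; rewrite lee_fin. Qed.

Let mdens_sigma_additive : semi_sigma_additive mdens'.
Proof.
move=> /= A mA tA mUA; rewrite /mdens ge0_integral_bigcup//.
- by apply: is_cvg_ereal_nneg_natsum_cond => n _ _; exact: mdens_ge0.
- by apply/measurable_EFinP; exact: measurable_funTS.
- by move=> x _; rewrite lee_fin.
Qed.

HB.instance Definition _ := isMeasure.Build _ _ _
  mdens' mdens_set0 mdens_ge0 mdens_sigma_additive.

Let mdens_sigma_finite : sigma_finite setT mdens'.
Proof.
(* Cutting both the argument and the density at n bounds the mass of the n-th piece by n times the
   length of the interval. *)
exists (fun n => `[(- n%:R)%R, n%:R] `&` [set x | (h x <= n%:R)%R]).
  apply/seteqP; split => // x _.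
  have [n nP] : exists n : nat, (`|x| + h x <= n%:R)%R.
    exists (Num.truncn (`|x| + h x)%R).+1.
    by rewrite ltW // truncnS_gt.
  exists n => //=; split; last by apply: le_trans nP; rewrite lerDr.
  rewrite in_itv /= -ler_norml; apply: le_trans nP; rewrite lerDl//.
move=> n; have mA : measurable (`[(- n%:R)%R, n%:R] `&` [set x | (h x <= n%:R)%R]).
  apply: measurableI; first exact: measurable_itv.
  by rewrite -[X in measurable X]setTI; apply: measurable_fun_ler.
split; first exact: mA.
rewrite /mdens; apply: (@le_lt_trans _ _
  (\int[leb]_(x in `[(- n%:R)%R, n%:R] `&` [set x | (h x <= n%:R)%R]) (n%:R)%:E)).
  apply: ge0_le_integral => //.
  - by move=> x _; rewrite lee_fin.
  - by apply/measurable_EFinP; exact: measurable_funTS.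
  - by move=> x [_ /=]; rewrite lee_fin.
rewrite integral_cst//; apply: lte_mul_pinfty; rewrite ?lee_fin//.
apply: (@le_lt_trans _ _ (leb `[(- n%:R)%R, n%:R])).
  by apply: le_measure; rewrite ?inE// => x [].
by rewrite /= lebesgue_measure_itv/=; case: ifP => _; rewrite ?ltry.
Qed.

HB.instance Definition _ := @Measure_isSigmaFinite.Build _ _ _
  mdens' mdens_sigma_finite.

(** The identity is the definition for indicators, extends to simple functions by additivity, and to
    [g] by monotone convergence along the same approximating sequence on both sides. *)
Lemma ge0_integral_mdens D (g : R -> \bar R) : measurable D ->
  measurable_fun setT g -> (forall x, 0 <= g x) ->
  \int[mdens']_(x in D) g x = \int[leb]_(x in D) (g x * (h x)%:E).
Proof.
move=> mD mg g0.
pose g_ := nnsfun_approx measurableT mg.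
have cg (x : R) : (g_ n x)%:E @[n --> \oo] --> g x.
  by apply: (cvg_nnsfun_approx measurableT mg) => // y _.
have mg_ n : measurable_fun setT (fun x : R => (g_ n x)%:E).
  by apply/measurable_EFinP.
have ndg (x : R) (a b : nat) : (a <= b)%N -> (g_ a x <= g_ b x)%R.
  by move=> ab; exact/lefP/nd_nnsfun_approx.
have hm : measurable_fun setT (EFin \o h) by apply/measurable_EFinP.
transitivity (limn (fun n => \int[mdens']_(x in D) (g_ n x)%:E)).
  rewrite -monotone_convergence//.
  - by apply: eq_integral => y _; apply/esym/cvg_lim.
  - by move=> n; apply/measurable_funTS/measurable_EFinP.
  - by move=> n y _; rewrite lee_fin.
  - by move=> y _ a b ab; rewrite lee_fin; exact: ndg.
transitivity (limn (fun n => \int[leb]_(x in D) ((g_ n x)%:E * (h x)%:E))).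
  congr (limn _); apply/funext => n.
  have ge0_ind (r x : R) : 0 <= (r * \1_(g_ n @^-1` [set r]) x)%:E.
    rewrite lee_fin indicE; case: (boolP (x \in _)) => [/set_mem/= <-|_];
      by rewrite ?mulr1 ?mulr0.
  have mind1 (r : R) : measurable_fun setT
      (fun x : R => (\1_(g_ n @^-1` [set r]) x : R)%:E).
    by apply/measurable_EFinP; exact: measurable_indic.
  have mind (r : R) : measurable_fun setT
      (fun x : R => (r * \1_(g_ n @^-1` [set r]) x)%:E).
    by apply/measurable_EFinP; exact: measurable_funM.
  under eq_integral do rewrite fimfunE -fsumEFin//.
  under [RHS]eq_integral => x _.
    rewrite fimfunE -fsumEFin// ge0_mule_fsuml; last first.
      by move=> r; exact: ge0_ind.
    over.
  rewrite ge0_integral_fsum//=; last first.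
    by move=> r; apply: measurable_funTS; exact: mind.
  rewrite ge0_integral_fsum//=; last 2 first.
  - by move=> r; apply/measurable_funTS; apply: emeasurable_funM; [exact: mind|].
  - by move=> r x _; apply: mule_ge0; [exact: ge0_ind|rewrite lee_fin].
  apply: eq_fsbigr => r /set_mem [x _ gx].
  have r0 : (0 <= r)%R by rewrite -gx.
  under eq_integral do rewrite EFinM.
  under [RHS]eq_integral do rewrite EFinM -muleA.
  rewrite ge0_integralZl//; last by apply/measurable_funTS/measurable_EFinP.
  rewrite [RHS]ge0_integralZl//.
  - congr (_ * _); rewrite integral_indic// setIC.
    transitivity (\int[leb]_(x in D `&` g_ n @^-1` [set r]) (h x)%:E) => //.
    rewrite integral_mkcondr; apply: eq_integral => y _.
    by rewrite epatch_indic muleC.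
  - apply/measurable_funTS; apply: emeasurable_funM => //.
    exact: mind1.
  - by move=> y _; rewrite mule_ge0// lee_fin.
rewrite -monotone_convergence//.
- apply: eq_integral => y _; apply/cvg_lim => //.
  by apply: cvgeZr => //.
- move=> n; apply/measurable_funTS; apply: emeasurable_funM => //.
  exact: mg_.
- by move=> n y _; rewrite mule_ge0// lee_fin.
- move=> y _ a b ab; by apply: lee_wpmul2r; rewrite lee_fin//; exact: ndg.
Qed.

Lemma integral_mdens D (g : R -> \bar R) : measurable D ->
  measurable_fun setT g ->
  \int[mdens']_(x in D) g x = \int[leb]_(x in D) (g x * (h x)%:E).
Proof.
move=> mD mg; rewrite integralE [RHS]integralE.
congr (_ - _).
  rewrite ge0_integral_mdens//; last exact: measurable_funepos.
  apply: eq_integral => x _; rewrite /= !funeposE.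
  by rewrite maxe_pMl ?lee_fin// mul0e.
rewrite ge0_integral_mdens//; last exact: measurable_funeneg.
apply: eq_integral => x _; rewrite /= !funenegE.
by rewrite maxe_pMl ?lee_fin// mul0e -mulNe.
Qed.

End density_measure.

(** * Change of variables for nonnegative integrands *)

Section substitution.
Context {R : realType}.
Local Notation leb := (@lebesgue_measure R).
Implicit Types (F f : R -> R) (a b : R) (h : R -> \bar R).

(** Endpoints have measure zero. The sets met below are preimages of half-open intervals under an
    increasing map, which lie between an open segment and its closure. *)
Lemma integral_sub_bounds f a b (S : set R) : a <= b -> measurable S ->
  measurable_fun setT f -> (forall x, S x -> 0 <= f x) -> 
  (forall x, a <= x <= b -> 0 <= f x) ->
  `]a, b[ `<=` S -> S `<=` `[a, b] ->
  (\int[leb]_(x in S) (f x)%:E = \int[leb]_(x in `[a, b]) (f x)%:E)%E.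
Proof.
move=> ab mS mf f0S f0 abS Sab.
have mf' D : measurable_fun D (fun x => (f x)%:E).
  by apply/measurable_funTS/measurable_EFinP.
apply/eqP; rewrite eq_le; apply/andP; split.
  by apply: ge0_subset_integral => //; exact: mf'.
have -> : (\int[leb]_(x in `[a, b]) (f x)%:E = \int[leb]_(x in `]a, b[) (f x)%:E)%E.
  exact: (integral_itv_bndoo true false (mf' _)).
by apply: ge0_subset_integral => //; exact: mf'.
Qed.

Section increasing_segment.
Variables (F f : R -> R) (a b : R).
Hypotheses (ab : a < b) (mF : measurable_fun setT F) (mf : measurable_fun setT f).
Hypotheses (dF : forall x, a <= x <= b -> is_derive x 1 F (f x)).
Hypotheses (cf : forall x, a <= x <= b -> {for x, continuous f}).
Hypotheses (f0 : forall x, a <= x <= b -> 0 < f x).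

Let cF x : a <= x <= b -> {for x, continuous F}.
Proof.
by move=> /dF[] dx _; apply/differentiable_continuous; exact/derivable1_diffP.
Qed.

Let cFab : {within `[a, b], continuous F}.
Proof.
apply: continuous_in_subspaceT => x.
by rewrite inE/= in_itv/=; exact: cF.
Qed.

Lemma subst_incr : {in `[a, b]%R &, {homo F : x y / x < y}}.
Proof.
move=> x y; rewrite !in_itv/= => xab yab xy.
apply: (@gtr0_derive1_lt_cc _ F a b) => //.
- move=> z; rewrite in_itv/= => /andP[az zb].
  by have [] := dF (x := z); rewrite ?(ltW az) ?(ltW zb).
- move=> z; rewrite in_itv/= => /andP[az zb].
  have zab : a <= z <= b by rewrite (ltW az) (ltW zb).
  by rewrite derive1E (@derive_val _ _ _ _ _ _ _ (dF zab)); exact: f0.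
Qed.

Lemma subst_incrW : {in `[a, b]%R &, {mono F : x y / x <= y}}.
Proof. by apply: le_mono_in; exact: subst_incr. Qed.

Let a_in : a \in `[a, b]%R. Proof. by rewrite in_itv/= lexx ltW. Qed.
Let b_in : b \in `[a, b]%R. Proof. by rewrite in_itv/= lexx ltW. Qed.

Let Fab : F a < F b. Proof. exact: subst_incr. Qed.

Lemma subst_surj y : F a <= y <= F b -> exists2 x, a <= x <= b & F x = y.
Proof.
move=> yab; have [|x] := @IVT _ F a b y (ltW ab) cFab.
  by rewrite min_l ?max_r// ltW.
by rewrite in_itv/= => xab <-; exists x.
Qed.

Lemma FTC_seg u v : a <= u -> u < v -> v <= b ->
  (\int[leb]_(x in `[u, v]) (f x)%:E = (F v - F u)%:E)%E.
Proof.
move=> au uv vb.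
have uvab x : u <= x <= v -> a <= x <= b.
  by move=> /andP[ux xv]; rewrite (le_trans au)// (le_trans xv).
rewrite EFinB (@continuous_FTC2 _ f F u v uv)//.
- apply: continuous_in_subspaceT => x; rewrite inE/= in_itv/= => xuv.
  by apply: cf; exact: uvab.
- split.
  + move=> x; rewrite in_itv/= => /andP[ux xv].
    by have [] := dF (x := x); rewrite ?uvab// (ltW ux) ltW.
  + by apply: cvg_at_right_filter; apply: cF; apply: uvab; rewrite lexx ltW.
  + by apply: cvg_at_left_filter; apply: cF; apply: uvab; rewrite lexx ltW.
- move=> x; rewrite in_itv/= => /andP[ux xv].
  have xab : a <= x <= b by rewrite uvab// (ltW ux) ltW.
  by rewrite derive1E (@derive_val _ _ _ _ _ _ _ (dF xab)).
Qed.

Let k (x : R) := f x * \1_`[a, b] x.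

Let k_ge0 x : 0 <= k x.
Proof.
rewrite /k indicE; case: (boolP (x \in _)) => [|_]; rewrite ?mulr0 ?mulr1//.
by rewrite inE/= in_itv/= => /f0/ltW.
Qed.

Let mk : measurable_fun setT k.
Proof. by apply: measurable_funM => //; exact: measurable_indic. Qed.

Let mC : measurable (~` `[F a, F b] : set (measurableTypeR R)).
Proof. by apply: measurableC; exact: measurable_itv. Qed.

Let mFR : measurable_fun setT (F : R -> measurableTypeR R) := mF.

Let pf : {measure set (measurableTypeR R) -> \bar R} :=
  measure_function_pushforward__canonical__measure_function_Measure
    (mdens k_ge0 mk) mFR.

(** Image under F of the measure with density f on [a, b], completed by Lebesgue measure outside
    [F a, F b]. The completion makes the sum comparable with Lebesgue measure on the whole line, so
    that agreement on half-open intervals identifies the two. *)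
Let m := measure_add pf [the measure _ _ of mrestr leb mC].

(** Clipping ]c, d] to [F a, F b] gives ends c' < d' that are values F u and F v. The preimage is
    then the segment from u to v up to its ends, and the fundamental theorem of calculus evaluates
    the integral of f over it. *)
Let pf_itv c d : c < d ->
  mdens k_ge0 mk (F @^-1` `]c, d]) = leb (`]c, d] `&` `[F a, F b]).
Proof.
move=> cd; rewrite /mdens.
transitivity (\int[leb]_(x in F @^-1` `]c, d] `&` `[a, b]) (f x)%:E)%E.
  rewrite integral_mkcondr; apply: eq_integral => x _.
  by rewrite epatch_indic /= EFinM.
have mS : measurable (F @^-1` `]c, d] `&` `[a, b]).
  apply: measurableI => //; rewrite -[X in measurable X]setTI.
  by apply: mF.
have f0S x : (F @^-1` `]c, d] `&` `[a, b]) x -> 0 <= f x.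
  by move=> [_]; rewrite /= in_itv/= => /f0/ltW.
set c' := Num.max c (F a); set d' := Num.min d (F b).
have [cd'|dc'] := ltP c' d'.
  have [u uab Fu] : exists2 u, a <= u <= b & F u = c'.
    apply: subst_surj; rewrite le_max lexx orbT/=.
    by rewrite (le_trans (ltW cd'))// ge_min lexx orbT.
  have [v vab Fv] : exists2 v, a <= v <= b & F v = d'.
    apply: subst_surj; rewrite ge_min lexx orbT andbT.
    by rewrite (le_trans _ (ltW cd'))// le_max lexx orbT.
  have uv : u < v.
    rewrite ltNge; apply/negP => vu.
    have : F v <= F u by rewrite subst_incrW.
    by rewrite Fu Fv leNgt cd'.
  have [/andP[au ub] /andP[av vb]] := (uab, vab).
  rewrite (integral_sub_bounds (ltW uv) mS)//; last 3 first.
  - by move=> x /andP[ux xv]; rewrite ltW// f0// (le_trans au)// (le_trans xv).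
  - move=> x/=; rewrite !in_itv/= => /andP[ux xv].
    have xab : x \in `[a, b]%R by rewrite in_itv/= (le_trans au (ltW ux)) (le_trans (ltW xv)).
    split; last by move: xab; rewrite in_itv.
    have : F u < F x by rewrite subst_incr.
    have : F x < F v by rewrite subst_incr.
    rewrite Fu Fv /c' /d' gt_max lt_min => /andP[xd _] /andP[cx _].
    by rewrite cx ltW.
  - move=> x/= []; rewrite !in_itv/= => /andP[cx xd] xab.
    rewrite -(subst_incrW (x := u))// -(subst_incrW (y := v))//.
    have : F a <= F x <= F b by rewrite !subst_incrW// in_itv/=.
    move=> /andP[? ?]; rewrite Fu Fv ge_max le_min.
    by apply/andP; split; apply/andP; split => //; exact: ltW.
  rewrite FTC_seg// Fv Fu.
  have -> : `]c, d] `&` `[F a, F b] = `]c, d] `&` `[c', d'].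
    apply/seteqP; split=> x/= [xcd]; split => //; move: b0 xcd; rewrite !in_itv/=.
      move=> /andP[? ?] /andP[? ?]; rewrite ge_max le_min.
      by apply/andP; split; apply/andP; split => //; exact: ltW.
    by rewrite ge_max le_min => /andP[/andP[_ ->] /andP[_ ->]].
  apply/esym/eqP; rewrite eq_le; apply/andP; split.
    apply: (@le_trans _ _ (leb `[c', d'])).
      by apply: le_measure; rewrite ?inE//; exact: measurableI.
    by rewrite lebesgue_measure_itv/= lte_fin cd' EFinB.
  apply: (@le_trans _ _ (leb `]c', d'[)).
    by rewrite lebesgue_measure_itv/= lte_fin cd' EFinB.
  apply: le_measure; rewrite ?inE//; first exact: measurableI.
  move=> x/=; rewrite !in_itv/= => /andP[cx xd]; split; last by rewrite !ltW.
  move: cx xd; rewrite gt_max lt_min => /andP[-> _] /andP[xd _].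
  by rewrite ltW.
(* When the clipped interval is empty or degenerate, both sides are carried by at most one point:
   [F a] on the right, [a] on the left. *)
transitivity (0%E : \bar R); last first.
  apply/esym/eqP; rewrite -measure_le0.
  apply: (@le_trans _ _ (leb [set F a])); last by rewrite lebesgue_measure_set1.
  apply: le_measure; rewrite ?inE//; first exact: measurableI.
  move=> x/= []; rewrite !in_itv/= => /andP[cx xd] /andP[ax xb].
  apply/eqP; rewrite eq_le ax andbT; move: dc'.
  rewrite ge_min !le_max => /orP[/orP[dc|dFa]|/orP[bc|ba]].
  - by move: (lt_le_trans cx xd); rewrite ltNge dc.
  - exact: le_trans dFa.
  - by move: (lt_le_trans cx xb); rewrite ltNge bc.
  - exact: le_trans ba.
apply/eqP; rewrite eq_le; apply/andP; split; last first.
  by apply: integral_ge0 => x Sx; rewrite lee_fin f0S.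
apply: (@le_trans _ _ (\int[leb]_(x in [set a]) (f x)%:E)%E).
  apply: ge0_subset_integral => //.
  - by apply/measurable_funTS/measurable_EFinP.
  - by move=> x /= ->; rewrite lee_fin ltW// f0// lexx ltW.
  move=> x/= []; rewrite !in_itv/= => /andP[cx xd] xab.
  have /andP[ax xb] : F a <= F x <= F b by rewrite !subst_incrW// in_itv/=.
  have Fxa : F x <= F a.
    move: dc'; rewrite ge_min !le_max => /orP[/orP[dc|dFa]|/orP[bc|ba]].
    - by move: (lt_le_trans cx xd); rewrite ltNge dc.
    - exact: le_trans dFa.
    - by move: (lt_le_trans cx xb); rewrite ltNge bc.
    - exact: le_trans ba.
  rewrite subst_incrW// in Fxa; apply/eqP; rewrite eq_le Fxa.
  by case/andP : xab.
by rewrite integral_set1.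
Qed.

Lemma ge0_integral_subst_seg h : measurable_fun setT h -> (forall x, (0 <= h x)%E) ->
  (\int[leb]_(x in `[F a, F b]) h x = \int[leb]_(x in `[a, b]) (h (F x) * (f x)%:E))%E.
Proof.
move=> mh h0.
have lebm A : measurable A -> leb A = m A.
  apply: lebesgue_measure_unique => _ [[c d] /= _ <-].
  have [dc|cd] := leP d c.
    by rewrite set_itv_ge ?measure0// bnd_simp -leNgt.
  rewrite /m /measure_add/= /msum !big_ord_recl big_ord0/= adde0 /pushforward/=.
  rewrite pf_itv// /mrestr/= (@measureDI _ _ _ leb _ `[F a, F b])//=.
  by rewrite addeC setDE.
transitivity (\int[pf]_(x in `[F a, F b]) h x)%E.
  apply: eq_measure_integral => A mA AD; transitivity (m A); first exact: lebm.
  rewrite /m /measure_add/= /msum !big_ord_recl big_ord0/= adde0.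
  rewrite [X in (_ + X)%E](_ : _ = 0%E) ?adde0// /mrestr.
  suff -> : A `&` ~` `[F a, F b] = set0 by rewrite measure0.
  by apply/seteqP; split => // x [/AD].
transitivity (\int[mdens k_ge0 mk]_(x in F @^-1` `[F a, F b]) (h \o F) x)%E.
  have mD : measurable (`[F a, F b]%classic : set (measurableTypeR R)).
    exact: measurable_itv.
  have mhD : measurable_fun (`[F a, F b]%classic : set (measurableTypeR R)) h.
    exact: measurable_funTS.
  exact: (ge0_integral_pushforward mFR (mdens k_ge0 mk) mD mhD (fun x _ => h0 x)).
have mS : measurable (F @^-1` `[F a, F b]).
  by rewrite -[X in measurable X]setTI; exact: mF.
rewrite ge0_integral_mdens; last 3 first.
- exact: mS.
- exact: (measurableT_comp mh mF).
- by move=> x; exact: h0.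
transitivity (\int[leb]_(x in F @^-1` `[F a, F b] `&` `[a, b]) (h (F x) * (f x)%:E))%E.
  rewrite integral_mkcondr; apply: eq_integral => x _.
  by rewrite epatch_indic /k EFinM muleA.
congr (integral _ _ _); apply/seteqP; split => [x []//|x/= xab]; split => //.
by rewrite /= in_itv/= !subst_incrW.
Qed.

End increasing_segment.

Section exhaustion.
Variables (I : set R) (u v : nat -> R).
Hypotheses (uv : forall n, u n < v n) (Iuv : I = \bigcup_n `[u n, v n]).
Hypotheses (ui : {homo u : m n / (m <= n)%N >-> n <= m}).
Hypotheses (vi : {homo v : m n / (m <= n)%N >-> m <= n}).

(** Both sides are continuous along the increasing union of the segments [u n, v n]. This removes
    any condition at the ends of I, where f may blow up or F may be unbounded. *)
Lemma ge0_integral_subst_increasing F f h :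
  measurable_fun setT F -> measurable_fun setT f ->
  (forall x, I x -> is_derive x 1 F (f x)) ->
  (forall x, I x -> {for x, continuous f}) ->
  (forall x, I x -> 0 < f x) ->
  measurable_fun setT h -> (forall x, (0 <= h x)%E) ->
  (\int[leb]_(x in F @` I) h x = \int[leb]_(x in I) (h (F x) * (f x)%:E))%E.
Proof.
move=> mF mf dF cf f0 mh h0.
have Iu n x : u n <= x <= v n -> I x.
  by move=> uxv; rewrite Iuv; exists n => //=; rewrite in_itv.
have dFn n x : u n <= x <= v n -> is_derive x 1 F (f x) by move=> /Iu; exact: dF.
have cfn n x : u n <= x <= v n -> {for x, continuous f} by move=> /Iu; exact: cf.
have f0n n x : u n <= x <= v n -> 0 < f x by move=> /Iu; exact: f0.
have incW n : {in `[u n, v n]%R &, {mono F : x y / x <= y}}.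
  exact: (subst_incrW (dFn n) (f0n n)).
have FI : F @` I = \bigcup_n `[F (u n), F (v n)].
  apply/seteqP; split => y.
    move=> [x Ix <-]; move: Ix; rewrite Iuv => -[n _ xn]; exists n => //=.
    have un : u n \in `[u n, v n]%R by rewrite in_itv/= lexx ltW.
    have vn : v n \in `[u n, v n]%R by rewrite in_itv/= lexx ltW.
    by rewrite in_itv/= !(incW n)//; move: xn; rewrite /= in_itv.
  move=> [n _]; rewrite /= in_itv/= => yuv.
  have [x xuv <-] := subst_surj (uv n) (dFn n) (f0n n) yuv.
  by exists x => //; exact: Iu xuv.
have mhF : measurable_fun setT (fun x => h (F x) * (f x)%:E)%E.
  have mhF : measurable_fun setT (fun x => h (F x)).
    exact: (measurableT_comp mh mF).
  have mfE : measurable_fun setT (fun x => (f x)%:E) by exact/measurable_EFinP.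
  exact: (emeasurable_funM mhF mfE).
pose A n := (\int[leb]_(x in `[F (u n), F (v n)]) h x)%E.
pose B n := (\int[leb]_(x in `[u n, v n]) (h (F x) * (f x)%:E))%E.
have AB : A = B.
  apply/funext => n.
  exact: (ge0_integral_subst_seg (uv n) mF mf (dFn n) (cfn n) (f0n n)).
have cA : A @ \oo --> (\int[leb]_(x in F @` I) h x)%E.
  rewrite FI; apply: ge0_nondecreasing_set_cvg_integral => //.
  - move=> m n mn; apply/subsetPset => x /=; rewrite !in_itv/= => /andP[ux xv].
    have um : u n <= u m <= v n.
      by rewrite ui//= (le_trans (ltW (uv m)))// vi.
    have vm : u n <= v m <= v n.
      by rewrite vi// andbT (le_trans _ (ltW (uv m)))// ui.
    have un : u n \in `[u n, v n]%R by rewrite in_itv/= lexx ltW.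
    have vn : v n \in `[u n, v n]%R by rewrite in_itv/= lexx ltW.
    apply/andP; split.
      by apply: le_trans ux; rewrite (incW n) ?in_itv// ui.
    by apply: (le_trans xv); rewrite (incW n) ?in_itv// vi.
  - by move=> n; exact: measurable_funTS.
have cB : B @ \oo --> (\int[leb]_(x in I) (h (F x) * (f x)%:E))%E.
  rewrite [in X in _ --> X]Iuv.
  apply: ge0_nondecreasing_set_cvg_integral => //.
  - move=> m n mn; apply/subsetPset => x /=; rewrite !in_itv/= => /andP[ux xv].
    by rewrite (le_trans (ui mn))// (le_trans xv)// vi.
  - by move=> n; exact: measurable_funTS.
  - move=> n x; rewrite /= in_itv/= => /f0n fx0.
    by rewrite mule_ge0// lee_fin ltW.
rewrite AB in cA; exact: (cvg_unique _ cA cB).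
Qed.

Lemma ge0_integral_oppr (J : set R) h : measurable J ->
  measurable_fun setT h -> (forall x, (0 <= h x)%E) ->
  (\int[leb]_(x in J) h x = \int[leb]_(x in -%R @` J) h (- x)%R)%E.
Proof.
move=> mJ mh h0.
have -> : -%R @` J = (-%R : _ -> measurableTypeR R) @^-1` J.
  apply/seteqP; split => x; first by move=> [y Jy <-]; rewrite /= opprK.
  by move=> Jx; exists (- x) => //; rewrite opprK.
transitivity (\int[pushforward leb (-%R : _ -> measurableTypeR R)]_(r in J) h r)%E.
  by apply: eq_measure_integral => //= A mA AS; exact/esym/lebesgue_measureN.
by rewrite ge0_integral_pushforward//=; exact: measurable_funTS.
Qed.

(** The increasing case is applied to - F, whose derivative is f, after a reflection of the line,
    which preserves Lebesgue measure. *)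
Lemma ge0_integral_subst_decreasing F f h : measurable (F @` I) ->
  measurable_fun setT F -> measurable_fun setT f ->
  (forall x, I x -> is_derive x 1 F (- f x)) ->
  (forall x, I x -> {for x, continuous f}) ->
  (forall x, I x -> 0 < f x) ->
  measurable_fun setT h -> (forall x, (0 <= h x)%E) ->
  (\int[leb]_(x in F @` I) h x = \int[leb]_(x in I) (h (F x) * (f x)%:E))%E.
Proof.
move=> mFI mF mf dF cf f0 mh h0; rewrite ge0_integral_oppr//.
rewrite image_comp.
have mF' : measurable_fun setT (-%R \o F) by exact: measurableT_comp.
have dF' x : I x -> is_derive x 1 (-%R \o F) (f x).
  by move=> Ix; rewrite -[f x]opprK; exact: is_deriveN (dF x Ix).
have mh' : measurable_fun setT (fun x : R => h (- x)%R) by exact: measurableT_comp.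
have := ge0_integral_subst_increasing mF' mf dF' cf f0 mh' (fun x => h0 (- x)).
move=> ->; by apply: eq_integral => x _; rewrite /= opprK.
Qed.

End exhaustion.
End substitution.

(** Writing 1 / x as x (x^2)^(-1) reduces the claim to a real power of a nonnegative function; at 0
    both sides take the value 0. *)
Lemma measurable_invr {R : realType} : measurable_fun setT (@GRing.inv R).
Proof.
have -> : @GRing.inv R = (fun x => x * (x ^+ 2) `^ (-1)).
  apply/funext => x; rewrite powR_inv1 ?sqr_ge0//.
  have [->|x0] := eqVneq x 0; first by rewrite mul0r invr0.
  by rewrite expr2 invfM mulrA divff// mul1r.
apply: measurable_funM => //.
by apply: (measurableT_comp (measurable_powR _)); exact: measurable_funX.
Qed.

Lemma measurable_compR d (T : measurableType d) (R : realType) (D : set T)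
    (f : R -> R) (g : T -> R) :
  measurable_fun setT f -> measurable_fun D g -> measurable_fun D (fun x => f (g x)).
Proof. by move=> mf mg; exact: (measurableT_comp mf mg). Qed.

Lemma measurable_cosR (R : realType) : measurable_fun setT (@cos R).
Proof. by apply: continuous_measurable_fun; exact: continuous_cos. Qed.

Lemma measurable_sinR (R : realType) : measurable_fun setT (@sin R).
Proof. by apply: continuous_measurable_fun; exact: continuous_sin. Qed.

Lemma measurable_sqrtR (R : realType) : measurable_fun setT (@Num.sqrt R).
Proof. by apply: continuous_measurable_fun; exact: sqrt_continuous. Qed.

Lemma measurable_normR (R : realType) : measurable_fun setT (@Num.norm R R).
Proof. exact: normr_measurable. Qed.

Lemma measurable_boolR d (T : measurableType d) (R : realType) (D : set T) (b : T -> bool) :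
  measurable_fun D b -> measurable_fun D (fun x => (b x)%:R : R).
Proof.
move=> mb; have mB : measurable_fun setT (fun b : bool => b%:R : R) by [].
exact: (measurableT_comp mB mb).
Qed.

Ltac measurable_structural := lazymatch goal with
  | |- measurable_fun _ (fun x => EFin _) => apply/measurable_EFinP
  | |- measurable_fun _ (EFin \o _) => apply/measurable_EFinP
  | |- measurable_fun _ (fun x => @GRing.mul _ _ _) => first [apply: measurable_funM | apply: emeasurable_funM]
  | |- measurable_fun _ (fun x => @GRing.add _ _ (- _)) => first [apply: measurable_funB | apply: emeasurable_funB]
  | |- measurable_fun _ (fun x => @GRing.add _ _ _) => first [apply: measurable_funD | apply: emeasurable_funD]
  | |- measurable_fun _ (fun x => @GRing.opp _ _) => apply: measurable_funN
  | |- measurable_fun _ (fun x => @GRing.exp _ _ _) => apply: measurable_funX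
  | |- measurable_fun _ (fun x => mule _ _) => apply: emeasurable_funM
  | |- measurable_fun _ (fun x => adde _ _) => apply: emeasurable_funD
  | |- measurable_fun _ (fun x => @GRing.inv _ (@?g x)) => refine (measurable_compR (g := g) measurable_invr _)
  | |- measurable_fun _ (fun x => expR (@?g x)) => refine (measurable_compR (g := g) (@measurable_expR _) _)
  | |- measurable_fun _ (fun x => ln (@?g x)) => refine (measurable_compR (g := g) (@measurable_ln _) _)
  | |- measurable_fun _ (fun x => (@?g x) `^ ?p) => refine (measurable_compR (g := g) (@measurable_powR _ p) _)
  | |- measurable_fun _ (fun x => cos (@?g x)) => refine (measurable_compR (g := g) (@measurable_cosR _) _)
  | |- measurable_fun _ (fun x => sin (@?g x)) => refine (measurable_compR (g := g) (@measurable_sinR _) _)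
  | |- measurable_fun _ (fun x => Num.sqrt (@?g x)) => refine (measurable_compR (g := g) (@measurable_sqrtR _) _)
  | |- measurable_fun _ (fun x => Num.norm (@?g x)) => refine (measurable_compR (g := g) (@measurable_normR _) _)
  end.
Ltac measurable_leaf := first [ exact: (measurable_indic (measurable_itv _)) | exact: measurable_cst | exact: measurable_id
  | exact: measurable_invr | exact: measurable_expR | exact: measurable_ln
  | exact: measurable_powR | exact: measurable_cosR | exact: measurable_sinR
  | exact: measurable_sqrtR | exact: measurable_normR
  | exact: measurable_fst | exact: measurable_snd | exact: measurable_indic
  | match goal with H : measurable_fun _ ?f |- measurable_fun _ (fun x => ?f (@?g x)) =>
      refine (measurable_compR (g := g) H _) end ].
Ltac mstep := first [ assumption | match goal with H : measurable_fun _ _ |- _ => exact: H end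
  | exact: (measurable_indic (measurable_itv _)) | measurable_structural | measurable_leaf ].
(* Matching hypotheses only syntactically first keeps conversion problems between unrelated integrands out of the search. *)
Ltac mstep_syntactic := first [ match goal with H : measurable_fun _ ?f |- measurable_fun _ ?f => exact: H end
  | measurable_structural | measurable_leaf ].
Ltac meas := first [ solve [repeat mstep_syntactic] | repeat mstep ].

Ltac nneg := rewrite ?lee_fin; repeat first
  [ assumption | exact: ltW | exact: powR_ge0 | exact: expR_ge0 | exact: sqr_ge0
  | exact: sqrtr_ge0 | exact: normr_ge0 | exact: ler01 | exact: ler0n
  | (rewrite indicE; exact: ler0n)
  | match goal with
    | |- context [(GRing.mul _ _)] => apply: mulr_ge0
    | |- context [(GRing.add _ _)] => apply: addr_ge0
    | |- context [(GRing.inv _)] => rewrite invr_ge0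
    | |- context [(mule _ _)] => apply: mule_ge0
    | |- context [(GRing.exp _ _)] => apply: exprn_ge0
    end | done ].
Ltac iside := solve [ exact: measurable_itv | exact: measurableT
  | by apply: measurable_funTS; meas | by meas | by move=> *; nneg | by nneg ].

(** * Substitutions on the half-line and on bounded intervals *)

Section half_line.
Context {R : realType}.
Local Notation leb := (@lebesgue_measure R).
Implicit Type h : R -> \bar R.

(** The shift in [n.+2] makes already the first segment [1/2, 2] nondegenerate. For bounded
    intervals the margin is divided by [n.+3] with the same aim. *)
Lemma itv0y_exhaust : `]0%R, +oo[%classic =
  \bigcup_n `[(n.+2%:R)^-1 : R, n.+2%:R]%classic.
Proof.
apply/seteqP; split => x /=; last first.
  move=> [n _]; rewrite /= !in_itv/= andbT => /andP[nx _].
  by rewrite (lt_le_trans _ nx)// invr_gt0.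
rewrite in_itv/= andbT => x0.
pose n := maxn (Num.truncn x) (Num.truncn x^-1).
exists n => //=; rewrite in_itv/=.
have xV : x^-1 <= n.+2%:R.
  apply: (le_trans (ltW (truncnS_gt _))); rewrite ler_nat.
  by rewrite ltnS (leq_trans _ (leqnSn _))// leq_maxr.
apply/andP; split; first by rewrite -[leRHS]invrK lef_pV2// posrE// invr_gt0.
apply: (le_trans (ltW (truncnS_gt _))); rewrite ler_nat.
by rewrite ltnS (leq_trans _ (leqnSn _))// leq_maxl.
Qed.

Lemma itvoo_exhaust (a b : R) : a < b -> `]a, b[%classic =
  \bigcup_n `[a + (b - a) / n.+3%:R, b - (b - a) / n.+3%:R]%classic.
Proof.
move=> ab; have ba0 : 0 < b - a by rewrite subr_gt0.
apply/seteqP; split => x /=; last first.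
  move=> [n _]; rewrite /= !in_itv/= => /andP[nx xn].
  have e0 : 0 < (b - a) / n.+3%:R by rewrite divr_gt0.
  apply/andP; split.
    by rewrite (lt_le_trans _ nx)// ltrDl.
  by rewrite (le_lt_trans xn)// ltrBlDr ltrDl.
rewrite in_itv/= => /andP[ax xb].
pose n := maxn (Num.truncn ((b - a) / (x - a))) (Num.truncn ((b - a) / (b - x))).
exists n => //=; rewrite in_itv/=.
have xa0 : 0 < x - a by rewrite subr_gt0.
have bx0 : 0 < b - x by rewrite subr_gt0.
have h1 : (b - a) / (x - a) <= n.+3%:R.
  apply: (le_trans (ltW (truncnS_gt _))); rewrite ler_nat.
  by rewrite ltnS (leq_trans _ (leqnSn _))// (leq_trans _ (leqnSn _))// leq_maxl.
have h2 : (b - a) / (b - x) <= n.+3%:R.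
  apply: (le_trans (ltW (truncnS_gt _))); rewrite ler_nat.
  by rewrite ltnS (leq_trans _ (leqnSn _))// (leq_trans _ (leqnSn _))// leq_maxr.
apply/andP; split.
  rewrite -lerBrDl ler_pdivrMr// mulrC -ler_pdivrMr//.
rewrite lerBrDr -lerBrDl ler_pdivrMr// mulrC -ler_pdivrMr//.
Qed.

Lemma itv0y_uv n : (n.+2%:R)^-1 < n.+2%:R :> R.
Proof.
by rewrite (@lt_trans _ _ 1)// ?invf_lt1 ?ltr1n.
Qed.

Lemma itv0y_u : {homo (fun n => (n.+2%:R)^-1 : R) : m n / (m <= n)%N >-> n <= m}.
Proof. by move=> m n mn; rewrite lef_pV2 ?posrE// ler_nat. Qed.

Lemma itv0y_v : {homo (fun n => n.+2%:R : R) : m n / (m <= n)%N >-> m <= n}.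
Proof. by move=> m n mn; rewrite ler_nat. Qed.

Lemma ge0_integral_subst0y_increasing (F f : R -> R) h :
  measurable_fun setT F -> measurable_fun setT f ->
  (forall x : R, 0 < x -> is_derive x 1 F (f x)) ->
  (forall x : R, 0 < x -> {for x, continuous f}) ->
  (forall x, 0 < x -> 0 < f x) ->
  measurable_fun setT h -> (forall x, (0 <= h x)%E) ->
  (\int[leb]_(x in F @` `]0%R, +oo[) h x =
   \int[leb]_(x in `]0%R, +oo[) (h (F x) * (f x)%:E))%E.
Proof.
move=> mF mf dF cf f0 mh h0.
by apply: (ge0_integral_subst_increasing itv0y_uv itv0y_exhaust itv0y_u itv0y_v) => //;
  move=> x; rewrite /= in_itv/= andbT; [exact: dF|exact: cf|exact: f0].
Qed.

Lemma ge0_integral_subst0y_decreasing (F f : R -> R) h :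
  measurable (F @` `]0%R, +oo[) ->
  measurable_fun setT F -> measurable_fun setT f ->
  (forall x : R, 0 < x -> is_derive x 1 F (- f x)) ->
  (forall x : R, 0 < x -> {for x, continuous f}) ->
  (forall x, 0 < x -> 0 < f x) ->
  measurable_fun setT h -> (forall x, (0 <= h x)%E) ->
  (\int[leb]_(x in F @` `]0%R, +oo[) h x =
   \int[leb]_(x in `]0%R, +oo[) (h (F x) * (f x)%:E))%E.
Proof.
move=> mFI mF mf dF cf f0 mh h0.
by apply: (ge0_integral_subst_decreasing itv0y_uv itv0y_exhaust itv0y_u itv0y_v) => //;
  move=> x; rewrite /= in_itv/= andbT; [exact: dF|exact: cf|exact: f0].
Qed.

Section bounded.
Variables (a b : R) (ab : a < b).

Let uv n : a + (b - a) / n.+3%:R < b - (b - a) / n.+3%:R.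
Proof.
have V3 : (n.+3%:R : R)^-1 <= 3^-1 by rewrite lef_pV2 ?posrE// ler_nat.
have : (b - a) / n.+3%:R <= (b - a) / 3 by rewrite ler_pM2l// subr_gt0.
move: ab; set w := _ / n.+3%:R => ab' wb; lra.
Qed.

Let u_homo : {homo (fun n => a + (b - a) / n.+3%:R) : m n / (m <= n)%N >-> n <= m}.
Proof.
move=> m n mn; rewrite lerD2l ler_pM2l ?subr_gt0// lef_pV2 ?posrE//.
by rewrite ler_nat.
Qed.

Let v_homo : {homo (fun n => b - (b - a) / n.+3%:R) : m n / (m <= n)%N >-> m <= n}.
Proof.
move=> m n mn; rewrite lerD2l lerN2 ler_pM2l ?subr_gt0// lef_pV2 ?posrE//.
by rewrite ler_nat.
Qed.

Lemma ge0_integral_substoo_increasing (F f : R -> R) h :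
  measurable_fun setT F -> measurable_fun setT f ->
  (forall x, a < x < b -> is_derive x 1 F (f x)) ->
  (forall x, a < x < b -> {for x, continuous f}) ->
  (forall x, a < x < b -> 0 < f x) ->
  measurable_fun setT h -> (forall x, (0 <= h x)%E) ->
  (\int[leb]_(x in F @` `]a, b[) h x =
   \int[leb]_(x in `]a, b[) (h (F x) * (f x)%:E))%E.
Proof.
move=> mF mf dF cf f0 mh h0.
by apply: (ge0_integral_subst_increasing uv (itvoo_exhaust ab) u_homo v_homo).
Qed.

Lemma ge0_integral_substoo_decreasing (F f : R -> R) h :
  measurable (F @` `]a, b[) ->
  measurable_fun setT F -> measurable_fun setT f ->
  (forall x, a < x < b -> is_derive x 1 F (- f x)) ->
  (forall x, a < x < b -> {for x, continuous f}) ->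
  (forall x, a < x < b -> 0 < f x) ->
  measurable_fun setT h -> (forall x, (0 <= h x)%E) ->
  (\int[leb]_(x in F @` `]a, b[) h x =
   \int[leb]_(x in `]a, b[) (h (F x) * (f x)%:E))%E.
Proof.
move=> mFI mF mf dF cf f0 mh h0.
by apply: (ge0_integral_subst_decreasing uv (itvoo_exhaust ab) u_homo v_homo).
Qed.

End bounded.

Lemma ge0_integral0y_scale (c : R) h : 0 < c ->
  measurable_fun setT h -> (forall x, (0 <= h x)%E) ->
  (\int[leb]_(x in `]0%R, +oo[) h x =
   c%:E * \int[leb]_(x in `]0%R, +oo[) h (c * x)%R)%E.
Proof.
move=> c0 mh h0.
have E : `]0%R, +oo[%classic = ( *%R c) @` `]0%R, +oo[.
  apply/seteqP; split => x /=; rewrite ?in_itv/= ?andbT.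
    move=> x0; exists (c^-1 * x); last by rewrite mulVKf// gt_eqF.
    by rewrite in_itv/= andbT mulr_gt0// invr_gt0.
  by move=> [y]; rewrite in_itv/= andbT => y0 <-; exact: mulr_gt0.
rewrite [in LHS]E.
transitivity (\int[leb]_(x in `]0%R, +oo[) (h (c * x)%R * c%:E))%E; last first.
  rewrite ge0_integralZr//.
  - by rewrite muleC.
  - by apply: measurable_funTS; apply: measurableT_comp => //; meas.
  - by rewrite lee_fin ltW.
apply: (@ge0_integral_subst0y_increasing _ (cst c)) => //.
- move=> x _; rewrite -[X in is_derive _ _ _ X]mulr1.
  exact: (is_deriveZ c (is_derive_id x 1)).
- by move=> x _; exact: cvg_cst.
Qed.

Lemma ge0_integral0y_sqr h :
  measurable_fun setT h -> (forall x, (0 <= h x)%E) ->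
  (\int[leb]_(x in `]0%R, +oo[) h x =
   \int[leb]_(x in `]0%R, +oo[) (h (x ^+ 2)%R * (2 * x)%:E))%E.
Proof.
move=> mh h0.
have E : `]0%R, +oo[%classic = (fun x : R => x ^+ 2) @` `]0%R, +oo[.
  apply/seteqP; split => x /=; rewrite ?in_itv/= ?andbT.
    move=> x0; exists (Num.sqrt x); last by rewrite sqr_sqrtr// ltW.
    by rewrite in_itv/= andbT sqrtr_gt0.
  by move=> [y]; rewrite in_itv/= andbT => y0 <-; exact: exprn_gt0.
rewrite [in LHS]E; apply: (@ge0_integral_subst0y_increasing _ (fun x => 2 * x)) => //; try by meas.
- move=> x _.
  have := is_deriveX 2 (is_derive_id x 1).
  by rewrite /= expr1 /GRing.scale/= mulr1.
- by move=> x _; apply: cvgMr; exact: cvg_id.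
- by move=> x x0; rewrite mulr_gt0.
Qed.

Lemma ge0_integral0y_inv (c : R) h : 0 < c ->
  measurable_fun setT h -> (forall x, (0 <= h x)%E) ->
  (\int[leb]_(x in `]0%R, +oo[) h x =
   \int[leb]_(x in `]0%R, +oo[) (h (c / x)%R * (c / x ^+ 2)%:E))%E.
Proof.
move=> c0 mh h0.
have E : `]0%R, +oo[%classic = (fun x : R => c / x) @` `]0%R, +oo[.
  apply/seteqP; split => x /=; rewrite ?in_itv/= ?andbT.
    move=> x0; exists (c / x).
      by rewrite in_itv/= andbT divr_gt0.
    by rewrite invf_div mulrC divfK ?gt_eqF.
  by move=> [y]; rewrite in_itv/= andbT => y0 <-; exact: divr_gt0.
rewrite [in LHS]E; apply: (@ge0_integral_subst0y_decreasing _ (fun x => c / x ^+ 2)) => //; try by meas.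
- by rewrite -E; exact: measurable_itv.
- move=> x x0.
  have xn0 : x != 0 by rewrite gt_eqF.
  have := is_deriveZ c (is_deriveV xn0 (is_derive_id x 1)).
  by rewrite /GRing.scale/= mulr1 mulrN.
- move=> x x0; apply: cvgMr; apply: cvgV; first by rewrite sqrf_eq0 gt_eqF.
  exact: exprn_continuous.
- by move=> x x0; rewrite divr_gt0// exprn_gt0.
Qed.

End half_line.

(** * Tonelli's theorem over measurable subsets *)

Section tonelli.
Context d1 d2 (T1 : measurableType d1) (T2 : measurableType d2) {R : realType}.
Variables (m1 : {sigma_finite_measure set T1 -> \bar R}).
Variables (m2 : {sigma_finite_measure set T2 -> \bar R}).
Variables (D1 : set T1) (D2 : set T2) (mD1 : measurable D1) (mD2 : measurable D2).
Variable F : T1 * T2 -> \bar R.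
Hypotheses (mF : measurable_fun setT F) (F0 : forall x, (0 <= F x)%E).

Lemma ge0_tonelli_in :
  (\int[m1]_(x in D1) \int[m2]_(y in D2) F (x, y) =
   \int[m2]_(y in D2) \int[m1]_(x in D1) F (x, y))%E.
Proof.
pose F' (p : T1 * T2) := (F p * (\1_D1 p.1 * \1_D2 p.2)%:E)%E.
have mF' : measurable_fun setT F'.
  apply: emeasurable_funM => //; apply/measurable_EFinP.
  apply: measurable_funM.
    by apply: (measurableT_comp (measurable_indic mD1)).
  by apply: (measurableT_comp (measurable_indic mD2)).
have F'0 p : (0 <= F' p)%E by rewrite mule_ge0// lee_fin mulr_ge0.
have mF1 x : measurable_fun setT (fun y => F (x, y)).
  exact: measurableT_comp mF (measurable_pair1 x).
have mF2 y : measurable_fun setT (fun x => F (x, y)).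
  exact: measurableT_comp mF (measurable_pair2 y).
transitivity (\int[m1]_x \int[m2]_y F' (x, y))%E.
  rewrite integral_mkcond; apply: eq_integral => x _; rewrite epatch_indic/=.
  rewrite -ge0_integralZr//; last exact: measurable_funTS.
  rewrite [LHS]integral_mkcond; apply: eq_integral => y _.
  by rewrite epatch_indic/= /F' /= EFinM muleA.
transitivity (\int[m2]_y \int[m1]_x F' (x, y))%E; first exact: fubini_tonelli.
rewrite [RHS]integral_mkcond; apply: eq_integral => y _; rewrite epatch_indic/=.
rewrite -ge0_integralZr//; last exact: measurable_funTS.
rewrite [RHS]integral_mkcond; apply: eq_integral => x _.
by rewrite epatch_indic/= /F' /= EFinM muleA muleAC.
Qed.

End tonelli.

(** * The Gamma function *)

Section gamma_function.
Context {R : realType}.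
Local Notation leb := (@lebesgue_measure R).
Local Notation Rp := (`]0%R, +oo[%classic : set R).
Implicit Types s r t x : R.

Lemma ge0_tonelli0y (F : R * R -> \bar R) : measurable_fun setT F ->
  (forall p, (0 <= F p)%E) ->
  (\int[leb]_(x in Rp) \int[leb]_(y in Rp) F (x, y) =
   \int[leb]_(y in Rp) \int[leb]_(x in Rp) F (x, y))%E.
Proof. by move=> mF F0; apply: ge0_tonelli_in => //; exact: measurable_itv. Qed.

Lemma integral_expRN_tail x :
  (\int[leb]_(t in `]x, +oo[) (expR (- t))%:E = (expR (- x))%:E)%E.
Proof.
have dE t : is_derive t 1 (fun t => - expR (- t)) (expR (- t)).
  have := is_deriveN (is_derive1_comp (is_derive_expR (- t)) (is_deriveN (is_derive_id t 1))).
  by rewrite /GRing.scale/= mulrN1 opprK.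
have cE : continuous (fun t : R => expR (- t)).
  move=> t; apply: (@continuous_comp _ _ _ -%R expR).
    exact: opp_continuous.
  exact: continuous_expR.
rewrite integral_itv_obnd_cbnd; last first.
  apply/measurable_funTS/measurable_EFinP; exact: continuous_measurable_fun.
rewrite (@ge0_continuous_FTC2y _ _ (fun t => - expR (- t)) x 0).
- by rewrite sub0e EFinN oppeK.
- by move=> t _; exact: expR_ge0.
- exact: continuous_subspaceT.
- rewrite -oppr0; apply: cvgN; exact: cvgr_expR.
- by move=> t _; case: (dE t).
- apply: cvg_at_right_filter; apply: cvgN; exact: cE.
- by move=> t _; rewrite derive1E; exact: (@derive_val _ _ _ _ _ _ _ (dE t)).
Qed.

Lemma is_derive_powR s t : 0 < t -> is_derive t 1 (fun x => x `^ s) (s * t `^ (s - 1)).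
Proof. exact: is_derive1_powR. Qed.

Lemma continuous_powR s t : 0 < t -> {for t, continuous (fun x : R => x `^ s)}.
Proof.
move=> t0; have [dt _] := is_derive_powR s t0.
by apply/differentiable_continuous; exact/derivable1_diffP.
Qed.

(** Substitution v = t^s in the integral of the constant 1, which is indifferent to the singularity
    of t^(s - 1) at 0 when s < 1. *)
Lemma integral_powR s x : 0 < s -> 0 < x ->
  (\int[leb]_(t in `]0%R, x[) (s * t `^ (s - 1))%:E = (x `^ s)%:E)%E.
Proof.
move=> s0 x0.
have E : `]0%R, x `^ s[%classic = (fun t => t `^ s) @` `]0%R, x[.
  apply/seteqP; split => y /=; rewrite ?in_itv/=.
    move=> /andP[y0 yx]; exists (y `^ s^-1).
      rewrite in_itv/= powR_gt0//=.
      have -> : x = (x `^ s) `^ s^-1.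
        by rewrite -powRrM mulfV ?gt_eqF// powRr1// ltW.
      by apply: gt0_ltr_powR; rewrite ?invr_gt0// nnegrE ?powR_ge0// ltW.
    by rewrite -powRrM mulVf ?gt_eqF// powRr1// ltW.
  move=> [t]; rewrite in_itv/= => /andP[t0 tx] <-.
  rewrite powR_gt0//=; apply: gt0_ltr_powR => //; rewrite nnegrE ltW//.
transitivity (\int[leb]_(t in `]0%R, (x `^ s)%R[) (cst 1%E t))%E; last first.
  rewrite integral_cst// mul1e /= lebesgue_measure_itv/= lte_fin powR_gt0//.
  by rewrite sube0.
rewrite E; transitivity (\int[leb]_(t in `]0%R, x[)
    (cst 1%E (t `^ s)%R * (s * t `^ (s - 1))%:E))%E.
  by apply: eq_integral => t _; rewrite mul1e.
apply/esym.
apply: ge0_integral_substoo_increasing => //; try by meas.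
- by move=> t /andP[t0 _]; exact: is_derive_powR.
- by move=> t /andP[t0 _]; apply: cvgMr; exact: continuous_powR.
- by move=> t /andP[t0 _]; rewrite mulr_gt0// powR_gt0.
Qed.

Let gE s := (\int[leb]_(t in Rp) (t `^ (s - 1) * expR (- t))%:E)%E.

Let gE_ge0 s : (0 <= gE s)%E.
Proof. by apply: integral_ge0 => t _; rewrite lee_fin mulr_ge0// ?powR_ge0 ?expR_ge0. Qed.

Let mg s : measurable_fun setT (fun t : R => (t `^ (s - 1) * expR (- t))%:E).
Proof. by meas. Qed.

Lemma integral_expRN r : 0 < r ->
  (\int[leb]_(t in Rp) (expR (- (r * t)))%:E = (r^-1)%:E)%E.
Proof.
move=> r0; have h := integral_expRN_tail 0; rewrite oppr0 expR0 in h.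
rewrite (@ge0_integral0y_scale _ r _ r0) in h; last 2 first.
- by meas.
- by move=> t; rewrite lee_fin expR_ge0.
move: h; set X := (\int[leb]_(t in _) _)%E => h.
have := congr1 (fun y => (r^-1)%:E * y)%E h.
by rewrite muleA -EFinM mulVf ?gt_eqF// mul1e mule1.
Qed.

(** One Taylor term of exp (t / 2), of order above |s|, dominates t^s for t >= 1. The halved
    exponent leaves a factor exp (- t / 2) when the bound is multiplied by exp (- t). *)
Lemma powR_le_expR s : exists K : R, 0 < K /\ forall t, 1 <= t -> t `^ s <= K * expR (2^-1 * t).
Proof.
pose n := (Num.truncn `|s|).
exists (n.+1`!%:R * 2 ^+ n.+1); split; first by rewrite mulr_gt0// ?ltr0n ?fact_gt0 ?exprn_gt0.
move=> t t1; have t0 : 0 <= t by apply: le_trans t1.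
apply: (@le_trans _ _ (t ^+ n.+1)).
  rewrite -powR_mulrn//; apply: ler_powR => //.
  by rewrite (le_trans (ler_norm _))// ltW// truncnS_gt.
have h : 1 + (2^-1 * t) ^+ n.+1 / n.+1`!%:R <= expR (2^-1 * t).
  by apply: expR_ge1Dxn; rewrite mulr_ge0.
have {}h : (2^-1 * t) ^+ n.+1 / n.+1`!%:R <= expR (2^-1 * t).
  by apply: le_trans h; rewrite lerDr.
rewrite ler_pdivrMr ?ltr0n ?fact_gt0// in h.
rewrite exprMn exprVn ler_pdivrMl ?exprn_gt0// in h.
by rewrite (le_trans h)// (mulrC (expR _)) mulrA (mulrC (2 ^+ _)).
Qed.

Lemma gammaE_lty s : 0 < s -> (gE s < +oo)%E.
Proof.
move=> s0; have [K [K0 hK]] := powR_le_expR (s - 1).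
have h t : 0 < t -> t `^ (s - 1) * expR (- t) <=
    t `^ (s - 1) * \1_(`]0%R, 1[%classic) t + K * expR (- (2^-1 * t)).
  move=> t0; have [t1|t1] := ltP t 1.
    rewrite indicE mem_set ?mulr1//=; last by rewrite in_itv/= t0.
    apply: (@le_trans _ _ (t `^ (s - 1))).
      by rewrite ler_piMr ?powR_ge0// expR_le1 oppr_le0 ltW.
    by rewrite lerDl mulr_ge0// ?expR_ge0// ltW.
  rewrite indicE memNset ?mulr0 ?add0r; last first.
    by rewrite /= in_itv/= t0/= ltNge t1.
  have -> : expR (- (2^-1 * t)) = expR (2^-1 * t) * expR (- t).
    by rewrite -expRD; congr expR; field.
  by rewrite mulrA ler_wpM2r ?expR_ge0// hK.
have m1 : measurable_fun setT (\1_(`]0%R, 1%R[%classic : set R) : R -> R).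
  exact: (measurable_indic (measurable_itv _)).
apply: (@le_lt_trans _ _ (\int[leb]_(t in Rp)
    ((t `^ (s - 1) * \1_(`]0%R, 1[%classic) t)%:E + (K * expR (- (2^-1 * t)))%:E))%E).
  apply: ge0_le_integral => //.
  - by move=> t _; rewrite lee_fin mulr_ge0// ?powR_ge0 ?expR_ge0.
  - by apply: measurable_funTS; meas.
  - by apply: measurable_funTS; meas.
  - by move=> t /=; rewrite in_itv/= andbT -EFinD lee_fin; exact: h.
rewrite ge0_integralD; [|iside ..].
apply: lte_add_pinfty.
  rewrite (_ : (\int[_]_(t in _) _ = \int[leb]_(t in `]0%R, 1%R[) (s^-1%:E * (s * t `^ (s - 1))%:E))%E); last first.
    rewrite [LHS]integral_mkcond [RHS]integral_mkcond; apply: eq_integral => t _.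
    rewrite !epatch_indic/= -!EFinM mulKf ?gt_eqF// -mulrA !indicE; congr (_ * _)%:E.
    rewrite !mem_setE !in_itv/= -natrM mulnb andbT; congr (nat_of_bool _)%:R.
    by case: (0 < t); rewrite ?andbT ?andbF.
  rewrite ge0_integralZl; [|iside ..].
  by rewrite integral_powR// -EFinM ltry.
under eq_integral do rewrite EFinM.
rewrite ge0_integralZl; [|iside ..].
by rewrite integral_expRN// -EFinM ltry.
Qed.

Lemma GammaE s : 0 < s -> (Gamma s)%:E = gE s.
Proof.
move=> s0; rewrite /Gamma /Rintegral fineK// ge0_fin_numE; first exact: gammaE_lty.
exact: gE_ge0.
Qed.

Lemma Gamma_ge0 s : 0 <= Gamma s.
Proof. by apply: Rintegral_ge0 => t _; rewrite mulr_ge0 ?powR_ge0 ?expR_ge0. Qed.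

Lemma integral_gamma s r : 0 < s -> 0 < r ->
  (\int[leb]_(t in Rp) (t `^ (s - 1) * expR (- (r * t)))%:E =
   (Gamma s * r `^ (- s))%:E)%E.
Proof.
move=> s0 r0; have h := GammaE s0; rewrite /gE (@ge0_integral0y_scale _ r _ r0)// in h; last first.
  by move=> t; rewrite lee_fin mulr_ge0 ?powR_ge0 ?expR_ge0.
have E : (\int[leb]_(t in Rp) ((r * t) `^ (s - 1) * expR (- (r * t)))%:E =
   (r `^ (s - 1))%:E * \int[leb]_(t in Rp) (t `^ (s - 1) * expR (- (r * t)))%:E)%E.
  rewrite -ge0_integralZl; [|iside ..].
  apply: eq_integral => t; rewrite inE/= in_itv/= andbT => t0.
  by rewrite powRM ?(ltW r0) ?(ltW t0)// -EFinM mulrA.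
rewrite E muleA -EFinM mulr_powRB1 ?(ltW r0)// in h; move: h.
set X := (\int[leb]_(t in _) _)%E => h.
rewrite EFinM h muleAC -EFinM powRN mulfV ?mul1e//.
by rewrite gt_eqF// powR_gt0.
Qed.

Lemma Gamma_gt0 s : 0 < s -> 0 < Gamma s.
Proof.
move=> s0; rewrite -lte_fin GammaE//.
apply: (@lt_le_trans _ _ (\int[leb]_(t in `[1%R, 2%R]) (cst (2^-1 * expR (- 2))%:E t))%E).
  rewrite integral_cst//= lebesgue_measure_itv/= lte_fin ltr1n -EFinB -EFinM lte_fin.
  by rewrite !mulr_gt0// ?expR_gt0// subr_gt0 ltr1n.
apply: (@le_trans _ _ (\int[leb]_(t in `[1%R, 2%R]) (t `^ (s - 1) * expR (- t))%:E)%E).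
  apply: ge0_le_integral => //.
  - by move=> t _; rewrite lee_fin mulr_ge0 ?expR_ge0.
  - by apply: measurable_funTS; meas.
  move=> t /=; rewrite in_itv/= => /andP[t1 t2]; rewrite lee_fin.
  have t0 : 0 < t by apply: lt_le_trans t1.
  apply: ler_pM; rewrite ?expR_ge0//; last by rewrite ler_expR lerN2.
  apply: (@le_trans _ _ (t `^ (- 1))).
    by rewrite powR_inv1 ?(ltW t0)// lef_pV2// posrE.
  by apply: ler_powR => //; lra.
apply: ge0_subset_integral => //.
- by apply: measurable_funTS; meas.
- by move=> t _; rewrite lee_fin mulr_ge0 ?powR_ge0 ?expR_ge0.
- move=> t /=; rewrite !in_itv/= andbT => /andP[t1 _].
  by apply: lt_le_trans t1.
Qed.

(** Writing t^s as the integral of s x^(s - 1) over ]0, t[ turns Gamma (s + 1) into a double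
    integral over x < t. Integrating in t first gives s Gamma (s), with no boundary terms to
    discuss. *)
Lemma GammaS s : 0 < s -> Gamma (s + 1) = s * Gamma s.
Proof.
move=> s0; apply: EFin_inj; rewrite EFinM !GammaE//; last by rewrite addr_gt0.
rewrite /gE addrK.
pose F (p : R * R) := ((s * p.1 `^ (s - 1)) * expR (- p.2) * (p.1 < p.2)%R%:R)%:E.
have mF : measurable_fun setT F.
  apply/measurable_EFinP; apply: measurable_funM; first by meas.
  apply: measurable_boolR.
  by apply: measurable_fun_ltr; [exact: measurable_fst|exact: measurable_snd].
have F0 p : (0 <= F p)%E.
  by rewrite lee_fin !mulr_ge0 ?powR_ge0 ?expR_ge0// ltW.
transitivity (\int[leb]_(t in Rp) \int[leb]_(x in Rp) F (x, t))%E.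
  apply: eq_integral => t; rewrite inE/= in_itv/= andbT => t0.
  rewrite EFinM -(integral_powR s0 t0) -ge0_integralZr; [|iside ..].
  rewrite [LHS]integral_mkcond [RHS]integral_mkcond; apply: eq_integral => x _.
  rewrite !epatch_indic/= /F/= -!EFinM !indicE; congr EFin.
  rewrite -[RHS]mulrA; congr (_ * _).
  rewrite !mem_setE /= !in_itv/= andbT -natrM mulnb.
  by rewrite andbC.
rewrite -ge0_tonelli0y// -ge0_integralZl; [|iside ..].
apply: eq_integral => x; rewrite inE/= in_itv/= andbT => x0.
transitivity (\int[leb]_(t in `]x, +oo[) ((s * x `^ (s - 1))%:E * (expR (- t))%:E))%E.
  rewrite [LHS]integral_mkcond [RHS]integral_mkcond; apply: eq_integral => t _.
  rewrite !epatch_indic/= /F/= -!EFinM !indicE; congr EFin.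
  rewrite -[LHS]mulrA; congr (_ * _).
  rewrite !mem_setE /= !in_itv/= !andbT -natrM mulnb.
  by case: ltP => //= xt; rewrite (lt_trans x0 xt).
rewrite ge0_integralZl; [|iside ..].
by rewrite integral_expRN_tail -!EFinM mulrA.
Qed.

(** Beta integral on the half-line: the double integral of v^(a - 1) r^(a + b - 1) exp (- (1 + v) r)
    is computed in both orders. *)
Lemma integral_beta a b : 0 < a -> 0 < b ->
  (\int[leb]_(v in Rp) (v `^ (a - 1) * (1 + v) `^ (- (a + b)))%:E =
   (Gamma a * Gamma b / Gamma (a + b))%:E)%E.
Proof.
move=> a0 b0; have ab0 : 0 < a + b by rewrite addr_gt0.
have Gab0 := Gamma_ge0 (a + b); have Ga0 := Gamma_ge0 a.
pose F (p : R * R) := (p.1 `^ (a - 1) * p.2 `^ (a + b - 1) * expR (- ((1 + p.1) * p.2)))%:E.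
have mF : measurable_fun setT F by rewrite /F; meas.
have F0 p : (0 <= F p)%E by rewrite lee_fin !mulr_ge0 ?powR_ge0 ?expR_ge0.
have E1 : (\int[leb]_(v in Rp) \int[leb]_(r in Rp) F (v, r) =
    (Gamma (a + b))%:E * \int[leb]_(v in Rp) (v `^ (a - 1) * (1 + v) `^ (- (a + b)))%:E)%E.
  rewrite -ge0_integralZl; [|iside ..].
  apply: eq_integral => v; rewrite inE/= in_itv/= andbT => v0.
  rewrite /F/=.
  under eq_integral do rewrite -mulrA EFinM.
  rewrite ge0_integralZl; [|iside ..].
  rewrite integral_gamma//; last by rewrite addr_gt0.
  by rewrite -!EFinM mulrCA.
have E2 : (\int[leb]_(v in Rp) \int[leb]_(r in Rp) F (v, r) =
    (Gamma a * Gamma b)%:E)%E.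
  rewrite ge0_tonelli0y// EFinM (GammaE b0) /gE -ge0_integralZl; [|iside ..].
  apply: eq_integral => r; rewrite inE/= in_itv/= andbT => r0.
  rewrite /F/=.
  transitivity (\int[leb]_(v in Rp) ((r `^ (a + b - 1) * expR (- r))%:E *
      (v `^ (a - 1) * expR (- (r * v)))%:E))%E.
    apply: eq_integral => v _; rewrite -EFinM; congr EFin.
    rewrite mulrDl mul1r opprD expRD (mulrC v r).
    by rewrite -!mulrA mulrCA; congr (_ * _); rewrite mulrCA.
  rewrite ge0_integralZl; [|iside ..].
  rewrite integral_gamma// -!EFinM; congr EFin.
  have -> : r `^ (a + b - 1) = r `^ a * r `^ (b - 1).
    by rewrite -powRD ?(gt_eqF r0) ?implybT// addrA.
  rewrite powRN; have : r `^ a != 0 by rewrite gt_eqF ?powR_gt0.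
  by move=> ?; field.
move: E2; rewrite E1; set X := (\int[leb]_(v in _) _)%E => h.
rewrite EFinM -h muleAC -EFinM mulfV ?mul1e//.
by rewrite gt_eqF// Gamma_gt0.
Qed.

End gamma_function.

(** * Pochhammer symbols and the finite sums behind the Bessel product formula *)

Section pochhammer.
Context {R : realFieldType}.
Implicit Types c X Y : R.

Definition poch c n : R := \prod_(i < n) (c + i%:R).

Lemma poch0 c : poch c 0 = 1. Proof. by rewrite /poch big_ord0. Qed.

Lemma pochSr c n : poch c n.+1 = poch c n * (c + n%:R).
Proof. by rewrite /poch big_ord_recr. Qed.

Lemma pochSl c n : poch c n.+1 = c * poch (c + 1) n.
Proof.
rewrite /poch big_ord_recl addr0; congr (_ * _); apply: eq_bigr => i _.
by rewrite lift0 -natr1 -[RHS]addrA [1 + _]addrC.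
Qed.

Lemma poch_gt0 c n : 0 < c -> 0 < poch c n.
Proof. by move=> c0; apply: prodr_gt0 => i _; rewrite ltr_wpDr. Qed.

Lemma pochD c k l : poch c (k + l) = poch c k * poch (c + k%:R) l.
Proof.
elim: l => [|l IH]; first by rewrite addn0 poch0 mulr1.
by rewrite addnS !pochSr IH -mulrA -addrA -natrD.
Qed.

(** Chu-Vandermonde: the left side is the terminating series 2F1(-k, -l; c; 1). Pascal's rule splits
    the sum for k + 1 into the sum for (c, l) and l / c times the one for (c + 1, l - 1). At l = 0
    the second carries the factor 0, so the truncated predecessor does no harm. *)
Lemma vandermonde_poch c k l : 0 < c ->
  \sum_(m < k.+1) ('C(k, m) * l ^_ m)%:R / poch c m = poch (c + l%:R) k / poch c k.
Proof.
elim: k c l => [|k IH] c l c0.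
  by rewrite big_ord_recl big_ord0 bin0 ffactn0 !poch0 addr0.
have ck n : c + n%:R != 0 by rewrite gt_eqF// ltr_wpDr.
have pk := gt_eqF (poch_gt0 k c0).
rewrite big_ord_recl bin0 ffactn0 poch0.
under eq_bigr do rewrite lift0 binS.
transitivity (\sum_(m < k.+1) ('C(k, m) * l ^_ m)%:R / poch c m +
  l%:R / c * \sum_(m < k.+1) ('C(k, m) * l.-1 ^_ m)%:R / poch (c + 1) m).
  rewrite [in RHS]big_ord_recl bin0 ffactn0 poch0 -[RHS]addrA; congr (_ + _).
  under [X in _ = X + _]eq_bigr do rewrite lift0.
  under eq_bigr do rewrite mulnDl natrD mulrDl.
  rewrite big_split/= big_ord_recr/= bin_small// mul0n mul0r addr0.
  congr (_ + _); rewrite big_distrr/=; apply: eq_bigr => m _.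
  rewrite ffactnS mulnCA pochSl natrM [in RHS]mulrACA.
  rewrite -invfM; congr (_ * _ / _).
rewrite IH// IH ?addr_gt0// pochSr [in RHS]pochSr.
case: l => [|l].
  rewrite !mul0r !addr0; have := ck k; have := negbT pk; move: (poch c k) => A ? ?.
  by field; apply/andP.
have -> : c + 1 + l%:R = c + l.+1%:R by rewrite -addrA -natr1 [1 + _]addrC.
have h : c * poch (c + 1) k = poch c k * (c + k%:R) by rewrite -pochSl pochSr.
have -> : poch (c + 1) k = poch c k * (c + k%:R) / c.
  by rewrite -h mulrC mulKf// -[c]addr0; exact: (ck 0%N).
have c1 : c != 0 by rewrite gt_eqF.
have := ck k; move: (negbT pk).
set A := poch c k; set B := poch _ k; rewrite -natr1.
set x : R := k%:R; set y : R := l%:R; move=> A0 cx0.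
by field; rewrite A0 c1 cx0.
Qed.

Lemma sum_even (F : nat -> R) N : (forall m, F m.*2.+1 = 0) ->
  \sum_(j < N.*2) F j = \sum_(m < N) F m.*2.
Proof.
move=> F0; elim: N => [|N IH]; first by rewrite !big_ord0.
by rewrite doubleS !big_ord_recr/= IH F0 addr0.
Qed.

Lemma half_poch m : poch (2^-1) m = (m.*2)`!%:R / (4 ^+ m * m`!%:R).
Proof.
elim: m => [|m IH]; first by rewrite poch0 expr0 mul1r double0 fact0 divr1.
rewrite pochSr IH doubleS !factS exprS !natrM.
have f0 : (m`!%:R : R) != 0 by rewrite pnatr_eq0 -lt0n fact_gt0.
have m0 : (m.+1%:R : R) != 0 by rewrite pnatr_eq0.
have p0 : (4 : R) ^+ m != 0 by rewrite expf_neq0// pnatr_eq0.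
have -> : m.*2.+2%:R = 2 * m.+1%:R :> R by rewrite -natrM mul2n.
have -> : m.*2.+1%:R = 2 * (2^-1 + m%:R) :> R.
  by rewrite mulrDr mulfV ?pnatr_eq0// -natrM mul2n -natr1 addrC.
move: f0 m0 p0.
move: (m`!%:R : R) (m.+1%:R : R) (4 ^+ m : R) (m%:R : R) ((m.*2)`!%:R : R).
by move=> A B D x y h1 h2 h3; field; rewrite ?h1 ?h2 ?h3 ?pnatr_eq0.
Qed.

(** Binomial expansion of (X + Y)^(n - 2m) with the index shifted by m. The falling factorials
    vanish unless m <= k <= n - m, so k may run over a range independent of m, and sums over k and m
    can then be exchanged. *)
Lemma binomial_ffact X Y n m : (m.*2 <= n)%N ->
  X ^+ m * Y ^+ m * (X + Y) ^+ (n - m.*2) / (n - m.*2)`!%:R =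
  \sum_(k < n.+1) X ^+ k * Y ^+ (n - k) * (k ^_ m * (n - k) ^_ m)%:R /
     (k`! * (n - k)`!)%:R.
Proof.
move=> mn; have fN0 a : (a`!%:R : R) != 0 by rewrite pnatr_eq0 -lt0n fact_gt0.
rewrite (addrC X) exprDn mulr_sumr mulr_suml.
rewrite -(big_mkord predT (fun k => X ^+ k * Y ^+ (n - k) *
   (k ^_ m * (n - k) ^_ m)%:R / (k`! * (n - k)`!)%:R)).
rewrite (@big_cat_nat _ _ _ m)//=; last by rewrite (leq_trans _ (leq_trans mn (leqnSn n)))// -addnn leq_addr.
rewrite [X in _ = X + _]big_nat_cond [X in _ = X + _]big1 ?add0r; last first.
  by move=> k /andP[/andP[_ km] _]; rewrite ffact_small// mul0n mulr0 mul0r.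
rewrite (@big_cat_nat _ _ _ (n - m).+1)//=; last 2 first.
- by rewrite (leq_trans _ (leqnSn _))// leq_subRL ?addnn// (leq_trans _ mn)// -addnn leq_addr.
- by rewrite ltnS leq_subr.
rewrite [X in _ = _ + X]big_nat_cond [X in _ = _ + X]big1 ?addr0; last first.
  move=> k /andP[/andP[nk kn] _].
  rewrite [(n - k) ^_ m]ffact_small ?muln0 ?mulr0 ?mul0r//.
  by rewrite ltn_subLR// addnC -ltn_subLR//; rewrite (leq_trans _ mn)// -addnn leq_addr.
rewrite [RHS](@big_addn _ _ _ 0 (n - m).+1 m).
have -> : ((n - m).+1 - m = (n - m.*2).+1)%N.
  by rewrite subSn ?leq_subRL ?addnn -?subnDA ?addnn// (leq_trans _ mn)// -addnn leq_addr.
rewrite big_mkord; apply: eq_bigr => i _.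
have im : (i <= n - m.*2)%N by rewrite -ltnS.
have imn : (i + m <= n)%N.
  by move: im mn; lia.
have -> : (n - (i + m) = (n - m.*2 - i) + m)%N.
  by move: im mn; lia.
set N := (n - m.*2)%N in im *; set j := (N - i)%N.
have Nij : N`!%:R = 'C(N, i)%:R * (i`!%:R * j`!%:R) :> R.
  by rewrite -!natrM bin_fact.
rewrite Nij -mulr_natr !exprD !natrM.
have ff a : ((a + m)`!%:R : R) = ((a + m) ^_ m)%:R * a`!%:R.
  by rewrite -natrM -(@ffact_fact (a + m) m) ?leq_addl// addnK.
rewrite !ff.
have bn0 : ('C(N, i)%:R : R) != 0 by rewrite pnatr_eq0 -lt0n bin_gt0.
have ff0 a : (((a + m) ^_ m)%:R : R) != 0 by rewrite pnatr_eq0 -lt0n ffact_gt0 leq_addl.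
have := ff0 i; have := ff0 j; have := fN0 i; have := fN0 j; move: bn0.
move: ('C(N, i)%:R : R) (((i + m) ^_ m)%:R : R) (((j + m) ^_ m)%:R : R) (i`!%:R : R) (j`!%:R : R).
move=> c1 c2 c3 c4 c5 h1 h2 h3 h4 h5.
by field; rewrite h1 h2 h3 h4 h5.
Qed.

(** Algebraic core of the product formula. With X = x^2 / 4 and Y = y^2 / 4 the left side is, up to
    sign, the n-th term of J at the third side of a triangle averaged over the angle, the quotients
    (1/2)_m / (c)_m being the even cosine moments. The right side is the n-th term of the Cauchy
    product of two Bessel series. For fixed k the sum over m is a Chu-Vandermonde sum with l = n -
    k. *)
Lemma gegenbauer_sum c X Y n : 0 < c ->
  (n`!%:R * poch c n)^-1 *
  (\sum_(m < n.+1) 'C(n, m.*2)%:R * (X + Y) ^+ (n - m.*2) * (4 * (X * Y)) ^+ m *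
      (poch (2^-1) m / poch c m)) =
  \sum_(k < n.+1) (X ^+ k / (k`!%:R * poch c k)) *
      (Y ^+ (n - k) / ((n - k)`!%:R * poch c (n - k))).
Proof.
move=> c0; have fN0 a : (a`!%:R : R) != 0 by rewrite pnatr_eq0 -lt0n fact_gt0.
have pN0 a : poch c a != 0 by rewrite gt_eqF// poch_gt0.
transitivity (\sum_(m < n.+1) \sum_(k < n.+1) (poch c n * m`!%:R * poch c m)^-1 *
   (X ^+ k * Y ^+ (n - k) * (k ^_ m * (n - k) ^_ m)%:R / (k`! * (n - k)`!)%:R)).
  rewrite mulr_sumr; apply: eq_bigr => m _; rewrite -mulr_sumr.
  have [mn|nm] := leqP m.*2 n; last first.
    rewrite bin_small// !mul0r mulr0 big1 ?mulr0// => k _.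
    suff -> : (k ^_ m * (n - k) ^_ m = 0)%N by rewrite mulr0 mul0r.
    have [km|mk] := ltnP k m; first by rewrite ffact_small.
    rewrite [(n - k) ^_ m]ffact_small ?muln0//.
    rewrite ltn_subLR; last by rewrite -ltnS.
    by rewrite (leq_trans nm)// -addnn leq_add2r.
  rewrite -binomial_ffact// half_poch exprMn exprMn.
  have <- : 'C(n, m.*2)%:R * ((m.*2)`!%:R * (n - m.*2)`!%:R) = n`!%:R :> R.
    by rewrite -!natrM bin_fact.
  have p4 : (4 : R) ^+ m != 0 by rewrite expf_neq0// pnatr_eq0.
  have bn0 : ('C(n, m.*2)%:R : R) != 0 by rewrite pnatr_eq0 -lt0n bin_gt0.
  have := fN0 m.*2; have := fN0 m; have := fN0 (n - m.*2)%N; have := pN0 n; have := pN0 m.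
  move: p4 bn0.
  move: (4 ^+ m : R) ('C(n, m.*2)%:R : R) (poch c m) (poch c n) ((n - m.*2)`!%:R : R) (m`!%:R : R) (m.*2`!%:R : R).
  move=> c1 c2 c3 c4 c5 c6 c7 h1 h2 h3 h4 h5 h6 h7.
  by field; rewrite h1 h2 h3 h4 h5 h6 h7.
rewrite exchange_big/=; apply: eq_bigr => k _.
have kn : (k <= n)%N by rewrite -ltnS.
transitivity (X ^+ k * Y ^+ (n - k) / (k`! * (n - k)`!)%:R / poch c n *
   \sum_(m < n.+1) ('C(k, m) * (n - k) ^_ m)%:R / poch c m).
  rewrite mulr_sumr; apply: eq_bigr => m _.
  have -> : (k ^_ m = 'C(k, m) * m`!)%N by rewrite bin_ffact.
  rewrite !natrM; have := fN0 m; have := fN0 k; have := fN0 (n - k)%N.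
  have := pN0 n; have := pN0 m.
  move: (poch c m) (poch c n) ((n - k)`!%:R : R) (k`!%:R : R) (m`!%:R : R).
  move=> c1 c2 c3 c4 c5 h1 h2 h3 h4 h5.
  by field; rewrite h1 h2 h3 h4 h5.
have -> : \sum_(m < n.+1) ('C(k, m) * (n - k) ^_ m)%:R / poch c m =
   \sum_(m < k.+1) ('C(k, m) * (n - k) ^_ m)%:R / poch c m.
  rewrite -!(big_mkord predT (fun m => ('C(k, m) * (n - k) ^_ m)%:R / poch c m)).
  rewrite (@big_cat_nat _ _ _ k.+1)//= [X in _ + X]big_nat_cond [X in _ + X]big1 ?addr0//.
  by move=> i /andP[/andP[ki _] _]; rewrite bin_small// mul0n mul0r.
rewrite vandermonde_poch// -[in poch c n](subnK kn) pochD natrM.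
have h : poch (c + (n - k)%:R) k != 0 by rewrite gt_eqF// poch_gt0// ltr_wpDr.
have := fN0 k; have := fN0 (n - k)%N; have := pN0 k; have := pN0 (n - k)%N; move: h.
move: (poch (c + _) k) (poch c (n - k)) (poch c k) ((n - k)`!%:R : R) (k`!%:R : R).
move=> c1 c2 c3 c4 c5 h1 h2 h3 h4 h5.
by field; rewrite h1 h2 h3 h4 h5.
Qed.

End pochhammer.

(** * Differentiability of the Gamma function *)

Section derivable_gamma.
Context {R : realType}.
Local Notation leb := (@lebesgue_measure R).
Local Notation Rp := (`]0%R, +oo[%classic : set R).

Lemma powRE_pos (t s : R) : 0 < t -> t `^ s = expR (s * ln t).
Proof. by move=> t0; rewrite /powR gt_eqF. Qed.

Lemma is_derive_compR (f g : R -> R) (x a b : R) :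
  is_derive (g x) 1 f a -> is_derive x 1 g b ->
  is_derive x 1 (fun x => f (g x)) (a * b).
Proof. by move=> df dg; exact: (is_derive1_comp df dg). Qed.

Lemma is_derive_powR_exponent (t s : R) : 0 < t ->
  is_derive s 1 (fun s => t `^ s) (ln t * t `^ s).
Proof.
move=> t0.
have -> : (fun s => t `^ s) = (fun s => expR (s * ln t)).
  by apply/funext => x; exact: powRE_pos.
have d1 : is_derive s 1 (fun s : R => s * ln t) (ln t).
  have := is_deriveZ (ln t) (is_derive_id s 1).
  by rewrite /GRing.scale/= mulr1; congr is_derive; apply/funext => x; rewrite mulrC.
have := @is_derive_compR expR (fun s => s * ln t) s _ _ (is_derive_expR (s * ln t)) d1.
by rewrite powRE_pos// mulrC.
Qed.

(** From 1 + s <= exp s at s = d ln y and at s = - d ln y: a logarithm costs an arbitrarily small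
    power in either direction. *)
Lemma norm_ln_le (d y : R) : 0 < d -> 0 < y -> `|ln y| <= d^-1 * (y `^ d + y `^ (- d)).
Proof.
move=> d0 y0; rewrite ler_pdivlMl//.
have -> : d * `|ln y| = `|d * ln y| by rewrite normrM gtr0_norm.
rewrite ler_norml.
rewrite !powRE_pos// mulNr.
have := expR_ge1Dx (d * ln y); have := expR_ge1Dx (- (d * ln y)).
have := expR_gt0 (d * ln y); have := expR_gt0 (- (d * ln y)).
by move=> *; apply/andP; split; lra.
Qed.

Lemma integrable_gamma s : 0 < s ->
  leb.-integrable Rp (EFin \o (fun t : R => t `^ (s - 1) * expR (- t))).
Proof.
move=> s0; apply/integrableP; split.
  by apply/measurable_EFinP; apply: measurable_funTS; meas.
rewrite (_ : (\int[_]_(x in _) _ = \int[leb]_(t in Rp) (t `^ (s - 1) * expR (- t))%:E)%E).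
  exact: gammaE_lty.
apply: eq_integral => t _ /=; rewrite ger0_norm// mulr_ge0 ?powR_ge0 ?expR_ge0//.
Qed.

(** Differentiation under the integral sign. It ensures that the derivative of [Gamma] occurring in
    [Calpha] is the value of an existing limit. *)
Lemma derivable_Gamma (s : R) : 0 < s -> derivable (@Gamma R) s 1.
Proof.
move=> s0; pose f (x t : R) := t `^ (x - 1) * expR (- t).
have df (x t : R) : 0 < t -> is_derive x 1 (f ^~ t) (ln t * t `^ (x - 1) * expR (- t)).
  move=> t0.
  have dB : is_derive x 1 (fun x : R => x - 1) 1.
    by have := is_deriveB (is_derive_id x 1) (is_derive_cst (1:R) x 1); rewrite subr0.
  have dp := @is_derive_compR (fun s => t `^ s) (fun x => x - 1) x _ _
    (is_derive_powR_exponent (x - 1) t0) dB.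
  have := is_deriveM dp (is_derive_cst (expR (- t)) x 1).
  rewrite /GRing.scale/= mulr0 add0r mulr1.
  by rewrite [expR _ * _]mulrC.
(* The parameter ranges over ]s / 2, s + 1[. With d = s / 4 the exponents u - d, u + d, v - d, v + d
   are all positive, so the four Gamma integrands in [G] are integrable; the shifts by d absorb the
   factor ln t. *)
pose d := s / 4; pose u := s / 2; pose v := s + 1.
have d0 : 0 < d by rewrite /d divr_gt0.
pose g (a t : R) := t `^ (a - 1) * expR (- t).
pose G (t : R) := d^-1 * (t `^ (u - d - 1) * expR (- t) + t `^ (u + d - 1) * expR (- t) +
   t `^ (v - d - 1) * expR (- t) + t `^ (v + d - 1) * expR (- t)).
apply: (@derivable_under_integral _ _ _ leb f Rp _ s u v _ _ _ G).
- exact: measurable_itv.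
- by rewrite /= in_itv/= /u /v; apply/andP; split; lra.
- move=> x; rewrite /= in_itv/= => /andP[ux _].
  by apply: integrable_gamma; rewrite (lt_trans _ ux)// /u divr_gt0.
- move=> x t _; rewrite /= in_itv/= andbT => t0.
  by have [] := df x t t0.
- by move=> t; rewrite /G mulr_ge0 ?invr_ge0 ?(ltW d0)// !addr_ge0// mulr_ge0 ?powR_ge0 ?expR_ge0.
- have -> : EFin \o G = (fun t => d^-1%:E * ((EFin \o g (u - d)%R) \+ (EFin \o g (u + d)%R) \+
   (EFin \o g (v - d)%R) \+ (EFin \o g (v + d)%R)) t)%E.
    by apply/funext => t; rewrite /G/= EFinM !EFinD.
  apply: integrableZl => //.
  have ig a : 0 < a -> leb.-integrable Rp (EFin \o g a) by exact: integrable_gamma.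
  apply: integrableD => //; last by apply: ig; rewrite /v /d; lra.
  apply: integrableD => //; last by apply: ig; rewrite /v /d; lra.
  by apply: integrableD => //; apply: ig; rewrite /u /d; lra.
- move=> x t; rewrite /= !in_itv/= andbT => /andP[ux xv] t0.
  rewrite /partial1of2 derive1E (@derive_val _ _ _ _ _ _ _ (df x t t0)).
  rewrite !normrM (ger0_norm (powR_ge0 _ _)) (ger0_norm (expR_ge0 _)).
  have hx : t `^ (x - 1) <= t `^ (u - 1) + t `^ (v - 1).
    have [t1|t1] := leP 1 t.
      apply: (@le_trans _ _ (t `^ (v - 1))); last by rewrite lerDr powR_ge0.
      by apply: ler_powR => //; rewrite lerD2r ltW.
    apply: (@le_trans _ _ (t `^ (u - 1))); last by rewrite lerDl powR_ge0.
    by apply: ger_powR; [rewrite t0 ltW|rewrite lerD2r ltW].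
  apply: (@le_trans _ _ (d^-1 * (t `^ d + t `^ (- d)) * (t `^ (u - 1) + t `^ (v - 1)) * expR (- t))).
    rewrite ler_wpM2r ?expR_ge0// ler_pM ?powR_ge0//; exact: norm_ln_le.
  have pD a b : t `^ a * t `^ b = t `^ (a + b).
    by rewrite powRD// (gt_eqF t0) implybT.
  rewrite /G -[leLHS]mulrA -[leLHS]mulrA ler_wpM2l ?invr_ge0 ?(ltW d0)//.
  rewrite le_eqVlt; apply/orP; left; apply/eqP.
  rewrite mulrDl !mulrDl !mulrDr; rewrite !(mulrA (t `^ _)) !pD.
  have -> : d + (u - 1) = u + d - 1 by ring.
  have -> : d + (v - 1) = v + d - 1 by ring.
  have -> : - d + (u - 1) = u - d - 1 by ring.
  have -> : - d + (v - 1) = v - d - 1 by ring.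
  by rewrite ?mulrDl; ring.
Qed.

End derivable_gamma.

(** * Termwise integration and Cauchy products *)

Section series_integral.
Context d (T : measurableType d) {R : realType} (m : {measure set T -> \bar R}).
Variables (u_ : (T -> R)^nat) (u : T -> R).
Hypotheses (mu_ : forall n, measurable_fun setT (u_ n)) (mu : measurable_fun setT u).
Hypothesis cu : forall x, series (fun n => u_ n x) @ \oo --> u x.
Hypothesis su : (\sum_(0 <= n <oo) \int[m]_x `|u_ n x|%:E < +oo)%E.

Let mabs n : measurable_fun setT (fun x => `|u_ n x|%:E).
Proof. by apply/measurable_EFinP; apply: (measurableT_comp (@normr_measurable _ _)). Qed.

Let g x := (\sum_(0 <= n <oo) `|u_ n x|%:E)%E.

Let ig : m.-integrable setT g.
Proof.
have mg : measurable_fun setT g by apply: ge0_emeasurable_sum => // n x _; rewrite lee_fin.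
apply/integrableP; split => //.
rewrite (eq_integral (fun x => g x)); last first.
  by move=> x _; rewrite gee0_abs// nneseries_ge0// => n _ _; rewrite lee_fin.
by rewrite integral_nneseries.
Qed.

Let iu_ n : m.-integrable setT (EFin \o u_ n).
Proof.
apply/integrableP; split; first exact/measurable_EFinP.
apply: le_lt_trans su.
rewrite (nneseries_split 0 n.+1)//; last by move=> k _; apply: integral_ge0 => x _; rewrite lee_fin.
rewrite add0n big_nat_recr//= -addeA addeCA leeDl// adde_ge0//.
  by apply: sume_ge0 => k _; apply: integral_ge0 => x _; rewrite lee_fin.
by apply: nneseries_ge0 => k _ _; apply: integral_ge0 => x _; rewrite lee_fin.
Qed.

(** Dominated convergence; the dominating function is the sum of the absolute values, integrable
    because sum and integral commute for nonnegative terms. *)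
Lemma series_integral : m.-integrable setT (EFin \o u) /\
  series (fun n => (\int[m]_x u_ n x)%R) @ \oo --> (\int[m]_x u x)%R.
Proof.
pose f_ n x := (series (fun k => u_ k x) n)%:E.
have mf_ n : measurable_fun setT (f_ n).
  apply/measurable_EFinP; rewrite /series/=.
  exact: measurable_sum.
have ff x : f_ ^~ x @ \oo --> (u x)%:E by apply: cvg_EFin; [exact: nearW|exact: cu].
have f_g x n : (`|f_ n x| <= g x)%E.
  rewrite /f_ /series/= /g (nneseries_split 0 n)//.
  rewrite add0n -[leLHS]adde0 leeD//; last by apply: nneseries_ge0 => k _ _; rewrite lee_fin.
  by rewrite sumEFin lee_fin; exact: ler_norm_sum.
have muE : measurable_fun setT (EFin \o u) by exact/measurable_EFinP.
have aeff : {ae m, forall x, [set: T] x -> f_ ^~ x @ \oo --> (EFin \o u) x}.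
  by apply: aeW => x _; exact: ff.
have aefg : {ae m, forall x n, [set: T] x -> (`|f_ n x| <= g x)%E}.
  by apply: aeW => x n _; exact: f_g.
have [iu _ c] := dominated_convergence measurableT mf_ muE aeff ig aefg.
split => //.
have E n : (\int[m]_x f_ n x)%E = (series (fun n => (\int[m]_x u_ n x)%R) n)%:E.
  rewrite /f_ /series/=.
  under eq_integral do rewrite -sumEFin.
  rewrite integral_sum//=.
  rewrite -sumEFin; apply: eq_bigr => k _.
  by rewrite /Rintegral fineK//; exact: (integrable_fin_num measurableT (iu_ k)).
move: c; rewrite (_ : [sequence _]_n = EFin \o series (fun n => (\int[m]_x u_ n x)%R)); last first.
  by apply/funext => n; rewrite /= -E.
move=> c; have fi : (\int[m]_x (u x)%:E)%E \is a fin_num by exact: integrable_fin_num.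
by rewrite -(fineK fi) in c; exact: (fine_cvg c).
Qed.

End series_integral.

Section cauchy_product.
Context {R : realType}.
Implicit Types a b : R^nat.

Lemma triangle_sum a b N :
  \sum_(0 <= n < N) \sum_(k < n.+1) a k * b (n - k)%N =
  \sum_(0 <= k < N) a k * \sum_(0 <= l < N - k) b l.
Proof.
elim: N => [|N IH]; first by rewrite !big_geq.
rewrite big_nat_recr//= IH [in RHS]big_nat_recr//= subSn// subnn big_nat1.
rewrite big_ord_recr/= subnn addrA; congr (_ + _).
rewrite -(big_mkord predT (fun k => a k * b (N - k)%N)) -big_split/=.
apply: eq_big_nat => k /andP[_ kN].
by rewrite subSn 1?ltnW// big_nat_recr//= mulrDr.
Qed.

Let T a b N := \sum_(0 <= k < N) a k * \sum_(0 <= l < N - k) b l.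

Let T_diff a b N : series a N * series b N - T a b N =
  \sum_(0 <= k < N) a k * \sum_(N - k <= l < N) b l.
Proof.
rewrite /T /series/= mulr_suml -sumrB; apply: eq_big_nat => k /andP[_ kN].
rewrite -mulrBr; congr (_ * _).
by rewrite (@big_cat_nat _ _ _ (N - k)%N)//= ?leq_subr// addrAC subrr add0r.
Qed.

(** The product of partial sums differs from the triangular sum by at most the same difference for
    absolute values. The triangle of side N contains the square of side N / 2, so this is at most P
    N - P (N / 2), which tends to 0. *)
Lemma cvg_cauchy_product a b (A B : R) :
  series a @ \oo --> A -> series b @ \oo --> B ->
  cvgn (series (fun n => `|a n|)) -> cvgn (series (fun n => `|b n|)) ->
  series (fun n => \sum_(k < n.+1) a k * b (n - k)%N) @ \oo --> A * B.
Proof.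
move=> cA cB ca cb.
rewrite (_ : series _ = T a b); last first.
  by apply/funext => N; rewrite /series/= triangle_sum.
pose P (N : nat) : R := series (fun n => `|a n|) N * series (fun n => `|b n|) N.
have cP : cvgn P by apply: is_cvgM.
have bound N : `|series a N * series b N - T a b N| <= P N - P N./2.
  rewrite T_diff (le_trans (ler_norm_sum _ _ _))//.
  apply: (@le_trans _ _ (P N - T (fun n => `|a n|) (fun n => `|b n|) N)).
    rewrite T_diff; apply: ler_sum => k _; rewrite normrM ler_wpM2l//.
    exact: ler_norm_sum.
  rewrite lerD2l lerN2 /P /T /series/= mulr_suml.
  have hN : (N./2 <= N)%N by rewrite -{2}(odd_double_half N) -addnn addnCA leq_addr.
  rewrite [leRHS](@big_cat_nat _ _ _ N./2)//= -[leLHS]addr0 lerD//.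
    rewrite big_nat_cond [leRHS]big_nat_cond; apply: ler_sum => k /andP[/andP[_ kN] _].
    rewrite ler_wpM2l//.
    have h : (N./2 <= N - k)%N.
      rewrite leq_subRL; last by rewrite (leq_trans (ltnW kN)).
      rewrite -{2}(odd_double_half N) -addnn (leq_trans _ (leq_addl _ _))//.
      by rewrite leq_add2r ltnW.
    by rewrite [leRHS](@big_cat_nat _ _ _ N./2)//= lerDl sumr_ge0.
  by apply: sumr_ge0 => k _; rewrite mulr_ge0// sumr_ge0.
have half_oo : (fun N => N./2) @ \oo --> \oo.
  apply/cvgnyPge => M; near=> N.
  by rewrite -(doubleK M) half_leq//; near: N; exact: nbhs_infty_ge.
have cD : (fun N => P N - P N./2) @ \oo --> (0 : R).
  have cP2 : (fun N => P N./2) @ \oo --> limn P by exact: (cvg_comp _ _ half_oo cP).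
  by rewrite -(subrr (limn P)); exact: cvgB.
have cS : (fun N => series a N * series b N) @ \oo --> A * B by exact: cvgM.
have c0 : (fun N => series a N * series b N - T a b N) @ \oo --> (0 : R).
  apply: norm_cvg0; apply: (@squeeze_cvgr _ _ _ _ (cst 0) (fun N => P N - P N./2)) => //.
    by apply: nearW => N; rewrite normr_ge0 bound.
  exact: cvg_cst.
have -> : T a b = (fun N => series a N * series b N - (series a N * series b N - T a b N)).
  by apply/funext => N; rewrite opprB addrC subrK.
by rewrite -[A * B]subr0; exact: cvgB.
Unshelve. all: by end_near. Qed.

End cauchy_product.

(** * The angle measure and the Hankel measure *)

Section weights.
Context {R : realType}.
Local Notation leb := (@lebesgue_measure R).
Variable alpha : R.

(** Weight of the angular average in [htrans]; with its constant the total mass is 1, so a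
    translation is an average over a probability measure. *)
Definition angle_weight (th : R) : R :=
  Gamma (alpha + 1) / (Gamma (1 / 2) * Gamma (alpha + 1 / 2)) *
  sin th `^ (2 * alpha) * \1_(`]0%R, pi[%classic : set R) th.

Lemma angle_weight_ge0 th : 0 <= angle_weight th.
Proof.
by rewrite /angle_weight !mulr_ge0 ?invr_ge0 ?mulr_ge0 ?Gamma_ge0 ?powR_ge0// indicE ler0n.
Qed.

Lemma measurable_angle_weight : measurable_fun setT angle_weight.
Proof. by rewrite /angle_weight; meas. Qed.

(** The measure mu is encoded by a density on the whole line that vanishes for x <= 0, so that its
    integrals run over the full space. *)
Definition half_line_weight (x : R) : R :=
  wdens alpha x * \1_(`]0%R, +oo[%classic : set R) x.

Lemma half_line_weight_ge0 x : 0 <= half_line_weight x.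
Proof.
rewrite /half_line_weight /wdens !mulr_ge0 ?invr_ge0 ?mulr_ge0 ?Gamma_ge0 ?powR_ge0//.
Qed.

Lemma measurable_half_line_weight : measurable_fun setT half_line_weight.
Proof. by rewrite /half_line_weight /wdens; meas. Qed.

End weights.

Notation angle_measure alpha := (mdens (angle_weight_ge0 alpha) (measurable_angle_weight alpha)).
Notation hankel_measure alpha :=
  (mdens (half_line_weight_ge0 alpha) (measurable_half_line_weight alpha)).

(** * Moments of the angle measure *)

Section angle_moments.
Context {R : realType}.
Local Notation leb := (@lebesgue_measure R).
Local Notation Rp := (`]0%R, +oo[%classic : set R).
Variable alpha : R.
Hypothesis alpha_gt : -1 / 2 < alpha.
Local Notation c := (alpha + 1).
Local Notation sigma := (angle_measure alpha).

Let pi0 : 0 < pi :> R := pi_gt0 R.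

Lemma pihalf_gt0 : 0 < pi / 2 :> R. Proof. by rewrite divr_gt0. Qed.

Lemma pihalf_ltpi : pi / 2 < pi :> R.
Proof. by rewrite ltr_pdivrMr// ltr_pMr// ltr1n. Qed.

Let c_gt0 : 0 < c. Proof. by move: alpha_gt; lra. Qed.
Let a_gt0 : 0 < alpha + 2^-1. Proof. by move: alpha_gt; lra. Qed.

Lemma exprn_double_ge0 (x : R) k : 0 <= x ^+ k.*2.
Proof. by rewrite -mul2n exprM exprn_ge0// sqr_ge0. Qed.

Lemma Gamma_poch (s : R) n : 0 < s -> Gamma (s + n%:R) = Gamma s * poch s n.
Proof.
move=> s0; elim: n => [|n IH]; first by rewrite addr0 poch0 mulr1.
by rewrite -natr1 addrA GammaS ?ltr_wpDr// IH pochSr; ring.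
Qed.

Lemma ge0_integral_reflect (b : R) (h : R -> \bar R) : 0 < b ->
  measurable_fun setT h -> (forall x, (0 <= h x)%E) ->
  (\int[leb]_(x in `](pi - b)%R, pi[) h x = \int[leb]_(x in `]0%R, b[) h (pi - x)%R)%E.
Proof.
move=> b0 mh h0.
have E : `](pi - b), pi[%classic = (fun x : R => pi - x) @` `]0%R, b[.
  apply/seteqP; split => x /=; rewrite in_itv/=.
    move=> /andP[bx xpi]; exists (pi - x); last by rewrite opprB addrC subrK.
    by rewrite in_itv/= subr_gt0 xpi/= ltrBlDr -ltrBlDl.
  move=> [y]; rewrite in_itv/= => /andP[y0 yb] <-.
  by rewrite ltrD2l ltrN2 yb/= ltrBlDr ltrDl.
rewrite [in LHS]E; transitivity (\int[leb]_(x in `]0%R, b[) (h (pi - x)%R * (cst (1%R : R) x)%:E))%E.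
  apply: ge0_integral_substoo_decreasing => //; try by meas.
  - by rewrite -E; exact: measurable_itv.
  - move=> x _; have := is_deriveB (is_derive_cst (pi : R) x 1) (is_derive_id x 1).
    by rewrite sub0r.
  - by move=> x _; exact: cvg_cst.
by apply: eq_integral => x _; rewrite mule1.
Qed.

Lemma cos_gt0_quarter (x : R) : 0 < x < pi / 2 -> 0 < cos x.
Proof.
move=> /andP[x0 xp]; apply: cos_gt0_pihalf; rewrite xp andbT (lt_trans _ x0)//.
by rewrite oppr_lt0 pihalf_gt0.
Qed.

Lemma integral_tan_subst (h : R -> \bar R) :
  measurable_fun setT h -> (forall x, (0 <= h x)%E) ->
  (\int[leb]_(v in Rp) h v =
   \int[leb]_(x in `]0%R, (pi / 2)%R[) (h (tan x ^+ 2)%R * (2 * tan x * (cos x ^+ 2)^-1)%:E))%E.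
Proof.
move=> mh h0.
have cos0 (x : R) : 0 < x < pi / 2 -> 0 < cos x.
  move=> /andP[x0 xp]; apply: cos_gt0_pihalf; rewrite xp andbT (lt_trans _ x0)//.
  by rewrite oppr_lt0 pihalf_gt0.
have sin0 (x : R) : 0 < x < pi / 2 -> 0 < sin x by exact: sin_gt0_pihalf.
have tan0 (x : R) : 0 < x < pi / 2 -> 0 < tan x.
  by move=> xp; rewrite /tan divr_gt0 ?sin0 ?cos0.
have mtan : measurable_fun setT (@tan R) by rewrite /tan; meas.
have E : Rp = (fun x : R => tan x ^+ 2) @` `]0%R, (pi / 2)%R[.
  apply/seteqP; split => v /=; rewrite in_itv/= ?andbT.
    move=> v0; have sv0 : 0 < Num.sqrt v by rewrite sqrtr_gt0.
    exists (atan (Num.sqrt v)); last by rewrite atanK sqr_sqrtr// ltW.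
    by rewrite in_itv/= atan_ltpi2 andbT -atan0 lt_atan.
  by move=> [x]; rewrite in_itv/= => xp <-; rewrite exprn_gt0// tan0.
rewrite [in LHS]E; apply: ge0_integral_substoo_increasing => //; try by meas.
- exact: pihalf_gt0.
- move=> x xp; have cx : cos x != 0 by rewrite gt_eqF// cos0.
  have := is_deriveX 2 (is_derive_tan cx).
  by rewrite /= expr1 /GRing.scale/=.
- move=> x xp; have cx : cos x != 0 by rewrite gt_eqF// cos0.
  apply: cvgM; first by apply: cvgMr; exact: continuous_tan.
  apply: cvgV; first by rewrite sqrf_eq0.
  apply: (@continuous_comp _ _ _ (@cos R) (fun y => y ^+ 2)); first exact: continuous_cos.
  exact: exprn_continuous.
- move=> x xp; have h1 := tan0 x xp; have h2 := cos0 x xp.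
  by apply: divr_gt0; [apply: mulr_gt0|apply: exprn_gt0].
Qed.

(** The substitution v = tan^2 x gives a Beta integral with parameters alpha + 1/2 and k + 1/2. The
    factors are written as exponentials of ln (sin x) and ln (cos x), which reduces the comparison
    to linear identities between exponents. *)
Lemma integral_cos_sin_quarter k :
  (\int[leb]_(x in `]0%R, (pi / 2)%R[) (cos x ^+ k.*2 * sin x `^ (2 * alpha))%:E =
   (2^-1 * (Gamma (alpha + 2^-1) * Gamma (2^-1 + k%:R) / Gamma (c + k%:R)))%:E)%E.
Proof.
have k0 : 0 < 2^-1 + k%:R :> R by rewrite ltr_wpDr.
have := integral_beta a_gt0 k0.
rewrite integral_tan_subst; last 2 first.
- by meas.
- by move=> v; rewrite lee_fin mulr_ge0 ?powR_ge0.
have -> : alpha + 2^-1 + (2^-1 + k%:R) = c + k%:R.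
  by field.
move=> h; rewrite EFinM -h -ge0_integralZl; last 4 first.
- exact: measurable_itv.
- apply: measurable_funTS; rewrite /tan; meas.
- move=> x; rewrite /= in_itv/= => xp.
  have h1 := sin_gt0_pihalf xp; have h2 := cos_gt0_quarter xp.
  by rewrite -EFinM lee_fin !mulr_ge0 ?powR_ge0 ?invr_ge0 ?exprn_ge0 ?(ltW h1) ?(ltW h2).
- by rewrite lee_fin.
apply: eq_integral => x; rewrite inE/= in_itv/= => xp; rewrite -!EFinM; congr EFin.
have s0 := sin_gt0_pihalf xp.
have c0 := cos_gt0_quarter xp.
rewrite -cos2_tan2 ?gt_eqF// /tan.
have -> : cos x ^- 2 = expR (- (2 * ln (cos x))).
  by rewrite expRN expRM_natl lnK.
have E2 : (sin x / cos x) ^+ 2 = expR (2 * (ln (sin x) - ln (cos x))).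
  by rewrite expRM_natl expRB !lnK.
have -> : 2^-1 * (((sin x / cos x) ^+ 2) `^ (alpha + 2^-1 - 1) *
  expR (- (2 * ln (cos x))) `^ (- (c + k%:R)) * (2 * (sin x / cos x) * expR (- (2 * ln (cos x))))) =
  ((sin x / cos x) ^+ 2) `^ (alpha + 2^-1 - 1) *
  expR (- (2 * ln (cos x))) `^ (- (c + k%:R)) * ((sin x / cos x) * expR (- (2 * ln (cos x)))).
  by field; rewrite gt_eqF.
rewrite E2 -!expRM.
have -> : sin x / cos x = expR (ln (sin x) - ln (cos x)) by rewrite expRB !lnK.
have -> : cos x ^+ k.*2 = expR (k%:R * 2 * ln (cos x)).
  by rewrite -natrM muln2 expRM_natl lnK.
rewrite powRE_pos// -!expRD; congr expR.
by field.
Qed.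

Lemma integral_cos_sin k :
  (\int[leb]_(x in `]0%R, pi[) (cos x ^+ k.*2 * sin x `^ (2 * alpha))%:E =
   (Gamma (alpha + 2^-1) * Gamma (2^-1 + k%:R) / Gamma (c + k%:R))%:E)%E.
Proof.
pose h (x : R) := (cos x ^+ k.*2 * sin x `^ (2 * alpha))%:E.
have mh : measurable_fun setT h by rewrite /h; meas.
have h0 x : (0 <= h x)%E.
  by rewrite lee_fin mulr_ge0 ?powR_ge0 ?exprn_double_ge0.
have E : `]0%R, pi[%classic = `]0%R, (pi / 2)%R] `|` `](pi / 2)%R, pi[ :> set R.
  rewrite -itv_bndbnd_setU// bnd_simp; [exact: ltW pihalf_gt0|exact: pihalf_ltpi].
transitivity (\int[leb]_(x in `]0%R, pi[) h x)%E => //.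
rewrite E ge0_integral_setU; last 5 first.
- exact: measurable_itv.
- exact: measurable_itv.
- exact: measurable_funTS.
- by move=> x _; exact: h0.
- rewrite disj_set2E; apply/eqP/seteqP; split => // x [/=]; rewrite !in_itv/=.
  by move=> /andP[_ xp] /andP[px _]; move: (le_lt_trans xp px); rewrite ltxx.
have -> : (\int[leb]_(x in `]0%R, (pi / 2)%R]) h x = \int[leb]_(x in `]0%R, (pi / 2)%R[) h x)%E.
  by apply/esym; apply: integral_itv_bndo_bndc; exact: measurable_funTS.
have -> : (\int[leb]_(x in `](pi / 2)%R, pi[) h x = \int[leb]_(x in `]0%R, (pi / 2)%R[) h x)%E.
  have p2 : pi - pi / 2 = pi / 2 :> R by rewrite {1}[pi in X in X - _]splitr addrK.
  have R2 := ge0_integral_reflect pihalf_gt0 mh h0; rewrite p2 in R2; rewrite R2.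
  apply: eq_integral => x _; rewrite /h; congr (_ * _ `^ _)%:E.
    by rewrite cosB cospi sinpi mul0r addr0 mulN1r -mul2n !exprM sqrrN.
  by rewrite sinB sinpi cospi mul0r sub0r mulN1r opprK.
rewrite /h integral_cos_sin_quarter -EFinD; congr EFin.
by set X := (_ / _); lra.
Qed.

Lemma even_moment k :
  (\int[sigma]_th (cos th ^+ k.*2)%:E = (poch 2^-1 k / poch c k)%:E)%E.
Proof.
rewrite ge0_integral_mdens//; last 2 first.
- by meas.
- by move=> x; rewrite lee_fin exprn_double_ge0.
have Gh : Gamma (2^-1 : R) != 0 by rewrite gt_eqF// Gamma_gt0.
have Ga : Gamma (alpha + 2^-1) != 0 by rewrite gt_eqF// Gamma_gt0.
have Gc : Gamma c != 0 by rewrite gt_eqF// Gamma_gt0.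
transitivity ((Gamma c / (Gamma 2^-1 * Gamma (alpha + 2^-1)))%:E *
   \int[leb]_(x in `]0%R, pi[) (cos x ^+ k.*2 * sin x `^ (2 * alpha))%:E)%E.
  rewrite -ge0_integralZl; last 4 first.
  - exact: measurable_itv.
  - by apply: measurable_funTS; meas.
  - by move=> x _; rewrite lee_fin mulr_ge0 ?powR_ge0 ?exprn_double_ge0.
  - by rewrite lee_fin divr_ge0 ?mulr_ge0 ?Gamma_ge0.
  rewrite [RHS]integral_mkcond; apply: eq_integral => x _.
  rewrite epatch_indic/= /angle_weight -!EFinM !div1r; congr EFin.
  by set A := Gamma c / _; set B := cos x ^+ _; set D := sin x `^ _; set I := \1_ _ _; ring.
rewrite integral_cos_sin -EFinM !Gamma_poch//; congr EFin.
have := gt_eqF (poch_gt0 k c_gt0) => /negbT pk.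
move: Gh Ga Gc pk; move: (Gamma c) (Gamma (alpha + 2^-1)) (Gamma 2^-1) (poch c k) (poch 2^-1 k) => ? ? ? ? ? h1 h2 h3 h4.
by field; rewrite h1 h2 h3 h4.
Qed.

Lemma angle_measure_setT : sigma setT = 1%E.
Proof.
have := even_moment 0; rewrite !poch0 divr1 => <-.
by under eq_integral do rewrite expr0; rewrite integral_cst// mul1e.
Qed.

Lemma integrable_angle (u : R -> R) (M : R) : measurable_fun setT u ->
  (forall x, `|u x| <= M) -> sigma.-integrable setT (EFin \o u).
Proof.
move=> mu uM; have fin : (sigma setT < +oo)%E by rewrite angle_measure_setT ltry.
apply: measurable_bounded_integrable => //.
exists M; split; first exact: num_real.
by move=> x Mx t _ /=; rewrite (le_trans (uM t))// ltW.
Qed.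

(** The reflection of th into pi - th preserves the angle measure and changes the sign of the
    cosine. The signed case follows from the nonnegative one through the two parts of g. *)
Lemma integral_angle_opp (g : R -> \bar R) : measurable_fun setT g ->
  (\int[sigma]_th g (cos th) = \int[sigma]_th g (- cos th)%R)%E.
Proof.
have pos (h : R -> \bar R) : measurable_fun setT h -> (forall x, (0 <= h x)%E) ->
    (\int[sigma]_th h (cos th) = \int[sigma]_th h (- cos th)%R)%E.
  move=> mh h0.
  have mh1 : measurable_fun setT (fun x => h (cos x)).
    by apply: (measurableT_comp mh); exact: measurable_cosR.
  have mh2 : measurable_fun setT (fun x => h (- cos x)%R).
    by apply: (measurableT_comp mh); meas.
  rewrite !ge0_integral_mdens//.
  have E (k : R -> \bar R) : (\int[leb]_x (k x * (angle_weight alpha x)%:E) =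
      \int[leb]_(x in `](pi - pi)%R, pi[) (k x * (angle_weight alpha x)%:E))%E.
    rewrite subrr [RHS]integral_mkcond; apply: eq_integral => x _.
    rewrite epatch_indic/= -muleA -EFinM /angle_weight -mulrA; congr (_ * _%:E)%E.
    by rewrite indicE; case: (x \in _); rewrite ?mulr1 ?mulr0.
  rewrite E ge0_integral_reflect//; last 2 first.
  - apply: emeasurable_funM => //; apply/measurable_EFinP; exact: measurable_angle_weight.
  - by move=> x; rewrite mule_ge0// lee_fin angle_weight_ge0.
  rewrite E subrr; apply: eq_integral => x; rewrite inE/= in_itv/= => /andP[x0 xp].
  rewrite cosB cospi sinpi mul0r addr0 mulN1r; congr (_ * _%:E)%E.
  rewrite /angle_weight sinB sinpi cospi mul0r sub0r mulN1r opprK !indicE.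
  by rewrite !mem_set//= in_itv/= ?x0 ?xp// subr_gt0 xp/= ltrBlDr ltrDl.
move=> mg; rewrite integralE [RHS]integralE; congr (_ - _)%E.
- under eq_integral do rewrite funeposE.
  under [RHS]eq_integral do rewrite funeposE.
  apply: (pos (fun x => maxe (g x) 0%E)); last by move=> x; rewrite le_max lexx orbT.
  exact: measurable_maxe.
- under eq_integral do rewrite funenegE.
  under [RHS]eq_integral do rewrite funenegE.
  apply: (pos (fun x => maxe (- g x)%E 0%E)); last by move=> x; rewrite le_max lexx orbT.
  by apply: measurable_maxe => //; exact: measurableT_comp.
Qed.

Lemma odd_moment k : \int[sigma]_th (cos th ^+ k.*2.+1) = 0.
Proof.
have ic : sigma.-integrable setT (EFin \o (fun th => cos th ^+ k.*2.+1)).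
  apply: (@integrable_angle _ 1); first by meas.
  by move=> x; rewrite normrX exprn_ile1// cos_max.
have mX : measurable_fun setT (fun x : R => (x ^+ k.*2.+1)%:E) by meas.
have h := integral_angle_opp mX.
have {}h : \int[sigma]_th (cos th ^+ k.*2.+1) = - \int[sigma]_th (cos th ^+ k.*2.+1).
  rewrite {1}/Rintegral h -[RHS]mulN1r -RintegralZl//.
  apply: eq_Rintegral => x _.
  by rewrite exprS -mul2n exprM sqrrN -exprM mul2n [in RHS]exprS mulNr mulN1r.
by move: h; set X := Rintegral _ _ _ => h; lra.
Qed.

End angle_moments.

(** * Bessel functions and their product formula *)

Section bessel.
Context {R : realType}.
Local Notation leb := (@lebesgue_measure R).
Local Notation Rp := (`]0%R, +oo[%classic : set R).
Variable alpha : R.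
Hypothesis alpha_gt : -1 / 2 < alpha.
Local Notation c := (alpha + 1).
Local Notation sigma := (angle_measure alpha).
Local Notation mu := (hankel_measure alpha).
Local Notation J := (jalpha alpha).

Let c_gt0 : 0 < c. Proof. by move: alpha_gt; lra. Qed.

(** Coefficients of the hypergeometric series 0F1(; c; z): [jalpha] is its value at - w^2 / 4, and
    [besselI] below its value at w^2 / 4. *)
Definition bcoef n : R := (n`!%:R * poch c n)^-1.

(** The first factor c exceeds 1/2 because alpha > -1/2, and every later factor exceeds 1. *)
Lemma poch_ge_half n : 2^-1 <= poch c n.
Proof.
case: n => [|n]; first by rewrite poch0; lra.
elim: n => [|n IH]; first by rewrite pochSr poch0 mul1r addr0; move: alpha_gt; lra.
rewrite pochSr -[2^-1]mulr1; apply: ler_pM => //.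
by rewrite -natr1; have := ler0n R n; move: c_gt0; lra.
Qed.

Lemma bcoef_ge0 n : 0 <= bcoef n.
Proof. by rewrite invr_ge0 mulr_ge0// ltW// poch_gt0. Qed.

Lemma bcoef_le n : bcoef n <= 2 / n`!%:R.
Proof.
rewrite /bcoef invfM mulrC ler_wpM2r ?invr_ge0//.
by rewrite -[leRHS]invrK lef_pV2 ?posrE ?poch_gt0 ?invr_gt0//; exact: poch_ge_half.
Qed.

Lemma nneseries_lty (x : R^nat) : (forall n, 0 <= x n) -> cvgn (series x) ->
  (\sum_(0 <= n <oo) (x n)%:E < +oo)%E.
Proof.
move=> x0 cx; rewrite (_ : (\sum_(0 <= n <oo) (x n)%:E)%E = (limn (series x))%:E) ?ltry//.
rewrite -EFin_lim//; congr (limn _); apply/funext => n.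
by rewrite /= sumEFin.
Qed.

Lemma cvg_series_ext (a b : R^nat) (l : R) : (forall n, a n = b n) ->
  series a @ \oo --> l -> series b @ \oo --> l.
Proof. by move=> ab; rewrite (_ : a = b)//; apply/funext. Qed.

Lemma cvg_exp_series (U : R) : cvgn (series (fun n => U ^+ n / n`!%:R)).
Proof. exact: is_cvg_series_exp_coeff. Qed.

Lemma cvg_dominated_exp_series (a : R^nat) (M U : R) : 0 <= U ->
  (forall n, `|a n| <= M / n`!%:R) -> cvgn (series (fun n => `|a n| * U ^+ n)).
Proof.
move=> U0 aM; apply: (@series_le_cvg _ _ (fun n => M * (U ^+ n / n`!%:R))).
- by move=> n; rewrite mulr_ge0 ?exprn_ge0.
- move=> n; rewrite mulr_ge0 ?divr_ge0 ?exprn_ge0//.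
  by have := le_trans (normr_ge0 _) (aM 0%N); rewrite fact0 divr1.
- by move=> n; rewrite mulrCA mulrC ler_wpM2l ?exprn_ge0//; move: (aM n).
- by apply: is_cvg_seriesZ; exact: cvg_exp_series.
Qed.

(** A power series with coefficients O(1 / n!) in a bounded function may be integrated term by term.
    The Poisson integral, the product formula and the integral for [besselI] all compare
    coefficients through this statement. *)
Lemma angle_series_integral (a : R^nat) (M U : R) (u F : R -> R) :
  measurable_fun setT u -> (forall th, `|u th| <= U) ->
  (forall n, `|a n| <= M / n`!%:R) ->
  (forall th, series (fun n => a n * u th ^+ n) @ \oo --> F th) ->
  sigma.-integrable setT (EFin \o F) /\
  series (fun n => a n * \int[sigma]_th (u th ^+ n)) @ \oo --> \int[sigma]_th F th.
Proof.
move=> mu_ uU aM cF; have U0 : 0 <= U by apply: le_trans (uU 0).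
have iu n : sigma.-integrable setT (EFin \o (fun th => u th ^+ n)).
  apply: (@integrable_angle _ _ alpha_gt _ (U ^+ n)); first by meas.
  by move=> x; rewrite normrX lerXn2r ?nnegrE.
have mF : measurable_fun setT F.
  apply: (@measurable_fun_cvg _ _ _ _ (fun n th => series (fun k => a k * u th ^+ k) n)).
    by move=> n; apply: measurable_sum => k; meas.
  by move=> th _; exact: cF.
have [||iF cvF] := @series_integral _ _ R sigma (fun n th => a n * u th ^+ n) F _ mF cF.
- by move=> n; meas.
- apply: (@le_lt_trans _ _ (\sum_(0 <= n <oo) (`|a n| * U ^+ n)%:E)%E).
    apply: lee_nneseries => [n _ _|n _]; first by apply: integral_ge0 => x _; rewrite lee_fin.
    apply: (@le_trans _ _ (\int[sigma]_x (cst (`|a n| * U ^+ n)%:E x))%E).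
      apply: ge0_le_integral => //.
      - by meas.
      - by move=> x _; rewrite lee_fin normrM ler_wpM2l// normrX lerXn2r ?nnegrE.
    rewrite integral_cst//.
    rewrite [X in (_ * X)%E](_ : _ = 1%E) ?mule1//.
    exact: angle_measure_setT.
  by apply: nneseries_lty; [move=> n; rewrite mulr_ge0 ?exprn_ge0|exact: cvg_dominated_exp_series aM].
split => //; apply: cvg_series_ext cvF => n.
by rewrite RintegralZl.
Qed.

Lemma norm_bcoef_alt n : `|(-1) ^+ n * bcoef n| <= 2 / n`!%:R.
Proof.
by rewrite normrM normrX normrN1 expr1n mul1r ger0_norm ?bcoef_ge0 ?bcoef_le.
Qed.

Lemma cvg_bessel (w : R) :
  series (fun n => (-1) ^+ n * bcoef n * (w ^+ 2 / 4) ^+ n) @ \oo --> J w.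
Proof.
have cv : cvgn (series (fun n => (-1) ^+ n * bcoef n * (w ^+ 2 / 4) ^+ n)).
  apply: normed_cvg.
  have w0 : 0 <= w ^+ 2 / 4 by rewrite divr_ge0 ?sqr_ge0.
  suff -> : [normed series (fun n => (-1) ^+ n * bcoef n * (w ^+ 2 / 4) ^+ n)] =
      series (fun n => `|(-1) ^+ n * bcoef n| * (w ^+ 2 / 4) ^+ n).
    exact: cvg_dominated_exp_series norm_bcoef_alt.
  congr series; apply/funext => n.
  by rewrite /= [LHS]normrM [X in _ * X = _]ger0_norm ?exprn_ge0.
rewrite /jalpha; set S := series _ in cv *.
have G0 : Gamma c != 0 by rewrite gt_eqF// Gamma_gt0.
have cT : series (fun n : nat => (-1) ^+ n / (n`!%:R * Gamma (n%:R + alpha + 1)) *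
    (w / 2) ^+ (2 * n)) @ \oo --> (Gamma c)^-1 * limn S.
  rewrite (_ : series _ = (fun n => (Gamma c)^-1 * S n)); first exact: cvgMr.
  apply/funext => N; rewrite /S /series/= mulr_sumr; apply: eq_bigr => n _.
  have -> : n%:R + alpha + 1 = c + n%:R by ring.
  rewrite Gamma_poch// /bcoef exprM expr_div_n.
  have -> : (2 : R) ^+ 2 = 4 by rewrite expr2 -natrM.
  have n0 : (n`!%:R : R) != 0 by rewrite pnatr_eq0 -lt0n fact_gt0.
  have p0 : poch c n != 0 by rewrite gt_eqF// poch_gt0.
  by move: (w ^+ 2 / 4) ((-1) ^+ n) => y z; field; rewrite n0 G0 p0.
by rewrite (cvg_lim (@norm_hausdorff _ _) cT) mulVKf.
Qed.

Lemma measurable_bessel : measurable_fun setT J.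
Proof.
apply: (@measurable_fun_cvg _ _ _ _
  (fun (n : nat) (w : R) => series (fun n => (-1) ^+ n * bcoef n * (w ^+ 2 / 4) ^+ n) n)).
  by move=> n; apply: measurable_sum => k; meas.
by move=> w _; exact: @cvg_bessel.
Qed.

Lemma even_momentR k : \int[sigma]_th (cos th ^+ k.*2) = poch 2^-1 k / poch c k.
Proof. by rewrite /Rintegral even_moment. Qed.

(** Poisson's integral: when the cosine series is integrated term by term, the even moments turn
    (2n)! into 4^n n! (c)_n. As the angle measure has mass 1, it follows that J is bounded by 1. *)
Lemma bessel_poisson w : J w = \int[sigma]_th cos (w * cos th).
Proof.
pose a n : R := (-1) ^+ n / (n.*2)`!%:R.
have aM n : `|a n| <= 1 / n`!%:R.
  rewrite /a normrM normrX normrN1 expr1n !mul1r ger0_norm ?invr_ge0//.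
  rewrite lef_pV2 ?posrE ?ltr0n ?fact_gt0// ler_nat.
  by apply: leq_fact; rewrite -addnn leq_addr.
have [|||_ cP] := @angle_series_integral a 1 (w ^+ 2) (fun th => (w * cos th) ^+ 2)
   (fun th => cos (w * cos th)) _ _ aM.
- by meas.
- move=> th; rewrite normrX normrM exprMn -[leRHS]mulr1 real_normK ?num_real//.
  by rewrite ler_wpM2l ?sqr_ge0// exprn_ile1// cos_max.
- move=> th; apply: cvg_series_ext (@cvg_cos_coeff' _ (w * cos th)) => n.
  by rewrite /cos_coeff'/= /a -mul2n mulrAC -exprM mul2n.
rewrite -(cvg_lim (@norm_hausdorff _ _) (@cvg_bessel w)); apply: cvg_lim => //; apply: cvg_series_ext cP => n.
have -> : \int[sigma]_th ((w * cos th) ^+ 2) ^+ n = (w ^+ 2) ^+ n * \int[sigma]_th (cos th ^+ n.*2).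
  rewrite -RintegralZl//; last first.
    by apply: (@integrable_angle _ _ alpha_gt _ 1); [meas|move=> x; rewrite normrX exprn_ile1// cos_max].
  by apply: eq_Rintegral => th _; rewrite -!exprM exprMn mul2n.
rewrite even_momentR half_poch /a /bcoef expr_div_n.
have n0 : (n`!%:R : R) != 0 by rewrite pnatr_eq0 -lt0n fact_gt0.
have n20 : ((n.*2)`!%:R : R) != 0 by rewrite pnatr_eq0 -lt0n fact_gt0.
have p0 : poch c n != 0 by rewrite gt_eqF// poch_gt0.
have p4 : (4 : R) ^+ n != 0 by rewrite expf_neq0// pnatr_eq0.
move: ((w ^+ 2) ^+ n) ((-1) ^+ n : R) n0 n20 p0 p4.
move: (n`!%:R : R) ((n.*2)`!%:R : R) (poch c n) ((4 : R) ^+ n).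
by move=> x1 x2 x3 x4 x5 x6 h1 h2 h3 h4; field; rewrite h1 h2 h3 h4.
Qed.

Lemma bessel_le1 w : `|J w| <= 1.
Proof.
rewrite bessel_poisson.
have ic : sigma.-integrable setT (EFin \o (fun th => cos (w * cos th))).
  by apply: (@integrable_angle _ _ alpha_gt _ 1); [meas|move=> x; exact: cos_max].
rewrite (le_trans (le_normr_Rintegral _ ic))//.
have i1 : sigma.-integrable setT (EFin \o cst (1:R)).
  by apply: (@integrable_angle _ _ alpha_gt _ 1); [meas|move=> x; rewrite normr1].
apply: (@le_trans _ _ (\int[sigma]_th (cst 1 th))).
  apply: le_Rintegral => //; first exact: integrable_norm.
  by move=> x _; exact: cos_max.
rewrite /Rintegral.
have -> : (\int[sigma]_th (cst 1 th)%:E)%E = sigma setT by have := integral_cst sigma measurableT 1%E; rewrite mul1e => <-.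
by rewrite angle_measure_setT.
Qed.

(** Argument of the function in [htrans]: the third side of a triangle whose sides x and y enclose
    the angle pi - th. *)
Definition chord (x y th : R) := Num.sqrt (x ^+ 2 + y ^+ 2 + 2 * x * y * cos th).

Lemma chord_ge0_arg (x y th : R) : 0 <= x ^+ 2 + y ^+ 2 + 2 * x * y * cos th.
Proof.
have -> : x ^+ 2 + y ^+ 2 + 2 * x * y * cos th =
   (x + y * cos th) ^+ 2 + (y * sin th) ^+ 2.
  rewrite !exprMn sin2cos2; ring.
by rewrite addr_ge0 ?sqr_ge0.
Qed.

Lemma sqr_chord x y th : chord x y th ^+ 2 = x ^+ 2 + y ^+ 2 + 2 * x * y * cos th.
Proof. by rewrite sqr_sqrtr// chord_ge0_arg. Qed.

Lemma chord_moment X Y x y n : X = x ^+ 2 -> Y = y ^+ 2 ->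
  \int[sigma]_th ((X + Y + 2 * x * y * cos th) ^+ n) =
  \sum_(m < n.+1) 'C(n, m.*2)%:R * (X + Y) ^+ (n - m.*2) * (4 * (X * Y)) ^+ m *
      (poch (2^-1) m / poch c m).
Proof.
move=> EX EY; pose b := 2 * x * y.
pose mom j := \int[sigma]_th (cos th ^+ j).
have icos j : sigma.-integrable setT (EFin \o (fun th => cos th ^+ j)).
  by apply: (@integrable_angle _ _ alpha_gt _ 1); [meas|move=> t; rewrite normrX exprn_ile1// cos_max].
pose F j := 'C(n, j)%:R * (X + Y) ^+ (n - j) * b ^+ j * mom j.
have -> : \int[sigma]_th ((X + Y + 2 * x * y * cos th) ^+ n) = \sum_(j < n.+1) F j.
  rewrite /Rintegral.
  under eq_integral do rewrite exprDn -sumEFin.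
  have iF j : sigma.-integrable setT (fun th =>
      ((X + Y) ^+ (n - j) * (2 * x * y * cos th) ^+ j *+ 'C(n, j))%:E).
    have := integrableZl measurableT ('C(n, j)%:R * (X + Y) ^+ (n - j) * b ^+ j) (icos j).
    apply: eq_integrable => // th _; rewrite /= -EFinM; congr EFin.
    rewrite -[RHS]mulr_natl -/b [in RHS]exprMn.
    by move: ((X + Y) ^+ _) (b ^+ j) => A B; ring.
  rewrite integral_sum//=.
  rewrite -sum_fine; last by move=> j _; apply: integrable_fin_num.
  apply: eq_bigr => j _; rewrite /F /mom -[RHS]/(_ * Rintegral _ _ _) -RintegralZl//.
  apply: eq_Rintegral => th _.
  rewrite -[LHS]mulr_natl -/b [in LHS]exprMn.
    by move: ((X + Y) ^+ _) (b ^+ j) => A B; ring.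
(* The range is extended to an even length by terms whose binomial coefficient is 0, so that even
   and odd indices pair up and the odd ones drop out. *)
have -> : \sum_(j < n.+1) F j = \sum_(j < (n.+1).*2) F j.
  rewrite -!(big_mkord predT F) [RHS](@big_cat_nat _ _ _ n.+1)//=; last first.
    by rewrite -addnn leq_addr.
  rewrite [X in _ = _ + X]big_nat_cond [X in _ = _ + X]big1 ?addr0//.
  by move=> j /andP[/andP[nj _] _]; rewrite /F bin_small// !mul0r.
rewrite sum_even; last by move=> m; rewrite /F /mom odd_moment// mulr0.
apply: eq_bigr => m _; rewrite /F /mom even_momentR -mul2n exprM.
have -> : b ^+ 2 = 4 * (X * Y) by rewrite /b EX EY; ring.
by [].
Qed.

(** Gegenbauer's product formula. J at the third side is a power series in chord^2 / 4 = X + Y + 2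
    (x / 2) (y / 2) cos th, so its average is a series of chord moments, and the finite identity
    recognises these as the coefficients of the Cauchy product. *)
Lemma bessel_product x y : J x * J y = \int[sigma]_th J (chord x y th).
Proof.
pose X := x ^+ 2 / 4; pose Y := y ^+ 2 / 4.
have ca w : cvgn (series (fun n => `|(-1) ^+ n * bcoef n * (w ^+ 2 / 4) ^+ n|)).
  have w0 : 0 <= w ^+ 2 / 4 by rewrite divr_ge0 ?sqr_ge0.
  suff -> : (fun n => `|(-1) ^+ n * bcoef n * (w ^+ 2 / 4) ^+ n|) =
      (fun n => `|(-1) ^+ n * bcoef n| * (w ^+ 2 / 4) ^+ n).
    exact: cvg_dominated_exp_series norm_bcoef_alt.
  apply/funext => n.
  by rewrite [LHS]normrM [X in _ * X = _]ger0_norm ?exprn_ge0.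
have cp := cvg_cauchy_product (@cvg_bessel x) (@cvg_bessel y) (ca x) (ca y).
have [|||_ cP] := @angle_series_integral (fun n => (-1) ^+ n * bcoef n) 2 (`|X + Y| + `|2 * (x / 2) * (y / 2)|)
   (fun th => X + Y + 2 * (x / 2) * (y / 2) * cos th)
   (fun th => J (chord x y th)) _ _ norm_bcoef_alt.
- by meas.
- move=> th; rewrite (le_trans (ler_normD _ _))// lerD2l normrM.
  by rewrite -[leRHS]mulr1 ler_wpM2l// cos_max.
- move=> th; apply: cvg_series_ext (@cvg_bessel (chord x y th)) => n; rewrite sqr_chord /X /Y.
  by congr (_ * _ ^+ n); field.
rewrite -(cvg_lim (@norm_hausdorff _ _) cp); apply: cvg_lim => //; apply: cvg_series_ext cP => n.
rewrite (@chord_moment X Y (x / 2) (y / 2)); last 2 first.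
- by rewrite /X; field.
- by rewrite /Y; field.
rewrite -mulrA /bcoef gegenbauer_sum// mulr_sumr; apply: eq_bigr => k _.
have kn : (k <= n)%N by rewrite -ltnS.
rewrite -[in (-1) ^+ n](subnK kn) exprD -/X -/Y.
by ring.
Qed.

End bessel.

(** * Fubini's theorem for real-valued integrals *)

Section real_fubini.
Context {d1 d2 : measure_display} {T1 : measurableType d1} {T2 : measurableType d2}.
Context {R : realType}.
Variables (m1 : {sigma_finite_measure set T1 -> \bar R}).
Variables (m2 : {sigma_finite_measure set T2 -> \bar R}).

(** The inner integral is a difference of two Tonelli integrals, and [fine], which sends infinite
    values to 0, is measurable; so the statement holds for every measurable F, integrable or not. *)
Lemma measurable_Rintegral_param (F : T1 * T2 -> R) : measurable_fun setT F ->
  measurable_fun setT (fun x => \int[m2]_y F (x, y)).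
Proof.
move=> mF; rewrite /Rintegral.
have mFE : measurable_fun setT (EFin \o F) by exact/measurable_EFinP.
apply: (@measurable_comp _ _ _ _ _ _ setT _ _ (fun x => \int[m2]_y (F (x, y))%:E)%E) => //.
rewrite (_ : (fun x => _) = (fun x =>
    \int[m2]_y ((EFin \o F)^\+ (x, y)) - \int[m2]_y ((EFin \o F)^\- (x, y)))%E); last first.
  apply/funext => x; rewrite [LHS]integralE; congr (_ - _)%E; apply: eq_integral => y _.
    by rewrite !funeposE.
  by rewrite !funenegE.
apply: emeasurable_funB.
- apply: (measurable_fun_fubini_tonelli_F (m2 := m2)); [exact: measurable_funepos|by move=> x; exact: funepos_ge0].
- apply: (measurable_fun_fubini_tonelli_F (m2 := m2)); [exact: measurable_funeneg|by move=> x; exact: funeneg_ge0].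
Qed.

Lemma Fubini_Rintegral (F : T1 * T2 -> R) : measurable_fun setT F ->
  (\int[m1]_x \int[m2]_y `|F (x, y)|%:E < +oo)%E ->
  (forall x, m2.-integrable setT (fun y => (F (x, y))%:E)) ->
  (forall y, m1.-integrable setT (fun x => (F (x, y))%:E)) ->
  \int[m1]_x \int[m2]_y F (x, y) = \int[m2]_y \int[m1]_x F (x, y).
Proof.
move=> mF Foo F2 F1.
have iF : (m1 \x m2)%E.-integrable setT (EFin \o F).
  by apply/integrable12ltyP => //; exact/measurable_EFinP.
rewrite /Rintegral.
transitivity (fine (\int[m1]_x \int[m2]_y (F (x, y))%:E)%E).
  congr fine; apply: eq_integral => x _; rewrite fineK//.
  exact: integrable_fin_num (F2 x).
rewrite (Fubini iF); congr fine; apply: eq_integral => y _; rewrite fineK//.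
exact: integrable_fin_num (F1 y).
Qed.

End real_fubini.

Section bounded_kernel.
Context {d : measure_display} {T : measurableType d} {R : realType}.

Lemma integrable_mul_bounded (m : {measure set T -> \bar R}) (A k : T -> R) (M : R) :
  m.-integrable setT (EFin \o A) -> measurable_fun setT k -> (forall x, `|k x| <= M) ->
  m.-integrable setT (EFin \o (fun x => A x * k x)).
Proof.
move=> iA mk kM; have /measurable_EFinP mA := measurable_int _ iA.
apply: (le_integrable measurableT _ _ (integrableZl measurableT M iA)).
  by apply/measurable_EFinP; exact: measurable_funM.
move=> x _; rewrite -EFinM/= lee_fin normrM [in leRHS]normrM mulrC.
by rewrite ler_wpM2r// (le_trans (kM x))// ler_norm.
Qed.

Lemma le_norm_Rintegral_bounded (m : {measure set T -> \bar R}) (A k : T -> R) (M : R) :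
  m.-integrable setT (EFin \o A) -> measurable_fun setT k -> (forall x, `|k x| <= M) ->
  `|\int[m]_x (A x * k x)| <= M * \int[m]_x `|A x|.
Proof.
move=> iA mk kM.
have iAk := integrable_mul_bounded iA mk kM.
rewrite (le_trans (le_normr_Rintegral _ iAk))//.
have inA : m.-integrable setT (EFin \o (fun x => `|A x|)) by exact: (integrable_norm iA).
rewrite -RintegralZl//; apply: le_Rintegral => //.
- exact: (integrable_norm iAk).
- exact: (integrableZl measurableT M inA).
- by move=> x _; rewrite normrM mulrC ler_wpM2r.
Qed.

End bounded_kernel.

Section bounded_kernel_fubini.
Context {d1 d2 : measure_display} {T1 : measurableType d1} {T2 : measurableType d2}.
Context {R : realType}.
Variables (m1 : {sigma_finite_measure set T1 -> \bar R}).
Variables (m2 : {sigma_finite_measure set T2 -> \bar R}).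

(** The integrand is dominated by M |A x| |B y|. The kernels in view are Bessel functions, bounded
    by 1. *)
Lemma Fubini_bounded_kernel (A : T1 -> R) (B : T2 -> R) (k : T1 * T2 -> R) (M : R) :
  m1.-integrable setT (EFin \o A) -> m2.-integrable setT (EFin \o B) ->
  measurable_fun setT k -> (forall p, `|k p| <= M) ->
  \int[m1]_x (A x * \int[m2]_y (B y * k (x, y))) =
  \int[m2]_y (B y * \int[m1]_x (A x * k (x, y))).
Proof.
move=> iA iB mk kM.
have /measurable_EFinP mA := measurable_int _ iA.
have /measurable_EFinP mB := measurable_int _ iB.
have mkx x : measurable_fun setT (fun y => k (x, y)) by exact: measurableT_comp.
have mky y : measurable_fun setT (fun x => k (x, y)) by exact: measurableT_comp.
have iBk x := integrable_mul_bounded iB (mkx x) (fun y => kM (x, y)).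
have iAk y := integrable_mul_bounded iA (mky y) (fun x => kM (x, y)).
have mF : measurable_fun setT (fun p : T1 * T2 => A p.1 * (B p.2 * k p)).
  apply: measurable_funM; first exact: measurableT_comp.
  by apply: measurable_funM => //; exact: measurableT_comp.
transitivity (\int[m1]_x \int[m2]_y (A x * (B y * k (x, y)))).
  by apply: eq_Rintegral => x _; rewrite RintegralZl//; exact: iBk.
rewrite (@Fubini_Rintegral _ _ _ _ _ m1 m2 (fun p => A p.1 * (B p.2 * k p)))//=.
- apply: eq_Rintegral => y _; rewrite -RintegralZl//.
  by apply: eq_Rintegral => x _; rewrite mulrCA.
- have M0 (x : T1) (y : T2) : 0 <= M by exact: le_trans (kM (x, y)).
  apply: (@le_lt_trans _ _ (\int[m1]_x (`|A x|%:E * ((`|M|)%:E * \int[m2]_y `|B y|%:E)))%E).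
    apply: ge0_le_integral => //.
    - by move=> x _; apply: integral_ge0 => y _; rewrite lee_fin.
    - by apply: (measurable_fun_fubini_tonelli_F (m2 := m2) (fun p : T1 * T2 => `|A p.1 * (B p.2 * k p)|%:E));
        [apply/measurable_EFinP; exact: measurableT_comp|move=> p; rewrite lee_fin].
    - apply: emeasurable_funM => //; apply/measurable_EFinP; exact: measurableT_comp.
    - move=> x _; have mnB : measurable_fun setT (fun y => `|B y|) by exact: measurableT_comp.
      rewrite -ge0_integralZl; [|exact: measurableT|by meas|by move=> *; nneg|by nneg].
      rewrite -ge0_integralZl; [|exact: measurableT|by meas|by move=> *; nneg|by nneg].
      apply: ge0_le_integral => //.
      + apply/measurable_EFinP; apply: measurableT_comp => //.
        by do 2 apply: measurable_funM => //.
      + apply/measurable_EFinP; do 2 apply: measurable_funM => //; exact: measurableT_comp.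
      + move=> y _; rewrite -!EFinM lee_fin !normrM ler_wpM2l// mulrC ler_wpM2r//.
        by rewrite (le_trans (kM _))// ler_norm.
  have B1 : (\int[m2]_y `|B y|%:E < +oo)%E by have /integrableP[] := iB.
  have B0 : (0 <= \int[m2]_y `|B y|%:E)%E by apply: integral_ge0 => y _; rewrite lee_fin.
  have mnA : measurable_fun setT (fun y => `|A y|) by exact: measurableT_comp.
  rewrite ge0_integralZr; [|exact: measurableT|by meas|by move=> *; nneg|by rewrite mule_ge0// lee_fin].
  have A1 : (\int[m1]_x `|A x|%:E < +oo)%E by have /integrableP[] := iA.
  apply: lte_mul_pinfty => //.
  - by apply: integral_ge0 => x _; rewrite lee_fin.
  - by rewrite ge0_fin_numE//; apply: integral_ge0 => x _; rewrite lee_fin.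
  - by apply: lte_mul_pinfty => //; rewrite lee_fin.
- by move=> x; exact: (integrableZl measurableT (A x) (iBk x)).
- move=> y; apply: eq_integrable (integrableZl measurableT (B y) (iAk y)) => //.
  by move=> x _; rewrite /= -EFinM mulrCA.
Qed.

End bounded_kernel_fubini.

(** * Exponential series with polynomial weights *)

Section series_values.
Context {R : realType}.

Lemma nneseries_cvg (a : R^nat) (l : R) : series a @ \oo --> l ->
  (\sum_(0 <= n <oo) (a n)%:E = l%:E)%E.
Proof.
move=> al; apply/cvg_lim => //.
rewrite (_ : (fun n => _) = EFin \o series a); last first.
  by apply/funext => n; rewrite /= sumEFin.
by apply: cvg_EFin => //; exact: nearW.
Qed.

Lemma cvg_expR_series (x : R) : series (fun n => x ^+ n / n`!%:R) @ \oo --> expR x.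
Proof. by rewrite /expR; exact: (is_cvg_series_exp_coeff x). Qed.

Lemma cvg_series_scale (a b : R^nat) (k l : R) : (forall n, b n = k * a n) ->
  series a @ \oo --> l -> series b @ \oo --> k * l.
Proof.
move=> ba al; have -> : series b = cst k \* series a.
  by apply/funext => N; rewrite /series/= mulr_sumr; apply: eq_bigr => n _.
exact: cvgMr.
Qed.

Lemma cvg_seriesD (a b : R^nat) (l m : R) : series a @ \oo --> l -> series b @ \oo --> m ->
  series (fun n => a n + b n) @ \oo --> l + m.
Proof.
move=> al bm; have -> : series (fun n => a n + b n) = series a \+ series b.
  by apply/funext => N; rewrite /series/= big_split.
exact: cvgD.
Qed.

Lemma cvg_series_shift (a : R^nat) (l : R) : a 0%N = 0 ->
  series (fun n => a n.+1) @ \oo --> l -> series a @ \oo --> l.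
Proof.
move=> a0 h; rewrite -cvg_shiftS; move: h; apply: cvg_trans.
rewrite (_ : (fun n => _) = series (fun n => a n.+1))//.
by apply/funext => n; rewrite /series/= big_nat_recl// a0 add0r.
Qed.

Lemma cvg_expR_series1 (x : R) :
  series (fun n => n%:R * (x ^+ n / n`!%:R)) @ \oo --> x * expR x.
Proof.
apply: cvg_series_shift; first by rewrite mul0r.
have h : series (fun n => x ^+ n / n`!%:R) \* cst x @ \oo --> expR x * x.
  by apply: cvgMl; exact: cvg_expR_series.
rewrite mulrC; move: h; apply: cvg_trans.
suff -> : series (fun n => n.+1%:R * (x ^+ n.+1 / (n.+1)`!%:R)) = series (fun n => x ^+ n / n`!%:R) \* cst x by [].
apply/funext => N; rewrite /series/= mulr_suml; apply: eq_bigr => n _.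
have n0 : (n`!%:R : R) != 0 by rewrite pnatr_eq0 -lt0n fact_gt0.
have n1 : (n.+1%:R : R) != 0 by rewrite pnatr_eq0.
rewrite factS natrM exprS; move: n0 n1; move: (n`!%:R : R) (n.+1%:R : R) (x ^+ n).
by move=> a b e h1 h2; field; rewrite h1 h2.
Qed.

Lemma cvg_expR_series2 (x : R) :
  series (fun n => n%:R * (n%:R - 1) * (x ^+ n / n`!%:R)) @ \oo --> x ^+ 2 * expR x.
Proof.
apply: cvg_series_shift; first by rewrite !mul0r.
have h : series (fun n => n%:R * (x ^+ n / n`!%:R)) \* cst x @ \oo --> x * expR x * x.
  by apply: cvgMl; exact: cvg_expR_series1.
rewrite (_ : x ^+ 2 * expR x = x * expR x * x); last by ring.
move: h; apply: cvg_trans.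
suff -> : series (fun n => n.+1%:R * (n.+1%:R - 1) * (x ^+ n.+1 / (n.+1)`!%:R)) =
  series (fun n => n%:R * (x ^+ n / n`!%:R)) \* cst x by [].
apply/funext => N; rewrite /series/= mulr_suml; apply: eq_bigr => n _.
have n0 : (n`!%:R : R) != 0 by rewrite pnatr_eq0 -lt0n fact_gt0.
have n1 : (n.+1%:R : R) != 0 by rewrite pnatr_eq0.
have -> : n.+1%:R - 1 = n%:R :> R by rewrite -natr1 addrK.
rewrite factS natrM exprS; move: n0 n1; move: (n`!%:R : R) (n.+1%:R : R) (x ^+ n).
by move=> a b e h1 h2; field; rewrite h1 h2.
Qed.

End series_values.

(** * The heat kernel of the Hankel transform *)

Section heat_kernel.
Context {R : realType}.
Local Notation leb := (@lebesgue_measure R).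
Local Notation Rp := (`]0%R, +oo[%classic : set R).
Variable alpha : R.
Hypothesis alpha_gt : -1 / 2 < alpha.
Local Notation c := (alpha + 1).
Local Notation sigma := (angle_measure alpha).
Local Notation mu := (hankel_measure alpha).
Local Notation J := (jalpha alpha).

Let c_gt0 : 0 < c. Proof. by move: alpha_gt; lra. Qed.

Lemma ge0_integral_hankel (h : R -> \bar R) : measurable_fun setT h -> (forall x, (0 <= h x)%E) ->
  (\int[mu]_x h x = \int[leb]_(x in Rp) (h x * (wdens alpha x)%:E))%E.
Proof.
move=> mh h0; rewrite ge0_integral_mdens// [RHS]integral_mkcond.
apply: eq_integral => x _; rewrite epatch_indic /half_line_weight EFinM muleA//.
Qed.

Lemma gauss_moment n (r : R) : 0 < r ->
  (\int[mu]_y ((y ^+ 2) ^+ n * expR (- (r * y ^+ 2)))%:E =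
   ((2 * r) `^ (- c) * (poch c n / r ^+ n))%:E)%E.
Proof.
move=> r0; have nc0 : 0 < c + n%:R by rewrite ltr_wpDr.
have K0 : 0 <= (2 `^ c * Gamma c)^-1 by rewrite invr_ge0 mulr_ge0 ?powR_ge0 ?Gamma_ge0.
have := integral_gamma nc0 r0; rewrite ge0_integral0y_sqr; [|by meas|by move=> x; nneg].
move=> h; rewrite ge0_integral_hankel; [|by meas|by move=> y; nneg].
transitivity (((2 `^ c * Gamma c)^-1)%:E * (Gamma (c + n%:R) * r `^ (- (c + n%:R)))%:E)%E.
  rewrite -h -ge0_integralZl; last 4 first.
  - exact: measurable_itv.
  - by apply: measurable_funTS; meas.
  - move=> x; rewrite /= in_itv/= andbT => x0.
    by rewrite -EFinM lee_fin !mulr_ge0 ?powR_ge0 ?expR_ge0// ltW.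
  - by rewrite lee_fin.
  apply: eq_integral => x; rewrite inE/= in_itv/= andbT => x0; rewrite -!EFinM; congr EFin.
  have x20 : 0 < x ^+ 2 by rewrite exprn_gt0.
  have E : (x ^+ 2) `^ (c + n%:R - 1) * (2 * x) = 2 * ((x ^+ 2) ^+ n * x `^ (2 * alpha + 1)).
    rewrite !powRE_pos// lnXn// -mulr_natl.
    have {2}-> : x = expR (ln x) by rewrite lnK.
    have -> : (x ^+ 2) ^+ n = expR (n%:R * (2 * ln x)) by rewrite !expRM_natl lnK.
    by rewrite -expRD mulrCA -expRD; congr (_ * expR _); ring.
  rewrite [_ * (2 * x)]mulrAC E /wdens (@powRD _ 2) ?pnatr_eq0 ?implybT// powRr1//.
  have G0 : Gamma c != 0 by rewrite gt_eqF// Gamma_gt0.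
  have p0 : (2 : R) `^ alpha != 0 by rewrite gt_eqF// powR_gt0.
  by move: (x `^ _) ((x ^+ 2) ^+ n) (expR _) => a b e; field; rewrite G0 p0.
rewrite -EFinM; congr EFin; rewrite Gamma_poch// opprD (@powRD _ r); last by rewrite (gt_eqF r0) implybT.
rewrite (powRM (- c)) ?(ltW r0)// !powRN powR_mulrn ?(ltW r0)//.
have G0 : Gamma c != 0 by rewrite gt_eqF// Gamma_gt0.
have p0 : (2 : R) `^ c != 0 by rewrite gt_eqF// powR_gt0.
have p1 : r `^ c != 0 by rewrite gt_eqF// powR_gt0.
have p2 : r ^+ n != 0 by rewrite expf_neq0// gt_eqF.
by field; rewrite G0 p0 p1 p2.
Qed.

Lemma integrable_gauss (r : R) : 0 < r ->
  mu.-integrable setT (EFin \o (fun y => expR (- (r * y ^+ 2)))).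
Proof.
move=> r0; apply/integrableP; split; first by meas.
have := gauss_moment 0 r0.
under eq_integral do rewrite expr0 mul1r.
move=> h; apply: (@le_lt_trans _ _ (\int[mu]_y (expR (- (r * y ^+ 2)))%:E)%E); last by rewrite h ltry.
rewrite le_eqVlt; apply/orP; left; apply/eqP; apply: eq_integral => y _.
by rewrite /= ger0_norm ?expR_ge0.
Qed.

(** Termwise integration of the Bessel series: without signs the integrals sum to a multiple of exp
    (z^2 / (4 t)), which justifies the exchange, and restoring (-1)^n changes the sign of the
    exponent. At t = 1/2 the Gaussian is its own Hankel transform. *)
Lemma gauss_bessel (t z : R) : 0 < t ->
  \int[mu]_y (expR (- (t * y ^+ 2)) * J (z * y)) = (2 * t) `^ (- c) * expR (- (z ^+ 2 / (4 * t))).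
Proof.
move=> t0.
pose u n y := expR (- (t * y ^+ 2)) * ((-1) ^+ n * bcoef alpha n * ((z * y) ^+ 2 / 4) ^+ n).
pose V := z ^+ 2 / (4 * t).
have V0 : 0 <= V by rewrite divr_ge0 ?sqr_ge0// mulr_ge0// ltW.
have mJ := measurable_bessel alpha_gt.
have mJz : measurable_fun setT (fun y : R => expR (- (t * y ^+ 2)) * J (z * y)).
  apply: measurable_funM; first by meas.
  by apply: (measurableT_comp mJ); meas.
have iu n : (\int[mu]_y `|u n y|%:E = ((2 * t) `^ (- c) * (V ^+ n / n`!%:R))%:E)%E.
  have := gauss_moment n t0 => h.
  have b0 : 0 <= bcoef alpha n * (z ^+ 2 / 4) ^+ n.
    by rewrite mulr_ge0 ?bcoef_ge0 ?exprn_ge0// divr_ge0 ?sqr_ge0.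
  transitivity ((bcoef alpha n * (z ^+ 2 / 4) ^+ n)%:E * ((2 * t) `^ (- c) * (poch c n / t ^+ n))%:E)%E.
    rewrite -h -ge0_integralZl//; last 2 first.
    - by meas.
    - by move=> y _; nneg.
    apply: eq_integral => y _; rewrite -EFinM; congr EFin; rewrite /u normrM ger0_norm ?expR_ge0//.
    have -> : (z * y) ^+ 2 / 4 = z ^+ 2 / 4 * y ^+ 2 by field.
    rewrite exprMn normrM [X in _ * (_ * X)]ger0_norm; last by nneg.
    rewrite normrM normrX normrN1 expr1n mul1r ger0_norm ?bcoef_ge0//.
    by ring.
  rewrite -EFinM; congr EFin; rewrite /V /bcoef !expr_div_n [(4 * t) ^+ n]exprMn.
  have n0 : (n`!%:R : R) != 0 by rewrite pnatr_eq0 -lt0n fact_gt0.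
  have p0 : poch c n != 0 by rewrite gt_eqF// poch_gt0.
  have p4 : (4 : R) ^+ n != 0 by rewrite expf_neq0// pnatr_eq0.
  have pt : t ^+ n != 0 by rewrite expf_neq0// gt_eqF.
  move: n0 p0 p4 pt; move: (n`!%:R : R) (poch c n) (4 ^+ n : R) (t ^+ n) (_ `^ _) ((z ^+ 2) ^+ n).
  by move=> x1 x2 x3 x4 x5 x6 h1 h2 h3 h4; field; rewrite h1 h2 h3 h4.
have cJ y : series (u ^~ y) @ \oo --> expR (- (t * y ^+ 2)) * J (z * y).
  have h : cst (expR (- (t * y ^+ 2))) \* series (fun n => (-1) ^+ n * bcoef alpha n * ((z * y) ^+ 2 / 4) ^+ n)
      @ \oo --> expR (- (t * y ^+ 2)) * J (z * y).
    by apply: cvgMr; exact: (@cvg_bessel _ _ alpha_gt (z * y)).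
  rewrite (_ : series (u ^~ y) = cst (expR (- (t * y ^+ 2))) \*
     series (fun n => (-1) ^+ n * bcoef alpha n * ((z * y) ^+ 2 / 4) ^+ n))//.
  by apply/funext => N; rewrite /series/= mulr_sumr.
have mu_ n : measurable_fun setT (u n) by rewrite /u; meas.
have iun n : mu.-integrable setT (EFin \o u n).
  by apply/integrableP; split; [apply/measurable_EFinP; exact: mu_|rewrite iu ltry].
have [|_ cv] := @series_integral _ _ R mu u _ mu_ mJz cJ.
  under eq_eseriesr do rewrite iu.
  rewrite (@nneseries_cvg _ _ ((2 * t) `^ (- c) * expR V)) ?ltry//.
  rewrite (_ : series _ = cst ((2 * t) `^ (- c)) \* series (fun n => V ^+ n / n`!%:R)); last first.
    by apply/funext => N; rewrite /series/= mulr_sumr.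
  by apply: cvgMr; exact: cvg_expR_series.
rewrite -(cvg_lim (@norm_hausdorff _ _) cv); apply: cvg_lim => //.
apply: (@cvg_series_ext _ (fun n => (2 * t) `^ (- c) * ((- V) ^+ n / n`!%:R))).
  move=> n; have := iu n.
  have -> : (\int[mu]_y `|u n y|%:E)%E = ((-1) ^+ n * \int[mu]_y u n y)%:E.
    rewrite -RintegralZl; [|exact: measurableT|exact: iun].
    rewrite /Rintegral fineK; last first.
      apply: integrable_fin_num => //; exact: (integrableZl measurableT ((-1) ^+ n) (iun n)).
    apply: eq_integral => y _; congr EFin.
    rewrite /u normrM ger0_norm ?expR_ge0// -[(-1) ^+ n * bcoef _ _ * _]mulrA normrM normrX normrN1 expr1n mul1r.
    rewrite ger0_norm; last by rewrite mulr_ge0 ?bcoef_ge0 ?exprn_ge0// divr_ge0 ?sqr_ge0.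
    have e1 : (-1) ^+ n * (-1) ^+ n = 1 :> R by rewrite -exprMn mulrNN mulr1 expr1n.
    set A := expR _; set B := bcoef _ _ * _.
    by transitivity ((-1) ^+ n * (-1) ^+ n * (A * B)); [rewrite e1 mul1r|ring].
  move=> [E]; rewrite exprNn.
  have -> : (2 * t) `^ (- c) * ((-1) ^+ n * V ^+ n / n`!%:R) = (-1) ^+ n * ((2 * t) `^ (- c) * (V ^+ n / n`!%:R)).
    by ring.
  by rewrite -E mulrA -exprMn mulrNN mulr1 expr1n mul1r.
rewrite (_ : series _ = cst ((2 * t) `^ (- c)) \* series (fun n => (- V) ^+ n / n`!%:R)); last first.
  by apply/funext => N; rewrite /series/= mulr_sumr.
by apply: cvgMr; exact: cvg_expR_series.
Qed.

(** Modified Bessel function normalised to 1 at 0, that is, J at an imaginary argument. *)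
Definition besselI (w : R) : R := limn (series (fun n => bcoef alpha n * (w ^+ 2 / 4) ^+ n)).

Lemma cvg_besselI w : series (fun n => bcoef alpha n * (w ^+ 2 / 4) ^+ n) @ \oo --> besselI w.
Proof.
have w0 : 0 <= w ^+ 2 / 4 by rewrite divr_ge0 ?sqr_ge0.
have nb n : `|bcoef alpha n| <= 2 / n`!%:R by rewrite ger0_norm ?bcoef_ge0 ?bcoef_le.
have := cvg_dominated_exp_series w0 nb.
rewrite (_ : (fun n => `|_| * _) = (fun n => bcoef alpha n * (w ^+ 2 / 4) ^+ n))//.
by apply/funext => n; rewrite ger0_norm ?bcoef_ge0.
Qed.

Lemma measurable_besselI : measurable_fun setT besselI.
Proof.
apply: (@measurable_fun_cvg _ _ _ _
  (fun (n : nat) (w : R) => series (fun n => bcoef alpha n * (w ^+ 2 / 4) ^+ n) n)).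
  by move=> n; apply: measurable_sum => k; meas.
by move=> w _; exact: (@cvg_besselI w).
Qed.

Lemma besselI_ge0 w : 0 <= besselI w.
Proof.
apply: limr_ge; first by apply/cvg_ex; exists (besselI w); exact: (@cvg_besselI w).
apply: nearW => n; apply: sumr_ge0 => k _; rewrite mulr_ge0 ?bcoef_ge0//.
by nneg.
Qed.

Lemma cvgn_double : (fun n => n.*2) @ \oo --> \oo.
Proof.
move=> P [N _ NP]; exists N => // n /= Nn; apply: NP => /=.
by rewrite (leq_trans Nn)// -addnn leq_addr.
Qed.

Lemma integral_exp_cos (w : R) : \int[sigma]_th expR (- (w * cos th)) = besselI w.
Proof.
pose a n : R := (n`!%:R)^-1.
have aM n : `|a n| <= 1 / n`!%:R by rewrite ger0_norm ?invr_ge0// div1r.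
have [|||_ cP] := @angle_series_integral _ _ alpha_gt a 1 `|w| (fun th => - (w * cos th))
   (fun th => expR (- (w * cos th))) _ _ aM.
- by meas.
- by move=> th; rewrite normrN normrM -[leRHS]mulr1 ler_wpM2l// cos_max.
- by move=> th; apply: cvg_series_ext (@cvg_expR_series _ (- (w * cos th))) => n; rewrite mulrC.
(* Only every second partial sum is kept: the odd moments vanish, so these are the partial sums of
   the series in w^2. *)
have h := cvg_comp _ _ cvgn_double cP.
rewrite -(cvg_lim (@norm_hausdorff _ _) h); apply: cvg_lim => //.
have mom n : \int[sigma]_th (- (w * cos th)) ^+ n = (- w) ^+ n * \int[sigma]_th (cos th ^+ n).
  rewrite -RintegralZl//; last first.
    by apply: (@integrable_angle _ _ alpha_gt _ 1); [meas|move=> x; rewrite normrX exprn_ile1// cos_max].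
  by apply: eq_Rintegral => th _; rewrite -exprMn mulNr.
rewrite (_ : _ \o _ = series (fun n => bcoef alpha n * (w ^+ 2 / 4) ^+ n)); first exact: cvg_besselI.
apply/funext => N; rewrite /= /series/= !big_mkord (@sum_even _ (fun n => a n * \int[sigma]_th (- (w * cos th)) ^+ n)); last first.
  by move=> m; rewrite mom odd_moment// !mulr0.
apply: eq_bigr => n _; rewrite mom even_momentR// half_poch /a /bcoef expr_div_n -mul2n exprM sqrrN.
have n0 : (n`!%:R : R) != 0 by rewrite pnatr_eq0 -lt0n fact_gt0.
have n20 : ((2 * n)`!%:R : R) != 0 by rewrite pnatr_eq0 -lt0n fact_gt0.
have p0 : poch c n != 0 by rewrite gt_eqF// poch_gt0.
have p4 : (4 : R) ^+ n != 0 by rewrite expf_neq0// pnatr_eq0.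
rewrite ?mul2n; rewrite ?mul2n in n20.
move: n0 n20 p0 p4; move: ((w ^+ 2) ^+ n) (n`!%:R : R) ((n.*2)`!%:R : R) (poch c n) ((4 : R) ^+ n).
by move=> x1 x3 x4 x5 x6 h1 h2 h3 h4; field; rewrite h1 h2 h3 h4.
Qed.

(* The kernel of the heat semigroup exp(-t xi^2) on the Hankel side. *)
Definition heat (t x y : R) : R :=
  (2 * t) `^ (- c) * expR (- ((x ^+ 2 + y ^+ 2) / (4 * t))) * besselI (x * y / (2 * t)).

Lemma heat_ge0 t x y : 0 <= heat t x y.
Proof. by rewrite /heat !mulr_ge0 ?powR_ge0 ?expR_ge0 ?besselI_ge0. Qed.

Lemma heatC t x y : heat t x y = heat t y x.
Proof. by rewrite /heat (addrC (x ^+ 2)) (mulrC x). Qed.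

Lemma measurable_heat d (T : measurableType d) (t x y : T -> R) :
  measurable_fun setT t -> measurable_fun setT x -> measurable_fun setT y ->
  measurable_fun setT (fun p => heat (t p) (x p) (y p)).
Proof.
by move=> mt mx my; have mI := measurable_besselI; rewrite /heat; meas.
Qed.

(** The heat kernel is a Hankel translate of a Gaussian: the average of the Gaussian over the third
    side of the triangle. *)
Lemma heat_chord t x y : 0 < t ->
  heat t x y = \int[sigma]_th ((2 * t) `^ (- c) * expR (- (chord x y th ^+ 2 / (4 * t)))).
Proof.
move=> t0; rewrite /heat -integral_exp_cos -RintegralZl; [|exact: measurableT|].
  2: apply: (@integrable_angle _ _ alpha_gt _ (expR `|x * y / (2 * t)|)); first by meas.
  2: move=> th; rewrite ger0_norm ?expR_ge0// ler_expR (le_trans (ler_norm _))// normrN normrM.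
  2: by rewrite -[leRHS]mulr1 ler_wpM2l// cos_max.
apply: eq_Rintegral => th _; rewrite -mulrA -expRD sqr_chord; congr (_ * expR _).
by field; rewrite gt_eqF.
Qed.

(** The product formula merges the two Bessel factors into an average of single ones, J (xi chord),
    for which the Gaussian integral is known. *)
Lemma bessel_heat t x y : 0 < t ->
  \int[mu]_xi (expR (- (t * xi ^+ 2)) * (J (x * xi) * J (y * xi))) = heat t x y.
Proof.
move=> t0; rewrite (heat_chord _ _ t0).
have mJ := measurable_bessel alpha_gt.
pose k (p : R * R) := J (p.1 * chord x y p.2).
have mk : measurable_fun setT k by rewrite /k /chord; meas.
have kM p : `|k p| <= 1 by exact: bessel_le1.
have i1 : sigma.-integrable setT (EFin \o cst (1:R)).
  by apply: (@integrable_angle _ _ alpha_gt _ 1); [meas|move=> z; rewrite normr1].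
have ig := integrable_gauss t0.
transitivity (\int[mu]_xi (expR (- (t * xi ^+ 2)) * \int[sigma]_th (cst 1 th * k (xi, th)))).
  apply: eq_Rintegral => xi _; congr (_ * _); rewrite bessel_product//.
  apply: eq_Rintegral => th _; rewrite mul1r /k/=.
  have EJ u v : u ^+ 2 = v ^+ 2 -> J u = J v.
    move=> uv; rewrite -(cvg_lim (@norm_hausdorff _ _) (@cvg_bessel _ _ alpha_gt u)) uv.
    by apply: cvg_lim => //; exact: cvg_bessel.
  apply: EJ; rewrite [(xi * _) ^+ 2]exprMn !sqr_chord; ring.
rewrite (Fubini_bounded_kernel ig i1 mk kM); apply: eq_Rintegral => th _.
rewrite mul1r -(gauss_bessel _ t0); apply: eq_Rintegral => xi _.
by rewrite /k/= (mulrC xi).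
Qed.

(** Expansion of [besselI] and termwise Gaussian integration. At s = 0 it says that under the heat
    kernel y^2 is a Poisson mixture of Gamma laws: with probability exp (- X) X^n / n! the shape is
    c + n and the scale 4 t, and the k-th moment of that law is (4 t)^k (c + n)_k. Mass, moments and
    Gaussian integrals of the kernel are read off from it. *)
Lemma heat_moment k (t x s : R) : 0 < t -> 0 <= s ->
  let r := s + (4 * t)^-1 in let X := x ^+ 2 / (4 * t) in
  (\int[mu]_y (heat t x y * ((y ^+ 2) ^+ k * expR (- (s * y ^+ 2))))%:E =
   \sum_(0 <= n <oo) ((4 * t * r) `^ (- c) * expR (- X) / r ^+ k *
      (poch (c + n%:R) k * ((X / (4 * t * r)) ^+ n / n`!%:R)))%:E)%E.
Proof.
move=> t0 s0 r X; have t40 : 0 < (4 * t)^-1 by rewrite invr_gt0 mulr_gt0.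
have r0 : 0 < r by rewrite ltr_wpDl.
pose z y := x * y / (2 * t).
pose K := (2 * t) `^ (- c) * expR (- X).
have K0 : 0 <= K by rewrite mulr_ge0 ?powR_ge0 ?expR_ge0.
pose u n y := K * (x ^+ 2 / (16 * t ^+ 2)) ^+ n * bcoef alpha n * ((y ^+ 2) ^+ (n + k) * expR (- (r * y ^+ 2))).
have W0 : 0 <= x ^+ 2 / (16 * t ^+ 2).
  by rewrite divr_ge0 ?sqr_ge0// mulr_ge0 ?sqr_ge0.
have u0 n y : 0 <= u n y by rewrite /u; have := bcoef_ge0 alpha_gt n => ?; nneg.
have mu_ n : measurable_fun setT (u n) by rewrite /u; meas.
transitivity (\int[mu]_y \sum_(0 <= n <oo) (u n y)%:E)%E.
  apply: eq_integral => y _; apply/esym.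
  apply: nneseries_cvg.
  pose v := K * ((y ^+ 2) ^+ k * expR (- (r * y ^+ 2))).
  rewrite (_ : heat t x y * _ = v * besselI (z y)); last first.
    rewrite /heat -/(z y) /v /K.
    have -> : expR (- ((x ^+ 2 + y ^+ 2) / (4 * t))) = expR (- X) * expR (- (y ^+ 2 / (4 * t))).
      by rewrite -expRD; congr expR; rewrite /X mulrDl opprD.
    have -> : expR (- (r * y ^+ 2)) = expR (- (s * y ^+ 2)) * expR (- (y ^+ 2 / (4 * t))).
      by rewrite -expRD; congr expR; rewrite /r; ring.
    by ring.
  have cv : cst v \* series (fun n => bcoef alpha n * (z y ^+ 2 / 4) ^+ n) @ \oo --> v * besselI (z y).
    by apply: cvgMr; exact: (@cvg_besselI (z y)).
  move: cv; apply: cvg_trans.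
  suff -> : series (u ^~ y) = cst v \* series (fun n => bcoef alpha n * (z y ^+ 2 / 4) ^+ n) by [].
  apply/funext => N; rewrite /series/= mulr_sumr; apply: eq_bigr => n _.
  rewrite /u /v exprD.
  have -> : z y ^+ 2 / 4 = x ^+ 2 / (16 * t ^+ 2) * y ^+ 2.
    by rewrite /z; field; rewrite gt_eqF.
  rewrite [(_ * y ^+ 2) ^+ n]exprMn; move: (_ ^+ n) ((y ^+ 2) ^+ n) ((y ^+ 2) ^+ k) => a b e; ring.
rewrite integral_nneseries//; last 2 first.
- by move=> n; apply/measurable_EFinP; exact: mu_.
- by move=> n y _; rewrite lee_fin.
apply: eq_eseriesr => n _.
transitivity ((K * (x ^+ 2 / (16 * t ^+ 2)) ^+ n * bcoef alpha n)%:E * ((2 * r) `^ (- c) * (poch c (n + k) / r ^+ (n + k)))%:E)%E.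
  rewrite -gauss_moment// -ge0_integralZl; [|exact: measurableT|by meas|by move=> *; nneg|].
    by apply: eq_integral => y _; rewrite -EFinM.
  by have := bcoef_ge0 alpha_gt n => ?; have := exprn_ge0 n W0 => ?; rewrite lee_fin; apply: mulr_ge0 => //; apply: mulr_ge0.
rewrite -EFinM; congr EFin; rewrite /K pochD /bcoef.
have -> : 4 * t * r = 2 * t * (2 * r) by ring.
have tt0 : 0 < 2 * t by rewrite mulr_gt0.
have rr0 : 0 < 2 * r by rewrite mulr_gt0.
rewrite (powRM (- c) (ltW tt0) (ltW rr0)) exprD.
have -> : X / (2 * t * (2 * r)) = x ^+ 2 / (16 * t ^+ 2) / r.
  by rewrite /X; field; rewrite !gt_eqF.
rewrite [(x ^+ 2 / (16 * t ^+ 2) / r) ^+ n]expr_div_n.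
have n0 : (n`!%:R : R) != 0 by rewrite pnatr_eq0 -lt0n fact_gt0.
have p0 : poch c n != 0 by rewrite gt_eqF// poch_gt0.
have r1 : r ^+ n != 0 by rewrite expf_neq0// gt_eqF.
have r2 : r ^+ k != 0 by rewrite expf_neq0// gt_eqF.
move: n0 p0 r1 r2; move: (n`!%:R : R) (poch c n) (r ^+ n) (r ^+ k) (_ ^+ n) (poch _ k) (_ `^ _) (_ `^ _) (expR _).
by move=> x1 x2 x3 x4 x5 x6 x7 x8 x9 h1 h2 h3 h4; field; rewrite h1 h2 h3 h4.
Qed.

Lemma heat_gauss (t x s : R) : 0 < t -> 0 <= s ->
  (\int[mu]_y (heat t x y * expR (- (s * y ^+ 2)))%:E =
   ((1 + 4 * s * t) `^ (- c) * expR (- (s * x ^+ 2 / (1 + 4 * s * t))))%:E)%E.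
Proof.
move=> t0 s0; have := heat_moment 0 x t0 s0 => /=.
under eq_integral do rewrite expr0 mul1r.
move=> ->; pose r := s + (4 * t)^-1; rewrite -/r.
have st0 : 0 < 1 + 4 * s * t by rewrite ltr_wpDr// !mulr_ge0// ltW.
have -> : 4 * t * r = 1 + 4 * s * t by rewrite /r; field; rewrite gt_eqF.
set X := x ^+ 2 / (4 * t).
apply: nneseries_cvg.
have -> : expR (- (s * x ^+ 2 / (1 + 4 * s * t))) = expR (- X) * expR (X / (1 + 4 * s * t)).
  by rewrite -expRD; congr expR; rewrite /X; field; rewrite !gt_eqF.
rewrite mulrA; apply: cvg_series_scale (@cvg_expR_series _ (X / (1 + 4 * s * t))) => n.
by rewrite poch0 mul1r divr1.
Qed.

Lemma heat_mass (t x : R) : 0 < t -> (\int[mu]_y (heat t x y)%:E = 1)%E.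
Proof.
move=> t0; have := heat_gauss x t0 (lexx 0).
under eq_integral do rewrite mul0r oppr0 expR0 mulr1.
by move=> ->; rewrite mulr0 mul0r addr0 powR1 mul0r mul0r oppr0 expR0 mulr1.
Qed.

Lemma heat_sqr_moment k (t x : R) : 0 < t ->
  let X := x ^+ 2 / (4 * t) in
  (\int[mu]_y (heat t x y * (y ^+ 2) ^+ k)%:E =
   \sum_(0 <= n <oo) (expR (- X) * (4 * t) ^+ k * (poch (c + n%:R) k * (X ^+ n / n`!%:R)))%:E)%E.
Proof.
move=> t0 X; have := heat_moment k x t0 (lexx 0) => /=.
under eq_integral do rewrite mul0r oppr0 expR0 mulr1.
have t40 : 4 * t != 0 by rewrite mulf_neq0// gt_eqF.
move=> ->; apply: eq_eseriesr => n _; congr EFin.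
by rewrite add0r mulfV// powR1 mul1r divr1 exprVn invrK.
Qed.

Lemma heat_moment1 (t x : R) : 0 < t ->
  (\int[mu]_y (heat t x y * y ^+ 2)%:E = (4 * t * c + x ^+ 2)%:E)%E.
Proof.
move=> t0; have := heat_sqr_moment 1 x t0 => /=.
under eq_integral do rewrite expr1.
move=> ->; set X := x ^+ 2 / (4 * t); apply: nneseries_cvg.
have -> : 4 * t * c + x ^+ 2 = expR (- X) * (4 * t) * (c * expR X + X * expR X).
  have e1 : expR (- X) * expR X = 1 by rewrite -expRD addNr expR0.
  transitivity ((expR (- X) * expR X) * (4 * t) * (c + X)); last by ring.
  by rewrite e1 /X; field; rewrite gt_eqF.
have cv := cvg_seriesD (cvg_series_scale (fun n => erefl) (@cvg_expR_series _ X)) (@cvg_expR_series1 _ X).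
apply: cvg_series_scale (cv c) => n.
by rewrite expr1 pochSr poch0; ring.
Qed.

(** (c + n) (c + n + 1) is expanded in n (n - 1), n and 1, whose exponential series have been
    summed. *)
Lemma heat_moment2 (t x : R) : 0 < t ->
  (\int[mu]_y (heat t x y * (y ^+ 2) ^+ 2)%:E =
   (x ^+ 4 + 8 * t * (c + 1) * x ^+ 2 + 16 * t ^+ 2 * (c * (c + 1)))%:E)%E.
Proof.
move=> t0; rewrite heat_sqr_moment//; set X := x ^+ 2 / (4 * t); apply: nneseries_cvg.
have -> : x ^+ 4 + 8 * t * (c + 1) * x ^+ 2 + 16 * t ^+ 2 * (c * (c + 1)) =
    expR (- X) * (4 * t) ^+ 2 * (c * (c + 1) * expR X + (2 * (c + 1)) * (X * expR X) + X ^+ 2 * expR X).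
  have e1 : expR (- X) * expR X = 1 by rewrite -expRD addNr expR0.
  transitivity ((expR (- X) * expR X) * (4 * t) ^+ 2 * (c * (c + 1) + 2 * (c + 1) * X + X ^+ 2)); last by ring.
  by rewrite e1 /X; field; rewrite gt_eqF.
have c0 := cvg_series_scale (k := c * (c + 1)) (fun n => erefl) (@cvg_expR_series _ X).
have c1 := cvg_series_scale (k := 2 * (c + 1)) (fun n => erefl) (@cvg_expR_series1 _ X).
apply: cvg_series_scale (cvg_seriesD (cvg_seriesD c0 c1) (@cvg_expR_series2 _ X)) => n.
by rewrite !pochSr poch0; ring.
Qed.

End heat_kernel.

Lemma EFin_Rintegral d (T : measurableType d) (R : realType) (m : {measure set T -> \bar R})
    (f : T -> R) : m.-integrable setT (EFin \o f) ->
  (\int[m]_x f x)%:E = (\int[m]_x (f x)%:E)%E.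
Proof. by move=> /(integrable_fin_num measurableT) h; rewrite /Rintegral fineK. Qed.

Section symmetrization.
Context {d : measure_display} {T : measurableType d} {R : realType}.
Variable m : {sigma_finite_measure set T -> \bar R}.

(** By Tonelli the integral of A is half that of A (x, y) + A (y, x); the argument takes place in
    the extended reals and covers infinite integrals. *)
Lemma ge0_integral_symmetrize (A B : T * T -> R) :
  measurable_fun setT A -> measurable_fun setT B ->
  (forall p, 0 <= A p) -> (forall p, 0 <= B p) ->
  (forall x y, 2 * B (x, y) <= A (x, y) + A (y, x)) ->
  (\int[m]_x \int[m]_y (B (x, y))%:E <= \int[m]_x \int[m]_y (A (x, y))%:E)%E.
Proof.
move=> mA mB A0 B0 AB.
have mAx x : measurable_fun setT (fun y => A (x, y)) by exact: measurableT_comp.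
have mAy y : measurable_fun setT (fun x => A (x, y)) by exact: measurableT_comp.
have mBx x : measurable_fun setT (fun y => B (x, y)) by exact: measurableT_comp.
have mAE : measurable_fun setT (EFin \o A) by exact/measurable_EFinP.
have A0E p : (0 <= (EFin \o A) p)%E by rewrite /= lee_fin.
have mF1 : measurable_fun setT (fun x => \int[m]_y (A (x, y))%:E)%E.
  exact: (measurable_fun_fubini_tonelli_F (m2 := m) _ mAE A0E).
have mF2 : measurable_fun setT (fun y => \int[m]_x (A (x, y))%:E)%E.
  exact: (measurable_fun_fubini_tonelli_G (m1 := m) _ mAE A0E).
have mF3 : measurable_fun setT (fun x => \int[m]_y (B (x, y))%:E)%E.
  apply: (measurable_fun_fubini_tonelli_F (m2 := m) (EFin \o B)); first exact/measurable_EFinP.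
  by move=> p; rewrite /= lee_fin.
have I1 x : (0 <= \int[m]_y (A (x, y))%:E)%E by apply: integral_ge0 => y _; rewrite lee_fin.
have I2 y : (0 <= \int[m]_x (A (x, y))%:E)%E by apply: integral_ge0 => x _; rewrite lee_fin.
set I := (\int[m]_x \int[m]_y (A (x, y))%:E)%E.
have -> : I = ((2^-1)%:E * (I + I))%E.
  rewrite -mule2n -[(I *+ 2)%E]mule_natl muleA -EFinM mulVf ?pnatr_eq0// mul1e//.
rewrite {2}/I (@fubini_tonelli _ _ _ _ _ m m (EFin \o A) mAE A0E) /=.
rewrite -ge0_integralD//.
rewrite -ge0_integralZl//; last 2 first.
- exact: emeasurable_funD.
- by move=> x _; rewrite adde_ge0.
apply: ge0_le_integral => //.
- by move=> x _; apply: integral_ge0 => y _; rewrite lee_fin.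
- by apply: emeasurable_funM => //; exact: emeasurable_funD.
move=> x _; rewrite -ge0_integralD//; last 4 first.
- by move=> y _; rewrite lee_fin.
- exact/measurable_EFinP.
- by move=> y _; rewrite lee_fin.
- exact/measurable_EFinP.
rewrite -ge0_integralZl//; last 2 first.
- by apply/measurable_EFinP; exact: measurable_funD.
- by move=> y _; rewrite -EFinD lee_fin addr_ge0.
apply: ge0_le_integral => //.
- by move=> y _; rewrite lee_fin.
- exact/measurable_EFinP.
- by apply/measurable_EFinP; apply: measurable_funM => //; exact: measurable_funD.
- by move=> y _; rewrite -EFinD -EFinM lee_fin -(ler_pM2l (ltr0Sn R 1)) mulrA mulfV ?mul1r ?pnatr_eq0.
Qed.

End symmetrization.

(** * The Hankel transform of integrable functions *)

Section hankel_transform.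
Context {R : realType}.
Local Notation leb := (@lebesgue_measure R).
Local Notation Rp := (`]0%R, +oo[%classic : set R).
Variable alpha : R.
Hypothesis alpha_gt : -1 / 2 < alpha.
Local Notation c := (alpha + 1).
Local Notation mu := (hankel_measure alpha).
Local Notation J := (jalpha alpha).
Local Notation heat := (heat alpha).

Let c_gt0 : 0 < c. Proof. by move: alpha_gt; lra. Qed.
Let mJ : measurable_fun setT J := measurable_bessel alpha_gt.

(** Transform of a real function, as an integral over the whole line against mu; complex functions
    are treated through their two components. *)
Definition hankelR (G : R -> R) (xi : R) : R := \int[mu]_x (G x * J (x * xi)).
Local Notation Hk := hankelR.

Lemma measurable_Hk G : measurable_fun setT G -> measurable_fun setT (Hk G).
Proof.
move=> mG; apply: (measurable_Rintegral_param mu (F := fun p : R * R => G p.2 * J (p.2 * p.1))).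
by meas.
Qed.

Lemma le_norm_Hk G xi : mu.-integrable setT (EFin \o G) ->
  `|Hk G xi| <= \int[mu]_x `|G x|.
Proof.
move=> iG; rewrite -[leRHS]mul1r; apply: le_norm_Rintegral_bounded => //; first by meas.
by move=> x; exact: bessel_le1.
Qed.

(** A crude uniform bound, obtained by replacing the Gaussian by 1 in the angular average; it serves
    to make products with the kernel integrable. *)
Lemma heat_le t x y : 0 < t -> heat t x y <= (2 * t) `^ (- c).
Proof.
move=> t0; rewrite (heat_chord alpha_gt _ _ t0); set K := _ `^ _.
have K0 : 0 <= K by exact: powR_ge0.
have iK : (angle_measure alpha).-integrable setT (EFin \o cst K).
  by apply: (@integrable_angle _ _ alpha_gt _ K); [meas|move=> z; rewrite ger0_norm].
have e1 th : expR (- (chord x y th ^+ 2 / (4 * t))) <= 1.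
  by rewrite -expR0 ler_expR oppr_le0 divr_ge0 ?sqr_ge0// mulr_ge0// ltW.
apply: (@le_trans _ _ (\int[angle_measure alpha]_th (cst K th))).
  apply: le_Rintegral => //; last by move=> th _; rewrite -[leRHS]mulr1 ler_wpM2l.
  apply: (@integrable_angle _ _ alpha_gt _ K); first by rewrite /chord; meas.
  by move=> th; rewrite ger0_norm ?mulr_ge0 ?expR_ge0// -[leRHS]mulr1 ler_wpM2l.
rewrite /Rintegral; have := integral_cst (angle_measure alpha) measurableT K%:E.
rewrite [X in (_ * X)%E](_ : _ = 1%E) ?mule1; last exact: angle_measure_setT.
by move=> ->.
Qed.

Lemma eq_integral_hankel (h k : R -> \bar R) :
  measurable_fun setT h -> measurable_fun setT k ->
  (forall x, 0 < x -> h x = k x) -> (\int[mu]_x h x = \int[mu]_x k x)%E.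
Proof.
move=> mh mk hk; rewrite !integral_mdens//; apply: eq_integral => x _.
rewrite /half_line_weight; have [x0|x0] := ltP 0 x; first by rewrite hk.
by rewrite indicE memNset ?mulr0 ?mule0//= in_itv/= andbT ltNge x0.
Qed.

Lemma le_integral_hankel (h k : R -> \bar R) :
  measurable_fun setT h -> measurable_fun setT k ->
  (forall x, 0 < x -> (0 <= h x)%E) ->
  (forall x, 0 < x -> (h x <= k x)%E) -> (\int[mu]_x h x <= \int[mu]_x k x)%E.
Proof.
move=> mh mk h0 hk; have mw := measurable_half_line_weight alpha; rewrite !integral_mdens//.
have z x : x <= 0 -> half_line_weight alpha x = 0.
  by move=> x0; rewrite /half_line_weight indicE memNset ?mulr0//= in_itv/= andbT ltNge x0.
apply: ge0_le_integral => //.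
- move=> x _; have [x0|x0] := ltP 0 x; last by rewrite z// mule0.
  by rewrite mule_ge0 ?h0// lee_fin half_line_weight_ge0.
- by meas.
- by meas.
move=> x _; have [x0|x0] := ltP 0 x; last by rewrite z// !mule0.
by rewrite lee_wpmul2r ?hk// lee_fin half_line_weight_ge0.
Qed.

Lemma integrable_gauss_mul (t M : R) (k : R -> R) : 0 < t -> measurable_fun setT k ->
  (forall x, `|k x| <= M) ->
  mu.-integrable setT (EFin \o (fun xi => expR (- (t * xi ^+ 2)) * k xi)).
Proof. by move=> t0 mk kM; exact: (integrable_mul_bounded (integrable_gauss alpha_gt t0) mk kM). Qed.

Lemma hankel_multiplication (A B : R -> R) :
  mu.-integrable setT (EFin \o A) -> mu.-integrable setT (EFin \o B) ->
  \int[mu]_xi (A xi * Hk B xi) = \int[mu]_x (B x * Hk A x).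
Proof.
move=> iA iB; have mk : measurable_fun setT (fun p : R * R => J (p.2 * p.1)) by meas.
rewrite (Fubini_bounded_kernel iA iB mk (fun p => bessel_le1 alpha_gt _)).
by apply: eq_Rintegral => x _; congr (_ * _); apply: eq_Rintegral => y _; rewrite mulrC/= mulrC (mulrC x).
Qed.

Section integrable_function.
Variable G : R -> R.
Hypothesis iG : mu.-integrable setT (EFin \o G).

Let mG : measurable_fun setT G.
Proof. by have /measurable_EFinP := measurable_int _ iG. Qed.
Let mHG : measurable_fun setT (Hk G) := measurable_Hk mG.

Lemma integrable_gauss_Hk t : 0 < t ->
  mu.-integrable setT (EFin \o (fun xi => expR (- (t * xi ^+ 2)) * Hk G xi)).
Proof. by move=> t0; exact: (integrable_gauss_mul t0 mHG (fun x => le_norm_Hk x iG)). Qed.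

(** Regularised inversion: transforming back the damped transform of G gives the average of G
    against the heat kernel. By symmetry H is moved from G to the Gaussian times J (x xi), whose
    transform is the kernel. *)
Lemma heat_Hk (t x : R) : 0 < t ->
  Hk (fun xi => expR (- (t * xi ^+ 2)) * Hk G xi) x = \int[mu]_y (G y * heat t x y).
Proof.
move=> t0; have mJx : measurable_fun setT (fun xi : R => J (x * xi)) by meas.
have iA := integrable_gauss_mul t0 mJx (fun xi => bessel_le1 alpha_gt _).
transitivity (\int[mu]_xi ((expR (- (t * xi ^+ 2)) * J (x * xi)) * Hk G xi)).
  by apply: eq_Rintegral => xi _; rewrite mulrAC (mulrC xi).
rewrite (hankel_multiplication iA iG); apply: eq_Rintegral => y _; congr (_ * _).
rewrite -(bessel_heat alpha_gt _ _ t0); apply: eq_Rintegral => xi _.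
by rewrite mulrA (mulrC y).
Qed.

Lemma energyE (t : R) : 0 < t ->
  \int[mu]_xi (expR (- (t * xi ^+ 2)) * Hk G xi ^+ 2) =
  \int[mu]_x (G x * \int[mu]_y (G y * heat t x y)).
Proof.
move=> t0; transitivity (\int[mu]_xi (expR (- (t * xi ^+ 2)) * Hk G xi * Hk G xi)).
  by apply: eq_Rintegral => xi _; rewrite -mulrA.
rewrite (hankel_multiplication (integrable_gauss_Hk t0) iG).
by apply: eq_Rintegral => x _; rewrite (heat_Hk _ t0).
Qed.

Lemma energyE_EFin (t : R) : 0 < t ->
  (\int[mu]_xi (expR (- (t * xi ^+ 2)) * Hk G xi ^+ 2)%:E =
   \int[mu]_x (G x * \int[mu]_y (G y * heat t x y))%:E)%E.
Proof.
move=> t0; have iL : mu.-integrable setT (EFin \o (fun xi => expR (- (t * xi ^+ 2)) * Hk G xi ^+ 2)).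
  rewrite (_ : (fun xi => _) = (fun xi => expR (- (t * xi ^+ 2)) * Hk G xi * Hk G xi)).
    exact: (integrable_mul_bounded (integrable_gauss_Hk t0) mHG (fun x => le_norm_Hk x iG)).
  by apply/funext => xi; rewrite -mulrA.
have iR : mu.-integrable setT (EFin \o (fun x => G x * \int[mu]_y (G y * heat t x y))).
  rewrite (_ : (fun x => _) = (fun x => G x * Hk (fun xi => expR (- (t * xi ^+ 2)) * Hk G xi) x)).
    apply: (integrable_mul_bounded iG); first by apply: measurable_Hk; meas.
    by move=> x; exact: (le_norm_Hk x (integrable_gauss_Hk t0)).
  by apply/funext => x; rewrite (heat_Hk _ t0).
by rewrite -(EFin_Rintegral iL) -(EFin_Rintegral iR) (energyE t0).
Qed.

(* Schur test: AM-GM with weight [h] in the double integral against the symmetric heat kernel. *)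
Lemma energy_le (t : R) (h : R -> R) : 0 < t -> measurable_fun setT h -> (forall x, 0 < h x) ->
  (\int[mu]_xi (expR (- (t * xi ^+ 2)) * Hk G xi ^+ 2)%:E <=
   \int[mu]_x ((G x ^+ 2 * h x)%:E * \int[mu]_y (heat t x y / h y)%:E))%E.
Proof.
move=> t0 mh h0; rewrite energyE_EFin//.
have mheat x : measurable_fun setT (fun y : R => heat t x y).
  by apply: measurable_heat => //; meas.
have mheat2 : measurable_fun setT (fun p : R * R => heat t p.1 p.2).
  by apply: measurable_heat => //; meas.
have mh2 : measurable_fun setT (fun p : R * R => h p.2) by meas.
have mP : measurable_fun setT (fun x => \int[mu]_y (G y * heat t x y)).
  apply: (measurable_Rintegral_param mu (F := fun p : R * R => G p.2 * heat t p.1 p.2)).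
  by meas.
pose A (p : R * R) := G p.1 ^+ 2 * h p.1 * (heat t p.1 p.2 / h p.2).
pose B (p : R * R) := `|G p.1| * (`|G p.2| * heat t p.1 p.2).
have mA : measurable_fun setT A by rewrite /A; meas.
have mB : measurable_fun setT B by rewrite /B; meas.
have hge x := heat_ge0 alpha_gt t x.
have B0 p : 0 <= B p by rewrite /B; apply: mulr_ge0 => //; apply: mulr_ge0.
have A0 p : 0 <= A p.
  by rewrite /A; apply: mulr_ge0; [apply: mulr_ge0|apply: divr_ge0]; rewrite ?sqr_ge0 ?(ltW (h0 _)).
apply: (@le_trans _ _ (\int[mu]_x \int[mu]_y (B (x, y))%:E)%E).
  apply: (@le_trans _ _ (\int[mu]_x `|(G x * \int[mu]_y (G y * heat t x y))%:E|)%E).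
    apply: (le_trans (lee_abs _)); apply: le_abse_integral => //.
    by apply/measurable_EFinP; exact: measurable_funM.
  apply: ge0_le_integral => //.
  - by apply: measurableT_comp => //; apply/measurable_EFinP; exact: measurable_funM.
  - apply: (measurable_fun_fubini_tonelli_F (m2 := mu) (EFin \o B)); first exact/measurable_EFinP.
    by move=> p; rewrite /= lee_fin.
  move=> x _; rewrite EFinM abseM /B/=.
  have mGh : measurable_fun setT (fun y => `|G y| * heat t x y) by meas.
  under [leRHS]eq_integral do rewrite EFinM.
  rewrite ge0_integralZl; [|exact: measurableT|by apply/measurable_EFinP|by move=> y _; rewrite lee_fin mulr_ge0|by rewrite lee_fin].
  rewrite lee_wpmul2l ?lee_fin//.
  have i1 : mu.-integrable setT (EFin \o (fun y => G y * heat t x y)).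
    apply: (integrable_mul_bounded iG (mheat x) (M := (2 * t) `^ (- c))) => y.
    by rewrite ger0_norm// heat_le.
  have := le_normr_Rintegral measurableT i1; rewrite -lee_fin => /le_trans; apply.
  rewrite (EFin_Rintegral (integrable_norm i1)) le_eqVlt; apply/orP; left; apply/eqP; apply: eq_integral => y _.
  by rewrite /= normrM (ger0_norm (hge _ _)).
apply: (le_trans (ge0_integral_symmetrize mu mA mB A0 B0 _)).
  move=> x y; rewrite /A /B/= (heatC alpha t y x).
  have -> : G x ^+ 2 * h x * (heat t x y / h y) + G y ^+ 2 * h y * (heat t x y / h x) =
     heat t x y * (G x ^+ 2 * (h x / h y) + G y ^+ 2 / (h x / h y)).
    by field; rewrite !gt_eqF.
  rewrite (_ : 2 * _ = heat t x y * (2 * (`|G x| * `|G y|))); last by ring.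
  rewrite ler_wpM2l//; set q := h x / h y; have q0 : 0 < q by rewrite divr_gt0.
  rewrite -(ler_pM2r q0) [leRHS]mulrDl divfK ?gt_eqF//.
  have := sqr_ge0 (q * `|G x| - `|G y|).
  rewrite -(real_normK (num_real (G x))) -(real_normK (num_real (G y))).
  by nra.
rewrite le_eqVlt; apply/orP; left; apply/eqP; apply: eq_integral => x _.
rewrite -ge0_integralZl; [by []|exact: measurableT|by meas| |].
- by move=> y _; rewrite lee_fin divr_ge0 ?(ltW (h0 _)).
- by rewrite lee_fin mulr_ge0 ?sqr_ge0 ?(ltW (h0 _)).
Qed.

End integrable_function.
End hankel_transform.

Ltac nneg_leaf := solve [ assumption | exact: ltW | done ].
Ltac nnegf := rewrite ?lee_fin; repeat lazymatch goal with
  | |- is_true (@Order.le _ _ _ (GRing.mul _ _)) => apply: mulr_ge0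
  | |- is_true (@Order.le _ _ _ (mule _ _)) => apply: mule_ge0
  | |- is_true (@Order.le _ _ _ (GRing.add _ _)) => apply: addr_ge0
  | |- is_true (@Order.le _ _ _ (GRing.inv _)) => rewrite invr_ge0
  | |- is_true (@Order.le _ _ _ (EFin _)) => rewrite lee_fin
  | |- is_true (@Order.le _ _ _ (expR _)) => exact: expR_ge0
  | |- is_true (@Order.le _ _ _ (powR _ _)) => exact: powR_ge0
  | |- is_true (@Order.le _ _ _ (Num.norm _)) => exact: normr_ge0
  | |- is_true (@Order.le _ _ _ (Gamma _)) => exact: Gamma_ge0
  | |- is_true (@Order.le _ _ _ (heat _ _ _ _)) => exact: heat_ge0
  | |- is_true (@Order.le _ _ _ (integral _ _ _)) => apply: integral_ge0 => ? _
  | |- is_true (@Order.le _ _ _ (GRing.exp _ 2)) => exact: sqr_ge0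
  | |- _ => nneg_leaf
  end.

Lemma measurable_integral_in d1 d2 (T1 : measurableType d1) (T2 : measurableType d2) (R : realType)
    (m2 : {sigma_finite_measure set T2 -> \bar R}) (D : set T2) (F : T1 * T2 -> \bar R) :
  measurable D -> measurable_fun setT F -> (forall p, (0 <= F p)%E) ->
  measurable_fun setT (fun x => \int[m2]_(y in D) F (x, y))%E.
Proof.
move=> mD mF F0.
rewrite (_ : (fun x => _) = (fun x => \int[m2]_y (F (x, y) * (\1_D y)%:E))%E); last first.
  by apply/funext => x; rewrite integral_mkcond; apply: eq_integral => y _; rewrite epatch_indic.
apply: (measurable_fun_fubini_tonelli_F (m2 := m2) (fun p : T1 * T2 => (F p * (\1_D p.2)%:E)%E)).
  apply: emeasurable_funM => //; apply/measurable_EFinP.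
  by apply: (measurableT_comp (measurable_indic mD)); exact: measurable_snd.
by move=> p; rewrite mule_ge0// lee_fin.
Qed.

(** * The sharp Pitt inequality *)

Section pitt.
Context {R : realType}.
Local Notation leb := (@lebesgue_measure R).
Local Notation Rp := (`]0%R, +oo[%classic : set R).
Variable alpha : R.
Hypothesis alpha_gt : -1 / 2 < alpha.
Local Notation c := (alpha + 1).
Local Notation mu := (hankel_measure alpha).
Local Notation J := (jalpha alpha).
Local Notation heat := (heat alpha).
Local Notation Hk := (hankelR alpha).

Let c_gt0 : 0 < c. Proof. by move: alpha_gt; lra. Qed.
Let b_gt0 : 0 < c / 2. Proof. by rewrite divr_gt0. Qed.

(** Formally H fixes x^(-c) and maps xi^(-c - 2e) to [pittC e] times x^(2e - c). The condition e < c
    / 2 imposed below keeps the former power of xi locally integrable for mu. *)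
Definition pittC (e : R) : R := 4 `^ (- e) * Gamma (c / 2 - e) / Gamma (c / 2 + e).

Lemma pitt_scaled_integral (u s x : R) : 0 < u -> 0 < s ->
  (\int[leb]_(t in Rp) (t `^ (u - 1) * ((1 + 4 * s * t) `^ (- c) * expR (- (s * x ^+ 2 / (1 + 4 * s * t)))))%:E =
   ((4 * s) `^ (- u))%:E *
   \int[leb]_(v in Rp) (v `^ (u - 1) * ((1 + v) `^ (- c) * expR (- (s * x ^+ 2 / (1 + v)))))%:E)%E.
Proof.
move=> u0 s0; have s40 : 0 < 4 * s by rewrite mulr_gt0.
have k0 : 0 < (4 * s)^-1 by rewrite invr_gt0.
rewrite (ge0_integral0y_scale k0); [|by meas|by move=> t; nnegf].
rewrite -ge0_integralZl; [|exact: measurable_itv|by apply: measurable_funTS; meas|by move=> *; nnegf|by rewrite lee_fin ltW].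
rewrite -ge0_integralZl; [|exact: measurable_itv|by apply: measurable_funTS; meas|by move=> *; nnegf|by rewrite lee_fin powR_ge0].
apply: eq_integral => v; rewrite inE/= in_itv/= andbT => v0; rewrite -!EFinM; congr EFin.
have -> : 4 * s * ((4 * s)^-1 * v) = v by rewrite mulrA mulfV ?mul1r ?gt_eqF.
rewrite (powRM _ (ltW k0) (ltW v0)).
have -> : (4 * s) `^ (- u) = (4 * s)^-1 * (4 * s)^-1 `^ (u - 1).
  rewrite -{1}(powRr1 (ltW k0)) -(@powRD _ _ 1) ?(gt_eqF k0) ?implybT//.
  by rewrite !powRE_pos// lnV ?posrE//; congr expR; ring.
by ring.
Qed.

(** After v = 4 s t the s-integral is a Gamma integral with parameter c / 2 - u, which is where u <
    c / 2 enters, and the v-integral is a Beta integral with parameters u and c / 2. *)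
Lemma pitt_kernel_integral (u x : R) : 0 < u < c / 2 -> 0 < x ->
  (\int[leb]_(t in Rp) \int[leb]_(s in Rp)
    (t `^ (u - 1) * s `^ (c / 2 - 1) * ((1 + 4 * s * t) `^ (- c) * expR (- (s * x ^+ 2 / (1 + 4 * s * t)))))%:E =
   (Gamma u * Gamma (c / 2) * pittC u * x `^ (2 * u - c))%:E)%E.
Proof.
move=> /andP[u0 ub] x0.
rewrite (@ge0_tonelli0y _ (fun p : R * R => (p.1 `^ (u - 1) * p.2 `^ (c / 2 - 1) *
  ((1 + 4 * p.2 * p.1) `^ (- c) * expR (- (p.2 * x ^+ 2 / (1 + 4 * p.2 * p.1)))))%:E)); last 2 first.
- by meas.
- by move=> p; rewrite lee_fin !mulr_ge0 ?powR_ge0 ?expR_ge0.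
transitivity (\int[leb]_(s in Rp) \int[leb]_(v in Rp)
   (4 `^ (- u) * (v `^ (u - 1) * (1 + v) `^ (- c)) *
     (s `^ (c / 2 - u - 1) * expR (- (x ^+ 2 / (1 + v) * s))))%:E)%E.
  apply: eq_integral => s; rewrite inE/= in_itv/= andbT => s0.
  transitivity ((s `^ (c / 2 - 1))%:E * ((4 * s) `^ (- u))%:E *
     \int[leb]_(v in Rp) (v `^ (u - 1) * ((1 + v) `^ (- c) * expR (- (s * x ^+ 2 / (1 + v)))))%:E)%E.
    rewrite -muleA -pitt_scaled_integral//.
    rewrite -ge0_integralZl; [|exact: measurable_itv|by apply: measurable_funTS; meas|by move=> *; nnegf|by rewrite lee_fin powR_ge0].
    by apply: eq_integral => t _; rewrite -EFinM /=; congr EFin; ring.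
  rewrite -EFinM -ge0_integralZl; [|exact: measurable_itv|by apply: measurable_funTS; meas|by move=> *; nnegf|by rewrite lee_fin mulr_ge0 ?powR_ge0].
  apply: eq_integral => v _; rewrite -EFinM; congr EFin.
  rewrite (powRM _ _ (ltW s0))//.
  have -> : c / 2 - u - 1 = (c / 2 - 1) + (- u) by ring.
  rewrite (@powRD _ s (c / 2 - 1) (- u)) ?(gt_eqF s0) ?implybT//.
  have -> : s * x ^+ 2 / (1 + v) = x ^+ 2 / (1 + v) * s by ring.
  by ring.
rewrite (@ge0_tonelli0y _ (fun p : R * R => (4 `^ (- u) * (p.2 `^ (u - 1) * (1 + p.2) `^ (- c)) *
     (p.1 `^ (c / 2 - u - 1) * expR (- (x ^+ 2 / (1 + p.2) * p.1))))%:E)); last 2 first.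
- by meas.
- by move=> p; rewrite lee_fin !mulr_ge0 ?powR_ge0 ?expR_ge0.
have bu : 0 < c / 2 - u by rewrite subr_gt0.
transitivity (\int[leb]_(v in Rp) ((4 `^ (- u) * Gamma (c / 2 - u) * x `^ (2 * u - c))%:E *
    (v `^ (u - 1) * (1 + v) `^ (- (u + c / 2)))%:E))%E.
  apply: eq_integral => v; rewrite inE/= in_itv/= andbT => v0.
  have v10 : 0 < 1 + v by rewrite addr_gt0.
  have r0 : 0 < x ^+ 2 / (1 + v) by rewrite divr_gt0// exprn_gt0.
  under eq_integral do rewrite EFinM.
  rewrite ge0_integralZl; [|exact: measurable_itv|by apply: measurable_funTS; meas|by move=> *; nnegf|
    by rewrite lee_fin !mulr_ge0 ?powR_ge0].
  rewrite /= integral_gamma// -!EFinM; congr EFin.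
  rewrite (@powRE_pos _ (x ^+ 2 / (1 + v)))// lnM ?posrE ?invr_gt0 ?exprn_gt0// lnV ?posrE// lnXn//.
  rewrite !(@powRE_pos _ (1 + v))// (@powRE_pos _ x)//.
  have -> : - (c / 2 - u) * (ln x *+ 2 - ln (1 + v)) = (2 * u - c) * ln x + (c / 2 - u) * ln (1 + v) by rewrite -mulr_natl; field.
  have -> : - (u + c / 2) * ln (1 + v) = - c * ln (1 + v) + (c / 2 - u) * ln (1 + v) by field.
  rewrite !expRD; move: (expR _) (expR _) (expR _) (Gamma _) => ? ? ? ?; ring.
rewrite ge0_integralZl; [|exact: measurable_itv|by apply: measurable_funTS; meas|by move=> *; nnegf|
  by rewrite lee_fin !mulr_ge0 ?powR_ge0 ?Gamma_ge0].
rewrite integral_beta// -EFinM; congr EFin; rewrite /pittC [u + c / 2]addrC.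
move: (Gamma (c / 2 - u)) (Gamma (c / 2 + u)) (Gamma u) (4 `^ (- u)) => ? ? ? ?; ring.
Qed.

Lemma inv_powR_gauss (s y : R) : 0 < s -> 0 < y ->
  (\int[leb]_(t in Rp) ((Gamma s)^-1 * (t `^ (s - 1) * expR (- (t * y ^+ 2))))%:E = (y `^ (- (2 * s)))%:E)%E.
Proof.
move=> s0 y0; have y20 : 0 < y ^+ 2 by rewrite exprn_gt0.
under eq_integral do rewrite EFinM.
rewrite ge0_integralZl; [|exact: measurable_itv|by apply: measurable_funTS; meas|by move=> *; nnegf|
  by rewrite lee_fin invr_ge0 Gamma_ge0].
under eq_integral do rewrite [_ * y ^+ 2]mulrC.
rewrite integral_gamma// -EFinM mulKf ?gt_eqF ?Gamma_gt0//; congr EFin.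
rewrite !powRE_pos// lnXn// -mulr_natl; congr expR; ring.
Qed.

(** The test function y^(-c) is itself a superposition of Gaussians, with parameter s, and the
    kernel acts explicitly on each. The weight is written [expR (c * ln y)] because the Schur test
    asks for positivity on the whole line. *)
Lemma heat_powR (t x : R) : 0 < t -> 0 < x ->
  (\int[mu]_y (heat t x y / expR (c * ln y))%:E =
   \int[leb]_(s in Rp) ((Gamma (c / 2))^-1 * (s `^ (c / 2 - 1) *
      ((1 + 4 * s * t) `^ (- c) * expR (- (s * x ^+ 2 / (1 + 4 * s * t))))))%:E)%E.
Proof.
move=> t0 x0.
have mh : measurable_fun setT (fun y : R => heat t x y) by apply: measurable_heat => //; meas.
have mh2 : measurable_fun setT (fun p : R * R => heat t x p.1) by meas.
pose F (p : R * R) : \bar R := ((Gamma (c / 2))^-1 * (p.2 `^ (c / 2 - 1) * expR (- (p.2 * p.1 ^+ 2))) * heat t x p.1)%:E.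
have G0 : 0 <= (Gamma (c / 2))^-1 by rewrite invr_ge0 Gamma_ge0.
have hge y := heat_ge0 alpha_gt t x y.
have mF : measurable_fun setT F by rewrite /F; meas.
have F0 p : (0 <= F p)%E by rewrite /F; nnegf.
transitivity (\int[mu]_y \int[leb]_(s in Rp) F (y, s))%E.
  have mF2 : measurable_fun setT (fun y => \int[leb]_(s in Rp) F (y, s))%E.
    exact: measurable_integral_in.
  apply: eq_integral_hankel => //; first by meas.
  move=> y y0.
  have -> : expR (c * ln y) = y `^ c by rewrite powRE_pos.
  rewrite -powRN EFinM.
  have -> : - c = - (2 * (c / 2)) by field.
  rewrite -(inv_powR_gauss b_gt0 y0) -ge0_integralZl; [|exact: measurable_itv|by apply: measurable_funTS; meas|by move=> *; nnegf|by rewrite lee_fin].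
  by apply: eq_integral => s _; rewrite /F -EFinM/=; congr EFin; ring.
rewrite (ge0_tonelli_in mu leb measurableT (measurable_itv _) mF F0).
apply: eq_integral => s; rewrite inE/= in_itv/= andbT => s0.
rewrite [X in _ = X%:E]mulrA EFinM -(heat_gauss alpha_gt x t0 (ltW s0)) -ge0_integralZl; [|exact: measurableT|by meas|by move=> *; nnegf|by nnegf].
by apply: eq_integral => y _; rewrite /F -EFinM/=; congr EFin; ring.
Qed.

(** Both xi^(-2u) and y^(-c) are replaced by superpositions of Gaussians, in t and in s, and the
    orders of integration are changed by Tonelli. The right side is allowed to be infinite. *)
Lemma pitt (u : R) (G : R -> R) : 0 < u < c / 2 -> mu.-integrable setT (EFin \o G) ->
  (\int[mu]_xi (xi `^ (- (2 * u)) * Hk G xi ^+ 2)%:E <=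
   (pittC u)%:E * \int[mu]_x (x `^ (2 * u) * G x ^+ 2)%:E)%E.
Proof.
move=> ub iG; have /andP[u0 ub2] := ub.
have mG : measurable_fun setT G by have /measurable_EFinP := measurable_int _ iG.
have mHG := measurable_Hk alpha_gt mG.
have Gu : 0 <= (Gamma u)^-1 by rewrite invr_ge0 Gamma_ge0.
have Gb : 0 <= (Gamma (c / 2))^-1 by rewrite invr_ge0 Gamma_ge0.
have mH2 := measurable_funX 2 mHG.
have mA : measurable_fun setT (fun xi : R => (xi `^ (- (2 * u)) * Hk G xi ^+ 2)%:E) by meas.
have mB t : measurable_fun setT (fun xi : R => (expR (- (t * xi ^+ 2)) * Hk G xi ^+ 2)%:E) by meas.
have mC : measurable_fun setT (fun x : R => (x `^ (2 * u) * G x ^+ 2)%:E) by meas.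
pose F (p : R * R) : \bar R := ((Gamma u)^-1 * (p.2 `^ (u - 1) * expR (- (p.2 * p.1 ^+ 2))) * Hk G p.1 ^+ 2)%:E.
have mHG1 : measurable_fun setT (fun p : R * R => Hk G p.1) := measurableT_comp mHG measurable_fst.
have mF : measurable_fun setT F by rewrite /F; meas.
have F0 p : (0 <= F p)%E by rewrite /F; nnegf.
rewrite [leLHS](_ : _ = \int[mu]_xi \int[leb]_(t in Rp) F (xi, t))%E; last first.
  have mF2 : measurable_fun setT (fun xi => \int[leb]_(t in Rp) F (xi, t))%E by exact: measurable_integral_in.
  apply: eq_integral_hankel; [exact: mA|exact: mF2|].
  move=> xi xi0; rewrite EFinM -(inv_powR_gauss u0 xi0) -ge0_integralZr; [|exact: measurable_itv|by apply: measurable_funTS; meas|by move=> *; nnegf|by nnegf].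
  by apply: eq_integral.
rewrite (ge0_tonelli_in mu leb measurableT (measurable_itv _) mF F0).
(* Integrand of the triple integral that the Schur test produces; the variables are ((t, x), s). *)
pose K (p : (R * R) * R) : \bar R := ((Gamma u)^-1 * (Gamma (c / 2))^-1 *
   (p.1.1 `^ (u - 1) * p.2 `^ (c / 2 - 1) *
    ((1 + 4 * p.2 * p.1.1) `^ (- c) * expR (- (p.2 * p.1.2 ^+ 2 / (1 + 4 * p.2 * p.1.1))))) *
   (G p.1.2 ^+ 2 * expR (c * ln p.1.2)))%:E.
have m12 : measurable_fun setT (fun p : (R * R) * R => p.1.2) by exact: (measurableT_comp measurable_snd).
have m11 : measurable_fun setT (fun p : (R * R) * R => p.1.1) by exact: (measurableT_comp measurable_fst).
have mG2 : measurable_fun setT (fun p : (R * R) * R => G p.1.2) by meas.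
have mK : measurable_fun setT K by rewrite /K; meas.
have K0 p : (0 <= K p)%E by rewrite /K; nnegf.
pose L (p : R * R) := (\int[leb]_(s in Rp) K (p, s))%E.
have mL : measurable_fun setT L by exact: measurable_integral_in.
have L0 p : (0 <= L p)%E by exact: integral_ge0.
have mh : measurable_fun setT (fun y : R => expR (c * ln y)) by meas.
have hge x := heat_ge0 alpha_gt _ x.
apply: (@le_trans _ _ (\int[leb]_(t in Rp) \int[mu]_x L (t, x))%E).
  apply: ge0_le_integral; [exact: measurable_itv| | | |].
  - by move=> t _; exact: integral_ge0.
  - apply: measurable_funTS; apply: (measurable_fun_fubini_tonelli_G (m1 := mu) F) => //.
  - apply: measurable_funTS; apply: (measurable_fun_fubini_tonelli_F (m2 := mu) L) => //.
  move=> t; rewrite /= in_itv/= andbT => t0.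
  have Gt : (0 <= ((Gamma u)^-1 * t `^ (u - 1))%:E)%E by rewrite lee_fin mulr_ge0 ?powR_ge0.
  have mt : measurable_fun setT (fun y : R * R => heat t y.1 y.2) by apply: measurable_heat => //; meas.
  have mI : measurable_fun setT (fun x => \int[mu]_y (heat t x y / expR (c * ln y))%:E)%E.
    apply: (measurable_fun_fubini_tonelli_F (m2 := mu) (fun p : R * R => (heat t p.1 p.2 / expR (c * ln p.2))%:E)); first by meas.
    by move=> p; rewrite lee_fin mulr_ge0 ?invr_ge0 ?expR_ge0// heat_ge0.
  apply: (@le_trans _ _ (((Gamma u)^-1 * t `^ (u - 1))%:E *
      \int[mu]_x ((G x ^+ 2 * expR (c * ln x))%:E * \int[mu]_y (heat t x y / expR (c * ln y))%:E))%E).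
    apply: le_trans (lee_wpmul2l Gt (energy_le alpha_gt iG t0 mh (fun x => expR_gt0 _))).
    rewrite -ge0_integralZl; [|exact: measurableT|exact: mB|by move=> *; nnegf|by []].
    rewrite le_eqVlt; apply/orP; left; apply/eqP; apply: eq_integral => xi _.
    by rewrite /F -EFinM/=; congr EFin; ring.
  have I0 x : (0 <= \int[mu]_y (heat t x y / expR (c * ln y))%:E)%E.
    by apply: integral_ge0 => y _; rewrite lee_fin mulr_ge0 ?invr_ge0 ?expR_ge0// heat_ge0.
  rewrite -ge0_integralZl; [|exact: measurableT|by meas|by move=> x _; rewrite mule_ge0// lee_fin mulr_ge0 ?sqr_ge0 ?expR_ge0|by []].
  rewrite le_eqVlt; apply/orP; left; apply/eqP; apply: eq_integral_hankel.
  - by meas.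
  - by apply: measurableT_comp mL _; exact: measurable_pair1.
  move=> x x0; rewrite (heat_powR t0 x0) muleA -EFinM.
  rewrite -ge0_integralZl; [|exact: measurable_itv|by apply: measurable_funTS; meas|by move=> *; nnegf|by nnegf].
  by apply: eq_integral => s _; rewrite /K -EFinM/=; congr EFin; ring.
rewrite -(ge0_tonelli_in mu leb measurableT (measurable_itv _) (F := fun p => L (p.2, p.1))); last 2 first.
- by apply: measurableT_comp mL _; apply/measurable_fun_pairP; split; meas.
- by move=> p; exact: L0.
rewrite -ge0_integralZl; [|exact: measurableT|by meas|by move=> x _; rewrite lee_fin mulr_ge0 ?powR_ge0 ?sqr_ge0|
  by rewrite lee_fin /pittC !mulr_ge0 ?invr_ge0 ?powR_ge0 ?Gamma_ge0].
rewrite le_eqVlt; apply/orP; left; apply/eqP; apply: eq_integral_hankel.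
- apply: (@measurable_integral_in _ _ _ _ _ leb _ (fun p => L (p.2, p.1))); [exact: measurable_itv| |by move=> p; exact: L0].
  by apply: measurableT_comp mL _; apply/measurable_fun_pairP; split; meas.
- by meas.
move=> x x0; rewrite /L.
pose k := (Gamma u)^-1 * (Gamma (c / 2))^-1 * (G x ^+ 2 * expR (c * ln x)).
have k0 : (0 <= k%:E)%E by rewrite /k; nnegf.
transitivity (k%:E * \int[leb]_(t in Rp) \int[leb]_(s in Rp)
    (t `^ (u - 1) * s `^ (c / 2 - 1) * ((1 + 4 * s * t) `^ (- c) * expR (- (s * x ^+ 2 / (1 + 4 * s * t)))))%:E)%E.
  rewrite -ge0_integralZl; [|exact: measurable_itv| |by move=> t _; apply: integral_ge0 => s _; nnegf|by []]; last first.
    apply: measurable_funTS.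
    apply: (@measurable_integral_in _ _ _ _ _ leb _ (fun p : R * R => (p.1 `^ (u - 1) * p.2 `^ (c / 2 - 1) * ((1 + 4 * p.2 * p.1) `^ (- c) * expR (- (p.2 * x ^+ 2 / (1 + 4 * p.2 * p.1)))))%:E)).
    - exact: measurable_itv.
    - by meas.
    - by move=> p; nnegf.
  apply: eq_integral => t _; rewrite -ge0_integralZl; [|exact: measurable_itv|by apply: measurable_funTS; meas|by move=> *; nnegf|by []].
  by apply: eq_integral => s _; rewrite -EFinM /K/= /k; congr EFin; ring.
rewrite pitt_kernel_integral// -!EFinM; congr EFin; rewrite /k.
have -> : x `^ (2 * u) = expR (c * ln x) * x `^ (2 * u - c).
  by rewrite !powRE_pos// -expRD; congr expR; ring.
have g1 : Gamma u != 0 by rewrite gt_eqF// Gamma_gt0.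
have g2 : Gamma (c / 2) != 0 by rewrite gt_eqF// Gamma_gt0.
move: g1 g2; move: (Gamma u) (Gamma (c / 2)) => ? ? g1 g2; by field; rewrite g1 g2.
Qed.

End pitt.

(** * Functions with controlled increments under the heat kernel *)

Section regular.
Context {R : realType}.
Local Notation leb := (@lebesgue_measure R).
Local Notation Rp := (`]0%R, +oo[%classic : set R).
Variable alpha : R.
Hypothesis alpha_gt : -1 / 2 < alpha.
Local Notation c := (alpha + 1).
Local Notation mu := (hankel_measure alpha).
Local Notation J := (jalpha alpha).
Local Notation heat := (heat alpha).
Local Notation Hk := (hankelR alpha).

Let c_gt0 : 0 < c. Proof. by move: alpha_gt; lra. Qed.

(** Reference decay: mu gives mass of order r^(2c) to [0, r], so this is integrable for every b >
    0. *)
Definition rho (b x : R) : R := (1 + x ^+ 2) `^ (- (c + b)).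

Lemma rho_ge0 b x : 0 <= rho b x. Proof. exact: powR_ge0. Qed.

Lemma measurable_rho b : measurable_fun setT (rho b).
Proof. by rewrite /rho; meas. Qed.

Lemma rho_le1 b x : 0 < b -> rho b x <= 1.
Proof.
move=> b0; have x1 : 1 <= 1 + x ^+ 2 by rewrite lerDl sqr_ge0.
rewrite /rho powRE_pos ?(lt_le_trans ltr01)// -[leRHS]expR0 ler_expR mulNr oppr_le0.
by apply: mulr_ge0; [exact: ltW (addr_gt0 c_gt0 b0)|exact: ln_ge0].
Qed.

Lemma rhoS b x : (1 + x ^+ 2) * rho (b + 1) x = rho b x.
Proof.
have x0 : 0 < 1 + x ^+ 2 by rewrite ltr_pwDl ?sqr_ge0.
rewrite /rho -{1}(powRr1 (ltW x0)) -powRD ?(gt_eqF x0) ?implybT//; congr (_ `^ _); ring.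
Qed.

Lemma integrable_rho b : 0 < b -> mu.-integrable setT (EFin \o rho b).
Proof.
move=> b0; have mr := measurable_rho b; apply/integrableP; split; first exact/measurable_EFinP.
under eq_integral do rewrite /= ger0_norm ?rho_ge0//.
have := integral_beta c_gt0 b0; rewrite ge0_integral0y_sqr; [|by meas|by move=> x; nnegf].
move=> h; rewrite ge0_integral_hankel; [|by meas|by move=> x; rewrite lee_fin rho_ge0].
apply: (@le_lt_trans _ _ (((2 `^ c * Gamma c)^-1)%:E * (Gamma c * Gamma b / Gamma (c + b))%:E)%E); last first.
  by rewrite -EFinM ltry.
rewrite -h -ge0_integralZl; last 4 first.
- exact: measurable_itv.
- by apply: measurable_funTS; meas.
- by move=> x; rewrite /= in_itv/= andbT => x0; nnegf.
- by nnegf.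
rewrite le_eqVlt; apply/orP; left; apply/eqP; apply: eq_integral => x; rewrite inE/= in_itv/= andbT => x0.
rewrite -!EFinM; congr EFin.
have E : (x ^+ 2) `^ (c - 1) * (2 * x) = 2 * x `^ (2 * alpha + 1).
  rewrite !powRE_pos ?exprn_gt0// lnXn// -mulr_natl.
  have {2}-> : x = expR (ln x) by rewrite lnK.
  by rewrite mulrCA -expRD; congr (_ * expR _); ring.
rewrite [_ * (2 * x)]mulrAC E /wdens /rho (@powRD _ 2) ?pnatr_eq0 ?implybT// powRr1//.
have G0 : Gamma c != 0 by rewrite gt_eqF// Gamma_gt0.
have p0 : (2 : R) `^ alpha != 0 by rewrite gt_eqF// powR_gt0.
by move: (x `^ _) (_ `^ (- (c + b))) => a e; field; rewrite G0 p0.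
Qed.

Lemma integrable_heat t x : 0 < t -> mu.-integrable setT (EFin \o heat t x).
Proof.
move=> t0; have mh : measurable_fun setT (heat t x) by apply: measurable_heat => //; meas.
apply/integrableP; split; first exact/measurable_EFinP.
under eq_integral do rewrite /= ger0_norm ?heat_ge0//.
by rewrite heat_mass// ltry.
Qed.

Lemma Rintegral_heat t x : 0 < t -> \int[mu]_y heat t x y = 1.
Proof. by move=> t0; rewrite /Rintegral heat_mass. Qed.

(** The terms in x^4 cancel: y^2 deviates from x^2 by a mean square that is O(t) for t <= 1, with a
    factor growing like 1 + x^2. *)
Lemma heat_spread (t x : R) : 0 < t ->
  (\int[mu]_y (heat t x y * (x ^+ 2 - y ^+ 2) ^+ 2)%:E =
   (8 * t * x ^+ 2 + 16 * t ^+ 2 * (c * (c + 1)))%:E)%E.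
Proof.
move=> t0; have mh : measurable_fun setT (heat t x) by apply: measurable_heat => //; meas.
have hge y := heat_ge0 alpha_gt t x y.
have I1 : mu.-integrable setT (EFin \o (fun y => heat t x y * y ^+ 2)).
  apply/integrableP; split; first by meas.
  by under eq_integral => y _ do rewrite /= (ger0_norm (mulr_ge0 (hge y) (sqr_ge0 y))); rewrite heat_moment1// ltry.
have I2 : mu.-integrable setT (EFin \o (fun y => heat t x y * (y ^+ 2) ^+ 2)).
  apply/integrableP; split; first by meas.
  by under eq_integral => y _ do rewrite /= (ger0_norm (mulr_ge0 (hge y) (sqr_ge0 (y ^+ 2)))); rewrite heat_moment2// ltry.
have I0 := integrable_heat x t0.
have J0 := integrableZl measurableT (x ^+ 4) I0.
have J1 := integrableZl measurableT (- (2 * x ^+ 2)) I1.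
have J01 := integrableD measurableT J0 J1.
rewrite (_ : (fun y => _) = (fun y => (x ^+ 4 * heat t x y + - (2 * x ^+ 2) * (heat t x y * y ^+ 2) + heat t x y * (y ^+ 2) ^+ 2)%:E)); last first.
  by apply/funext => y; congr EFin; ring.
rewrite -(EFin_Rintegral (integrableD measurableT J01 I2)); congr EFin.
rewrite (RintegralD measurableT J01 I2) (RintegralD measurableT J0 J1).
rewrite (RintegralZl _ measurableT I0) (RintegralZl _ measurableT I1).
rewrite Rintegral_heat// /Rintegral heat_moment1// heat_moment2//=; ring.
Qed.

(** Increments are measured in x^2 - y^2 because the second moment of this quantity under the heat
    kernel is explicit, and because an even smooth function is smooth in x^2. That moment grows like
    1 + x^2, which lowers the decay of the increment bound from [rho 2] to the integrable
    [rho 1]. *)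
Definition heat_regular (G : R -> R) := measurable_fun setT G /\
  exists C : R, [/\ 0 <= C, forall x, `|G x| <= C * rho 1 x &
    forall x y, (G x - G y) ^+ 2 <= C * (rho 2 x + rho 2 y) * (x ^+ 2 - y ^+ 2) ^+ 2].

Lemma gauss_limit_le (h : R -> R) (M : \bar R) : measurable_fun setT h -> (forall x, 0 <= h x) ->
  (forall t, 0 < t <= 1 -> (\int[mu]_x (expR (- (t * x ^+ 2)) * h x)%:E <= M)%E) ->
  (\int[mu]_x (h x)%:E <= M)%E.
Proof.
move=> mh h0 hM.
pose g (n : nat) x := (expR (- (n.+1%:R^-1 * x ^+ 2)) * h x)%:E.
have mg n : measurable_fun setT (g n) by rewrite /g; meas.
have g0 n x : [set: R] x -> (0 <= g n x)%E by move=> _; rewrite /g; nnegf.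
have ndg x : [set: R] x -> {homo g ^~ x : n m / (n <= m)%N >-> (n <= m)%E}.
  move=> _ n m nm; rewrite /g lee_fin ler_wpM2r// ler_expR lerN2 ler_wpM2r ?sqr_ge0//.
  by rewrite lef_pV2 ?posrE// ler_nat.
have := monotone_convergence mu measurableT mg g0 ndg.
have lim_g x : limn (g ^~ x) = (h x)%:E.
  apply/cvg_lim => //; apply: cvg_EFin; first exact: nearW.
  have cv0 : (fun n : nat => - (n.+1%:R^-1 * x ^+ 2)) @ \oo --> - (0 * x ^+ 2).
    by apply: cvgN; apply: cvgMl; exact: (@cvg_harmonic R).
  have cv : (fun n : nat => expR (- (n.+1%:R^-1 * x ^+ 2)) * h x) @ \oo --> expR (- (0 * x ^+ 2)) * h x.
    by apply: cvgMl; apply: continuous_cvg cv0; exact: continuous_expR.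
  by rewrite mul0r oppr0 expR0 mul1r in cv.
under eq_integral do rewrite lim_g.
move=> ->; apply: lime_le; last first.
  by apply: nearW => n; apply: hM; rewrite invr_gt0 ltr0n/= invf_le1// ler1n.
apply: ereal_nondecreasing_is_cvgn => n m nm; apply: ge0_le_integral => //.
- exact: g0.
- by move=> x _; exact: ndg.
Qed.

Section fixed_function.
Variable G : R -> R.
Hypothesis rG : heat_regular G.
Let mG : measurable_fun setT G. Proof. by case: rG. Qed.

Lemma heat_regular_bounded : exists M : R, forall x, `|G x| <= M.
Proof.
case: rG => _ [C [C0 GC _]]; exists C => x; rewrite (le_trans (GC x))//.
by rewrite -[leRHS]mulr1 ler_wpM2l// rho_le1.
Qed.

Lemma heat_regular_integrable : mu.-integrable setT (EFin \o G).
Proof.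
case: rG => _ [C [C0 GC _]].
apply: (le_integrable measurableT _ _ (integrableZl measurableT C (integrable_rho ltr01))).
  exact/measurable_EFinP.
by move=> x _; rewrite -EFinM/= lee_fin (le_trans (GC x))// ler_norm.
Qed.

Lemma heat_regular_sqr_integrable : mu.-integrable setT (EFin \o (fun x => G x ^+ 2)).
Proof.
have [M GM] := heat_regular_bounded.
by have := integrable_mul_bounded heat_regular_integrable mG GM.
Qed.

Let iG := heat_regular_integrable.
Let iG2 := heat_regular_sqr_integrable.
Let mHG := measurable_Hk alpha_gt mG.

(** Expansion of the square, the kernel having mass 1. At a = G x it is the local contribution to
    the energy deficit; at the mean of G it is a variance, and its nonnegativity gives Jensen's
    inequality. *)
Lemma heat_deficit t a x : 0 < t ->
  \int[mu]_y (heat t x y * (a - G y) ^+ 2) =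
  a ^+ 2 - 2 * (a * \int[mu]_y (G y * heat t x y)) + \int[mu]_y (G y ^+ 2 * heat t x y).
Proof.
move=> t0; have mh : measurable_fun setT (heat t x) by apply: measurable_heat => //; meas.
have hge y := heat_ge0 alpha_gt t x y.
have hK y : `|heat t x y| <= (2 * t) `^ (- c) by rewrite ger0_norm// heat_le.
have I0 := integrable_heat x t0.
have I1 := integrable_mul_bounded iG mh hK.
have I2 := integrable_mul_bounded iG2 mh hK.
have J0 := integrableZl measurableT (a ^+ 2) I0.
have J1 := integrableZl measurableT (- (2 * a)) I1.
have J01 := integrableD measurableT J0 J1.
transitivity (\int[mu]_y (a ^+ 2 * heat t x y + - (2 * a) * (G y * heat t x y) + G y ^+ 2 * heat t x y)).
  by apply: eq_Rintegral => y _; ring.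
rewrite (RintegralD measurableT J01 I2) (RintegralD measurableT J0 J1).
rewrite (RintegralZl _ measurableT I0) (RintegralZl _ measurableT I1) Rintegral_heat//.
by move: (Rintegral _ _ _) (Rintegral _ _ _) => A B; ring.
Qed.

Lemma heat_sqr_mass t : 0 < t ->
  (\int[mu]_x (\int[mu]_y (G y ^+ 2 * heat t x y))%:E = \int[mu]_x (G x ^+ 2)%:E)%E.
Proof.
move=> t0; have mh x : measurable_fun setT (heat t x) by apply: measurable_heat => //; meas.
have mh2 : measurable_fun setT (fun p : R * R => heat t p.1 p.2) by apply: measurable_heat => //; meas.
have hK x y : `|heat t x y| <= (2 * t) `^ (- c) by rewrite ger0_norm ?heat_le ?heat_ge0.
pose F (p : R * R) := (G p.2 ^+ 2 * heat t p.1 p.2)%:E.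
have mG2 : measurable_fun setT (fun p : R * R => G p.2) by meas.
have mF : measurable_fun setT F by rewrite /F; meas.
have F0 p : (0 <= F p)%E by rewrite /F lee_fin mulr_ge0 ?sqr_ge0 ?heat_ge0.
transitivity (\int[mu]_x \int[mu]_y F (x, y))%E.
  by apply: eq_integral => x _; rewrite (EFin_Rintegral (integrable_mul_bounded iG2 (mh x) (hK x))).
rewrite (@fubini_tonelli _ _ _ _ _ mu mu F mF F0); apply: eq_integral => y _; rewrite /F/=.
under eq_integral do rewrite EFinM heatC.
have mhy := mh y.
by rewrite ge0_integralZl ?heat_mass ?mule1//; [by meas|by move=> x _; rewrite lee_fin heat_ge0|by rewrite lee_fin sqr_ge0].
Qed.

(** Half the double integral of the kernel times (G x - G y)^2 is the squared norm of G minus its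
    damped energy, since the kernel is symmetric of mass 1. Symmetrisation places the weight of the
    increment bound on x alone, and the spread of the kernel gives O(t). The rate itself is used
    again for the second moment of H G. *)
Lemma energy_deficit : exists2 C : R, 0 <= C & forall t, 0 < t <= 1 ->
  (\int[mu]_x (G x ^+ 2)%:E <=
   \int[mu]_xi (expR (- (t * xi ^+ 2)) * Hk G xi ^+ 2)%:E + (C * t)%:E)%E.
Proof.
case: (rG) => _ [C [C0 GC GD]].
have cc : 0 <= c * (c + 1) by have c0 := ltW c_gt0; apply: mulr_ge0 => //; exact: addr_ge0.
have k0 : 0 <= 8 + 16 * (c * (c + 1)) by apply: addr_ge0 => //; apply: mulr_ge0.
have iR1 := integrable_rho (ltr01 : 0 < 1).
pose I := \int[mu]_x rho 1 x.
have I0 : 0 <= I by apply: Rintegral_ge0 => x _; exact: rho_ge0.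
exists (C * (8 + 16 * (c * (c + 1))) * I) => [|t /andP[t0 t1]]; first by rewrite !mulr_ge0.
have mh2 : measurable_fun setT (fun p : R * R => heat t p.1 p.2) by apply: measurable_heat => //; meas.
have hge x y := heat_ge0 alpha_gt t x y.
have mh x : measurable_fun setT (heat t x) by apply: measurable_heat => //; meas.
have hK x y : `|heat t x y| <= (2 * t) `^ (- c) by rewrite ger0_norm ?heat_le.
have mr := measurable_rho 2.
have mr1 : measurable_fun setT (fun p : R * R => rho 2 p.1) by meas.
have mr2 : measurable_fun setT (fun p : R * R => rho 2 p.2) by meas.
have mG1 : measurable_fun setT (fun p : R * R => G p.1) by meas.
have mG2 : measurable_fun setT (fun p : R * R => G p.2) by meas.
pose P x := \int[mu]_y (G y * heat t x y).
pose P2 x := \int[mu]_y (G y ^+ 2 * heat t x y).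
pose D x := \int[mu]_y (heat t x y * (G x - G y) ^+ 2).
have iGP : mu.-integrable setT (EFin \o (fun x => G x * P x)).
  apply: (integrable_mul_bounded iG (M := \int[mu]_y `|expR (- (t * y ^+ 2)) * Hk G y|)).
    apply: (measurable_Rintegral_param mu (F := fun p : R * R => G p.2 * heat t p.1 p.2)); by meas.
  by move=> x; rewrite /P -(heat_Hk alpha_gt iG x t0); exact: (le_norm_Hk alpha_gt x (integrable_gauss_Hk alpha_gt iG t0)).
have mP2 : measurable_fun setT P2.
  apply: (measurable_Rintegral_param mu (F := fun p : R * R => G p.2 ^+ 2 * heat t p.1 p.2)); by meas.
have P20 x : 0 <= P2 x by apply: Rintegral_ge0 => y _; rewrite mulr_ge0 ?sqr_ge0.
have G2lty : (\int[mu]_x (G x ^+ 2)%:E < +oo)%E.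
  by have := integrable_fin_num measurableT iG2; rewrite ge0_fin_numE//; apply: integral_ge0 => x _; rewrite lee_fin sqr_ge0.
have iP2 : mu.-integrable setT (EFin \o P2).
  apply/integrableP; split; first exact/measurable_EFinP.
  under eq_integral do rewrite /= ger0_norm//.
  by rewrite (heat_sqr_mass t0).
have J1 := integrableZl measurableT (- 2) iGP.
have J2 := integrableD measurableT iG2 J1.
have J3 := integrableD measurableT J2 iP2.
have ED : D = (fun x => G x ^+ 2 + - 2 * (G x * P x) + P2 x).
  by apply/funext => x; rewrite /D heat_deficit// mulNr.
have iD : mu.-integrable setT (EFin \o D) by rewrite ED.
have SD : \int[mu]_x D x = 2 * (\int[mu]_x (G x ^+ 2) - \int[mu]_x (G x * P x)).
  rewrite ED (RintegralD measurableT J2 iP2) (RintegralD measurableT iG2 J1) (RintegralZl _ measurableT iGP).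
  have -> : \int[mu]_x P2 x = \int[mu]_x (G x ^+ 2) by rewrite /Rintegral (heat_sqr_mass t0).
  by move: (Rintegral _ _ _) (Rintegral _ _ _) => a b; ring.
have bD : ((\int[mu]_x D x)%:E <= (2 * (C * (8 + 16 * (c * (c + 1))) * I * t))%:E)%E.
  rewrite (EFin_Rintegral iD).
  pose B (p : R * R) := heat t p.1 p.2 * (G p.1 - G p.2) ^+ 2.
  pose A (p : R * R) := 2 * C * rho 2 p.1 * (heat t p.1 p.2 * (p.1 ^+ 2 - p.2 ^+ 2) ^+ 2).
  have mA : measurable_fun setT A by rewrite /A; meas.
  have mB : measurable_fun setT B by rewrite /B; meas.
  have A0 p : 0 <= A p by rewrite /A; have := rho_ge0 2 p.1 => ?; nnegf.
  have B0 p : 0 <= B p by rewrite /B; nnegf.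
  rewrite (_ : (fun x => (D x)%:E) = (fun x => \int[mu]_y (B (x, y))%:E)%E); last first.
    apply/funext => x; rewrite /D /B/= EFin_Rintegral//.
    have [M GM] := heat_regular_bounded.
    apply: (integrable_mul_bounded (M := (M + M) ^+ 2) (integrable_heat x t0)); first by meas.
    move=> y; rewrite normrX lerXn2r ?nnegrE ?addr_ge0 ?(le_trans (normr_ge0 _) (GM x))//.
    by rewrite (le_trans (ler_normB _ _))// lerD.
  apply: (le_trans (ge0_integral_symmetrize mu mA mB A0 B0 _)).
    move=> x y; rewrite /A /B/= (heatC alpha t y x).
    have -> : (y ^+ 2 - x ^+ 2) ^+ 2 = (x ^+ 2 - y ^+ 2) ^+ 2 by ring.
    rewrite [leRHS](_ : _ = 2 * (heat t x y * (C * (rho 2 x + rho 2 y) * (x ^+ 2 - y ^+ 2) ^+ 2))); last by ring.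
    by rewrite ler_wpM2l// ler_wpM2l.
  apply: (@le_trans _ _ (\int[mu]_x ((2 * C * (8 + 16 * (c * (c + 1))) * t) * rho 1 x)%:E)%E).
    apply: ge0_le_integral => //.
    - by move=> x _; apply: integral_ge0 => y _; rewrite lee_fin.
    - apply: (measurable_fun_fubini_tonelli_F (m2 := mu) (EFin \o A)); first exact/measurable_EFinP.
      by move=> p; rewrite /= lee_fin.
    - by apply/measurable_EFinP; apply: measurable_funM => //; exact: measurable_rho.
    move=> x _; rewrite /A/=; under eq_integral do rewrite EFinM.
    have mhx := mh x.
    rewrite ge0_integralZl; [|exact: measurableT|by meas|by move=> y _; nnegf|by have := rho_ge0 2 x => ?; nnegf].
    rewrite heat_spread// -EFinM lee_fin -(rhoS 1 x) -[1 + 1]/(2%:R).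
    rewrite [leRHS](_ : _ = 2 * C * rho 2 x * ((8 + 16 * (c * (c + 1))) * t * (1 + x ^+ 2))); last by ring.
    rewrite ler_wpM2l ?mulr_ge0 ?rho_ge0//.
    have := sqr_ge0 x.
    move: (x ^+ 2) (c * (c + 1)) cc => X Q Q0 X0.
    have tt : t ^+ 2 <= t by rewrite expr2 -[leRHS]mulr1 ler_wpM2l// ltW.
    have h1 : Q * t ^+ 2 <= Q * t by rewrite ler_wpM2l.
    have h2 : 0 <= Q * t * X by rewrite !mulr_ge0// ltW.
    have h3 : 0 <= t by exact: ltW.
    by nra.
  under eq_integral do rewrite EFinM.
  have mr' := measurable_rho 1.
  rewrite ge0_integralZl; [|exact: measurableT|by meas|by move=> x _; rewrite lee_fin rho_ge0|by rewrite lee_fin !mulr_ge0// ltW].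
  by rewrite -(EFin_Rintegral iR1) -/I -EFinM lee_fin le_eqVlt; apply/orP; left; apply/eqP; ring.
rewrite (energyE_EFin alpha_gt iG t0) -(EFin_Rintegral iGP) -(EFin_Rintegral iG2) -EFinD lee_fin.
move: bD; rewrite lee_fin SD.
by move: (Rintegral _ _ _) (Rintegral _ _ _) (_ * t) => a b e; lra.
Qed.

End fixed_function.
End regular.

Lemma limn_einf_le (R : realType) (u : (\bar R)^nat) (M : \bar R) :
  (forall n, (u n <= M)%E) -> (limn_einf u <= M)%E.
Proof.
move=> uM; rewrite (le_trans (limn_einf_sup u))//.
rewrite limn_esup_lim; apply: lime_le; first exact: is_cvg_esups.
by apply: nearW => n; apply: ge_ereal_sup => _ [k _ <-]; exact: uM.
Qed.

(** * Plancherel for regular functions *)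

Section plancherel.
Context {R : realType}.
Local Notation leb := (@lebesgue_measure R).
Variable alpha : R.
Hypothesis alpha_gt : -1 / 2 < alpha.
Local Notation c := (alpha + 1).
Local Notation mu := (hankel_measure alpha).
Local Notation heat := (heat alpha).
Local Notation Hk := (hankelR alpha).

Let c_gt0 : 0 < c. Proof. by move: alpha_gt; lra. Qed.

Variable G : R -> R.
Hypothesis rG : heat_regular alpha G.
Let mG : measurable_fun setT G. Proof. by case: rG. Qed.
Let iG := heat_regular_integrable alpha_gt rG.
Let iG2 := heat_regular_sqr_integrable alpha_gt rG.
Let mHG := measurable_Hk alpha_gt mG.

Lemma energy_le_sqr t : 0 < t ->
  (\int[mu]_xi (expR (- (t * xi ^+ 2)) * Hk G xi ^+ 2)%:E <= \int[mu]_x (G x ^+ 2)%:E)%E.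
Proof.
move=> t0; have m1 : measurable_fun setT (cst 1 : R -> R) by [].
apply: (le_trans (energy_le alpha_gt iG t0 m1 (fun _ => ltr01))).
rewrite le_eqVlt; apply/orP; left; apply/eqP; apply: eq_integral => x _.
rewrite mulr1 [X in (_ * X)%E](_ : _ = 1%E) ?mule1//.
by rewrite -(heat_mass alpha_gt x t0); apply: eq_integral => y _; rewrite divr1.
Qed.

Lemma plancherel : (\int[mu]_xi (Hk G xi ^+ 2)%:E = \int[mu]_x (G x ^+ 2)%:E)%E.
Proof.
apply/eqP; rewrite eq_le; apply/andP; split.
  apply: (gauss_limit_le (h := fun xi => Hk G xi ^+ 2)); first by meas.
    by move=> x; rewrite sqr_ge0.
  by move=> t /andP[t0 _]; exact: energy_le_sqr.
have [C C0 hC] := energy_deficit alpha_gt rG.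
apply/lee_addgt0Pr => e e0.
pose t := Num.min 1 (e / (C + 1)).
have C10 : 0 < C + 1 by rewrite ltr_wpDl.
have t0 : 0 < t by rewrite lt_min ltr01 divr_gt0.
have t1 : 0 < t <= 1 by rewrite t0 ge_min lexx.
apply: (le_trans (hC t t1)); apply: leeD.
  apply: ge0_le_integral; [exact: measurableT|by move=> x _; nnegf|by meas|by meas|].
  move=> x _; rewrite lee_fin -[leRHS]mul1r ler_wpM2r ?sqr_ge0//.
  by rewrite -expR0 ler_expR oppr_le0 mulr_ge0 ?sqr_ge0// ltW.
rewrite lee_fin; apply: (@le_trans _ _ ((C + 1) * t)).
  by rewrite ler_wpM2r ?lerDl// ltW.
by rewrite -ler_pdivlMl// mulrC ge_min lexx orbT.
Qed.

Lemma sqr_integral_lty : (\int[mu]_x (G x ^+ 2)%:E < +oo)%E.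
Proof. by rewrite -(EFin_Rintegral iG2) ltry. Qed.

(** The inequality exp (- s) (1 + s) <= 1 at s = t xi^2 bounds t times the damped second moment by
    the energy deficit, which is at most C t. Dividing by t and letting t tend to 0 leaves the bound
    C. *)
Lemma hankel_second_moment : (\int[mu]_xi (xi ^+ 2 * Hk G xi ^+ 2)%:E < +oo)%E.
Proof.
have [C C0 hC] := energy_deficit alpha_gt rG.
apply: (@le_lt_trans _ _ C%:E); last exact: ltry.
apply: (gauss_limit_le (h := fun xi => xi ^+ 2 * Hk G xi ^+ 2)); first by meas.
  by move=> x; nnegf.
move=> t /andP[t0 t1].
have := hC t; rewrite t0 t1 => /(_ isT).
set E := (\int[mu]_xi (expR (- (t * xi ^+ 2)) * Hk G xi ^+ 2)%:E)%E.
have E0 : (0 <= E)%E by apply: integral_ge0 => x _; nnegf.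
have Efin : E \is a fin_num.
  by rewrite ge0_fin_numE//; exact: le_lt_trans (energy_le_sqr t0) sqr_integral_lty.
move=> h; have t0E : (0 <= t%:E)%E by rewrite lee_fin ltW.
rewrite -(lee_pmul2l (x := t%:E))//.
rewrite -EFinM [t * C]mulrC -(leeD2lE _ _ Efin); apply: le_trans h; rewrite -plancherel.
rewrite -ge0_integralZl; [|exact: measurableT|by meas|by move=> *; nnegf|by []].
rewrite /E -ge0_integralD; [|exact: measurableT|by move=> *; nnegf|by meas|by move=> *; rewrite -EFinM; have := ltW t0 => ?; nnegf|by meas].
apply: ge0_le_integral; [exact: measurableT| |by meas|by meas|].
  by move=> x _; rewrite -EFinM -EFinD; have := ltW t0 => ?; nnegf.
move=> x _; rewrite -EFinM -EFinD lee_fin.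
rewrite (_ : _ + _ = Hk G x ^+ 2 * (expR (- (t * x ^+ 2)) * (1 + t * x ^+ 2))); last by ring.
rewrite -[leRHS]mulr1 ler_wpM2l ?sqr_ge0// expRN ler_pdivrMl ?expR_gt0// mulr1.
by apply: expR_ge1Dx.
Qed.

(** Pointwise inversion. The squared error of the kernel average is at most the average of the
    squared increments, and the latter is O(t) at the fixed point x. *)
Lemma heat_cvg x :
  (fun n : nat => Hk (fun xi => expR (- (n.+1%:R^-1 * xi ^+ 2)) * Hk G xi) x) @ \oo --> G x.
Proof.
have [_ [C [C0 _ GD]]] := rG.
have cc : 0 <= c * (c + 1) by have c0 := ltW c_gt0; apply: mulr_ge0 => //; exact: addr_ge0.
pose K := 2 * C * (8 * x ^+ 2 + 16 * (c * (c + 1))).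
have K0 : 0 <= K by rewrite /K; apply: mulr_ge0; [exact: mulr_ge0|apply: addr_ge0; [nnegf|exact: mulr_ge0]].
have [M GM] := heat_regular_bounded alpha_gt rG.
have err t : 0 < t -> t <= 1 -> (\int[mu]_y (G y * heat t x y) - G x) ^+ 2 <= K * t.
  move=> t0 t1; have mh : measurable_fun setT (heat t x) by apply: measurable_heat => //; meas.
  have hge y := heat_ge0 alpha_gt t x y.
  set P := \int[mu]_y (G y * heat t x y).
  have D0 a : 0 <= a ^+ 2 - 2 * (a * P) + \int[mu]_y (G y ^+ 2 * heat t x y).
    by rewrite -(heat_deficit alpha_gt rG a x t0); apply: Rintegral_ge0 => y _; rewrite mulr_ge0 ?sqr_ge0.
  apply: (@le_trans _ _ (\int[mu]_y (heat t x y * (G x - G y) ^+ 2))).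
    rewrite (heat_deficit alpha_gt rG (G x) x t0) -/P; have := D0 P.
    by move: (Rintegral _ _ _) (G x) => Q g; nra.
  have iD : mu.-integrable setT (EFin \o (fun y => heat t x y * (G x - G y) ^+ 2)).
    apply: (integrable_mul_bounded (M := (M + M) ^+ 2) (integrable_heat alpha_gt x t0)); first by meas.
    move=> y; rewrite normrX lerXn2r ?nnegrE ?addr_ge0 ?(le_trans (normr_ge0 _) (GM x))//.
    by rewrite (le_trans (ler_normB _ _))// lerD.
  rewrite -lee_fin (EFin_Rintegral iD).
  apply: (@le_trans _ _ (\int[mu]_y ((2 * C)%:E * (heat t x y * (x ^+ 2 - y ^+ 2) ^+ 2)%:E))%E).
    apply: ge0_le_integral; [exact: measurableT|by move=> *; nnegf|by meas|by meas|].
    move=> y _; rewrite -EFinM lee_fin [leRHS]mulrCA ler_wpM2l// (le_trans (GD x y))//.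
    rewrite ler_wpM2r ?sqr_ge0// mulrC ler_wpM2r// -[2]/(1 + 1) lerD// rho_le1//.
  rewrite ge0_integralZl; [|exact: measurableT|by meas|by move=> *; nnegf|by rewrite lee_fin mulr_ge0].
  rewrite heat_spread// -EFinM lee_fin /K [leRHS](_ : _ = 2 * C * ((8 * x ^+ 2 + 16 * (c * (c + 1))) * t)); last by ring.
  rewrite ler_wpM2l ?mulr_ge0//; move: (x ^+ 2) (c * (c + 1)) cc => X Q Q0.
  have h1 : Q * t ^+ 2 <= Q * t by rewrite ler_wpM2l// expr2 -[leRHS]mulr1 ler_wpM2l// ltW.
  by nra.
apply/cvgrPdist_le => e e0.
have cK : (fun n : nat => K * n.+1%:R^-1) @ \oo --> K * 0 by apply: cvgMr; exact: (@cvg_harmonic R).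
rewrite mulr0 in cK; have e20 : 0 < e ^+ 2 by rewrite exprn_gt0.
move/cvgrPdist_le : cK => /(_ _ e20) near1.
near=> n.
have t0 : 0 < n.+1%:R^-1 :> R by rewrite invr_gt0 ltr0n.
rewrite (heat_Hk alpha_gt iG x t0) distrC -(ler_pXn2r (n := 2)) ?nnegrE ?(ltW e0)//.
rewrite real_normK ?num_real//; apply: (le_trans (err _ t0 _)); first by rewrite invf_le1// ler1n.
have : `|0 - K * n.+1%:R^-1| <= e ^+ 2 by near: n.
by rewrite sub0r normrN ger0_norm// mulr_ge0// ltW.
Unshelve. all: by end_near.
Qed.

(** Pitt's inequality is applied to the damped transform of G, which is integrable and whose own
    transform tends to G pointwise. Fatou's lemma handles the left side in the limit; on the right,
    damping only decreases the integral. *)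
Lemma dual_pitt (u : R) : 0 < u < c / 2 ->
  (\int[mu]_x (x `^ (- (2 * u)) * G x ^+ 2)%:E <=
   (pittC alpha u)%:E * \int[mu]_xi (xi `^ (2 * u) * Hk G xi ^+ 2)%:E)%E.
Proof.
move=> ub; have /andP[u0 ub2] := ub.
pose F (n : nat) xi := expR (- (n.+1%:R^-1 * xi ^+ 2)) * Hk G xi.
pose g (n : nat) x := (x `^ (- (2 * u)) * Hk (F n) x ^+ 2)%:E.
have t0 n : 0 < n.+1%:R^-1 :> R by rewrite invr_gt0 ltr0n.
have iF n : mu.-integrable setT (EFin \o F n) by exact: integrable_gauss_Hk.
have mF n : measurable_fun setT (F n) by rewrite /F; meas.
have mHF n := measurable_Hk alpha_gt (mF n).
have mg n : measurable_fun setT (g n) by have := mHF n => ?; rewrite /g; meas.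
have g0 n x : [set: R] x -> (0 <= g n x)%E by move=> _; rewrite /g; nnegf.
have := fatou mu measurableT mg g0.
have lim_g x : limn_einf (g ^~ x) = (x `^ (- (2 * u)) * G x ^+ 2)%:E.
  have h : g ^~ x @ \oo --> (x `^ (- (2 * u)) * G x ^+ 2)%:E.
    apply: cvg_EFin; first exact: nearW.
    by apply: cvgMr; rewrite expr2; apply: cvgM; exact: heat_cvg.
  by have [] := cvg_limn_einf_sup h.
under eq_integral do rewrite lim_g.
move=> /le_trans; apply; apply: limn_einf_le => n.
apply: (le_trans (pitt alpha_gt ub (iF n))).
have Gb : 0 <= pittC alpha u by rewrite /pittC; nnegf.
rewrite lee_wpmul2l ?lee_fin//.
apply: ge0_le_integral; [exact: measurableT|by move=> *; nnegf|by have := mF n => ?; meas|by meas|].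
move=> x _; rewrite lee_fin ler_wpM2l ?powR_ge0// /F exprMn -[leRHS]mul1r ler_wpM2r ?sqr_ge0//.
rewrite expr_le1 ?expR_ge0// -expR0 ler_expR oppr_le0 mulr_ge0 ?sqr_ge0// ltW//.
Qed.

End plancherel.

(** * Even Schwartz functions have controlled increments *)

Section schwartz.
Context {R : realType}.
Variable alpha : R.
Hypothesis alpha_gt : -1 / 2 < alpha.
Local Notation c := (alpha + 1).
Let c_gt0 : 0 < c. Proof. by move: alpha_gt; lra. Qed.

Lemma rho_le (b x y : R) : 0 < b -> x ^+ 2 <= y ^+ 2 -> rho alpha b y <= rho alpha b x.
Proof.
move=> b0 xy; have X (z : R) : 0 < 1 + z ^+ 2 by rewrite ltr_pwDl ?sqr_ge0.
rewrite /rho !powRE_pos// ler_expR ler_wnM2l ?ler_ln ?posrE ?lerD2l//.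
by rewrite oppr_le0 ltW// addr_gt0.
Qed.

Lemma expr_1sqr_le (x : R) k : (1 + x ^+ 2) ^+ k <= 2 ^+ k * (1 + x ^+ (2 * k)).
Proof.
have x20 := sqr_ge0 x; rewrite exprM.
have [x1|x1] := leP (x ^+ 2) 1.
  apply: (@le_trans _ _ (2 ^+ k)); first by rewrite lerXn2r ?nnegrE ?addr_ge0//; lra.
  by rewrite -[leLHS]mulr1 ler_wpM2l ?exprn_ge0// lerDl exprn_ge0.
apply: (@le_trans _ _ ((2 * x ^+ 2) ^+ k)).
  have h : 1 + x ^+ 2 <= 2 * x ^+ 2 by move: (x ^+ 2) x1 => X; lra.
  by apply: lerXn2r; rewrite ?nnegrE; [exact: addr_ge0|exact: mulr_ge0|].
by rewrite exprMn ler_wpM2l ?exprn_ge0// lerDr.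
Qed.

Variable f : R -> R.
Hypothesis sf : schwartzR f.
Hypothesis ef : forall x, f (- x) = f x.

(** Two seminorms suffice, with powers 0 and 2k of x for an integer k above c + b, because (1 +
    x^2)^k <= 2^k (1 + x^(2k)). *)
Lemma schwartz_rho n b : 0 < b -> exists2 C, 0 <= C & forall x, `|derive1n n f x| <= C * rho alpha b x.
Proof.
move=> b0; have cb0 : 0 <= c + b by rewrite ltW// addr_gt0.
pose k := Num.bound (c + b); have kb : c + b < k%:R by exact: archi_boundP.
have [M0 HM0] := sf.2 0%N n; have [M1 HM1] := sf.2 (2 * k)%N n.
exists (2 ^+ k * (`|M0| + `|M1|)) => [|x]; first by rewrite mulr_ge0 ?exprn_ge0// addr_ge0.
have x0 : 0 < 1 + x ^+ 2 by rewrite ltr_pwDl ?sqr_ge0.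
have x1 : 1 <= 1 + x ^+ 2 by rewrite lerDl sqr_ge0.
have h1 : `|derive1n n f x| * (1 + x ^+ 2) ^+ k <= 2 ^+ k * (`|M0| + `|M1|).
  rewrite (le_trans (ler_wpM2l (normr_ge0 _) (expr_1sqr_le x k)))// mulrCA ler_wpM2l ?exprn_ge0//.
  rewrite mulrDr mulr1 lerD//.
    by have := HM0 x; rewrite expr0 mul1r => /le_trans; apply; exact: ler_norm.
  have h0 : 0 <= x ^+ (2 * k) by rewrite exprM exprn_ge0 ?sqr_ge0.
  by apply: le_trans (ler_norm M1); have := HM1 x; rewrite normrM (ger0_norm h0) mulrC.
have p0 : 0 < (1 + x ^+ 2) ^+ k by rewrite exprn_gt0.
rewrite -(ler_pM2r p0) (le_trans h1)// -mulrA -[leLHS]mulr1 ler_wpM2l//.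
rewrite /rho -[(1 + x ^+ 2) ^+ k]powR_mulrn ?(ltW x0)// -powRD ?(gt_eqF x0) ?implybT//.
rewrite powRE_pos// -[leLHS]expR0 ler_expR mulr_ge0 ?ln_ge0//.
by move: kb; set K : R := k%:R; lra.
Qed.

Let df (x : R) : is_derive x 1 f (derive1 f x).
Proof. by apply: DeriveDef; [exact: (sf.1 0%N x)|rewrite derive1E]. Qed.

Let ddf (x : R) : is_derive x 1 (derive1 f) (derive1 (derive1 f) x).
Proof. by apply: DeriveDef; [exact: (sf.1 1%N x)|rewrite derive1E]. Qed.

Lemma schwartz_continuous : continuous f.
Proof.
by move=> x; apply: differentiable_continuous; apply/derivable1_diffP; exact: (sf.1 0%N x).
Qed.

Lemma schwartz_derive_continuous : continuous (derive1 f).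
Proof.
by move=> x; apply: differentiable_continuous; apply/derivable1_diffP; exact: (sf.1 1%N x).
Qed.

Lemma even_derive0 : derive1 f 0 = 0.
Proof.
have d1 : is_derive (0 : R) 1 (f \o -%R) (derive1 f 0 * (-1)).
  have dN : is_derive (0 : R) 1 (-%R : R -> R) (-1) by have := is_deriveN (is_derive_id (0 : R) 1).
  have dfN : is_derive (- (0 : R)) 1 f (derive1 f 0) by rewrite oppr0.
  by apply: (is_derive_compR dfN dN).
have E : f \o -%R = f by apply/funext => x; exact: ef.
rewrite E in d1.
have := @derive_val _ _ _ _ _ _ _ d1; rewrite (@derive_val _ _ _ _ _ _ _ (df 0)).
by lra.
Qed.

(** f'(x) / (2 x) is the derivative of f with respect to x^2. Evenness gives f'(0) = 0, so up to 1
    the mean value theorem for f' absorbs the division by x; beyond 1 the decay of f' is enough. *)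
Lemma schwartz_slope : exists2 C, 0 <= C & forall xi, 0 < xi ->
  (derive1 f xi / (2 * xi)) ^+ 2 <= C * rho alpha 2 xi.
Proof.
have [S S0 HS] := schwartz_rho 2 (ltr0Sn R 1).
have [D D0 HD] := schwartz_rho 1 (ltr0Sn R 1).
have r1 : 0 < rho alpha 2 1 by rewrite /rho powR_gt0// addr_gt0 ?exprn_gt0.
exists (S ^+ 2 / rho alpha 2 1 + D ^+ 2) => [|xi xi0].
  by rewrite addr_ge0 ?divr_ge0 ?sqr_ge0// ltW.
have rge x := rho_ge0 alpha 2 x.
have [x1|x1] := leP xi 1.
  have : `|derive1 f xi| <= S * xi.
    have [||z _] := @MVT R (derive1 f) (derive1 (derive1 f)) 0 xi xi0.
    - by move=> z _; exact: ddf.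
    - by apply: continuous_subspaceT; exact: schwartz_derive_continuous.
    rewrite even_derive0 !subr0 => ->; rewrite normrM (gtr0_norm xi0) ler_wpM2r// ?(ltW xi0)//.
    apply: (le_trans (HS z)); rewrite -[leRHS]mulr1 ler_wpM2l//.
    by apply: rho_le1.
  move=> h; apply: (@le_trans _ _ (S ^+ 2)).
    rewrite -(real_normK (num_real _)) normrM normfV [`|2 * xi|]gtr0_norm ?mulr_gt0//.
    have xi2 : 0 < 2 * xi by rewrite mulr_gt0.
    have h2 : `|derive1 f xi| / (2 * xi) <= S.
      by rewrite ler_pdivrMr//; apply: (le_trans h); rewrite mulrCA; have := mulr_ge0 S0 (ltW xi0); lra.
    have h3 : 0 <= `|derive1 f xi| / (2 * xi) by rewrite mulr_ge0// invr_ge0 ltW.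
    by rewrite lerXn2r ?nnegrE.
  rewrite mulrDl -[leLHS]addr0 lerD ?mulr_ge0 ?sqr_ge0// -mulrA -[leLHS]mulr1 ler_wpM2l ?sqr_ge0//.
  rewrite mulrC ler_pdivlMr// mul1r; apply: rho_le => //.
  by rewrite expr1n expr_le1// ltW.
apply: (@le_trans _ _ (D ^+ 2 * rho alpha 2 xi)); last first.
  by rewrite ler_wpM2r// lerDr divr_ge0 ?sqr_ge0// ltW.
apply: (@le_trans _ _ ((D * rho alpha 2 xi) ^+ 2)).
  rewrite -(real_normK (num_real (_ / _))) lerXn2r ?nnegrE ?mulr_ge0//.
  rewrite normrM normfV [`|2 * xi|]gtr0_norm ?mulr_gt0// ler_pdivrMr ?mulr_gt0//.
  apply: (le_trans (HD xi)); rewrite -[leLHS]mulr1 ler_wpM2l ?mulr_ge0//; lra.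
rewrite exprMn ler_wpM2l ?sqr_ge0// expr2 -[leRHS]mulr1 ler_wpM2l//.
exact: rho_le1.
Qed.

Lemma even_norm x : f `|x| = f x.
Proof. by have [x0|x0] := leP 0 x; [rewrite ger0_norm|rewrite ltr0_norm]. Qed.

(** Cauchy's mean value theorem for f against x^2 yields f x - f y = f'(z) / (2 z) (x^2 - y^2) with
    z between x and y. Since [rho] decreases on the half-line, its value at z is bounded by the one
    at the smaller point. *)
Lemma schwartz_heat_regular : heat_regular alpha f.
Proof.
split; first by apply: continuous_measurable_fun; exact: schwartz_continuous.
have [C1 C10 H1] := schwartz_rho 0 (ltr01 : 0 < (1 : R)).
have [C2 C20 H2] := schwartz_slope.
have rge b x := rho_ge0 alpha b x.
exists (C1 + C2); split; first exact: addr_ge0.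
  by move=> x; apply: (le_trans (H1 x)); rewrite ler_wpM2r// lerDl.
have main x y : 0 <= y -> y < x -> (f x - f y) ^+ 2 <= C2 * rho alpha 2 y * (x ^+ 2 - y ^+ 2) ^+ 2.
  (* The combination of f and u^2 that takes equal values at x and y, as in the proof of Cauchy's
     mean value theorem. *)
  move=> y0 yx; pose h u := f u * (x ^+ 2 - y ^+ 2) - u ^+ 2 * (f x - f y).
  have dh (u : R) : is_derive u 1 h (derive1 f u * (x ^+ 2 - y ^+ 2) - (2 * u) * (f x - f y)).
    have -> : h = (x ^+ 2 - y ^+ 2) *: f - (f x - f y) *: (fun v : R => v ^+ 2).
      by apply/funext => v; rewrite /h !fctE /GRing.scale/=; ring.
    apply: (is_derive_eq (is_deriveB (is_deriveZ _ (df u)) (is_deriveZ _ (is_deriveX 2 (is_derive_id u 1))))).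
    by rewrite /GRing.scale/= expr1; ring.
  have [|z] := @MVT R h _ y x yx (fun z _ => dh z).
  - by apply: continuous_subspaceT => z; apply: differentiable_continuous; apply/derivable1_diffP; exact: (@ex_derive _ _ _ _ _ _ _ (dh z)).
  rewrite in_itv/= => /andP[yz zx] E.
  have z0 : 0 < z by exact: le_lt_trans yz.
  have {}E : f x - f y = derive1 f z / (2 * z) * (x ^+ 2 - y ^+ 2).
    have : (derive1 f z * (x ^+ 2 - y ^+ 2) - 2 * z * (f x - f y)) * (x - y) = 0.
      by rewrite -E /h; ring.
    move/eqP; rewrite mulf_eq0 [x - y == 0]subr_eq0 (gt_eqF yx) orbF subr_eq0 => /eqP E2.
    by rewrite mulrAC E2; field; rewrite gt_eqF.
  rewrite E exprMn ler_wpM2r ?sqr_ge0// (le_trans (H2 z z0))// ler_wpM2l//.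
  by apply: rho_le => //; rewrite ler_pXn2r ?nnegrE ?(ltW z0) ?(ltW yz).
have main2 x y : 0 <= x -> 0 <= y ->
    (f x - f y) ^+ 2 <= (C1 + C2) * (rho alpha 2 x + rho alpha 2 y) * (x ^+ 2 - y ^+ 2) ^+ 2.
  move=> x0 y0; have [xy|yx|->] := ltgtP x y; last by rewrite !subrr expr0n/= mulr0.
  - rewrite -sqrrN opprB (le_trans (main _ _ x0 xy))// -[(x ^+ 2 - _) ^+ 2]sqrrN opprB ler_wpM2r ?sqr_ge0//.
    by apply: ler_pM => //; rewrite ?lerDr ?lerDl.
  - rewrite (le_trans (main _ _ y0 yx))// ler_wpM2r ?sqr_ge0//.
    by apply: ler_pM => //; rewrite ?lerDr ?lerDl.
move=> x y; have := main2 `|x| `|y| (normr_ge0 _) (normr_ge0 _).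
by rewrite !even_norm /rho !real_normK ?num_real.
Qed.

End schwartz.

(** * Fubini's theorem with inner integrals finite almost everywhere *)

Section product_integrals.
Context {d1 d2 : measure_display} {T1 : measurableType d1} {T2 : measurableType d2}.
Context {R : realType}.
Variables (m1 : {sigma_finite_measure set T1 -> \bar R}).
Variables (m2 : {sigma_finite_measure set T2 -> \bar R}).

(** Integrability over the product makes the inner integral finite for almost every x. At the
    exceptional points [Rintegral] takes its default value 0 or another real, which the outer
    integral does not see. *)
Lemma Rintegral_prod_weighted (A : T1 -> R) (M : R) (F : T1 * T2 -> R) :
  measurable_fun setT A -> (forall x, `|A x| <= M) ->
  (m1 \x m2)%E.-integrable setT (EFin \o F) ->
  \int[m1]_x (A x * \int[m2]_y F (x, y)) =
  fine (\int[m1 \x m2]_p (A p.1 * F p)%:E)%E.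
Proof.
move=> mA AM iF.
have mA1 : measurable_fun setT (fun p : T1 * T2 => A p.1) by exact: measurableT_comp.
have iAF : (m1 \x m2)%E.-integrable setT (EFin \o (fun p => A p.1 * F p)).
  have := integrable_mul_bounded iF mA1 (fun p => AM p.1).
  by rewrite (_ : (fun p => F p * A p.1) = (fun p => A p.1 * F p))//; apply/funext => p; rewrite mulrC.
have /measurable_EFinP mF := measurable_int _ iF.
have mAF : measurable_fun setT (fun p : T1 * T2 => A p.1 * F p) by exact: measurable_funM.
rewrite -(integral12_prod_meas1 iAF) /Rintegral; congr fine.
apply: ae_eq_integral => //.
- apply/measurable_EFinP; apply: measurable_funM => //.
  exact: (measurable_Rintegral_param m2 mF).
- exact: (measurable_fubini_F iAF).
- have := ae_integrable1 iF; apply: filterS => x iFx _.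
  rewrite /fubini_F/=; under [RHS]eq_integral do rewrite EFinM.
  by rewrite integralZl// EFinM fineK//; exact: integrable_fin_num.
Qed.

Lemma Rintegral_prod12 (F : T1 * T2 -> R) :
  (m1 \x m2)%E.-integrable setT (EFin \o F) ->
  \int[m1]_x \int[m2]_y F (x, y) = fine (\int[m1 \x m2]_p (F p)%:E)%E.
Proof.
move=> iF; have n1 (x : T1) : `|cst (1 : R) x| <= 1 by rewrite normr1.
have := Rintegral_prod_weighted (measurable_cst _) n1 iF.
under eq_Rintegral do rewrite mul1r.
by move=> ->; congr fine; apply: eq_integral => p _; rewrite mul1r.
Qed.

Lemma Rintegral_prod21 (F : T1 * T2 -> R) :
  (m1 \x m2)%E.-integrable setT (EFin \o F) ->
  \int[m2]_y \int[m1]_x F (x, y) = fine (\int[m1 \x m2]_p (F p)%:E)%E.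
Proof.
move=> iF; have /measurable_EFinP mF := measurable_int _ iF.
rewrite -(integral21_prod_meas1 iF) /Rintegral; congr fine.
have mFs : measurable_fun setT (fun p : T2 * T1 => F (p.2, p.1)).
  by apply: (measurableT_comp mF); apply/measurable_fun_pairP; split; [exact: measurable_snd|exact: measurable_fst].
apply: ae_eq_integral => //.
- apply/measurable_EFinP; exact: (measurable_Rintegral_param m1 mFs).
- exact: (measurable_fubini_G iF).
- have := ae_integrable2 iF; apply: filterS => y iFy _.
  by rewrite /fubini_G/= fineK//; exact: integrable_fin_num.
Qed.

Lemma Fubini_weighted (A : T1 -> R) (M : R) (F : T1 * T2 -> R) :
  measurable_fun setT A -> (forall x, `|A x| <= M) ->
  (m1 \x m2)%E.-integrable setT (EFin \o F) ->
  \int[m1]_x (A x * \int[m2]_y F (x, y)) = \int[m2]_y \int[m1]_x (A x * F (x, y)).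
Proof.
move=> mA AM iF; rewrite (Rintegral_prod_weighted mA AM iF).
have mA1 : measurable_fun setT (fun p : T1 * T2 => A p.1) by exact: measurableT_comp.
rewrite (@Rintegral_prod21 (fun p => A p.1 * F p))//.
have := integrable_mul_bounded iF mA1 (fun p => AM p.1).
by rewrite (_ : (fun p => F p * A p.1) = (fun p => A p.1 * F p))//; apply/funext => p; rewrite mulrC.
Qed.

End product_integrals.

(** * Translation and convolution *)

Section translation.
Context {R : realType}.
Local Notation leb := (@lebesgue_measure R).
Local Notation Rp := (`]0%R, +oo[%classic : set R).
Variable alpha : R.
Hypothesis alpha_gt : -1 / 2 < alpha.
Local Notation c := (alpha + 1).
Local Notation sigma := (angle_measure alpha).
Local Notation mu := (hankel_measure alpha).
Local Notation J := (jalpha alpha).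
Local Notation Hk := (hankelR alpha).

Let c_gt0 : 0 < c. Proof. by move: alpha_gt; lra. Qed.
Let mJ : measurable_fun setT J := measurable_bessel alpha_gt.

(* Sixteen times the squared area of the triangle with sides t, x, z (Heron). *)
Definition heron (t x z : R) : R := ((x + t) ^+ 2 - z ^+ 2) * (z ^+ 2 - (x - t) ^+ 2).

(* Density, with respect to mu, of the third side of the triangle with sides t, x; it is symmetric in x, z. *)
Definition triangle_kernel (t x z : R) : R :=
  Gamma c / (Gamma (1 / 2) * Gamma (alpha + 1 / 2)) * (2 `^ alpha * Gamma c) * 4 `^ (1 / 2 - alpha) *
  t `^ (- (2 * alpha)) * (x `^ (- (2 * alpha)) * z `^ (- (2 * alpha))) *
  heron t x z `^ (alpha - 1 / 2) * (0 < heron t x z)%R%:R.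

Lemma heronC t x z : heron t x z = heron t z x.
Proof. by rewrite /heron; ring. Qed.

Lemma triangle_kernelC t x z : triangle_kernel t x z = triangle_kernel t z x.
Proof. by rewrite /triangle_kernel heronC (mulrC (x `^ _)). Qed.

Lemma triangle_kernel_ge0 t x z : 0 <= triangle_kernel t x z.
Proof.
have h1 := Gamma_ge0 c; have h2 := Gamma_ge0 (1 / 2 : R); have h3 := Gamma_ge0 (alpha + 1 / 2).
by rewrite /triangle_kernel; nnegf.
Qed.

Lemma measurable_triangle_kernel t :
  measurable_fun setT (fun p : R * R => triangle_kernel t p.1 p.2).
Proof.
rewrite /triangle_kernel; have mh : measurable_fun setT (fun p : R * R => heron t p.1 p.2) by rewrite /heron; meas.
apply: measurable_funM; first by meas.
by apply: measurable_boolR; apply: measurable_fun_ltr; meas.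
Qed.

Lemma heron_chord (t x th : R) : heron t x (chord x t th) = 4 * (x * t * sin th) ^+ 2.
Proof.
rewrite /heron sqr_chord !exprMn sin2cos2; ring.
Qed.

Lemma chord_gt0 (t x th : R) : 0 < t -> 0 < x -> 0 < th < pi -> 0 < chord x t th.
Proof.
move=> t0 x0 /andP[th0 thpi]; rewrite sqrtr_gt0.
have cos1 : -1 < cos th.
  rewrite -cospi ltr_cos// in_itv/= ?lexx ?(ltW th0) ?(ltW thpi)// ?andbT ltW ?pi_gt0//.
have -> : x ^+ 2 + t ^+ 2 + 2 * x * t * cos th = (x - t) ^+ 2 + 2 * (x * t) * (1 + cos th) by ring.
by rewrite ltr_wpDl ?sqr_ge0// !mulr_gt0// -ltrBlDl sub0r.
Qed.

Lemma is_derive_chord (t x th : R) : 0 < t -> 0 < x -> 0 < th < pi ->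
  is_derive th 1 (chord x t) (- (x * t * sin th / chord x t th)).
Proof.
move=> t0 x0 thp; have z0 := chord_gt0 t0 x0 thp.
have q0 : 0 < x ^+ 2 + t ^+ 2 + 2 * x * t * cos th by rewrite -sqr_chord exprn_gt0.
have d1 : is_derive th 1 (fun th => x ^+ 2 + t ^+ 2 + 2 * x * t * cos th) (- (2 * x * t * sin th)).
  have dc := is_deriveD (is_derive_cst (x ^+ 2 + t ^+ 2 : R) th 1) (is_deriveZ (2 * x * t) (is_derive_cos th)).
  by apply: (is_derive_eq dc); rewrite /GRing.scale/=; ring.
have d2 : is_derive th 1 (chord x t) ((2 * chord x t th)^-1 * (- (2 * x * t * sin th))).
  exact: (@is_derive_compR _ Num.sqrt (fun th : R => x ^+ 2 + t ^+ 2 + 2 * x * t * cos th) th _ _ (is_derive1_sqrt q0) d1).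
by apply: (is_derive_eq d2); field; rewrite gt_eqF.
Qed.

(** Positivity of [heron] expresses the strict triangle inequalities; equivalently C, the cosine
    prescribed by the three sides, lies strictly between -1 and 1, and the angle is its arc
    cosine. *)
Lemma chord_image (t x : R) : 0 < t -> 0 < x ->
  chord x t @` `]0%R, pi[ = [set z | 0 < z /\ 0 < heron t x z].
Proof.
move=> t0 x0; apply/seteqP; split => z /=.
  move=> [th]; rewrite in_itv/= => thp <-; split; first exact: chord_gt0.
  by rewrite heron_chord mulr_gt0// exprn_gt0// !mulr_gt0// sin_gt0_pi.
move=> [z0 hz]; have xt0 : 0 < 2 * x * t by rewrite !mulr_gt0.
pose C := (z ^+ 2 - x ^+ 2 - t ^+ 2) / (2 * x * t).
have hC : 0 < (1 - C) * (1 + C).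
  have -> : (1 - C) * (1 + C) = heron t x z / (2 * x * t) ^+ 2.
    by rewrite /C /heron; field; rewrite !gt_eqF.
  by rewrite divr_gt0// exprn_gt0.
have C1 : -1 < C < 1 by apply/andP; split; nra.
have /andP[C2 C3] := C1.
exists (acos C).
  by rewrite in_itv/= acos_gt0 ?acos_ltpi// ?C3 ?C2 ?ltW.
rewrite /chord acosK ?in_itv/= ?(ltW C2) ?(ltW C3)//.
have -> : x ^+ 2 + t ^+ 2 + 2 * x * t * C = z ^+ 2.
  by rewrite /C; field; rewrite !gt_eqF.
by rewrite sqrtr_sqr gtr0_norm.
Qed.

(** Jacobian identity for the passage from the angle to z = chord. Since [heron] equals 4 (x t sin
    th)^2 there, the kernel, the density of mu at z and |dz / dth| multiply to the angular weight;
    the constants of [triangle_kernel] are fixed by this requirement. *)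
Lemma chord_weight (t x th : R) : 0 < t -> 0 < x -> 0 < th < pi ->
  triangle_kernel t x (chord x t th) * wdens alpha (chord x t th) * (x * t * sin th / chord x t th) =
  angle_weight alpha th.
Proof.
move=> t0 x0 thp; have z0 := chord_gt0 t0 x0 thp.
have s0 : 0 < sin th by rewrite sin_gt0_pi.
have h0 : 0 < 4 * (x * t * sin th) ^+ 2 by rewrite mulr_gt0// exprn_gt0// !mulr_gt0.
rewrite /triangle_kernel heron_chord h0 mulr1 /angle_weight indicE mem_set ?in_itv//= mulr1 /wdens.
move: (chord x t th) z0 => z z0.
have G0 : Gamma c != 0 by rewrite gt_eqF// Gamma_gt0.
have p0 : (2 : R) `^ alpha != 0 by rewrite gt_eqF// powR_gt0.
set K := Gamma c / _.
transitivity (K * (4 `^ (1 / 2 - alpha) * t `^ (- (2 * alpha)) * (x `^ (- (2 * alpha)) * z `^ (- (2 * alpha))) *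
  (4 * (x * t * sin th) ^+ 2) `^ (alpha - 1 / 2) * z `^ (2 * alpha + 1) * (x * t * sin th / z))).
  by field; rewrite G0 p0 gt_eqF.
congr (_ * _).
have E4 : x * t * sin th / z = expR (ln x + ln t + ln (sin th) - ln z).
  by rewrite expRB !expRD !lnK.
rewrite E4 !powRE_pos// lnM ?posrE ?exprn_gt0 ?mulr_gt0// lnXn ?mulr_gt0// !lnM ?posrE ?mulr_gt0//.
by rewrite -!expRD; congr expR; rewrite -mulr_natl; field.
Qed.

Lemma angle_integral_side t x (Psi : R -> \bar R) : 0 < t -> 0 < x ->
  measurable_fun setT Psi -> (forall z, (0 <= Psi z)%E) ->
  (\int[sigma]_th Psi (chord x t th) = \int[mu]_z (Psi z * (triangle_kernel t x z)%:E))%E.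
Proof.
move=> t0 x0 mPsi Psi0.
have mk : measurable_fun setT (triangle_kernel t x).
  exact: (measurableT_comp (measurable_triangle_kernel t) (measurable_pair1 x)).
have kge z := triangle_kernel_ge0 t x z.
have mch : measurable_fun setT (chord x t) by rewrite /chord; meas.
have wge z : 0 <= wdens alpha z by rewrite /wdens mulr_ge0 ?powR_ge0// invr_ge0 mulr_ge0 ?powR_ge0 ?Gamma_ge0.
pose h z := (Psi z * (triangle_kernel t x z * wdens alpha z)%:E)%E.
have mw : measurable_fun setT (wdens alpha) by rewrite /wdens; meas.
have mh : measurable_fun setT h by rewrite /h; meas.
have h0 z : (0 <= h z)%E by rewrite /h mule_ge0// lee_fin mulr_ge0.
have Eimg := chord_image t0 x0.
have mimg : measurable (chord x t @` `]0%R, pi[ : set R).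
  rewrite Eimg.
  have -> : [set z | 0 < z /\ 0 < heron t x z] = `]0%R, +oo[%classic `&` (heron t x @^-1` `]0%R, +oo[%classic) :> set R.
    by apply/seteqP; split => z /=; rewrite !in_itv/= !andbT.
  apply: measurableI; first exact: measurable_itv.
  rewrite -[X in measurable X]setTI; have mheron : measurable_fun setT (heron t x) by rewrite /heron; meas.
  by apply: mheron => //; exact: measurable_itv.
transitivity (\int[leb]_(z in chord x t @` `]0%R, pi[) h z)%E; last first.
  rewrite ge0_integral_hankel; [|by meas|by move=> z; rewrite mule_ge0// lee_fin].
  rewrite [LHS]integral_mkcond [RHS]integral_mkcond; apply: eq_integral => z _.
  rewrite !epatch_indic /= /h Eimg !indicE -!muleA; congr (_ * _)%E; rewrite -!EFinM; congr EFin.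
  rewrite [RHS]mulrA; have [zi|] := boolP (z \in [set z | 0 < z /\ 0 < heron t x z]).
    have := set_mem zi => -[z0 _]; rewrite (mem_set (A := `]0%R, +oo[%classic))//= ?in_itv/= ?andbT//.
  move=> zni; rewrite /= mulr0; have [zp|] := boolP (z \in (`]0%R, +oo[%classic : set R)); last by rewrite !mulr0.
  have z0 : 0 < z by have := set_mem zp; rewrite /= in_itv/= andbT.
  have hn : ~~ (0 < heron t x z) by apply: contraNN zni => hz; exact: mem_set.
  by rewrite /triangle_kernel (negbTE hn) mulr0 !mul0r.
transitivity (\int[leb]_(th in `]0%R, pi[) (h (chord x t th) * (x * t * sin th / chord x t th)%:E))%E; last first.
  apply/esym; apply: (ge0_integral_substoo_decreasing (pi_gt0 R)) => //.
  - by meas.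
  - by move=> th thp; exact: is_derive_chord.
  - move=> th thp; have z0 := chord_gt0 t0 x0 thp.
    apply: cvgM; first by apply: cvgMr; exact: continuous_sin.
    apply: cvgV; first by rewrite gt_eqF.
    apply: differentiable_continuous; apply/derivable1_diffP; exact: (@ex_derive _ _ _ _ _ _ _ (is_derive_chord t0 x0 thp)).
  - by move=> th thp; rewrite divr_gt0 ?chord_gt0// !mulr_gt0// sin_gt0_pi.
rewrite ge0_integral_mdens//; last by apply: (measurableT_comp mPsi).
rewrite [RHS]integral_mkcond; apply: eq_integral => th _; rewrite epatch_indic /= indicE.
have [thi|thn] := boolP (th \in (`]0%R, pi[%classic : set R)).
  have thp : 0 < th < pi by have := set_mem thi; rewrite /= in_itv.
  by rewrite mule1 /h -muleA -EFinM chord_weight.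
by rewrite mule0 /angle_weight indicE (negbTE thn) mulr0 mule0.
Qed.

(** In terms of the third side z both integrals carry [triangle_kernel t x z], symmetric in x and z.
    This is the self-adjointness of translation, stated for a function of both variables. *)
Lemma translation_duality t (Phi : R * R -> \bar R) : 0 < t ->
  measurable_fun setT Phi -> (forall p, (0 <= Phi p)%E) ->
  (\int[mu]_x \int[sigma]_th Phi (x, chord x t th) =
   \int[mu]_x \int[sigma]_th Phi (chord x t th, x))%E.
Proof.
move=> t0 mPhi Phi0; have mk := measurable_triangle_kernel t.
have kge x z := triangle_kernel_ge0 t x z.
have mch : measurable_fun setT (fun p : R * R => chord p.1 t p.2) by rewrite /chord; meas.
pose F (p : R * R) := (Phi p * (triangle_kernel t p.1 p.2)%:E)%E.
have mF : measurable_fun setT F by rewrite /F; meas.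
have F0 p : (0 <= F p)%E by rewrite /F mule_ge0// lee_fin.
have mP1 : measurable_fun setT (fun p : R * R => Phi (p.1, chord p.1 t p.2)).
  by apply: (measurableT_comp mPhi); apply/measurable_fun_pairP; split; [exact: measurable_fst|exact: mch].
have mP2 : measurable_fun setT (fun p : R * R => Phi (chord p.1 t p.2, p.1)).
  by apply: (measurableT_comp mPhi); apply/measurable_fun_pairP; split; [exact: mch|exact: measurable_fst].
have mPs : measurable_fun setT (fun p : R * R => Phi (p.2, p.1)).
  by apply: (measurableT_comp mPhi); apply/measurable_fun_pairP; split; [exact: measurable_snd|exact: measurable_fst].
transitivity (\int[mu]_x \int[mu]_z F (x, z))%E.
  apply: eq_integral_hankel.
  - exact: (measurable_fun_fubini_tonelli_F (m2 := sigma) _ mP1).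
  - exact: (measurable_fun_fubini_tonelli_F (m2 := mu) _ mF).
  move=> x x0; rewrite (angle_integral_side (Psi := fun z => Phi (x, z)))//.
  exact: (measurableT_comp mPhi (measurable_pair1 x)).
rewrite (@fubini_tonelli _ _ _ _ _ mu mu F mF F0).
apply: eq_integral_hankel.
- exact: (measurable_fun_fubini_tonelli_G (m1 := mu) _ mF).
- exact: (measurable_fun_fubini_tonelli_F (m2 := sigma) _ mP2).
move=> x x0; rewrite (angle_integral_side (Psi := fun z => Phi (z, x)))//.
  by apply: eq_integral => z _; rewrite /F/= triangle_kernelC.
exact: (measurableT_comp mPhi (measurable_pair2 x)).
Qed.

End translation.

Lemma abs_fine_le (R : realType) (x : \bar R) : (`|fine x|%:E <= `|x|)%E.
Proof. by case: x => [r| |] //=; rewrite ?normr0 ?leey. Qed.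

Section convolution.
Context {R : realType}.
Local Notation leb := (@lebesgue_measure R).
Local Notation Rp := (`]0%R, +oo[%classic : set R).
Variable alpha : R.
Hypothesis alpha_gt : -1 / 2 < alpha.
Local Notation c := (alpha + 1).
Local Notation sigma := (angle_measure alpha).
Local Notation mu := (hankel_measure alpha).
Local Notation J := (jalpha alpha).
Local Notation Hk := (hankelR alpha).

Let c_gt0 : 0 < c. Proof. by move: alpha_gt; lra. Qed.
Let mJ : measurable_fun setT J := measurable_bessel alpha_gt.

Definition hankel_translate (phi : R -> R) (x t : R) : R := \int[sigma]_th phi (chord x t th).

Lemma bessel_chord x t xi : \int[sigma]_th J (chord x t th * xi) = J (x * xi) * J (t * xi).
Proof.
rewrite bessel_product//; apply: eq_Rintegral => th _.
have EJ u v : u ^+ 2 = v ^+ 2 -> J u = J v.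
  move=> uv; rewrite -(cvg_lim (@norm_hausdorff _ _) (@cvg_bessel _ _ alpha_gt u)) uv.
  by apply: cvg_lim => //; exact: cvg_bessel.
by apply: EJ; rewrite [(_ * xi) ^+ 2]exprMn !sqr_chord; ring.
Qed.

Lemma integral_angle_cst (r : R) : (\int[sigma]_th r%:E = r%:E)%E.
Proof.
have := integral_cst sigma measurableT r%:E.
by rewrite [X in (_ * X)%E](_ : _ = 1%E) ?mule1//; exact: angle_measure_setT.
Qed.

Lemma eq_Rintegral_hankel (h k : R -> R) :
  measurable_fun setT h -> measurable_fun setT k ->
  (forall x, 0 < x -> h x = k x) -> \int[mu]_x h x = \int[mu]_x k x.
Proof.
move=> mh mk hk; rewrite /Rintegral; congr fine; apply: eq_integral_hankel.
- exact/measurable_EFinP.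
- exact/measurable_EFinP.
- by move=> x x0; rewrite hk.
Qed.

Lemma integral_duality_prod t (Phi : R * R -> \bar R) : 0 < t -> measurable_fun setT Phi ->
  (\int[mu \x sigma]_p Phi (p.1, chord p.1 t p.2) = \int[mu \x sigma]_p Phi (chord p.1 t p.2, p.1))%E.
Proof.
move=> t0 mPhi.
have mch : measurable_fun setT (fun p : R * R => chord p.1 t p.2) by rewrite /chord; meas.
have m1 : measurable_fun setT (fun p : R * R => (p.1, chord p.1 t p.2)).
  by apply/measurable_fun_pairP; split; [exact: measurable_fst|exact: mch].
have m2 : measurable_fun setT (fun p : R * R => (chord p.1 t p.2, p.1)).
  by apply/measurable_fun_pairP; split; [exact: mch|exact: measurable_fst].
have pos (Psi : R * R -> \bar R) : measurable_fun setT Psi -> (forall p, (0 <= Psi p)%E) ->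
   (\int[mu \x sigma]_p Psi (p.1, chord p.1 t p.2) = \int[mu \x sigma]_p Psi (chord p.1 t p.2, p.1))%E.
  move=> mPsi Psi0.
  rewrite (fubini_tonelli1 (m1 := mu) (m2 := sigma) (fun p => Psi (p.1, chord p.1 t p.2)) (measurableT_comp mPsi m1) (fun p => Psi0 _)).
  rewrite (fubini_tonelli1 (m1 := mu) (m2 := sigma) (fun p => Psi (chord p.1 t p.2, p.1)) (measurableT_comp mPsi m2) (fun p => Psi0 _)).
  exact: translation_duality.
rewrite integralE [RHS]integralE; congr (_ - _)%E.
- under eq_integral do rewrite funeposE.
  under [RHS]eq_integral do rewrite funeposE.
  apply: (pos (fun p => maxe (Phi p) 0%E)); last by move=> x; rewrite le_max lexx orbT.
  exact: measurable_maxe.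
- under eq_integral do rewrite funenegE.
  under [RHS]eq_integral do rewrite funenegE.
  apply: (pos (fun p => maxe (- Phi p)%E 0%E)); last by move=> x; rewrite le_max lexx orbT.
  by apply: measurable_maxe => //; exact: measurableT_comp.
Qed.

Section one_function.
Variable phi : R -> R.
Hypothesis iphi : mu.-integrable setT (EFin \o phi).
Let mphi : measurable_fun setT phi.
Proof. by have /measurable_EFinP := measurable_int _ iphi. Qed.

Lemma measurable_htau : measurable_fun setT (fun p : R * R => hankel_translate phi p.1 p.2).
Proof.
apply: (measurable_Rintegral_param sigma (F := fun q : (R * R) * R => phi (chord q.1.1 q.1.2 q.2))).
have m12 : measurable_fun setT (fun p : (R * R) * R => p.1.2) by exact: (measurableT_comp measurable_snd).
have m11 : measurable_fun setT (fun p : (R * R) * R => p.1.1) by exact: (measurableT_comp measurable_fst).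
by apply: (measurableT_comp mphi); rewrite /chord; meas.
Qed.

Lemma translation_mass t : 0 < t ->
  (\int[mu]_x \int[sigma]_th `|phi (chord x t th)|%:E = \int[mu]_x `|phi x|%:E)%E.
Proof.
move=> t0; rewrite (@translation_duality _ _ alpha_gt t (fun p => `|phi p.2|%:E)) => //.
- by apply: eq_integral => x _ /=; rewrite integral_angle_cst.
- have m2 : measurable_fun setT (fun p : R * R => phi p.2) by meas.
  by meas.
Qed.

Lemma integrable_translation_prod t : 0 < t ->
  (mu \x sigma)%E.-integrable setT (EFin \o (fun p => phi (chord p.1 t p.2))).
Proof.
move=> t0; have mch : measurable_fun setT (fun p : R * R => chord p.1 t p.2) by rewrite /chord; meas.
apply/integrable12ltyP; first by apply/measurable_EFinP; exact: (measurableT_comp mphi).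
rewrite /= (translation_mass t0).
by have /integrableP[] := iphi.
Qed.

Lemma le_htau_abs t x : (`|hankel_translate phi x t|%:E <= \int[sigma]_th `|phi (chord x t th)|%:E)%E.
Proof.
apply: (le_trans (abs_fine_le _)).
apply: (le_abse_integral sigma measurableT (f := fun th => (phi (chord x t th))%:E)).
by apply/measurable_EFinP; apply: (measurableT_comp mphi); rewrite /chord; meas.
Qed.

Lemma htau_mass_le t : 0 < t -> (\int[mu]_x `|hankel_translate phi x t|%:E <= \int[mu]_x `|phi x|%:E)%E.
Proof.
move=> t0; rewrite -(translation_mass t0).
have mt := measurable_htau.
have mtx : measurable_fun setT (fun x => hankel_translate phi x t).
  exact: (measurableT_comp measurable_htau (measurable_pair2 t)).
have mc2 : measurable_fun setT (fun p : R * R => phi (chord p.1 t p.2)).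
  by apply: (measurableT_comp mphi); rewrite /chord; meas.
apply: ge0_le_integral => //.
- by meas.
- apply: (measurable_fun_fubini_tonelli_F (m2 := sigma) (fun p : R * R => `|phi (chord p.1 t p.2)|%:E)).
    by meas.
  by move=> p; rewrite lee_fin.
- by move=> x _; exact: le_htau_abs.
Qed.

Lemma integrable_htau t : 0 < t -> mu.-integrable setT (EFin \o (fun x => hankel_translate phi x t)).
Proof.
move=> t0; apply/integrableP; split.
  apply/measurable_EFinP; exact: (measurableT_comp measurable_htau (measurable_pair2 t)).
by apply: (le_lt_trans (htau_mass_le t0)); have /integrableP[] := iphi.
Qed.

(** Duality exchanges x with the third side, so that the angular average falls on the Bessel
    function, where the product formula evaluates it. *)
Lemma translation_hankel t xi : 0 < t ->
  \int[mu]_x (J (x * xi) * hankel_translate phi x t) = J (t * xi) * Hk phi xi.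
Proof.
move=> t0; have mJx : measurable_fun setT (fun x : R => J (x * xi)) by meas.
rewrite (Rintegral_prod_weighted mJx (fun x => bessel_le1 alpha_gt _) (integrable_translation_prod t0)).
have m1 : measurable_fun setT (fun p : R * R => (J (p.1 * xi) * phi p.2)%:E).
  have mp : measurable_fun setT (fun p : R * R => phi p.2) by meas.
  by meas.
rewrite (integral_duality_prod t0 m1) /=.
have mJc : measurable_fun setT (fun p : R * R => J (chord p.1 t p.2 * xi)) by rewrite /chord; meas.
have i1 : (mu \x sigma)%E.-integrable setT (EFin \o (fun p => phi p.1)).
  apply/integrable12ltyP; first by apply/measurable_EFinP; meas.
  under eq_integral do rewrite /= integral_angle_cst.
  by have /integrableP[] := iphi.
have i2 : (mu \x sigma)%E.-integrable setT (EFin \o (fun p => J (chord p.1 t p.2 * xi) * phi p.1)).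
  have := integrable_mul_bounded i1 mJc (fun p => bessel_le1 alpha_gt _).
  by rewrite (_ : (fun p => _ * _) = (fun p => J (chord p.1 t p.2 * xi) * phi p.1))//; apply/funext => p; rewrite mulrC.
rewrite -(Rintegral_prod12 i2) /= /hankelR.
have iJ x : sigma.-integrable setT (EFin \o (fun th => J (chord x t th * xi))).
  apply: (@integrable_angle _ _ alpha_gt _ 1); first by rewrite /chord; meas.
  by move=> th; exact: bessel_le1.
have ip : mu.-integrable setT (EFin \o (fun x => phi x * J (x * xi))).
  exact: (integrable_mul_bounded iphi mJx (fun x => bessel_le1 alpha_gt _)).
rewrite -(RintegralZl _ measurableT ip).
apply: eq_Rintegral => x _; rewrite (RintegralZr _ measurableT (iJ x)) bessel_chord; ring.
Qed.

End one_function.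

Lemma integrable_convolution_prod f phi :
  mu.-integrable setT (EFin \o f) -> mu.-integrable setT (EFin \o phi) ->
  (mu \x mu)%E.-integrable setT (EFin \o (fun p => f p.2 * hankel_translate phi p.1 p.2)).
Proof.
move=> iF iphi; have /measurable_EFinP mf := measurable_int _ iF.
have mt := measurable_htau iphi.
have mf2 : measurable_fun setT (fun p : R * R => f p.2) by meas.
have mft : measurable_fun setT (fun p : R * R => f p.2 * hankel_translate phi p.1 p.2) by meas.
apply/integrable21ltyP; first exact/measurable_EFinP.
have /integrableP[_ lf] := iF; have /integrableP[_ lphi] := iphi.
set P := (\int[mu]_x `|phi x|%:E)%E in lphi *.
have P0 : (0 <= P)%E by apply: integral_ge0 => x _; rewrite lee_fin.
have Pf : P \is a fin_num by rewrite ge0_fin_numE.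
have F0 : (0 <= \int[mu]_x `|f x|%:E)%E by apply: integral_ge0 => x _; rewrite lee_fin.
apply: (@le_lt_trans _ _ (\int[mu]_t (`|f t|%:E * P))%E).
  apply: le_integral_hankel.
  - apply: (measurable_fun_fubini_tonelli_G (m1 := mu) (fun p : R * R => `|f p.2 * hankel_translate phi p.1 p.2|%:E)).
      by meas.
    by move=> p; rewrite lee_fin.
  - by apply: emeasurable_funM; [apply/measurable_EFinP; exact: measurableT_comp|exact: measurable_cst].
  - by move=> t _; apply: integral_ge0 => x _; rewrite lee_fin.
  - move=> t t0 /=; have mtx : measurable_fun setT (fun x => hankel_translate phi x t) by exact: (measurableT_comp mt (measurable_pair2 t)).
    under eq_integral do rewrite normrM EFinM.
    rewrite ge0_integralZl; [|exact: measurableT|by meas|by move=> x _; rewrite lee_fin|by rewrite lee_fin].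
    by rewrite lee_wpmul2l ?lee_fin//; exact: htau_mass_le.
rewrite ge0_integralZr; [|exact: measurableT|by apply/measurable_EFinP; exact: measurableT_comp|by move=> x _; rewrite lee_fin|exact: P0].
by apply: lte_mul_pinfty => //; rewrite ge0_fin_numE.
Qed.

(** Two convolutions are added at once because the real and imaginary parts of f times the conjugate
    of the translated wavelet have this shape. *)
Lemma convolution_hankel f1 f2 phi1 phi2 xi :
  mu.-integrable setT (EFin \o f1) -> mu.-integrable setT (EFin \o f2) ->
  mu.-integrable setT (EFin \o phi1) -> mu.-integrable setT (EFin \o phi2) ->
  Hk (fun x => \int[mu]_t (f1 t * hankel_translate phi1 x t + f2 t * hankel_translate phi2 x t)) xi =
  Hk f1 xi * Hk phi1 xi + Hk f2 xi * Hk phi2 xi.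
Proof.
move=> i1 i2 p1 p2; have mJx : measurable_fun setT (fun x : R => J (x * xi)) by meas.
have bJ x : `|J (x * xi)| <= 1 by exact: bessel_le1.
have C1 := integrable_convolution_prod i1 p1.
have C2 := integrable_convolution_prod i2 p2.
have C : (mu \x mu)%E.-integrable setT (EFin \o (fun p => f1 p.2 * hankel_translate phi1 p.1 p.2 + f2 p.2 * hankel_translate phi2 p.1 p.2)).
  exact: (integrableD measurableT C1 C2).
rewrite {1}/hankelR; under eq_Rintegral do rewrite mulrC.
rewrite (Fubini_weighted mJx bJ C) /=.
have /measurable_EFinP mf1 := measurable_int _ i1.
have /measurable_EFinP mf2 := measurable_int _ i2.
have /measurable_EFinP mC := measurable_int _ C.
have K1 := integrable_mul_bounded i1 mJx bJ.
have K2 := integrable_mul_bounded i2 mJx bJ.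
have L1 := integrableZl measurableT (Hk phi1 xi) K1.
have L2 := integrableZl measurableT (Hk phi2 xi) K2.
transitivity (\int[mu]_t (Hk phi1 xi * (f1 t * J (t * xi)) + Hk phi2 xi * (f2 t * J (t * xi)))).
  apply: eq_Rintegral_hankel; [|by meas|].
    apply: (measurable_Rintegral_param mu (F := fun p : R * R => J (p.2 * xi) * (f1 p.1 * hankel_translate phi1 p.2 p.1 + f2 p.1 * hankel_translate phi2 p.2 p.1))).
    apply: measurable_funM; first by meas.
    have mS : measurable_fun setT (fun p : R * R => (p.2, p.1)).
      by apply/measurable_fun_pairP; split; [exact: measurable_snd|exact: measurable_fst].
    exact: (measurableT_comp mC mS).
  move=> t t0.
  have M1 := integrable_mul_bounded (integrable_htau p1 t0) mJx bJ.
  have M2 := integrable_mul_bounded (integrable_htau p2 t0) mJx bJ.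
  have N1 := integrableZl measurableT (f1 t) M1.
  have N2 := integrableZl measurableT (f2 t) M2.
  transitivity (\int[mu]_x (f1 t * (hankel_translate phi1 x t * J (x * xi)) + f2 t * (hankel_translate phi2 x t * J (x * xi)))).
    by apply: eq_Rintegral => x _; ring.
  rewrite (RintegralD measurableT N1 N2) (RintegralZl _ measurableT M1) (RintegralZl _ measurableT M2).
  have tH p : mu.-integrable setT (EFin \o p) ->
      \int[mu]_x (hankel_translate p x t * J (x * xi)) = J (t * xi) * Hk p xi.
    by move=> ip; rewrite -(translation_hankel ip _ t0); apply: eq_Rintegral => x _; rewrite mulrC.
  by rewrite (tH _ p1) (tH _ p2); ring.
rewrite (RintegralD measurableT L1 L2) (RintegralZl _ measurableT K1) (RintegralZl _ measurableT K2).
by rewrite /hankelR; ring.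
Qed.

Lemma ge0_integral_hankel_scale a (h : R -> \bar R) : 0 < a ->
  measurable_fun setT h -> (forall x, (0 <= h x)%E) ->
  (\int[mu]_x h (a * x)%R = (a `^ (- (2 * c)))%:E * \int[mu]_x h x)%E.
Proof.
move=> a0 mh h0; have mha : measurable_fun setT (fun x => h (a * x)) by apply: (measurableT_comp mh); meas.
have mw : measurable_fun setT (wdens alpha) by rewrite /wdens; meas.
have wge z : 0 <= wdens alpha z by rewrite /wdens mulr_ge0 ?powR_ge0// invr_ge0 mulr_ge0 ?powR_ge0 ?Gamma_ge0.
rewrite !ge0_integral_hankel//.
have hw0 x : (0 <= h x * (wdens alpha x)%:E)%E by rewrite mule_ge0// lee_fin.
rewrite (ge0_integral0y_scale a0 (h := fun x => (h x * (wdens alpha x)%:E)%E)) => //; last by meas.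
rewrite muleA -EFinM -ge0_integralZl; [|exact: measurable_itv| |by move=> x _; exact: hw0|by rewrite lee_fin mulr_ge0 ?powR_ge0 ?ltW]; last first.
  have mwa : measurable_fun setT (fun x : R => wdens alpha (a * x)) by apply: (measurableT_comp mw); meas.
  by apply: measurable_funTS; apply: emeasurable_funM; [exact: mha|exact/measurable_EFinP].
apply: eq_integral => x; rewrite inE/= in_itv/= andbT => x0.
rewrite muleCA; congr (_ * _)%E; rewrite -EFinM; congr EFin; rewrite /wdens (powRM _ (ltW a0) (ltW x0)).
have -> : a = a `^ 1 by rewrite powRr1 ?ltW.
rewrite -!powRrM !mul1r.
rewrite -powRD ?(gt_eqF a0) ?implybT// !mulrA -powRD ?(gt_eqF a0) ?implybT//.
have -> : - (2 * c) + 1 + (2 * alpha + 1) = 0 by ring.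
by rewrite powRr0 mul1r.
Qed.

Lemma integrable_hankel_scale a (h : R -> R) : 0 < a -> mu.-integrable setT (EFin \o h) ->
  mu.-integrable setT (EFin \o (fun x => h (a * x))).
Proof.
move=> a0 ih; have /measurable_EFinP mh := measurable_int _ ih.
have mha : measurable_fun setT (fun x => h (a * x)) by apply: (measurableT_comp mh); meas.
apply/integrableP; split; first exact/measurable_EFinP.
have mn : measurable_fun setT (fun x => `|h x|%:E) by meas.
rewrite /= (ge0_integral_hankel_scale a0 mn) => //.
have /integrableP[_ l] := ih.
by apply: lte_mul_pinfty => //; rewrite lee_fin powR_ge0.
Qed.

Lemma Rintegral_hankel_scale a (h : R -> R) : 0 < a -> mu.-integrable setT (EFin \o h) ->
  \int[mu]_x h (a * x) = a `^ (- (2 * c)) * \int[mu]_x h x.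
Proof.
move=> a0 ih; have mh := measurable_int _ ih.
rewrite /Rintegral -[a `^ _]/(fine (a `^ (- (2 * c)))%:E) -fineM//; last exact: integrable_fin_num.
congr fine; rewrite integralE [in RHS]integralE.
rewrite muleBr//; last by apply: fin_num_adde_defl; rewrite fin_numN; exact: (integrable_neg_fin_num measurableT ih).
rewrite -!ge0_integral_hankel_scale//.
- congr (_ - _)%E; apply: eq_integral => x _.
    by rewrite !funeposE.
  by rewrite !funenegE.
- exact: (measurable_funeneg mh).
- exact: (measurable_funepos mh).
Qed.

Lemma hankel_dilation a (phi : R -> R) xi : 0 < a -> mu.-integrable setT (EFin \o phi) ->
  Hk (fun x => a `^ c * phi (a * x)) xi = a `^ (- c) * Hk phi (xi / a).
Proof.
move=> a0 iphi; have mJx : measurable_fun setT (fun x : R => J (x * (xi / a))) by meas.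
have ip := integrable_mul_bounded iphi mJx (fun x => bessel_le1 alpha_gt _).
rewrite /hankelR.
transitivity (\int[mu]_x (a `^ c * (phi (a * x) * J (a * x * (xi / a))))).
  apply: eq_Rintegral => x _; rewrite mulrA; congr (_ * J _); field; rewrite gt_eqF//.
rewrite (RintegralZl _ measurableT (integrable_hankel_scale a0 ip)) (Rintegral_hankel_scale a0 ip) mulrA.
rewrite -powRD ?(gt_eqF a0) ?implybT//; congr (_ `^ _ * _); ring.
Qed.

End convolution.

(** No integrability is involved: if the positive or the negative part has infinite integral, it
    stays infinite after multiplication by k > 0, and [fine] sends both sides to 0. *)
Lemma Rintegral_ge0Zl d (T : measurableType d) (R : realType) (m : {measure set T -> \bar R})
    (D : set T) (k : R) (h : T -> R) : measurable D -> measurable_fun D h -> 0 <= k ->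
  \int[m]_(x in D) (k * h x) = k * \int[m]_(x in D) h x.
Proof.
move=> mD mh; rewrite le_eqVlt => /predU1P[<-|k0].
  rewrite mul0r /Rintegral; under eq_integral do rewrite mul0r.
  by rewrite integral0.
rewrite /Rintegral integralE [in RHS]integralE.
have mhE : measurable_fun D (EFin \o h) by exact/measurable_EFinP.
have -> : (\int[m]_(x in D) (fun x => (k * h x)%:E)^\+ x = k%:E * \int[m]_(x in D) (fun x => (h x)%:E)^\+ x)%E.
  rewrite -ge0_integralZl//; last 2 first.
  - exact: measurable_funepos.
  - by rewrite lee_fin ltW.
  apply: eq_integral => x _; rewrite !funeposE -!EFin_max -EFinM; congr EFin.
  by rewrite maxr_pMr ?mulr0// ltW.
have -> : (\int[m]_(x in D) (fun x => (k * h x)%:E)^\- x = k%:E * \int[m]_(x in D) (fun x => (h x)%:E)^\- x)%E.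
  rewrite -ge0_integralZl//; last 2 first.
  - exact: measurable_funeneg.
  - by rewrite lee_fin ltW.
  apply: eq_integral => x _; rewrite !funenegE -!EFinN -!EFin_max -EFinM; congr EFin.
  by rewrite maxr_pMr ?mulr0 ?mulrN// ltW.
set A := (\int[m]_(x in D) _ ^\+ x)%E; set B := (\int[m]_(x in D) _ ^\- x)%E.
have A0 : (0 <= A)%E by apply: integral_ge0 => x _; exact: funepos_ge0.
have B0 : (0 <= B)%E by apply: integral_ge0 => x _; exact: funeneg_ge0.
move: A B A0 B0 => [r| |] [s| |]// _ _; rewrite ?gt0_muley ?lte_fin//= ?mulr0//.
by rewrite mulrBr.
Qed.

(** * From complex-valued definitions to real components *)

Section components.
Context {R : realType}.
Local Notation leb := (@lebesgue_measure R).
Local Notation Rp := (`]0%R, +oo[%classic : set R).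
Variable alpha : R.
Hypothesis alpha_gt : -1 / 2 < alpha.
Local Notation c := (alpha + 1).
Local Notation sigma := (angle_measure alpha).
Local Notation mu := (hankel_measure alpha).
Local Notation J := (jalpha alpha).
Local Notation Hk := (hankelR alpha).
Local Notation htau := (hankel_translate alpha).

Let c_gt0 : 0 < c. Proof. by move: alpha_gt; lra. Qed.
Let mJ : measurable_fun setT J := measurable_bessel alpha_gt.

(* Real and imaginary parts of a function on the half-line, extended evenly to the line. *)
Definition hre (g : R -> R[i]) (x : R) : R := complex.Re (g `|x|).
Definition him (g : R -> R[i]) (x : R) : R := complex.Im (g `|x|).

Lemma measurable_even_ext (h : R -> R) : measurable_fun (`[0%R, +oo[ : set R) h ->
  measurable_fun setT (fun x : R => h `|x|).
Proof.
move=> mh; apply: (measurable_comp _ _ mh (g := fun x : R => `|x|)).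
- exact: measurable_itv.
- by move=> _ [x _ <-]/=; rewrite in_itv/= andbT.
- exact: measurable_normR.
Qed.

Lemma wdens0 : wdens alpha 0 = 0.
Proof. by rewrite /wdens powR0 ?mul0r// gt_eqF//; move: alpha_gt; lra. Qed.

Lemma integral_half_line (G : R -> \bar R) : measurable_fun setT G ->
  (\int[leb]_(x in `[0%R, +oo[) (G x * (wdens alpha x)%:E) = \int[mu]_x G x)%E.
Proof.
move=> mG; rewrite integral_mdens// integral_mkcond; apply: eq_integral => x _.
rewrite epatch_indic /= /half_line_weight -muleA -EFinM; congr (_ * _%:E)%E.
rewrite !indicE; have [x0|x0|->] := ltgtP x 0.
- have n1 : ~ `[0%R, +oo[%classic x by rewrite /= in_itv/= (lt_geF x0).
  have n2 : ~ `]0%R, +oo[%classic x by rewrite /= in_itv/= (lt_gtF x0).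
  by rewrite (memNset n1) (memNset n2).
- have n1 : `[0%R, +oo[%classic x by rewrite /= in_itv/= (ltW x0).
  have n2 : `]0%R, +oo[%classic x by rewrite /= in_itv/= x0.
  by rewrite (mem_set n1) (mem_set n2).
- by rewrite wdens0 !mul0r.
Qed.

Lemma Rintegral_half_line (G : R -> R) (g : R -> R) : measurable_fun setT G ->
  (forall x, 0 <= x -> g x = G x * wdens alpha x) ->
  \int[leb]_(x in `[0%R, +oo[) g x = \int[mu]_x G x.
Proof.
move=> mG gG; rewrite /Rintegral; congr fine.
rewrite -(integral_half_line (G := EFin \o G)); last exact/measurable_EFinP.
by apply: eq_integral => x; rewrite inE/= in_itv/= andbT => x0; rewrite gG.
Qed.

Lemma measurable_hre (g : R -> R[i]) : cmeasurable `[0%R, +oo[ g -> measurable_fun setT (hre g).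
Proof. by move=> [mg _]; exact: (measurable_even_ext mg). Qed.

Lemma measurable_him (g : R -> R[i]) : cmeasurable `[0%R, +oo[ g -> measurable_fun setT (him g).
Proof. by move=> [_ mg]; exact: (measurable_even_ext mg). Qed.

Lemma sqr_cabs (z : R[i]) : cabs z ^+ 2 = complex.Re z ^+ 2 + complex.Im z ^+ 2.
Proof. by rewrite sqr_sqrtr// addr_ge0// sqr_ge0. Qed.

Lemma in_L1_integrable (g : R -> R[i]) : in_L1 alpha g ->
  mu.-integrable setT (EFin \o hre g) /\ mu.-integrable setT (EFin \o him g).
Proof.
move=> [cg lg]; have m1 := measurable_hre cg; have m2 := measurable_him cg.
have mc : measurable_fun setT (fun x => (Num.sqrt (hre g x ^+ 2 + him g x ^+ 2))%:E) by meas.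
have {}lg : (\int[mu]_x (Num.sqrt (hre g x ^+ 2 + him g x ^+ 2))%:E < +oo)%E.
  rewrite -(integral_half_line mc); apply: le_lt_trans lg.
  rewrite le_eqVlt; apply/orP; left; apply/eqP; apply: eq_integral => x.
  by rewrite inE/= in_itv/= andbT => x0; rewrite -EFinM /hre /him ger0_norm.
split; (apply/integrableP; split; first exact/measurable_EFinP);
  apply: le_lt_trans lg; apply: ge0_le_integral => //; try by meas.
- by apply: measurableT_comp => //; exact/measurable_EFinP.
- by move=> x _; rewrite lee_fin -sqrtr_sqr ler_wsqrtr// lerDl sqr_ge0.
- by apply: measurableT_comp => //; exact/measurable_EFinP.
- by move=> x _; rewrite lee_fin -sqrtr_sqr ler_wsqrtr// lerDr sqr_ge0.
Qed.

Lemma ReM_real (z : R[i]) (r : R) : complex.Re (z * Complex r 0) = complex.Re z * r.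
Proof. by case: z => u v; rewrite /= mulr0 subr0. Qed.

Lemma ImM_real (z : R[i]) (r : R) : complex.Im (z * Complex r 0) = complex.Im z * r.
Proof. by case: z => u v; rewrite /= mulr0 add0r. Qed.

Lemma hankelE (psi : R -> R[i]) a : cmeasurable `[0%R, +oo[ psi ->
  hankel alpha psi a = Complex (Hk (hre psi) a) (Hk (him psi) a).
Proof.
move=> cpsi; have m1 := measurable_hre cpsi; have m2 := measurable_him cpsi.
rewrite /hankel /int_mu /cint; congr Complex; apply: Rintegral_half_line; try by meas.
- by move=> x x0; rewrite !ReM_real /hre ger0_norm.
- by move=> x x0; rewrite !ImM_real /him ger0_norm.
Qed.

Lemma sqr_cabs_hankel (psi : R -> R[i]) a : cmeasurable `[0%R, +oo[ psi ->
  cabs (hankel alpha psi a) ^+ 2 = Hk (hre psi) a ^+ 2 + Hk (him psi) a ^+ 2.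
Proof. by move=> cpsi; rewrite sqr_cabs hankelE. Qed.

Lemma chord_norm (x y th : R) : `|chord x y th| = chord x y th.
Proof. by rewrite ger0_norm// sqrtr_ge0. Qed.

Lemma Rintegral_angle (h : R -> R) : measurable_fun setT h ->
  Gamma c / (Gamma (1 / 2) * Gamma (alpha + 1 / 2)) *
    \int[leb]_(th in `[0%R, pi]) (h th * sin th `^ (2 * alpha)) = \int[sigma]_th h th.
Proof.
move=> mh; have K0 : 0 <= Gamma c / (Gamma (1 / 2 : R) * Gamma (alpha + 1 / 2)).
  by rewrite mulr_ge0 ?invr_ge0 ?mulr_ge0 ?Gamma_ge0.
have mhs : measurable_fun setT (fun th : R => h th * sin th `^ (2 * alpha)) by meas.
rewrite -Rintegral_ge0Zl//; [|exact: measurable_funTS].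
rewrite /Rintegral; congr fine; rewrite integral_mdens//; last exact/measurable_EFinP.
have mE : measurable_fun setT (fun th : R => (Gamma c / (Gamma (1 / 2) * Gamma (alpha + 1 / 2)) * (h th * sin th `^ (2 * alpha)))%:E).
  by meas.
rewrite -integral_itv_bndo_bndc; last by apply: measurable_funTS.
rewrite -integral_itv_obnd_cbnd; last by apply: measurable_funTS.
rewrite integral_mkcond; apply: eq_integral => th _; rewrite epatch_indic/= /angle_weight -!EFinM; congr EFin.
by move: (Gamma c / _) (\1_ _ _) => k i; ring.
Qed.

Lemma htransE (g : R -> R[i]) x y : cmeasurable `[0%R, +oo[ g ->
  htrans alpha x g y = Complex (htau (hre g) x y) (htau (him g) x y).
Proof.
move=> cg; have m1 := measurable_hre cg; have m2 := measurable_him cg.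
have mch : measurable_fun setT (chord x y) by rewrite /chord; meas.
rewrite /htrans /cint mulrC; set Z := Complex _ _; set K := Gamma c / _.
have -> : Z * Complex K 0 = Complex (complex.Re Z * K) (complex.Im Z * K).
  by rewrite -ReM_real -ImM_real; case: (Z * _).
rewrite /Z/=; congr Complex; rewrite mulrC /hankel_translate -Rintegral_angle; try by meas.
- congr (_ * _); apply: eq_Rintegral => th _; rewrite ReM_real /hre chord_norm//.
- congr (_ * _); apply: eq_Rintegral => th _; rewrite ImM_real /him chord_norm//.
Qed.

Definition hdil (a : R) (phi : R -> R) (z : R) : R := a `^ c * phi (a * z).

Lemma dil_components (psi : R -> R[i]) a : 0 < a -> cmeasurable `[0%R, +oo[ psi ->
  [/\ cmeasurable `[0%R, +oo[ (dil alpha a psi), hre (dil alpha a psi) = hdil a (hre psi) &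
      him (dil alpha a psi) = hdil a (him psi)].
Proof.
move=> a0 cpsi; have m1 := measurable_hre cpsi; have m2 := measurable_him cpsi.
have E1 x : complex.Re (dil alpha a psi `|x|) = hdil a (hre psi) x.
  by rewrite /dil mulrC ReM_real /hdil /hre normrM (gtr0_norm a0) mulrC.
have E2 x : complex.Im (dil alpha a psi `|x|) = hdil a (him psi) x.
  by rewrite /dil mulrC ImM_real /hdil /him normrM (gtr0_norm a0) mulrC.
split; [|by apply/funext => x; rewrite -E1|by apply/funext => x; rewrite -E2].
split.
- apply: (eq_measurable_fun (hdil a (hre psi))); last by apply: measurable_funTS; rewrite /hdil; meas.
  by move=> x; rewrite inE/= in_itv/= andbT => x0; rewrite -E1 ger0_norm.
- apply: (eq_measurable_fun (hdil a (him psi))); last by apply: measurable_funTS; rewrite /hdil; meas.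
  by move=> x; rewrite inE/= in_itv/= andbT => x0; rewrite -E2 ger0_norm.
Qed.

Section transform.
Variables psi f : R -> R[i].
Hypothesis L1psi : in_L1 alpha psi.
Hypothesis mf1 : measurable_fun setT (hre f).
Hypothesis mf2 : measurable_fun setT (him f).
Hypothesis if1 : mu.-integrable setT (EFin \o hre f).
Hypothesis if2 : mu.-integrable setT (EFin \o him f).

Let cpsi_meas : cmeasurable `[0%R, +oo[ psi. Proof. by case: L1psi. Qed.
Let m1 := measurable_hre cpsi_meas.
Let m2 := measurable_him cpsi_meas.
Let i1 : mu.-integrable setT (EFin \o hre psi). Proof. by case: (in_L1_integrable L1psi). Qed.
Let i2 : mu.-integrable setT (EFin \o him psi). Proof. by case: (in_L1_integrable L1psi). Qed.
Let K := (Num.sqrt (cpsi alpha psi))^-1.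
Let K0 : 0 <= K. Proof. by rewrite invr_ge0 sqrtr_ge0. Qed.

(** The signs come from conjugating the wavelet. In [wim] the minus is placed on [hre f], so that
    both components are sums of two convolutions with the same wavelet components. *)
Definition wre a x := K * \int[mu]_t (hre f t * htau (hdil a (hre psi)) x t + him f t * htau (hdil a (him psi)) x t).
Definition wim a x := K * \int[mu]_t (him f t * htau (hdil a (hre psi)) x t + - hre f t * htau (hdil a (him psi)) x t).

Lemma measurable_htau3 (phi : R -> R) : measurable_fun setT phi ->
  measurable_fun setT (fun q : (R * R) * R => htau (hdil q.1.1 phi) q.1.2 q.2).
Proof.
move=> mphi.
apply: (measurable_Rintegral_param sigma (F := fun q : ((R * R) * R) * R => hdil q.1.1.1 phi (chord q.1.1.2 q.1.2 q.2))).
have a1 : measurable_fun setT (fun p : ((R * R) * R) * R => p.1.1.1).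
  by apply: (measurableT_comp measurable_fst); exact: (measurableT_comp measurable_fst).
have a2 : measurable_fun setT (fun p : ((R * R) * R) * R => p.1.1.2).
  by apply: (measurableT_comp measurable_snd); exact: (measurableT_comp measurable_fst).
have a3 : measurable_fun setT (fun p : ((R * R) * R) * R => p.1.2) by exact: (measurableT_comp measurable_snd).
by rewrite /hdil /chord; meas.
Qed.

Lemma measurable_wavelet_integral (f1 f2 phi1 phi2 : R -> R) :
  measurable_fun setT f1 -> measurable_fun setT f2 ->
  measurable_fun setT phi1 -> measurable_fun setT phi2 ->
  measurable_fun setT (fun p : R * R =>
    \int[mu]_t (f1 t * htau (hdil p.1 phi1) p.2 t + f2 t * htau (hdil p.1 phi2) p.2 t)).
Proof.
move=> mf mg mp1 mp2; apply: (measurable_Rintegral_param mu (F := fun q : (R * R) * R =>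
  f1 q.2 * htau (hdil q.1.1 phi1) q.1.2 q.2 + f2 q.2 * htau (hdil q.1.1 phi2) q.1.2 q.2)).
have h1 := measurable_htau3 mp1; have h2 := measurable_htau3 mp2.
have mf' : measurable_fun setT (fun q : (R * R) * R => f1 q.2) by meas.
have mg' : measurable_fun setT (fun q : (R * R) * R => f2 q.2) by meas.
by apply: measurable_funD; apply: measurable_funM.
Qed.

Let mf1N : measurable_fun setT (fun t => - hre f t). Proof. by meas. Qed.

Lemma measurable_wre : measurable_fun setT (fun p : R * R => wre p.1 p.2).
Proof. by apply: measurable_funM => //; exact: (measurable_wavelet_integral mf1 mf2 m1 m2). Qed.

Lemma measurable_wim : measurable_fun setT (fun p : R * R => wim p.1 p.2).
Proof. by apply: measurable_funM => //; exact: (measurable_wavelet_integral mf2 mf1N m1 m2). Qed.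

Lemma hwtE a x : 0 < a -> hwt alpha psi f a x = Complex (wre a x) (wim a x).
Proof.
move=> a0; have [cd E1 E2] := dil_components a0 cpsi_meas.
have h1 := measurable_htau3 m1; have h2 := measurable_htau3 m2.
have mp : measurable_fun setT (fun t : R => ((a, x), t)) by exact: measurable_pair1.
have t1 : measurable_fun setT (htau (hdil a (hre psi)) x) by exact: (measurableT_comp h1 mp).
have t2 : measurable_fun setT (htau (hdil a (him psi)) x) by exact: (measurableT_comp h2 mp).
rewrite /hwt mulrC -/K.
have -> : (fun t => f t * conjc (htrans alpha x (dil alpha a psi) t)) =
    (fun t => f t * Complex (htau (hdil a (hre psi)) x t) (- htau (hdil a (him psi)) x t)).
  by apply/funext => t; rewrite htransE// E1 E2.
set Z := int_mu _ _.
have -> : Z * Complex K 0 = Complex (complex.Re Z * K) (complex.Im Z * K).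
  by rewrite -ReM_real -ImM_real; case: (Z * _).
rewrite /Z /int_mu /cint /wre /wim; congr Complex; rewrite mulrC; congr (_ * _).
- apply: Rintegral_half_line; first by meas.
  by move=> t t0; rewrite ReM_real /hre /him ger0_norm//; case: (f t) => u v /=; ring.
- apply: Rintegral_half_line; first by meas.
  by move=> t t0; rewrite ImM_real /hre /him ger0_norm//; case: (f t) => u v /=; ring.
Qed.

Lemma Hk_scale (k : R) (G : R -> R) xi : 0 <= k -> measurable_fun setT G -> Hk (fun x => k * G x) xi = k * Hk G xi.
Proof.
move=> k0 mG; rewrite /hankelR -Rintegral_ge0Zl//; last by meas.
by apply: eq_Rintegral => x _; rewrite mulrA.
Qed.

Lemma integrable_hdil (a : R) (phi : R -> R) : 0 < a -> mu.-integrable setT (EFin \o phi) ->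
  mu.-integrable setT (EFin \o hdil a phi).
Proof.
move=> a0 ip; have := integrableZl measurableT (a `^ c) (integrable_hankel_scale a0 ip).
by apply: eq_integrable => // x _; rewrite /hdil/= EFinM.
Qed.

Lemma Hk_opp (G : R -> R) xi : mu.-integrable setT (EFin \o G) -> Hk (fun x => - G x) xi = - Hk G xi.
Proof.
move=> iG; have mJx : measurable_fun setT (fun x : R => J (x * xi)) by meas.
have ip := integrable_mul_bounded iG mJx (fun x => bessel_le1 alpha_gt _).
rewrite /hankelR -mulN1r -(RintegralZl _ measurableT ip).
by apply: eq_Rintegral => x _; rewrite mulN1r mulNr.
Qed.

(** The cross terms cancel in (p u + q v)^2 + (q u - p v)^2 = (p^2 + q^2) (u^2 + v^2); the dilation
    contributes the factor a^(-c) and the argument xi / a. *)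
Lemma sqr_Hk_wavelet a xi : 0 < a ->
  Hk (wre a) xi ^+ 2 + Hk (wim a) xi ^+ 2 =
  (cpsi alpha psi)^-1 * (a `^ (- c)) ^+ 2 * (Hk (hre f) xi ^+ 2 + Hk (him f) xi ^+ 2) *
    (cabs (hankel alpha psi (xi / a)) ^+ 2).
Proof.
move=> a0; have d1 := integrable_hdil a0 i1; have d2 := integrable_hdil a0 i2.
have in1 : mu.-integrable setT (EFin \o (fun t => - hre f t)) by exact: (integrableN if1).
have mp : measurable_fun setT (fun x : R => (a, x)) by exact: measurable_pair1.
have mW1 := measurableT_comp (measurable_wavelet_integral mf1 mf2 m1 m2) mp.
have mW2 := measurableT_comp (measurable_wavelet_integral mf2 mf1N m1 m2) mp.
rewrite (Hk_scale xi K0 mW1) (Hk_scale xi K0 mW2) /=.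
rewrite (convolution_hankel alpha_gt xi if1 if2 d1 d2) (convolution_hankel alpha_gt xi if2 in1 d1 d2) Hk_opp//.
rewrite !(hankel_dilation alpha_gt _ a0)// sqr_cabs_hankel//.
have -> : (cpsi alpha psi)^-1 = K ^+ 2.
  rewrite exprVn sqr_sqrtr//; apply: fine_ge0; apply: integral_ge0 => b; rewrite /= in_itv/= andbT => b0.
  by rewrite lee_fin divr_ge0 ?sqr_ge0// ltW.
move: (Hk (hre f) xi) (Hk (him f) xi) (Hk (hre psi) (xi / a)) (Hk (him psi) (xi / a)) (a `^ (- c)) (K).
by move=> x1 x2 x3 x4 x5 x6; ring.
Qed.

End transform.
End components.

(** * Elementary estimates for the logarithm *)

Section estimates.
Context {R : realType}.
Variable alpha : R.
Hypothesis alpha_gt : -1 / 2 < alpha.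
Local Notation c := (alpha + 1).
Local Notation mu := (hankel_measure alpha).
Let c_gt0 : 0 < c. Proof. by move: alpha_gt; lra. Qed.
Let b_gt0 : 0 < c / 2. Proof. by rewrite divr_gt0. Qed.

(** Taylor bound valid for both signs: s (exp s - 1) is at most s^2 exp s when s >= 0 and at most
    s^2 when s < 0. *)
Lemma expR_le_quadratic (s : R) : expR s <= 1 + s + s ^+ 2 * (1 + expR s).
Proof.
have h1 := expR_ge1Dx s; have h2 := expR_ge1Dx (- s); have e0 := expR_gt0 s.
have h3 : expR s - 1 <= s * expR s.
  have : expR s * (1 + - s) <= expR s * expR (- s) by rewrite ler_wpM2l// ltW.
  by rewrite expRN mulfV ?gt_eqF//; lra.
have h4 : s * (expR s - 1) <= s ^+ 2 * (1 + expR s).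
  have [s0|s0] := leP 0 s.
    have : s * (expR s - 1) <= s * (s * expR s) by rewrite ler_wpM2l.
    by have := sqr_ge0 s; nra.
  have : s * (expR s - 1) <= s * s by rewrite ler_wnM2l ?(ltW s0)//; lra.
  have : 0 <= s ^+ 2 * expR s by rewrite mulr_ge0 ?sqr_ge0 ?ltW.
  by rewrite expr2; lra.
by move: h3 h4; rewrite expr2; lra.
Qed.

(** The bound is uniform in u <= 1/2. Its right side contains only y^2 and a small negative power,
    whose integrals against the spectrum are finite by the second moment and by Pitt's
    inequality. *)
Lemma sqr_ln_le (d u y : R) : 0 < d -> 2 * d <= 1 -> 0 < u -> 2 * u <= 1 -> 0 < y ->
  (ln y) ^+ 2 * (1 + y `^ (2 * u)) <= 8 * d ^- 2 * (y ^+ 2 + y `^ (- (2 * d))).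
Proof.
move=> d0 d1 u0 u1 y0.
have i0 : 0 < d ^- 2 by rewrite invr_gt0 exprn_gt0.
have l1 : (ln y) ^+ 2 <= d ^- 2 * (2 * (y `^ (2 * d) + y `^ (- (2 * d)))).
  have := norm_ln_le d0 y0; set p := y `^ d; set q := y `^ (- d) => h.
  have -> : y `^ (2 * d) = p ^+ 2 by rewrite /p -powR_mulrn ?powR_ge0// -powRrM mulrC.
  have -> : y `^ (- (2 * d)) = q ^+ 2 by rewrite /q -powR_mulrn ?powR_ge0// -powRrM mulNr mulrC.
  have p0 : 0 <= p by exact: powR_ge0.
  have q0 : 0 <= q by exact: powR_ge0.
  rewrite -real_normK ?num_real// -exprVn; apply: (@le_trans _ _ ((d^-1 * (p + q)) ^+ 2)).
    by rewrite ler_pXn2r ?nnegrE ?mulr_ge0 ?addr_ge0 ?invr_ge0 ?(ltW d0)//.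
  by rewrite exprMn ler_wpM2l ?sqr_ge0//; have := sqr_ge0 (p - q); nra.
have P0 : 0 <= 1 + y `^ (2 * u) by rewrite addr_ge0 ?powR_ge0.
apply: (le_trans (ler_wpM2r P0 l1)); rewrite -mulrA [8 * _]mulrC -!mulrA ler_wpM2l ?(ltW i0)//.
have [y1|y1] := leP 1 y.
  have h1 : y `^ (2 * d) <= y by rewrite -[leRHS]powRr1 ?(ltW y0)// ler_powR.
  have h2 : y `^ (2 * u) <= y by rewrite -[leRHS]powRr1 ?(ltW y0)// ler_powR.
  have h3 : y `^ (- (2 * d)) <= 1 by rewrite -[leRHS](powRr0 y) ler_powR// oppr_le0 mulr_ge0// ltW.
  have h4 := powR_ge0 y (- (2 * d)); have h5 := powR_ge0 y (2 * d); have h6 := powR_ge0 y (2 * u).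
  move: (y `^ (2 * d)) (y `^ (2 * u)) (y `^ (- (2 * d))) h1 h2 h3 h4 h5 h6 => A B C *.
  have : (A + C) * (1 + B) <= (y + 1) * (1 + y).
    by apply: ler_pM; rewrite ?addr_ge0//; lra.
  nra.
have lt1 (s : R) : 0 <= s -> y `^ s <= 1.
  by move=> s0; rewrite powRE_pos// -expR0 ler_expR mulr_ge0_le0// ln_le0// ltW.
have h1 : y `^ (2 * d) <= 1 by apply: lt1; rewrite mulr_ge0// ltW.
have h2 : y `^ (2 * u) <= 1 by apply: lt1; rewrite mulr_ge0// ltW.
have h3 : 1 <= y `^ (- (2 * d)).
  rewrite powRE_pos// -expR0 ler_expR mulr_le0 ?oppr_le0 ?mulr_ge0 ?(ltW d0)// ln_le0// ltW//.
have h5 := powR_ge0 y (2 * d); have h6 := powR_ge0 y (2 * u); have := sqr_ge0 y.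
move: (y `^ (2 * d)) (y `^ (2 * u)) (y `^ (- (2 * d))) h1 h2 h3 h5 h6 => A B C *.
have : (A + C) * (1 + B) <= (C + C) * 2.
  by apply: ler_pM; rewrite ?addr_ge0//; lra.
nra.
Qed.

Lemma powR_le_quadratic (d u y : R) : 0 < d -> 2 * d <= 1 -> 0 < u -> 2 * u <= 1 -> 0 < y ->
  y `^ (2 * u) <= 1 + 2 * u * ln y + 4 * u ^+ 2 * (8 * d ^- 2 * (y ^+ 2 + y `^ (- (2 * d)))).
Proof.
move=> d0 d1 u0 u1 y0; have h := sqr_ln_le d0 d1 u0 u1 y0.
have := expR_le_quadratic (2 * u * ln y); rewrite -(powRE_pos _ y0) => /le_trans; apply.
rewrite lerD2l exprMn (_ : (2 * u) ^+ 2 = 4 * u ^+ 2); last by ring.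
by rewrite -[leLHS]mulrA ler_wpM2l// mulr_ge0 ?sqr_ge0.
Qed.

Lemma norm_ln_le_quadratic (d y : R) : 0 < d -> 2 * d <= 1 -> 0 < y ->
  `|ln y| <= 1 + 8 * d ^- 2 * (y ^+ 2 + y `^ (- (2 * d))).
Proof.
move=> d0 d1 y0; have hu : 0 < (2^-1 : R) by [].
have h := sqr_ln_le d0 d1 hu (_ : 2 * 2^-1 <= 1) y0.
have {}h : (ln y) ^+ 2 * (1 + y `^ (2 * 2^-1)) <= 8 * d ^- 2 * (y ^+ 2 + y `^ (- (2 * d))) by apply: h; lra.
apply: (@le_trans _ _ (1 + (ln y) ^+ 2)).
  by rewrite -(real_normK (num_real (ln y))); have := sqr_ge0 (`|ln y| - 1); have := normr_ge0 (ln y); nra.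
by rewrite lerD2l (le_trans _ h)// -[leLHS]mulr1 ler_wpM2l ?sqr_ge0// lerDl powR_ge0.
Qed.

(* ln x >= (1 - x^{-2u}) / (2u), written with positive and negative parts. *)
Lemma ln_parts_ge (u x : R) : 0 < u -> 0 < x ->
  1 + 2 * u * Num.max (- ln x) 0 <= 2 * u * Num.max (ln x) 0 + x `^ (- (2 * u)).
Proof.
move=> u0 x0; have u20 : 0 < 2 * u by rewrite mulr_gt0.
have := expR_ge1Dx (- (2 * u) * ln x); rewrite -(powRE_pos _ x0).
move: (x `^ _) => P h.
have [l0|l0] := leP 0 (ln x).
  by rewrite max_r ?oppr_le0//; lra.
by rewrite max_l ?oppr_ge0 ?(ltW l0)//; lra.
Qed.

Lemma pittC_quotient_cvg :
  (fun u => (pittC alpha u - 1) / u) @ (0 : R)^'+ -->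
  - (2 * (ln 2 + derive1 Gamma (c / 2) / Gamma (c / 2))).
Proof.
set b := c / 2; set g' := derive1 Gamma b.
have G0 : Gamma b != 0 by rewrite gt_eqF// Gamma_gt0.
have dG (x : R) : x = b -> is_derive x 1 Gamma g'.
  by move=> ->; apply: DeriveDef; [exact: derivable_Gamma|rewrite /g' derive1E].
have d1 : is_derive (0 : R) 1 (fun u : R => b - u) (-1).
  by have := is_deriveB (is_derive_cst b (0 : R) 1) (is_derive_id (0 : R) 1); rewrite sub0r.
have d2 : is_derive (0 : R) 1 (fun u : R => b + u) 1.
  by have := is_deriveD (is_derive_cst b (0 : R) 1) (is_derive_id (0 : R) 1); rewrite add0r.
have e1 : is_derive (0 : R) 1 (fun u : R => Gamma (b - u)) (g' * -1).
  by apply: (@is_derive_compR _ Gamma (fun u : R => b - u) 0 _ _ (dG _ (subr0 b)) d1).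
have e2 : is_derive (0 : R) 1 (fun u : R => Gamma (b + u)) (g' * 1).
  by apply: (@is_derive_compR _ Gamma (fun u : R => b + u) 0 _ _ (dG _ (addr0 b)) d2).
have e3 : is_derive (0 : R) 1 (fun u : R => expR (- (ln 4) * u)) (expR (- (ln 4) * 0) * (- ln 4)).
  have dl : is_derive (0 : R) 1 (fun u : R => - (ln 4) * u) (- ln 4).
    by have := is_deriveZ (- ln 4) (is_derive_id (0 : R) 1); rewrite /GRing.scale/= mulr1.
  exact: (@is_derive_compR _ expR (fun u : R => - (ln 4) * u) 0 _ _ (is_derive_expR _) dl).
have G0' : Gamma (b + 0) != 0 by rewrite addr0.
have e4 := @is_deriveV _ (fun u : R => Gamma (b + u)) 0 _ 1 G0' e2.
have e5 := is_deriveM (is_deriveM e3 e1) e4.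
have E : pittC alpha = (fun u : R => expR (- (ln 4) * u)) * (fun u : R => Gamma (b - u)) * (fun u : R => (Gamma (b + u))^-1).
  apply/funext => u; rewrite /pittC !fctE powRE_pos//.
  by have -> : - u * ln 4 = - ln 4 * u by ring.
have P0 : pittC alpha 0 = 1.
  by rewrite /pittC oppr0 powRr0 !addr0 mul1r mulfV.
rewrite -E in e5.
have [dv val] := e5.
have ln4 : ln 4 = 2 * ln 2 :> R.
  have -> : 4 = 2 * 2 :> R by rewrite -natrM.
  by rewrite lnM ?posrE//; ring.
have cv : (fun h : R => h^-1 *: (pittC alpha (h *: (1 : R) + 0) - pittC alpha 0)) @ (0 : R)^' --> 'D_1 (pittC alpha) 0 by exact: dv.
rewrite val in cv.
have -> : - (2 * (ln 2 + g' / Gamma b)) =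
    ((fun u : R => expR (- ln 4 * u)) * (fun u : R => Gamma (b - u))) 0 *:
       (- (Gamma (b + 0)) ^- 2 *: (g' * 1)) +
       (Gamma (b + 0))^-1 *:
       (expR (- ln 4 * 0) *: (g' * -1) + Gamma (b - 0) *: (expR (- ln 4 * 0) * - ln 4)).
  by rewrite !fctE /GRing.scale/= ?mulr0 ?expR0 ?subr0 ?addr0 ln4; field.
have -> : (fun u => (pittC alpha u - 1) / u) = (fun h : R => h^-1 *: (pittC alpha (h *: (1 : R) + 0) - pittC alpha 0)).
  by apply/funext => u; rewrite P0 addr0 /GRing.scale/= mulr1 mulrC.
exact: cvg_dnbhs_at_right.
Qed.

(** G^2 is bounded by a multiple of two factors [rho 1]: one absorbs x^(2d) <= 1 + x^2, the other is
    integrable. *)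
Lemma heat_regular_moment (G : R -> R) (d : R) : heat_regular alpha G -> 0 < d -> 2 * d <= 1 ->
  (\int[mu]_x (x `^ (2 * d) * G x ^+ 2)%:E < +oo)%E.
Proof.
move=> [mG [C [C0 GC _]]] d0 d1.
have iR := integrable_rho alpha_gt (ltr01 : 0 < (1 : R)).
have mr := measurable_rho alpha 1.
apply: (@le_lt_trans _ _ (\int[mu]_x (C ^+ 2 * rho alpha 1 x)%:E)%E); last first.
  by have /integrableP[_] := integrableZl measurableT (C ^+ 2) iR; apply: le_lt_trans; apply: ge0_le_integral;
    [exact: measurableT|by move=> x _; rewrite lee_fin mulr_ge0 ?sqr_ge0 ?rho_ge0|by meas|
     by apply: measurableT_comp => //; meas|by move=> x _; rewrite /= lee_abs].
apply: le_integral_hankel; [by meas|by meas|by move=> x _; nnegf|].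
move=> x x0; rewrite lee_fin.
have X0 : 0 < 1 + x ^+ 2 by rewrite ltr_pwDl ?sqr_ge0.
have X1 : 1 <= 1 + x ^+ 2 by rewrite lerDl sqr_ge0.
have h1 : x `^ (2 * d) <= 1 + x ^+ 2.
  have [y1|y1] := leP 1 x.
    apply: (@le_trans _ _ x); first by rewrite -[leRHS]powRr1 ?(ltW x0)// ler_powR.
    by nra.
  rewrite (le_trans _ X1)// powRE_pos// -expR0 ler_expR mulr_ge0_le0 ?mulr_ge0 ?(ltW d0)// ln_le0// ltW//.
have h2 : G x ^+ 2 <= C ^+ 2 * rho alpha 1 x ^+ 2.
  by rewrite -exprMn -(real_normK (num_real (G x))) ler_pXn2r ?nnegrE ?mulr_ge0 ?rho_ge0.
apply: (@le_trans _ _ ((1 + x ^+ 2) * (C ^+ 2 * rho alpha 1 x ^+ 2))).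
  by apply: ler_pM => //; rewrite ?powR_ge0 ?sqr_ge0.
rewrite mulrCA ler_wpM2l ?sqr_ge0// expr2 mulrA -[leRHS]mul1r ler_wpM2r ?rho_ge0//.
rewrite /rho -{1}(powRr1 (ltW X0)) -powRD ?(gt_eqF X0) ?implybT// powRE_pos// -[leRHS]expR0 ler_expR.
by rewrite mulr_le0_ge0 ?ln_ge0//; move: c_gt0; lra.
Qed.

End estimates.

(** * Weighted iterated integrals *)

Section weighted_iterated_integral.
Context {d1 d2 : measure_display} {T1 : measurableType d1} {T2 : measurableType d2}.
Context {R : realType}.
Variables (m1 : {sigma_finite_measure set T1 -> \bar R}).
Variables (m2 : {sigma_finite_measure set T2 -> \bar R}).
Variables (D1 : set T1) (D2 : set T2) (w : T1 * T2 -> R).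
Hypotheses (mD1 : measurable D1) (mD2 : measurable D2).
Hypotheses (mw : measurable_fun setT w) (w0 : forall p, 0 <= w p).

(** Iterated because slices are estimated one at a time; weighted so that the integrals in scale and
    space and those in frequency obey the same rules. *)
Definition wint (v : T1 * T2 -> R) : \bar R :=
  (\int[m1]_(x in D1) \int[m2]_(y in D2) (v (x, y) * w (x, y))%:E)%E.

Let mvw (v : T1 * T2 -> R) : measurable_fun setT v ->
  measurable_fun setT (fun p => (v p * w p)%:E).
Proof. by move=> mv; apply/measurable_EFinP; exact: measurable_funM. Qed.

Let mvwx (v : T1 * T2 -> R) x : measurable_fun setT v ->
  measurable_fun D2 (fun y => (v (x, y) * w (x, y))%:E).
Proof. by move=> mv; apply: measurable_funTS; exact: (measurableT_comp (mvw mv) (measurable_pair1 x)). Qed.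

Lemma measurable_wint_slice (v : T1 * T2 -> R) : measurable_fun setT v -> (forall p, 0 <= v p) ->
  measurable_fun setT (fun x => \int[m2]_(y in D2) (v (x, y) * w (x, y))%:E)%E.
Proof.
move=> mv v0; apply: (measurable_integral_in m2 (F := fun p => (v p * w p)%:E)) => //; first exact: mvw.
by move=> p; rewrite lee_fin mulr_ge0.
Qed.

Lemma wint_slice_ge0 (v : T1 * T2 -> R) x : (forall p, 0 <= v p) ->
  (0 <= \int[m2]_(y in D2) (v (x, y) * w (x, y))%:E)%E.
Proof. by move=> v0; apply: integral_ge0 => y _; rewrite lee_fin mulr_ge0. Qed.

Lemma wint_ge0 (v : T1 * T2 -> R) : (forall p, 0 <= v p) -> (0 <= wint v)%E.
Proof. by move=> v0; apply: integral_ge0 => x _; exact: wint_slice_ge0. Qed.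

Lemma wintD (v1 v2 : T1 * T2 -> R) : measurable_fun setT v1 -> measurable_fun setT v2 ->
  (forall p, 0 <= v1 p) -> (forall p, 0 <= v2 p) ->
  wint (fun p => v1 p + v2 p) = (wint v1 + wint v2)%E.
Proof.
move=> mv1 mv2 p1 p2; rewrite /wint -ge0_integralD//.
- apply: eq_integral => x _; rewrite -ge0_integralD//.
  + by apply: eq_integral => y _; rewrite -EFinD mulrDl.
  + by move=> y _; rewrite lee_fin mulr_ge0.
  + exact: mvwx.
  + by move=> y _; rewrite lee_fin mulr_ge0.
  + exact: mvwx.
- by move=> x _; exact: wint_slice_ge0.
- by apply: measurable_funTS; exact: measurable_wint_slice.
- by move=> x _; exact: wint_slice_ge0.
- by apply: measurable_funTS; exact: measurable_wint_slice.
Qed.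

Lemma wintZ (k : R) (v : T1 * T2 -> R) : 0 <= k -> measurable_fun setT v -> (forall p, 0 <= v p) ->
  wint (fun p => k * v p) = (k%:E * wint v)%E.
Proof.
move=> k0 mv v0; rewrite /wint -ge0_integralZl//.
- apply: eq_integral => x _; rewrite -ge0_integralZl//.
  + by apply: eq_integral => y _; rewrite -EFinM mulrA.
  + exact: mvwx.
  + by move=> y _; rewrite lee_fin mulr_ge0.
- by apply: measurable_funTS; exact: measurable_wint_slice.
- by move=> x _; exact: wint_slice_ge0.
Qed.

Lemma le_wint (v1 v2 : T1 * T2 -> R) : measurable_fun setT v1 -> measurable_fun setT v2 ->
  (forall p, 0 <= v1 p) -> (forall p, 0 <= v2 p) ->
  (forall x y, D1 x -> D2 y -> v1 (x, y) <= v2 (x, y)) -> (wint v1 <= wint v2)%E.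
Proof.
move=> mv1 mv2 p1 p2 v12; apply: ge0_le_integral => //.
- by move=> x _; exact: wint_slice_ge0.
- by apply: measurable_funTS; exact: measurable_wint_slice.
- by apply: measurable_funTS; exact: measurable_wint_slice.
move=> x Dx; apply: ge0_le_integral => //.
- by move=> y _; rewrite lee_fin mulr_ge0.
- exact: mvwx.
- exact: mvwx.
- by move=> y Dy; rewrite lee_fin ler_wpM2r// v12.
Qed.

Lemma eq_wint (v1 v2 : T1 * T2 -> R) : (forall x y, D1 x -> D2 y -> v1 (x, y) = v2 (x, y)) -> wint v1 = wint v2.
Proof.
move=> v12; apply: eq_integral => x /set_mem Dx; apply: eq_integral => y /set_mem Dy.
by rewrite v12.
Qed.

End weighted_iterated_integral.

(** * Plancherel and Pitt for pairs of real functions *)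

Section pairs.
Context {R : realType}.
Variable alpha : R.
Hypothesis alpha_gt : -1 / 2 < alpha.
Local Notation c := (alpha + 1).
Local Notation mu := (hankel_measure alpha).
Local Notation Hk := (hankelR alpha).

Lemma measurable_EFinT (g : R -> R) : measurable_fun setT g -> measurable_fun setT (fun x => (g x)%:E).
Proof. by move=> mg; apply/measurable_EFinP. Qed.

Variables G1 G2 : R -> R.
Hypotheses (rG1 : heat_regular alpha G1) (rG2 : heat_regular alpha G2).
Let m1 : measurable_fun setT G1. Proof. by case: rG1. Qed.
Let m2 : measurable_fun setT G2. Proof. by case: rG2. Qed.

Lemma measurable_pair_energy : measurable_fun setT (fun x => G1 x ^+ 2 + G2 x ^+ 2).
Proof. by meas. Qed.

Lemma plancherel_pair : (\int[mu]_x (G1 x ^+ 2 + G2 x ^+ 2)%:E =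
  \int[mu]_xi (Hk G1 xi ^+ 2 + Hk G2 xi ^+ 2)%:E)%E.
Proof.
have k1 := measurable_Hk alpha_gt m1; have k2 := measurable_Hk alpha_gt m2.
under eq_integral do rewrite EFinD.
rewrite ge0_integralD; [|exact: measurableT|by move=> *; nnegf|by meas|by move=> *; nnegf|by meas].
rewrite -(plancherel alpha_gt rG1) -(plancherel alpha_gt rG2).
by rewrite -ge0_integralD; [|exact: measurableT|by move=> *; nnegf|by meas|by move=> *; nnegf|by meas].
Qed.

Lemma dual_pitt_pair (u : R) : 0 < u < c / 2 ->
  (\int[mu]_x (x `^ (- (2 * u)) * (G1 x ^+ 2 + G2 x ^+ 2))%:E <=
   (pittC alpha u)%:E * \int[mu]_xi (xi `^ (2 * u) * (Hk G1 xi ^+ 2 + Hk G2 xi ^+ 2))%:E)%E.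
Proof.
move=> ub.
have k1 := measurable_Hk alpha_gt m1; have k2 := measurable_Hk alpha_gt m2.
under eq_integral do rewrite mulrDr EFinD.
rewrite ge0_integralD; [|exact: measurableT|by move=> *; nnegf|by meas|by move=> *; nnegf|by meas].
apply: (le_trans (leeD (dual_pitt alpha_gt rG1 ub) (dual_pitt alpha_gt rG2 ub))).
rewrite -ge0_muleDr; [|by apply: integral_ge0 => *; nnegf|by apply: integral_ge0 => *; nnegf].
rewrite -ge0_integralD; [|exact: measurableT|by move=> *; nnegf|by meas|by move=> *; nnegf|by meas].
rewrite le_eqVlt; apply/orP; left; apply/eqP; congr (_ * _)%E.
by apply: eq_integral => xi _; rewrite -EFinD -mulrDr.
Qed.

End pairs.

Local Opaque wre wim hankelR.

(** * Slices of the wavelet transform *)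

Section slices.
Context {R : realType}.
Local Notation leb := (@lebesgue_measure R).
Local Notation Rp := (`]0%R, +oo[%classic : set R).
Variable alpha : R.
Hypothesis alpha_gt : -1 / 2 < alpha.
Local Notation c := (alpha + 1).
Local Notation mu := (hankel_measure alpha).
Local Notation Hk := (hankelR alpha).
Let c_gt0 : 0 < c. Proof. by move: alpha_gt; lra. Qed.

Lemma integral_hankel_Rp (h : R -> \bar R) : measurable_fun setT h ->
  (\int[mu]_x h x = \int[mu]_(x in Rp) h x)%E.
Proof.
move=> mh; rewrite (integral_mdens _ _ measurableT mh) (integral_mdens _ _ (measurable_itv _) mh).
rewrite [RHS]integral_mkcond; apply: eq_integral => x _; rewrite epatch_indic/= -muleA; congr (_ * _)%E.
by rewrite -EFinM /half_line_weight -mulrA indicE; case: (x \in _); rewrite ?mulr1 ?mulr0.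
Qed.

Lemma schwartz_e_regular (g : R -> R[i]) : schwartz_e g ->
  heat_regular alpha (hre g) /\ heat_regular alpha (him g).
Proof.
move=> [s1 s2 ev]; have En x : g `|x| = g x.
  by have [x0|x0] := leP 0 x; [rewrite ger0_norm|rewrite ltr0_norm].
split.
- rewrite (_ : hre g = fun x => complex.Re (g x)); last by apply/funext => x; rewrite /hre En.
  by apply: schwartz_heat_regular => // x; rewrite ev.
- rewrite (_ : him g = fun x => complex.Im (g x)); last by apply/funext => x; rewrite /him En.
  by apply: schwartz_heat_regular => // x; rewrite ev.
Qed.

Variables psi f : R -> R[i].
Hypothesis adm : admissible alpha psi.
Hypothesis sf : schwartz_e f.
Hypothesis sW : forall a : R, 0 < a -> exists g : R -> R[i], schwartz_e g /\
  forall x : R, 0 <= x -> g x = hwt alpha psi f a x.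

Let L1psi : in_L1 alpha psi. Proof. by case: adm. Qed.
Let cm : cmeasurable `[0%R, +oo[ psi. Proof. by case: L1psi. Qed.
Let rf1 : heat_regular alpha (hre f). Proof. by case: (schwartz_e_regular sf). Qed.
Let rf2 : heat_regular alpha (him f). Proof. by case: (schwartz_e_regular sf). Qed.
Let mf1 : measurable_fun setT (hre f). Proof. by case: rf1. Qed.
Let mf2 : measurable_fun setT (him f). Proof. by case: rf2. Qed.
Let if1 := heat_regular_integrable alpha_gt rf1.
Let if2 := heat_regular_integrable alpha_gt rf2.
Let mp1 := measurable_hre cm.
Let mp2 := measurable_him cm.

Local Notation wre := (wre alpha psi f).
Local Notation wim := (wim alpha psi f).
Local Notation cw := (cpsi alpha psi).

Definition spectrum (xi : R) : R := Hk (hre f) xi ^+ 2 + Hk (him f) xi ^+ 2.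
Definition wspectrum (b : R) : R := cabs (hankel alpha psi b) ^+ 2.
Definition wenergy (p : R * R) : R := wre p.1 p.2 ^+ 2 + wim p.1 p.2 ^+ 2.

Lemma spectrum_ge0 xi : 0 <= spectrum xi.
Proof. by rewrite addr_ge0// sqr_ge0. Qed.

Lemma wspectrum_ge0 b : 0 <= wspectrum b.
Proof. exact: sqr_ge0. Qed.

Lemma wenergyE (a x : R) : wenergy (a, x) = wre a x ^+ 2 + wim a x ^+ 2.
Proof. by []. Qed.

Lemma wenergy_ge0 p : 0 <= wenergy p.
Proof. by rewrite addr_ge0// sqr_ge0. Qed.

Lemma measurable_spectrum : measurable_fun setT spectrum.
Proof.
have h1 := measurable_Hk alpha_gt mf1; have h2 := measurable_Hk alpha_gt mf2.
by rewrite /spectrum; meas.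
Qed.

Lemma measurable_wspectrum : measurable_fun setT wspectrum.
Proof.
have h1 := measurable_Hk alpha_gt mp1; have h2 := measurable_Hk alpha_gt mp2.
rewrite (_ : wspectrum = fun b => Hk (hre psi) b ^+ 2 + Hk (him psi) b ^+ 2); first by meas.
by apply/funext => b; rewrite /wspectrum sqr_cabs_hankel.
Qed.

Lemma measurable_wenergy : measurable_fun setT wenergy.
Proof.
have h1 := measurable_wre L1psi mf1 mf2; have h2 := measurable_wim L1psi mf1 mf2.
by rewrite /wenergy; apply: measurable_funD; apply: measurable_funX.
Qed.

Let cw_gt0 : 0 < cw.
Proof. by case: adm => _ _ _ /andP[h1 h2]; rewrite /cpsi fine_gt0// h1. Qed.

Lemma cpsiEE : cpsiE alpha psi = cw%:E.
Proof.
case: adm => _ _ _ /andP[h1 h2]; rewrite /cpsi fineK// ge0_fin_numE// ltW//.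
Qed.

(** The hypothesis supplies a Schwartz function that agrees with the slice for x >= 0. Composition
    with |x| extends the slice evenly, a change that mu, carried by x > 0, does not see. *)
Lemma slice_regular a : 0 < a ->
  heat_regular alpha (fun x => wre a `|x|) /\ heat_regular alpha (fun x => wim a `|x|).
Proof.
move=> a0; have [g [sg gE]] := sW a0; have [r1 r2] := schwartz_e_regular sg.
have E x : g `|x| = Complex (wre a `|x|) (wim a `|x|) by rewrite gE// hwtE.
split.
- by rewrite (_ : (fun x => wre a `|x|) = hre g)//; apply/funext => x; rewrite /hre E.
- by rewrite (_ : (fun x => wim a `|x|) = him g)//; apply/funext => x; rewrite /him E.
Qed.

Lemma even_ext_Hk (h : R -> R) xi : measurable_fun setT h -> Hk (fun x => h `|x|) xi = Hk h xi.
Proof.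
move=> mh; have mJ := measurable_bessel alpha_gt.
have mhn : measurable_fun setT (fun x : R => h `|x|) by meas.
apply: eq_Rintegral_hankel; [by meas|by meas|].
by move=> x x0; rewrite gtr0_norm.
Qed.

Let slice_spectrum a xi : R := cw^-1 * (a `^ (- c)) ^+ 2 * spectrum xi * wspectrum (xi / a).

Let slice_spectrum_ge0 a xi : 0 <= slice_spectrum a xi.
Proof.
apply: mulr_ge0; last exact: wspectrum_ge0.
by apply: mulr_ge0; [rewrite mulr_ge0 ?exprn_ge0 ?powR_ge0 ?invr_ge0 ?(ltW cw_gt0)|exact: spectrum_ge0].
Qed.

Lemma sqr_Hk_slice a xi : 0 < a ->
  Hk (fun x => wre a `|x|) xi ^+ 2 + Hk (fun x => wim a `|x|) xi ^+ 2 = slice_spectrum a xi.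
Proof.
move=> a0; have h1 := measurable_wre L1psi mf1 mf2; have h2 := measurable_wim L1psi mf1 mf2.
have mp : measurable_fun setT (fun x : R => (a, x)) by exact: measurable_pair1.
have m1 : measurable_fun setT (fun x => wre a x) := measurableT_comp h1 mp.
have m2 : measurable_fun setT (fun x => wim a x) := measurableT_comp h2 mp.
have E1 := even_ext_Hk (h := fun x => wre a x) xi m1.
have E2 := even_ext_Hk (h := fun x => wim a x) xi m2.
exact: etrans (congr2 (fun r s => r ^+ 2 + s ^+ 2) E1 E2) (sqr_Hk_wavelet alpha_gt L1psi mf1 mf2 if1 if2 xi a0).
Qed.

Local Opaque wenergy spectrum wspectrum.

Lemma slice_plancherel a : 0 < a ->
  (\int[mu]_x (wenergy (a, x))%:E = \int[mu]_xi (slice_spectrum a xi)%:E)%E.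
Proof.
move=> a0; have [r1 r2] := slice_regular a0.
have mE : measurable_fun setT (fun x => wenergy (a, x)) := measurableT_comp measurable_wenergy (measurable_pair1 a).
under [RHS]eq_integral do rewrite -(sqr_Hk_slice _ a0).
rewrite -(plancherel_pair alpha_gt r1 r2).
apply: (eq_integral_hankel alpha (measurable_EFinT mE) (measurable_EFinT (measurable_pair_energy r1 r2))).
by move=> x x0; rewrite wenergyE (gtr0_norm x0).
Qed.

Lemma slice_dual_pitt u a : 0 < u < c / 2 -> 0 < a ->
  (\int[mu]_x (x `^ (- (2 * u)) * wenergy (a, x))%:E <=
   (pittC alpha u)%:E * \int[mu]_xi (xi `^ (2 * u) * slice_spectrum a xi)%:E)%E.
Proof.
move=> ub a0; have [r1 r2] := slice_regular a0.
have mE : measurable_fun setT (fun x => wenergy (a, x)) := measurableT_comp measurable_wenergy (measurable_pair1 a).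
have mp : measurable_fun setT (fun x : R => x `^ (- (2 * u))) by apply: measurable_powR.
under [X in (_ <= _ * X)%E]eq_integral do rewrite -(sqr_Hk_slice _ a0).
apply: (le_trans _ (dual_pitt_pair alpha_gt r1 r2 ub)).
rewrite le_eqVlt; apply/orP; left; apply/eqP.
apply: (eq_integral_hankel alpha (measurable_EFinT (measurable_funM mp mE))
  (measurable_EFinT (measurable_funM mp (measurable_pair_energy r1 r2)))).
by move=> x x0; rewrite /= wenergyE (gtr0_norm x0).
Qed.

Definition space_weight (p : R * R) : R := wenergy p * p.1 `^ (2 * alpha + 1).
(** Density in the frequency xi and the reduced scale b = xi / a; the scale measure becomes db / b.
    The absolute value keeps the weight nonnegative on the whole plane. *)
Definition freq_weight (p : R * R) : R := cw^-1 * spectrum p.1 * (wspectrum p.2 / `|p.2|).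

Lemma measurable_space_weight : measurable_fun setT space_weight.
Proof. by have h := measurable_wenergy; rewrite /space_weight; meas. Qed.

Lemma space_weight_ge0 p : 0 <= space_weight p.
Proof. by rewrite mulr_ge0 ?wenergy_ge0 ?powR_ge0. Qed.

Lemma measurable_freq_weight : measurable_fun setT freq_weight.
Proof.
have h1 := measurable_spectrum; have h2 := measurable_wspectrum.
have h3 : measurable_fun setT (fun p : R * R => spectrum p.1) := measurableT_comp h1 measurable_fst.
have h4 : measurable_fun setT (fun p : R * R => wspectrum p.2) := measurableT_comp h2 measurable_snd.
by rewrite /freq_weight; meas.
Qed.

Lemma freq_weight_ge0 p : 0 <= freq_weight p.
Proof.
apply: mulr_ge0; last by rewrite divr_ge0 ?wspectrum_ge0.
by rewrite mulr_ge0 ?spectrum_ge0// invr_ge0 ltW.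
Qed.

Definition space_int (v : R * R -> R) : \bar R := wint leb mu Rp Rp space_weight v.
Definition freq_int (v : R * R -> R) : \bar R := wint mu leb Rp Rp freq_weight v.

(** Substitution a = xi / b at fixed xi. The power a^(-2c) from the dilation and a^(2 alpha + 1)
    from nu combine to 1 / a, so the scale integral is invariant under dilation and turns into one
    against db / b. *)
Lemma slice_change (v : R * R -> R) : measurable_fun setT v -> (forall p, 0 <= v p) ->
  (\int[leb]_(a in Rp) \int[mu]_(xi in Rp) (v (xi, a) * slice_spectrum a xi * a `^ (2 * alpha + 1))%:E =
   freq_int (fun p => v (p.1, p.1 / p.2)%R))%E.
Proof.
move=> mv v0; have h1 := measurable_spectrum; have h2 := measurable_wspectrum.
pose F (p : R * R) := (v (p.2, p.1) * slice_spectrum p.1 p.2 * p.1 `^ (2 * alpha + 1))%:E.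
have mvs : measurable_fun setT (fun p : R * R => v (p.2, p.1)).
  by apply: (measurableT_comp mv); apply/measurable_fun_pairP; split; [exact: measurable_snd|exact: measurable_fst].
have h3 : measurable_fun setT (fun p : R * R => spectrum p.2) := measurableT_comp h1 measurable_snd.
have h4 : measurable_fun setT (fun p : R * R => wspectrum (p.2 / p.1)).
  by apply: (measurableT_comp h2); meas.
have mF : measurable_fun setT F by rewrite /F /slice_spectrum; meas.
have F0 p : (0 <= F p)%E.
  by rewrite lee_fin; exact: mulr_ge0 (mulr_ge0 (v0 _) (slice_spectrum_ge0 _ _)) (powR_ge0 _ _).
rewrite -[LHS]/(\int[leb]_(a in Rp) \int[mu]_(xi in Rp) F (a, xi))%E.
rewrite (ge0_tonelli_in leb mu (measurable_itv _) (measurable_itv _) mF F0).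
apply: eq_integral => xi; rewrite inE/= in_itv/= andbT => xi0.
rewrite (ge0_integral0y_inv xi0); last 2 first.
- exact: (measurableT_comp mF (measurable_pair2 xi)).
- by move=> a; exact: F0.
apply: eq_integral => b; rewrite inE/= in_itv/= andbT => b0.
rewrite /F/= -EFinM; congr EFin; rewrite -!(mulrA (v _)); congr (_ * _).
rewrite /slice_spectrum /freq_weight/= (gtr0_norm b0).
have -> : xi / (xi / b) = b by field; rewrite !gt_eqF.
have E : (xi / b) `^ (- c) ^+ 2 * (xi / b) `^ (2 * alpha + 1) = b / xi.
  have q0 : 0 < xi / b by rewrite divr_gt0.
  rewrite -powR_mulrn ?powR_ge0// -powRrM -powRD ?(gt_eqF q0) ?implybT//.
  have -> : - c * 2 + (2 * alpha + 1) = - 1 by ring.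
  by rewrite powR_inv1 ?(ltW q0)// invf_div.
transitivity (cw^-1 * spectrum xi * wspectrum b * ((xi / b) `^ (- c) ^+ 2 * (xi / b) `^ (2 * alpha + 1)) * (xi / b ^+ 2)).
  by ring.
by rewrite E; field; rewrite !gt_eqF.
Qed.

(** A weight that depends on the scale alone is constant on each slice, so Plancherel on the slice
    transfers it without loss. *)
Lemma space_int_scale (k : R -> R) : measurable_fun setT k -> (forall a, 0 <= k a) ->
  space_int (fun p => k p.1) = freq_int (fun p => k (p.1 / p.2)).
Proof.
move=> mk k0; rewrite -(slice_change (v := fun p => k p.2)); [|exact: (measurableT_comp mk measurable_snd)|by []].
have h1 := measurable_spectrum; have h2 := measurable_wspectrum; have h3 := measurable_wenergy.
apply: eq_integral => a; rewrite inE/= in_itv/= andbT => a0.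
have mp : measurable_fun setT (fun x : R => (a, x)) by exact: measurable_pair1.
have mE : measurable_fun setT (fun x => wenergy (a, x)) := measurableT_comp measurable_wenergy mp.
have mq : measurable_fun setT (fun xi : R => wspectrum (xi / a)) by apply: (measurableT_comp h2); meas.
have ms : measurable_fun setT (slice_spectrum a) by rewrite /slice_spectrum; meas.
have s0 xi : 0 <= slice_spectrum a xi by exact: slice_spectrum_ge0.
have e0 x : 0 <= wenergy (a, x) by exact: wenergy_ge0.
have K0 : (0 <= (k a * a `^ (2 * alpha + 1))%:E)%E by rewrite lee_fin mulr_ge0 ?powR_ge0.
rewrite -integral_hankel_Rp; last by rewrite /space_weight/=; meas.
rewrite -integral_hankel_Rp; last by meas.
transitivity ((k a * a `^ (2 * alpha + 1))%:E * \int[mu]_x (wenergy (a, x))%:E)%E.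
  rewrite -ge0_integralZl; [|exact: measurableT|by meas|by move=> x _; rewrite lee_fin|by []].
  by apply: eq_integral => x _; rewrite -EFinM /space_weight/=; congr EFin; ring.
rewrite (slice_plancherel a0) -ge0_integralZl; [|exact: measurableT|by meas|by move=> x _; rewrite lee_fin|by []].
by apply: eq_integral => x _; rewrite -EFinM; congr EFin; ring.
Qed.

Lemma space_int_pitt (u : R) : 0 < u < c / 2 ->
  (space_int (fun p => p.2 `^ (- (2 * u)))%R <= (pittC alpha u)%:E * freq_int (fun p => p.1 `^ (2 * u))%R)%E.
Proof.
move=> ub; have P0 : 0 <= pittC alpha u by rewrite /pittC; nnegf.
have h1 := measurable_spectrum; have h2 := measurable_wspectrum; have h3 := measurable_wenergy.
rewrite -(slice_change (v := fun p => p.1 `^ (2 * u))); [|by meas|by move=> p; exact: powR_ge0].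
have h4 : measurable_fun setT (fun p : R * R => spectrum p.2) := measurableT_comp h1 measurable_snd.
have h5 : measurable_fun setT (fun p : R * R => wspectrum (p.2 / p.1)).
  by apply: (measurableT_comp h2); meas.
have s0 a xi : 0 <= slice_spectrum a xi by exact: slice_spectrum_ge0.
have mS2 : measurable_fun setT (fun p : R * R => slice_spectrum p.1 p.2) by rewrite /slice_spectrum; meas.
have mI : measurable_fun setT (fun a => \int[mu]_(xi in Rp) (xi `^ (2 * u) * slice_spectrum a xi * a `^ (2 * alpha + 1))%:E)%E.
  apply: (measurable_integral_in mu (F := fun p : R * R => (p.2 `^ (2 * u) * slice_spectrum p.1 p.2 * p.1 `^ (2 * alpha + 1))%:E)); [exact: measurable_itv|by meas|].
  by move=> p; rewrite lee_fin; exact: mulr_ge0 (mulr_ge0 (powR_ge0 _ _) (slice_spectrum_ge0 _ _)) (powR_ge0 _ _).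
rewrite -ge0_integralZl; [|exact: measurable_itv|exact: measurable_funTS| |by rewrite lee_fin]; last first.
  by move=> a _; apply: integral_ge0 => xi _; rewrite lee_fin; exact: mulr_ge0 (mulr_ge0 (powR_ge0 _ _) (slice_spectrum_ge0 _ _)) (powR_ge0 _ _).
have mpu : measurable_fun setT (fun p : R * R => p.2 `^ (- (2 * u))) by meas.
apply: ge0_le_integral; [exact: measurable_itv| | | |].
- by move=> a _; apply: integral_ge0 => x _; rewrite lee_fin; exact: mulr_ge0 (powR_ge0 _ _) (space_weight_ge0 _).
- apply: measurable_funTS; apply: (@measurable_wint_slice _ _ _ _ _ mu _ _ (measurable_itv _) measurable_space_weight space_weight_ge0 _ mpu).
  by move=> p; exact: powR_ge0.
- by apply: measurable_funTS; apply: emeasurable_funM.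
move=> a; rewrite /= in_itv/= andbT => a0.
have mp : measurable_fun setT (fun x : R => (a, x)) by exact: measurable_pair1.
have mE : measurable_fun setT (fun x => wenergy (a, x)) := measurableT_comp measurable_wenergy mp.
have ms := measurableT_comp mS2 mp; rewrite /= in ms.
have e0 x : 0 <= wenergy (a, x) by exact: wenergy_ge0.
have K0 : (0 <= (a `^ (2 * alpha + 1))%:E)%E by rewrite lee_fin powR_ge0.
rewrite -integral_hankel_Rp; last by rewrite /space_weight/=; meas.
rewrite -integral_hankel_Rp; last by meas.
rewrite [leLHS](_ : _ = (a `^ (2 * alpha + 1))%:E * \int[mu]_x (x `^ (- (2 * u)) * wenergy (a, x))%:E)%E; last first.
  rewrite -ge0_integralZl; [|exact: measurableT|by meas|by move=> x _; rewrite lee_fin mulr_ge0 ?powR_ge0|by []].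
  by apply: eq_integral => x _; rewrite -EFinM /space_weight/=; congr EFin; ring.
apply: (le_trans (lee_wpmul2l K0 (slice_dual_pitt ub a0))).
rewrite muleCA lee_wpmul2l ?lee_fin// -ge0_integralZl; [|exact: measurableT|by meas|by move=> x _; rewrite lee_fin mulr_ge0 ?powR_ge0|by []].
rewrite le_eqVlt; apply/orP; left; apply/eqP; apply: eq_integral => x _; rewrite -EFinM; congr EFin; ring.
Qed.

(** In the variables xi and b signal and wavelet separate, and the double integral is a product. *)
Lemma freq_int_prod (k1 k2 : R -> R) : measurable_fun setT k1 -> measurable_fun setT k2 ->
  (forall x, 0 <= k1 x) -> (forall x, 0 <= k2 x) ->
  freq_int (fun p => k1 p.1 * k2 p.2) =
  (\int[mu]_xi (k1 xi * spectrum xi)%:E * ((cw^-1)%:E * \int[leb]_(b in Rp) (k2 b * (wspectrum b / b))%:E))%E.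
Proof.
move=> mk1 mk2 k10 k20; have h1 := measurable_spectrum; have h2 := measurable_wspectrum.
have i0 : 0 <= cw^-1 by rewrite invr_ge0 ltW.
have mb : measurable_fun setT (fun b : R => (k2 b * (wspectrum b / b))%:E) by meas.
have b0 b : Rp b -> (0 <= (k2 b * (wspectrum b / b))%:E)%E.
  by rewrite /= in_itv/= andbT => b0; rewrite lee_fin mulr_ge0// divr_ge0 ?wspectrum_ge0// ltW.
rewrite integral_hankel_Rp; last by meas.
have I0 : (0 <= (cw^-1)%:E * \int[leb]_(b in Rp) (k2 b * (wspectrum b / b))%:E)%E.
  by rewrite mule_ge0 ?lee_fin//; exact: integral_ge0.
rewrite -ge0_integralZr; [|exact: measurable_itv|by apply: measurable_funTS; meas|by move=> xi _; rewrite lee_fin mulr_ge0 ?spectrum_ge0|by []].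
apply: eq_integral => xi _.
rewrite muleA -EFinM -ge0_integralZl; [|exact: measurable_itv|exact: measurable_funTS|by []|by rewrite lee_fin !mulr_ge0 ?spectrum_ge0].
apply: eq_integral => b; rewrite inE/= in_itv/= andbT => bp.
by rewrite -EFinM /freq_weight/= (gtr0_norm bp); congr EFin; ring.
Qed.

End slices.

(** * Positive and negative parts of the logarithm *)

Definition lnp {R : realType} (x : R) : R := Num.max (ln x) 0.
Definition lnm {R : realType} (x : R) : R := Num.max (- ln x) 0.

Section log_parts.
Context {R : realType}.
Implicit Types x y k s : R.

Lemma lnp_ge0 x : 0 <= lnp x. Proof. by rewrite le_max lexx orbT. Qed.
Lemma lnm_ge0 x : 0 <= lnm x. Proof. by rewrite le_max lexx orbT. Qed.

Lemma measurable_lnp : measurable_fun setT (@lnp R).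
Proof. by apply: measurable_maxr => //; exact: measurable_ln. Qed.

Lemma measurable_lnm : measurable_fun setT (@lnm R).
Proof. by apply: measurable_maxr => //; apply: measurableT_comp => //; exact: measurable_ln. Qed.

Lemma lnp_le_norm x : lnp x <= `|ln x|.
Proof. by rewrite ge_max normr_ge0 ler_norm. Qed.

Lemma lnm_le_norm x : lnm x <= `|ln x|.
Proof. by rewrite ge_max normr_ge0 andbT -normrN ler_norm. Qed.

Lemma ln_div_parts x y : 0 < x -> 0 < y ->
  lnp (x / y) + lnm x + lnp y = lnm (x / y) + lnp x + lnm y.
Proof.
move=> x0 y0; rewrite /lnp /lnm ln_div//.
move: (ln x) (ln y) => s t.
have pm (r : R) : Num.max r 0 - Num.max (- r) 0 = r.
  by have [r0|r0] := leP r 0; have [r1|r1] := leP (- r) 0; lra.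
by have := pm s; have := pm t; have := pm (s - t); lra.
Qed.

Lemma lnp_div_le x y : 0 < x -> 0 < y -> lnp (x / y) <= lnp x + lnm y.
Proof.
move=> x0 y0; rewrite {1}/lnp ln_div// ge_max addr_ge0 ?lnp_ge0 ?lnm_ge0// andbT.
by rewrite lerD// ?le_max ?lexx.
Qed.

Lemma lnm_div_le x y : 0 < x -> 0 < y -> lnm (x / y) <= lnm x + lnp y.
Proof. by move=> x0 y0; have := ln_div_parts x0 y0; have := lnp_div_le x0 y0; lra. Qed.

Lemma lnm_le_powR (u x : R) : 0 < u -> 0 < x -> 2 * u * lnm x <= x `^ (- (2 * u)).
Proof.
move=> u0 x0; have h : 1 + 2 * u * lnm x <= 2 * u * lnp x + x `^ (- (2 * u)) := ln_parts_ge u0 x0.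
move: h (powR_ge0 x (- (2 * u))); move: (x `^ _) => P; rewrite /lnp /lnm.
by have [l0|l0] := leP (ln x) 0; have [l1|l1] := leP (- ln x) 0; rewrite ?mulr0 ?add0r; [lra|lra|lra|lra].
Qed.

Lemma maxe_mul0 k s : 0 <= s -> maxe (k * s)%:E 0%E = (Num.max k 0 * s)%:E.
Proof.
move=> s0; rewrite -EFin_max; congr EFin; have [k0|k0] := leP k 0.
- by rewrite mul0r max_r// mulr_le0_ge0.
- by rewrite max_l// mulr_ge0// ltW.
Qed.

End log_parts.

Section nonneg_parts.
Context {d : measure_display} {T : measurableType d} {R : realType}.
Variable m : {measure set T -> \bar R}.

Lemma integral_signed_weight (D : set T) (k s : T -> R) : (forall x, D x -> 0 <= s x) ->
  (\int[m]_(x in D) (k x * s x)%:E = \int[m]_(x in D) (Num.max (k x) 0 * s x)%:E -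
   \int[m]_(x in D) (Num.max (- k x) 0 * s x)%:E)%E.
Proof.
move=> s0; rewrite integralE; congr (_ - _)%E; apply: eq_integral => x /set_mem Dx.
- by rewrite funeposE maxe_mul0// s0.
- by rewrite funenegE -EFinN -mulNr maxe_mul0// s0.
Qed.

End nonneg_parts.

(** * Logarithmic moments *)

Section log_moments.
Context {R : realType}.
Local Notation leb := (@lebesgue_measure R).
Local Notation Rp := (`]0%R, +oo[%classic : set R).
Variable alpha : R.
Hypothesis alpha_gt : -1 / 2 < alpha.
Local Notation c := (alpha + 1).
Local Notation mu := (hankel_measure alpha).
Local Notation Hk := (hankelR alpha).
Let c_gt0 : 0 < c. Proof. by move: alpha_gt; lra. Qed.

Variables psi f : R -> R[i].
Hypothesis adm : admissible alpha psi.
Hypothesis sf : schwartz_e f.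
Hypothesis sW : forall a : R, 0 < a -> exists g : R -> R[i], schwartz_e g /\
  forall x : R, 0 <= x -> g x = hwt alpha psi f a x.

Local Notation cw := (cpsi alpha psi).
Local Notation A0 := (L2norm2 alpha f).
Local Notation N := (spectrum alpha f).
Local Notation W := (wspectrum alpha psi).
Local Notation S := (space_int alpha psi f).
Local Notation F := (freq_int alpha psi f).
Let rf1 : heat_regular alpha (hre f). Proof. by case: (schwartz_e_regular alpha_gt sf). Qed.
Let rf2 : heat_regular alpha (him f). Proof. by case: (schwartz_e_regular alpha_gt sf). Qed.
Let mf1 : measurable_fun setT (hre f). Proof. by case: rf1. Qed.
Let mf2 : measurable_fun setT (him f). Proof. by case: rf2. Qed.

Let cw_gt0 : 0 < cw.
Proof. by case: adm => _ _ _ /andP[h1 h2]; rewrite /cpsi fine_gt0// h1. Qed.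

Lemma spectrum_mass : (\int[mu]_xi (N xi)%:E = A0%:E)%E.
Proof.
have i1 := heat_regular_sqr_integrable alpha_gt rf1.
have i2 := heat_regular_sqr_integrable alpha_gt rf2.
rewrite /spectrum -(plancherel_pair alpha_gt rf1 rf2).
have mE := measurable_pair_energy rf1 rf2.
rewrite /L2norm2 (Rintegral_half_line (G := fun x => hre f x ^+ 2 + him f x ^+ 2) alpha_gt mE); last first.
  by move=> x x0; rewrite sqr_cabs /hre /him ger0_norm.
have i12 : mu.-integrable setT (EFin \o (fun x => hre f x ^+ 2 + him f x ^+ 2)).
  exact: (integrableD measurableT i1 i2).
by rewrite (EFin_Rintegral i12).
Qed.

Lemma spectrum_split (k : R -> R) : measurable_fun setT k -> (forall x, 0 <= k x) ->
  (\int[mu]_xi (k xi * N xi)%:E =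
   \int[mu]_xi (k xi * Hk (hre f) xi ^+ 2)%:E + \int[mu]_xi (k xi * Hk (him f) xi ^+ 2)%:E)%E.
Proof.
move=> mk k0; have h1 := measurable_Hk alpha_gt mf1; have h2 := measurable_Hk alpha_gt mf2.
under eq_integral do rewrite /spectrum mulrDr EFinD.
have k1 g x : (0 <= (k x * Hk g x ^+ 2)%:E)%E by rewrite lee_fin mulr_ge0// sqr_ge0.
have kk g : measurable_fun setT (Hk g) -> measurable_fun setT (fun x => (k x * Hk g x ^+ 2)%:E).
  by move=> mg; exact: (measurable_EFinT (measurable_funM mk (measurable_funX 2 mg))).
by rewrite ge0_integralD; [|exact: measurableT|by []|exact: kk|by []|exact: kk].
Qed.

(** One exponent d meets both demands: 2 d <= 1 for the logarithmic estimates and d < c / 2 for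
    Pitt's inequality. *)
Let dexp : R := Num.min (1 / 2) (c / 4).
Let dexp_gt0 : 0 < dexp. Proof. by rewrite lt_min; apply/andP; split; move: c_gt0; lra. Qed.
Let dexp_le : 2 * dexp <= 1. Proof. by have : dexp <= 1 / 2 by [rewrite ge_min lexx]; lra. Qed.
Let dexp_lt : 0 < dexp < c / 2.
Proof. by rewrite dexp_gt0/=; have : dexp <= c / 4 by [rewrite ge_min lexx orbT]; move: c_gt0; lra. Qed.

Definition log_majorant (y : R) : R := 8 * dexp ^- 2 * (y ^+ 2 + y `^ (- (2 * dexp))).

Let K_ge0 : 0 <= 8 * dexp ^- 2. Proof. by rewrite mulr_ge0// invr_ge0 exprn_ge0// ltW. Qed.

Lemma log_majorant_ge0 y : 0 <= log_majorant y.
Proof. by rewrite mulr_ge0// addr_ge0 ?sqr_ge0 ?powR_ge0. Qed.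

Lemma measurable_log_majorant : measurable_fun setT log_majorant.
Proof. by rewrite /log_majorant; meas. Qed.

(** The second moment controls high frequencies and Pitt's inequality at the exponent [dexp] the low
    ones; the right side of the latter is a finite moment of f. *)
Lemma spectrum_majorant_lty : (\int[mu]_xi (log_majorant xi * N xi)%:E < +oo)%E.
Proof.
rewrite (spectrum_split measurable_log_majorant log_majorant_ge0).
have key G : heat_regular alpha G -> (\int[mu]_xi (log_majorant xi * Hk G xi ^+ 2)%:E < +oo)%E.
  move=> rG; have [mG _] := rG; have mH := measurable_Hk alpha_gt mG.
  have e1 := hankel_second_moment alpha_gt rG.
  have e2 := pitt alpha_gt dexp_lt (heat_regular_integrable alpha_gt rG).
  have e3 := heat_regular_moment alpha_gt rG dexp_gt0 dexp_le.
  have e4 : (\int[mu]_xi (xi `^ (- (2 * dexp)) * Hk G xi ^+ 2)%:E < +oo)%E.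
    apply: (le_lt_trans e2); rewrite lte_mul_pinfty ?lee_fin ?fin_numE//.
    by rewrite /pittC; nnegf.
  rewrite (_ : (\int[mu]_xi _)%E = ((8 * dexp ^- 2)%:E *
     (\int[mu]_xi (xi ^+ 2 * Hk G xi ^+ 2)%:E + \int[mu]_xi (xi `^ (- (2 * dexp)) * Hk G xi ^+ 2)%:E))%E).
    by rewrite lte_mul_pinfty ?lee_fin ?fin_numE// lte_add_pinfty.
  have m1 : measurable_fun setT (fun xi : R => (xi ^+ 2 * Hk G xi ^+ 2)%:E) by meas.
  have m2 : measurable_fun setT (fun xi : R => (xi `^ (- (2 * dexp)) * Hk G xi ^+ 2)%:E) by meas.
  have p1 (xi : R) : (0 <= (xi ^+ 2 * Hk G xi ^+ 2)%:E)%E by rewrite lee_fin mulr_ge0 ?sqr_ge0.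
  have p2 (xi : R) : (0 <= (xi `^ (- (2 * dexp)) * Hk G xi ^+ 2)%:E)%E by rewrite lee_fin mulr_ge0 ?sqr_ge0 ?powR_ge0.
  rewrite -ge0_integralD; [|exact: measurableT|by []|exact: m1|by []|exact: m2].
  rewrite -ge0_integralZl; [|exact: measurableT|exact: emeasurable_funD|by move=> x _; rewrite adde_ge0|by rewrite lee_fin].
  by apply: eq_integral => xi _; rewrite -EFinD -EFinM -mulrDl mulrA.
by apply: lte_add_pinfty; exact: key.
Qed.

Let majorant_mass : R := fine (\int[mu]_xi (log_majorant xi * N xi)%:E)%E.
Let majorantE : (\int[mu]_xi (log_majorant xi * N xi)%:E = majorant_mass%:E)%E.
Proof.
rewrite fineK// ge0_fin_numE ?spectrum_majorant_lty//.
by apply: integral_ge0 => x _; rewrite lee_fin mulr_ge0 ?log_majorant_ge0 ?spectrum_ge0.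
Qed.

Let mN : measurable_fun setT N := measurable_spectrum alpha_gt sf.
Let N0 x : 0 <= N x := spectrum_ge0 alpha f x.

Lemma spectrum_int_fin (k : R -> R) : measurable_fun setT k -> (forall x, 0 <= k x) ->
  (forall x, 0 < x -> k x <= `|ln x|) -> (\int[mu]_xi (k xi * N xi)%:E < +oo)%E.
Proof.
move=> mk k0 kle; have mM := measurable_log_majorant.
have M0 := log_majorant_ge0.
apply: (@le_lt_trans _ _ (\int[mu]_xi ((N xi)%:E + (log_majorant xi * N xi)%:E))%E).
  apply: le_integral_hankel; [exact: measurable_EFinT (measurable_funM mk mN)| | |].
  - by apply: emeasurable_funD; apply: measurable_EFinT => //; exact: measurable_funM.
  - by move=> x; rewrite lee_fin mulr_ge0.
  move=> x x0; rewrite -EFinD lee_fin -{2}(mul1r (N x)) -mulrDl ler_wpM2r//.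
  exact: le_trans (kle x x0) (norm_ln_le_quadratic dexp_gt0 dexp_le x0).
rewrite ge0_integralD; [|exact: measurableT|by move=> x _; rewrite lee_fin|exact: measurable_EFinT|by move=> x _; rewrite lee_fin mulr_ge0|exact: measurable_EFinT (measurable_funM mM mN)].
by rewrite spectrum_mass majorantE -EFinD ltry.
Qed.

Lemma wspectrum_mass : (\int[leb]_(b in Rp) (W b / b)%:E = cw%:E)%E.
Proof. by rewrite -(cpsiEE adm). Qed.

Lemma freq_int_fst (k : R -> R) : measurable_fun setT k -> (forall x, 0 <= k x) ->
  F (fun p => k p.1) = (\int[mu]_xi (k xi * N xi)%:E)%E.
Proof.
move=> mk k0.
transitivity (F (fun p => k p.1 * 1)); first by apply: eq_wint => x y _ _; rewrite mulr1.
rewrite (freq_int_prod alpha_gt adm sf (k2 := fun=> 1) mk); [|by []|by []|by []].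
under [X in (_ * (_ * X))%E]eq_integral do rewrite mul1r.
by rewrite wspectrum_mass -EFinM mulVf ?gt_eqF// mule1.
Qed.

Lemma freq_int_snd (k : R -> R) : measurable_fun setT k -> (forall x, 0 <= k x) ->
  F (fun p => k p.2) = (A0%:E * ((cw^-1)%:E * \int[leb]_(b in Rp) (k b * (W b / b))%:E))%E.
Proof.
move=> mk k0.
transitivity (F (fun p => 1 * k p.2)); first by apply: eq_wint => x y _ _; rewrite mul1r.
rewrite (freq_int_prod alpha_gt adm sf (k1 := fun=> 1) _ mk); [|by []|by []|by []].
by under [X in (X * _)%E]eq_integral do rewrite mul1r; rewrite spectrum_mass.
Qed.

Let mlp := measurable_lnp (R := R).
Let mlm := measurable_lnm (R := R).

Lemma spectrum_lnp_lty : (\int[mu]_xi (lnp xi * N xi)%:E < +oo)%E.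
Proof. by apply: spectrum_int_fin => // x *; rewrite ?lnp_ge0 ?lnp_le_norm. Qed.

Lemma spectrum_lnm_lty : (\int[mu]_xi (lnm xi * N xi)%:E < +oo)%E.
Proof. by apply: spectrum_int_fin => // x *; rewrite ?lnm_ge0 ?lnm_le_norm. Qed.

Let fine_ge0E d (T : measurableType d) (m : {measure set T -> \bar R}) (D : set T) (h : T -> R) :
  (forall x, D x -> 0 <= h x) -> (\int[m]_(x in D) (h x)%:E < +oo)%E ->
  (\int[m]_(x in D) (h x)%:E = (Rintegral m D h)%:E)%E.
Proof.
move=> h0 hl; rewrite /Rintegral fineK// ge0_fin_numE//.
by apply: integral_ge0 => x Dx; rewrite lee_fin h0.
Qed.

Let Lp : R := \int[mu]_xi (lnp xi * N xi).
Let Lm : R := \int[mu]_xi (lnm xi * N xi).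
Let LpE : (\int[mu]_xi (lnp xi * N xi)%:E = Lp%:E)%E.
Proof. by apply: fine_ge0E; [move=> x _; rewrite mulr_ge0 ?lnp_ge0|exact: spectrum_lnp_lty]. Qed.
Let LmE : (\int[mu]_xi (lnm xi * N xi)%:E = Lm%:E)%E.
Proof. by apply: fine_ge0E; [move=> x _; rewrite mulr_ge0 ?lnm_ge0|exact: spectrum_lnm_lty]. Qed.

Hypothesis psi_log : (\int[leb]_(a in `]0%R, +oo[)
      (`|ln a| * cabs (hankel alpha psi a) ^+ 2 / a)%:E < +oo)%E.

Let mW : measurable_fun setT W := measurable_wspectrum alpha_gt adm.
Let W0 b : 0 <= W b := wspectrum_ge0 alpha psi b.

Let psi_log_lty (k : R -> R) : measurable_fun setT k -> (forall x, 0 <= k x) ->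
  (forall x, k x <= `|ln x|) -> (\int[leb]_(b in Rp) (k b * (W b / b))%:E < +oo)%E.
Proof.
move=> mk k0 kle; apply: le_lt_trans psi_log.
have mWb : measurable_fun setT (fun b : R => W b / b) by meas.
have Wb b : Rp b -> 0 <= W b / b.
  by rewrite /= in_itv/= andbT => b0; rewrite divr_ge0 ?W0// ltW.
have mln : measurable_fun setT (fun b : R => `|ln b|) by apply: measurableT_comp => //; exact: measurable_ln.
apply: ge0_le_integral; [exact: measurable_itv| | | |].
- by move=> b /Wb h; rewrite lee_fin mulr_ge0.
- by apply: measurable_funTS; exact: measurable_EFinT (measurable_funM mk mWb).
- have -> : (fun x : R => (`|ln x| * cabs (hankel alpha psi x) ^+ 2 / x)%:E) = (fun x => (`|ln x| * (W x / x))%:E).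
    by apply/funext => x; congr EFin; exact: esym (mulrA _ _ _).
  by apply: measurable_funTS; exact: measurable_EFinT (measurable_funM mln mWb).
- by move=> b /Wb h; rewrite lee_fin -[leRHS]mulrA ler_wpM2r.
Qed.

Let Mp : R := \int[leb]_(b in Rp) (lnp b * (W b / b)).
Let Mm : R := \int[leb]_(b in Rp) (lnm b * (W b / b)).
Let Wb_ge0 b : Rp b -> 0 <= W b / b.
Proof. by rewrite /= in_itv/= andbT => b0; rewrite divr_ge0 ?W0// ltW. Qed.
Let MpE : (\int[leb]_(b in Rp) (lnp b * (W b / b))%:E = Mp%:E)%E.
Proof.
apply: fine_ge0E => [b /Wb_ge0 h|]; first by rewrite mulr_ge0 ?lnp_ge0.
by apply: psi_log_lty => // x; rewrite ?lnp_ge0 ?lnp_le_norm.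
Qed.
Let MmE : (\int[leb]_(b in Rp) (lnm b * (W b / b))%:E = Mm%:E)%E.
Proof.
apply: fine_ge0E => [b /Wb_ge0 h|]; first by rewrite mulr_ge0 ?lnm_ge0.
by apply: psi_log_lty => // x; rewrite ?lnm_ge0 ?lnm_le_norm.
Qed.

Lemma Calpha_parts : Calpha alpha psi =
  ln 2 + derive1 Gamma (c / 2) / Gamma (c / 2) - cw^-1 * (Mp - Mm).
Proof.
rewrite /Calpha; congr (_ - _ * _); rewrite /Rintegral.
under eq_integral do rewrite -mulrA (mulrC _^-1) -/(W _).
transitivity (fine (Mp%:E - Mm%:E)%E); last by rewrite -EFinB.
congr fine; rewrite -MpE -MmE; exact: (integral_signed_weight leb (@ln R) Wb_ge0).
Qed.

Let mFw := measurable_freq_weight alpha_gt adm sf.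
Let Fw0 := freq_weight_ge0 f adm.
Let mSw := measurable_space_weight alpha_gt adm sf.
Let Sw0 := space_weight_ge0 alpha psi f.

(* Comparing the positive and negative parts of [ln (xi / b) = ln xi - ln b] keeps every integral nonnegative. *)
Lemma scale_log_parts : exists Xp Xm : R,
  [/\ S (fun p => lnp p.1) = Xp%:E, S (fun p => lnm p.1) = Xm%:E &
      Xp - Xm = (Lp - Lm) - A0 * (cw^-1 * (Mp - Mm))].
Proof.
rewrite (space_int_scale alpha_gt adm sf sW mlp lnp_ge0) (space_int_scale alpha_gt adm sf sW mlm lnm_ge0).
have mdiv : measurable_fun setT (fun p : R * R => p.1 / p.2) by meas.
have q1 : measurable_fun setT (fun p : R * R => lnp (p.1 / p.2)) := measurableT_comp mlp mdiv.
have q2 : measurable_fun setT (fun p : R * R => lnm (p.1 / p.2)) := measurableT_comp mlm mdiv.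
have a1 : measurable_fun setT (fun p : R * R => lnp p.1) := measurableT_comp mlp measurable_fst.
have a2 : measurable_fun setT (fun p : R * R => lnm p.1) := measurableT_comp mlm measurable_fst.
have b1 : measurable_fun setT (fun p : R * R => lnp p.2) := measurableT_comp mlp measurable_snd.
have b2 : measurable_fun setT (fun p : R * R => lnm p.2) := measurableT_comp mlm measurable_snd.
have mRp : measurable Rp := measurable_itv _.
have fD (v1 v2 : R * R -> R) : measurable_fun setT v1 -> measurable_fun setT v2 ->
    (forall p, 0 <= v1 p) -> (forall p, 0 <= v2 p) -> F (fun p => v1 p + v2 p) = (F v1 + F v2)%E.
  by move=> *; exact: (wintD mu leb mRp mRp mFw Fw0).
have fle (v1 v2 : R * R -> R) : measurable_fun setT v1 -> measurable_fun setT v2 ->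
    (forall p, 0 <= v1 p) -> (forall p, 0 <= v2 p) ->
    (forall x y, 0 < x -> 0 < y -> v1 (x, y) <= v2 (x, y)) -> (F v1 <= F v2)%E.
  move=> *; apply: (le_wint mu leb mRp mRp mFw Fw0) => // x y; rewrite /= !in_itv/= !andbT; auto.
have E1 := freq_int_fst mlp lnp_ge0; have E2 := freq_int_fst mlm lnm_ge0.
have E3 := freq_int_snd mlp lnp_ge0; have E4 := freq_int_snd mlm lnm_ge0.
rewrite LpE in E1; rewrite LmE in E2; rewrite MpE -!EFinM in E3; rewrite MmE -!EFinM in E4.
have F0 (v : R * R -> R) : (forall p, 0 <= v p) -> (0 <= F v)%E.
  by move=> v0; apply: (wint_ge0 mu leb Rp Rp Fw0).
have n1 p := lnp_ge0 (p : R); have n2 p := lnm_ge0 (p : R).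
have [xp Ep] : exists r : R, F (fun p => lnp (p.1 / p.2)) = r%:E.
  exists (fine (F (fun p => lnp (p.1 / p.2)))); rewrite fineK//.
  rewrite ge0_fin_numE; last by apply: F0.
  apply: (@le_lt_trans _ _ (F (fun p => lnp p.1 + lnm p.2))).
    by apply: fle => //; [exact: measurable_funD|by move=> p; rewrite addr_ge0|exact: lnp_div_le].
  by rewrite fD// E1 E4 -EFinD ltry.
have [xm Em] : exists r : R, F (fun p => lnm (p.1 / p.2)) = r%:E.
  exists (fine (F (fun p => lnm (p.1 / p.2)))); rewrite fineK//.
  rewrite ge0_fin_numE; last by apply: F0.
  apply: (@le_lt_trans _ _ (F (fun p => lnm p.1 + lnp p.2))).
    by apply: fle => //; [exact: measurable_funD|by move=> p; rewrite addr_ge0|exact: lnm_div_le].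
  by rewrite fD// E2 E3 -EFinD ltry.
exists xp, xm; split; [exact: Ep|exact: Em|].
have : F (fun p => lnp (p.1 / p.2) + lnm p.1 + lnp p.2) = F (fun p => lnm (p.1 / p.2) + lnp p.1 + lnm p.2).
  by apply: eq_wint => x y; rewrite /= !in_itv/= !andbT; exact: ln_div_parts.
rewrite !fD//; try (exact: measurable_funD); try (by move=> p; rewrite addr_ge0).
rewrite Ep Em E1 E2 E3 E4 -!EFinD => -[].
by move: (cw^-1) => w h; rewrite !mulrBr; move: h; lra.
Qed.

Let R' := majorant_mass.

(** Second-order expansion of xi^(2u) in u, integrated against the spectrum. The negative part of
    the logarithm stands on the left so that every term is nonnegative. *)
Lemma freq_int_powR_le (u : R) : 0 < u -> 2 * u <= 1 ->
  (F (fun p => p.1 `^ (2 * u))%R + (2 * u * Lm)%:E <= (A0 + 2 * u * Lp + 4 * u ^+ 2 * R')%:E)%E.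
Proof.
move=> u0 u1; have mp : measurable_fun setT (fun x : R => x `^ (2 * u)) by apply: measurable_powR.
have mM := measurable_log_majorant; have M0 := log_majorant_ge0.
have c1 : 0 <= 2 * u by rewrite mulr_ge0// ltW.
have c2 : 0 <= 4 * u ^+ 2 by rewrite mulr_ge0// sqr_ge0.
rewrite (freq_int_fst mp) => [|x]; last exact: powR_ge0.
rewrite !EFinD EFinM -LmE (EFinM (2 * u) Lp) -LpE (EFinM (4 * u ^+ 2)) -majorantE -spectrum_mass.
have e1 : measurable_fun setT (fun x => (x `^ (2 * u) * N x)%:E) := measurable_EFinT (measurable_funM mp mN).
have e2 : measurable_fun setT (fun x => (lnm x * N x)%:E) := measurable_EFinT (measurable_funM mlm mN).
have e3 : measurable_fun setT (fun x => (lnp x * N x)%:E) := measurable_EFinT (measurable_funM mlp mN).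
have e4 : measurable_fun setT (fun x => (log_majorant x * N x)%:E) := measurable_EFinT (measurable_funM mM mN).
have e5 : measurable_fun setT (fun x => (N x)%:E) := measurable_EFinT mN.
have s k (x : R) : 0 <= k x -> (0 <= (k x * N x)%:E)%E by move=> h; rewrite lee_fin mulr_ge0.
have s1 x : (0 <= (x `^ (2 * u) * N x)%:E)%E by rewrite lee_fin mulr_ge0 ?powR_ge0.
have s2 x := s lnm x (lnm_ge0 x); have s3 x := s lnp x (lnp_ge0 x); have s4 x := s log_majorant x (M0 x).
have s5 x : (0 <= (N x)%:E)%E by rewrite lee_fin.
have cm (r : R) (h : R -> \bar R) : measurable_fun setT h -> measurable_fun setT (fun x => r%:E * h x)%E.
  by move=> mh; exact: measurable_funeM.
have cp (r : R) (h : R -> \bar R) : 0 <= r -> (forall x, 0 <= h x)%E -> forall x, (0 <= r%:E * h x)%E.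
  by move=> r0 h0 x; rewrite mule_ge0 ?lee_fin.
have Z (r : R) (h : R -> \bar R) : 0 <= r -> measurable_fun setT h -> (forall x, 0 <= h x)%E ->
   (r%:E * \int[mu]_x h x = \int[mu]_x (r%:E * h x))%E.
  by move=> r0 mh h0; rewrite ge0_integralZl.
have Dd (g h : R -> \bar R) : measurable_fun setT g -> (forall x, 0 <= g x)%E ->
   measurable_fun setT h -> (forall x, 0 <= h x)%E ->
   (\int[mu]_x g x + \int[mu]_x h x = \int[mu]_x (g x + h x))%E.
  by move=> mg g0 mh h0; rewrite ge0_integralD.
rewrite (Z _ _ c1 e2 s2) (Z _ _ c1 e3 s3) (Z _ _ c2 e4 s4).
rewrite (Dd _ _ e1 s1 (cm _ _ e2) (cp _ _ c1 s2)) (Dd _ _ e5 s5 (cm _ _ e3) (cp _ _ c1 s3)).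
have s6 x : (0 <= (N x)%:E + (2 * u)%:E * (lnp x * N x)%:E)%E by apply: adde_ge0 => //; exact: (cp _ _ c1 s3 x).
rewrite (Dd _ _ (emeasurable_funD e5 (cm _ _ e3)) s6 (cm _ _ e4) (cp _ _ c2 s4)).
apply: le_integral_hankel; [exact: emeasurable_funD e1 (cm _ _ e2)| | |].
- exact: emeasurable_funD (emeasurable_funD e5 (cm _ _ e3)) (cm _ _ e4).
- by move=> x _; apply: adde_ge0 => //; exact: (cp _ _ c1 s2 x).
move=> x x0; rewrite -!EFinM -!EFinD lee_fin !mulrA -mulrDl -{2}(mul1r (N x)) -!mulrDl ler_wpM2r//.
have := powR_le_quadratic dexp_gt0 dexp_le u0 u1 x0; rewrite -/(log_majorant x).
have : ln x = lnp x - lnm x.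
  by rewrite /lnp /lnm; have [l0|l0] := leP (ln x) 0; have [l1|l1] := leP (- ln x) 0; lra.
move=> ->; rewrite /log_majorant; move: (x `^ (2 * u)) (x ^+ 2 + x `^ (- (2 * dexp))) (dexp ^- 2) => P Q D; lra.
Qed.

Lemma space_mass : S (fun=> 1) = A0%:E.
Proof.
rewrite (space_int_scale alpha_gt adm sf sW (k := fun=> 1)); [|by []|by []].
rewrite (freq_int_fst (k := fun=> 1)); [|by []|by []].
by rewrite -spectrum_mass; apply: eq_integral => x _; rewrite mul1r.
Qed.

Let mRp : measurable Rp := measurable_itv _.
Let mb1 : measurable_fun setT (fun p : R * R => lnp p.2) := measurableT_comp mlp measurable_snd.
Let mb2 : measurable_fun setT (fun p : R * R => lnm p.2) := measurableT_comp mlm measurable_snd.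

Lemma space_lnp_ge0 : (0 <= S (fun p => lnp p.2))%E.
Proof. by apply: (wint_ge0 leb mu Rp Rp Sw0) => p; exact: lnp_ge0. Qed.

Lemma space_lnm_ge0 : (0 <= S (fun p => lnm p.2))%E.
Proof. by apply: (wint_ge0 leb mu Rp Rp Sw0) => p; exact: lnm_ge0. Qed.

Let mpow (e : R) : measurable_fun setT (fun p : R * R => p.2 `^ e).
Proof. by meas. Qed.

(** Pitt's inequality at the single exponent [dexp] bounds the negative part. The positive part is
    left possibly infinite; with this bound their difference is never of the form oo - oo. *)
Lemma space_lnm_lty : (S (fun p => lnm p.2) < +oo)%E.
Proof.
have ub := dexp_lt; have u0 := dexp_gt0; have P0 : 0 <= pittC alpha dexp by rewrite /pittC; nnegf.
have d20 : 0 <= 2 * dexp by rewrite mulr_ge0// ltW.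
have FF : (F (fun p => p.1 `^ (2 * dexp))%R < +oo)%E.
  have := freq_int_powR_le u0 dexp_le; move: (F _) => [r| |] //=; by rewrite ltry.
have h : ((2 * dexp)%:E * S (fun p => lnm p.2) < +oo)%E.
  rewrite -(wintZ leb mu mRp mRp mSw Sw0 d20 mb2) => [|p]; last exact: lnm_ge0.
  apply: (@le_lt_trans _ _ (S (fun p => p.2 `^ (- (2 * dexp)))%R)).
    apply: (le_wint leb mu mRp mRp mSw Sw0) => [| |p|p|x y].
    - by apply: measurable_funM.
    - exact: mpow.
    - by rewrite mulr_ge0// lnm_ge0.
    - exact: powR_ge0.
    - by rewrite /= !in_itv/= !andbT => _; exact: lnm_le_powR.
  apply: (le_lt_trans (space_int_pitt alpha_gt adm sf sW ub)).
  by rewrite lte_mul_pinfty ?lee_fin ?fin_numE.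
move: space_lnm_ge0 h; case: (S (fun p => lnm p.2)) => [r _ _| _|] //; first by rewrite ltry.
by rewrite gt0_muley ?ltxx// lte_fin mulr_gt0.
Qed.

(** The tangent line bound x^(-2u) >= 1 - 2 u ln x is integrated over scale and space, where Pitt's
    inequality controls its left side. *)
Lemma space_log_parts_le (u : R) : 0 < u < c / 2 -> 2 * u <= 1 ->
  (A0%:E + (2 * u)%:E * S (fun p => lnm p.2) <= (2 * u)%:E * S (fun p => lnp p.2) +
   (pittC alpha u)%:E * F (fun p => p.1 `^ (2 * u))%R)%E.
Proof.
move=> ub u1; have /andP[u0 _] := ub; have d20 : 0 <= 2 * u by rewrite mulr_ge0// ltW.
have n1 := @lnp_ge0 R; have n2 := @lnm_ge0 R.
rewrite -space_mass -(wintZ leb mu mRp mRp mSw Sw0 d20 mb1) => [|p]; last exact: n1.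
rewrite -(wintZ leb mu mRp mRp mSw Sw0 d20 mb2) => [|p]; last exact: n2.
apply: (le_trans _ (leeD2l _ (space_int_pitt alpha_gt adm sf sW ub))).
have k1 : measurable_fun setT (fun p : R * R => 2 * u * lnm p.2) by exact: measurable_funM.
have k2 : measurable_fun setT (fun p : R * R => 2 * u * lnp p.2) by exact: measurable_funM.
have p1 (p : R * R) : 0 <= 2 * u * lnm p.2 by rewrite mulr_ge0.
have p2 (p : R * R) : 0 <= 2 * u * lnp p.2 by rewrite mulr_ge0.
have p3 (p : R * R) : 0 <= p.2 `^ (- (2 * u)) by exact: powR_ge0.
rewrite /space_int -(wintD leb mu mRp mRp mSw Sw0 (v1 := fun=> 1) _ k1 _ p1); [|by []|by []].
rewrite -(wintD leb mu mRp mRp mSw Sw0 k2 (mpow _) p2 p3).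
apply: (le_wint leb mu mRp mRp mSw Sw0) => [| |p|p|x y].
- exact: measurable_funD.
- by apply: measurable_funD => //; exact: mpow.
- by rewrite addr_ge0.
- by rewrite addr_ge0.
- by rewrite /= !in_itv/= !andbT => _; exact: ln_parts_ge.
Qed.

(** The bound from Pitt's inequality and the expansion of xi^(2u) are combined and divided by 2 u.
    As u decreases to 0 the difference quotient of [pittC] produces the constant and the quadratic
    error disappears. *)
Lemma space_log_lower_bound (yp ym : R) : S (fun p => lnp p.2) = yp%:E -> S (fun p => lnm p.2) = ym%:E ->
  (ln 2 + derive1 Gamma (c / 2) / Gamma (c / 2)) * A0 - (Lp - Lm) <= yp - ym.
Proof.
move=> Yp Ym; set kappa := ln 2 + _.
pose q u := (pittC alpha u - 1) / u.
have qc : q @ (0 : R)^'+ --> - (2 * kappa) := pittC_quotient_cvg alpha_gt.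
have uc : (fun u : R => u) @ (0 : R)^'+ --> (0 : R) by exact: cvg_at_right_filter.
have uq : (fun u => 1 + u * q u) @ (0 : R)^'+ --> (1 : R).
  by rewrite -[X in _ --> X](_ : 1 + 0 * (- (2 * kappa)) = 1 :> R); [apply: cvgD; [exact: cvg_cst|exact: cvgM]|rewrite mul0r addr0].
have ur : (fun u => Lp - Lm + 2 * u * R') @ (0 : R)^'+ --> Lp - Lm + 2 * 0 * R'.
  by apply: cvgD; [exact: cvg_cst|apply: cvgMl; apply: cvgMr].
(* The quantity shown below to be nonpositive for small u > 0; nonpositivity of its limit is the
   claim. *)
have phic : (fun u => - (q u / 2) * A0 + (ym - yp) - (1 + u * q u) * (Lp - Lm + 2 * u * R')) @ (0 : R)^'+ -->
   - (- (2 * kappa) / 2) * A0 + (ym - yp) - 1 * (Lp - Lm + 2 * 0 * R').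
  apply: cvgB; last exact: cvgM.
  by apply: cvgD; [apply: cvgMl; apply: cvgN; exact: cvgMl|exact: cvg_cst].
suff : - (- (2 * kappa) / 2) * A0 + (ym - yp) - 1 * (Lp - Lm + 2 * 0 * R') <= 0.
  by rewrite mulr0 mul0r addr0; lra.
apply: (cvgr_to_le phic).
near=> u.
have u0 : 0 < u by near: u; exact: nbhs_right_gt.
have uM : u < dexp by near: u; apply: nbhs_right_lt; exact: dexp_gt0.
have u1 : 2 * u <= 1 by have := dexp_le; lra.
have ub : 0 < u < c / 2 by rewrite u0; have /andP[_ ] := dexp_lt; lra.
have := space_log_parts_le ub u1; rewrite Yp Ym.
have := freq_int_powR_le u0 u1.
have P0 : 0 <= pittC alpha u by rewrite /pittC; nnegf.
have : (0 <= F (fun p => p.1 `^ (2 * u))%R)%E by apply: (wint_ge0 mu leb Rp Rp Fw0) => p; exact: powR_ge0.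
case: (F _) => [b _| |//]; last by [].
rewrite -!EFinM -!EFinD !lee_fin => h1 h2.
have PE : pittC alpha u = 1 + u * q u by rewrite /q mulrC divfK ?gt_eqF// addrC subrK.
rewrite -PE; have qE : q u = (pittC alpha u - 1) / u by [].
have h3 : pittC alpha u * b <= pittC alpha u * (A0 + 2 * u * Lp + 4 * u ^+ 2 * R' - 2 * u * Lm).
  by rewrite ler_wpM2l//; lra.
rewrite -(pmulr_rle0 _ (_ : 0 < 2 * u)); last by rewrite mulr_gt0.
rewrite qE; move: h2 h3; move: (pittC alpha u) => P h2 h3.
rewrite [leLHS](_ : _ = (1 - P) * A0 + 2 * u * (ym - yp) - P * (2 * u * (Lp - Lm) + 4 * u ^+ 2 * R')); first by lra.
by field; rewrite gt_eqF.
Unshelve. all: by end_near. Qed.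

Lemma log_uncertainty :
  ((Calpha alpha psi * A0)%:E <=
    (S (fun p => lnp p.1) - S (fun p => lnm p.1)) + (S (fun p => lnp p.2) - S (fun p => lnm p.2)))%E.
Proof.
have [Xp [Xm [-> -> X]]] := scale_log_parts.
have bound := space_log_lower_bound.
move: space_lnp_ge0 space_lnm_ge0 space_lnm_lty bound.
case: (S (fun p => lnm p.2)) => [ym| |] // + + _.
(* If the positive part is infinite, so is the right side, since the other three integrals are
   finite. *)
case: (S (fun p => lnp p.2)) => [yp| |] // _ _ bound; last by rewrite leey.
rewrite -!EFinB -EFinD lee_fin Calpha_parts mulrBl X.
have := bound yp ym erefl erefl; move: (_ / Gamma _) => g.
rewrite (mulrC _ A0) (mulrC _ A0); move: (cw^-1 * _) => k; lra.
Qed.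

(** Passage from the product integral to the iterated one. The line x = 0 carries no mass, so closed
    and open half-lines agree, and for a > 0 the transform is replaced by its real components. *)
Lemma nu_integral (k : R * R -> R) : measurable_fun setT k -> (forall p, 0 <= k p) ->
  (\int[(leb \x leb)%E]_(p in `]0%R, +oo[ `*` `[0%R, +oo[)
     (k p * (cabs (hwt alpha psi f p.1 p.2) ^+ 2 * nudens alpha p))%:E = S k)%E.
Proof.
move=> mk k0; have [L1psi _ _ _] := adm.
have mSp := mSw.
pose G (p : R * R) := k p * space_weight alpha psi f p.
have mG : measurable_fun setT G by exact: measurable_funM.
have G0 p : 0 <= G p by rewrite mulr_ge0// Sw0.
have mwd : measurable_fun setT (wdens alpha).
  by rewrite /wdens; meas.
have wd0 x : 0 <= wdens alpha x by rewrite /wdens; nnegf.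
pose H (p : R * R) : \bar R := (\1_Rp p.1 * (\1_`[0%R, +oo[ p.2 * (G p * wdens alpha p.2)))%:E.
have mH : measurable_fun setT H.
  have i1 : measurable_fun setT (fun p : R * R => \1_Rp p.1 : R) := measurableT_comp (measurable_indic mRp) measurable_fst.
  have i2 : measurable_fun setT (fun p : R * R => \1_(`[0%R, +oo[ : set R) p.2 : R).
    by apply: (measurableT_comp _ measurable_snd); apply: measurable_indic; exact: measurable_itv.
  have i3 : measurable_fun setT (fun p : R * R => wdens alpha p.2) := measurableT_comp mwd measurable_snd.
  by apply/measurable_EFinP; exact: (measurable_funM i1 (measurable_funM i2 (measurable_funM mG i3))).
have H0 p : (0 <= H p)%E by rewrite lee_fin; apply: mulr_ge0; [|apply: mulr_ge0; [|exact: mulr_ge0]]; rewrite indicE ler0n.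
transitivity (\int[(leb \x leb)%E]_p H p)%E.
  rewrite integral_mkcond; apply: eq_integral => -[a x] _.
  rewrite /patch /H in_setX/= !indicE; case: ifP => [/andP[]|].
    rewrite !inE/= !in_itv/= !andbT => a0 x0.
    rewrite !mem_set/= ?in_itv/= ?andbT// !mul1r; congr EFin.
    rewrite (hwtE alpha_gt L1psi mf1 mf2 x a0) sqr_cabs /G /space_weight /nudens /= wenergyE; ring.
  by case: (a \in _); case: (x \in _) => //=; rewrite ?mul0r ?mulr0.
rewrite (@fubini_tonelli1 _ _ _ _ _ leb leb H mH H0) /fubini_F /space_int /wint [RHS]integral_mkcond.
apply: eq_integral => a _; rewrite epatch_indic.
have mGa : measurable_fun setT (fun x => G (a, x)) := measurableT_comp mG (measurable_pair1 a).
have E1 : (\int[mu]_(x in Rp) (G (a, x))%:E =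
    \int[leb]_(x in `[0%R, +oo[) ((G (a, x))%:E * (wdens alpha x)%:E))%E.
  rewrite (integral_half_line alpha_gt (measurable_EFinT mGa)).
  by rewrite (integral_hankel_Rp alpha (measurable_EFinT mGa)).
rewrite -[X in (X * _)%E]/(\int[mu]_(x in Rp) (G (a, x))%:E)%E E1 /H/= indicE.
case: (a \in _); last by rewrite mule0; apply: integral0_eq => x _; rewrite mul0r.
rewrite mule1 [RHS]integral_mkcond; apply: eq_integral => x _.
by rewrite epatch_indic mul1r -!EFinM mulrC.
Qed.

(** The integral of a signed function is the difference of the integrals of its two parts; as the
    density is nonnegative, these are the parts of h times the density. *)
Lemma nu_integral_signed (h : R * R -> R) :
  measurable_fun setT (fun p => Num.max (h p) 0) -> measurable_fun setT (fun p => Num.max (- h p) 0) ->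
  (\int[(leb \x leb)%E]_(p in `]0%R, +oo[ `*` `[0%R, +oo[)
     (h p * cabs (hwt alpha psi f p.1 p.2) ^+ 2 * nudens alpha p)%:E =
   S (fun p => Num.max (h p) 0)%R - S (fun p => Num.max (- h p) 0)%R)%E.
Proof.
move=> m1 m2; have M0 (r : R) : 0 <= Num.max r 0 by rewrite le_max lexx orbT.
have w0 p : 0 <= cabs (hwt alpha psi f p.1 p.2) ^+ 2 * nudens alpha p.
  by rewrite mulr_ge0 ?sqr_ge0// /nudens mulr_ge0 ?powR_ge0// /wdens; nnegf.
under eq_integral do rewrite -[X in X%:E]mulrA.
etransitivity; first by apply: integral_signed_weight => p _; exact: w0.
by rewrite (nu_integral m1 (fun p => M0 _)) (nu_integral m2 (fun p => M0 _)).
Qed.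

End log_moments.

(** * The logarithmic uncertainty inequality *)

Theorem mainTheorem6 (R : realType) (alpha : R) (psi f : R -> R[i]) :
  -1 / 2 < alpha ->
  admissible alpha psi ->
  (\int[lebesgue_measure]_(a in `]0%R, +oo[)
      (`|ln a| * cabs (hankel alpha psi a) ^+ 2 / a)%:E < +oo)%E ->
  schwartz_e f ->
  (forall a : R, 0 < a ->
     exists g : R -> R[i], schwartz_e g /\
       forall x : R, 0 <= x -> g x = hwt alpha psi f a x) ->
  ((Calpha alpha psi * L2norm2 alpha f)%:E <=
   \int[(lebesgue_measure \x lebesgue_measure)%E]_(p in `]0%R, +oo[ `*` `[0%R, +oo[)
       (ln p.1 * cabs (hwt alpha psi f p.1 p.2) ^+ 2 * nudens alpha p)%:E
   + \int[(lebesgue_measure \x lebesgue_measure)%E]_(p in `]0%R, +oo[ `*` `[0%R, +oo[)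
       (ln p.2 * cabs (hwt alpha psi f p.1 p.2) ^+ 2 * nudens alpha p)%:E)%E.
Proof.
move=> alpha_gt adm psi_log sf sW.
apply: (le_trans (log_uncertainty alpha_gt adm sf sW psi_log)).
have mp := @measurable_lnp R; have mm := @measurable_lnm R.
apply: leeD; rewrite le_eqVlt; apply/orP; left; apply/eqP; apply: esym.
- exact: (nu_integral_signed alpha_gt adm sf (h := fun p => ln p.1)
    (measurableT_comp mp measurable_fst) (measurableT_comp mm measurable_fst)).
- exact: (nu_integral_signed alpha_gt adm sf (h := fun p => ln p.2)
    (measurableT_comp mp measurable_snd) (measurableT_comp mm measurable_snd)).
Qed.
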